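(* Let $f$ be distributionally integrable over $[a,b]$. If $\beta>0$ then the function $f_\beta(x)=(b-x)^\beta f(x)$ is distributionally integrable over $[a,b]$. Similarly, $(x-a)^\beta f(x)$ is also distributionally integrable over $[a,b]$.
   Context: $\beta$ is a real number. Distributions are real. Notation: $\overline{\mathbb R}=\mathbb R\cup\{-\infty,\infty\}$; $\mathcal E'[a,b]$ is the space of distributions on $\mathbb R$ with support contained in $[a,b]$; $\langle \mathsf g(x+ty),\phi(y)\rangle:=|t|^{-1}\langle \mathsf g(y),\phi((y-x)/t)\rangle$ for $t\ne0$. Point values. For $\mathsf g\in\mathcal D'(\mathbb R)$, the distributional (Łojasiewicz) point value $\mathsf g(x_0)$ exists and equals $\gamma\in\mathbb R$ if $\lim_{\varepsilon\to0}\langle \mathsf g(x_0+\varepsilon y),\phi(y)\rangle=\gamma\int_{-\infty}^\infty\phi(y)\,dy$ for every $\phi\in\mathcal D(\mathbb R)$. A Łojasiewicz distribution is one having a point value at every point of $\mathbb R$. Test classes. $\mathcal T_0$: functions $\phi\in C^\infty(\mathbb R)$, $\phi\ge0$, $\int\phi=1$, such that for some $\alpha<-1$, $\phi^{(m)}(x)=O(|x|^{\alpha-m})$ as $|x|\to\infty$ for all $m\ge0$. $\mathcal T_1$: those $\phi\in\mathcal T_0$ with $x\phi'(x)\le0$ for all $x$. For $\mathsf g\in\mathcal E'(\mathbb R)$, $\phi\in\mathcal T_0$: $\mathsf g^{+}_{\phi,0}(x)=\limsup_{t\to0^+}\langle \mathsf g(x+ty),\phi(y)\rangle$ and $\mathsf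 g^{-}_{\phi,0}(x)=\liminf_{t\to0^+}\langle \mathsf g(x+ty),\phi(y)\rangle$. Integral. Let $f:[a,b]\to\overline{\mathbb R}$. A major distributional pair $(\mathsf u,\mathsf U)$ for $f$ consists of $\mathsf u\in\mathcal E'[a,b]$ and a Łojasiewicz distribution $\mathsf U$ with $\mathsf U'=\mathsf u$, $\mathsf U(a)=0$, such that there exist a countable set $E$ and a Lebesgue null set $Z$ with $\mathsf u^-_{\phi,0}(x)\ge f(x)$ for all $x\in[a,b]\setminus Z$, $\phi\in\mathcal T_0$, and $\mathsf u^-_{\phi,0}(x)>-\infty$ for all $x\in[a,b]\setminus E$, $\phi\in\mathcal T_1$. A minor distributional pair $(\mathsf v,\mathsf V)$ for $f$ consists of $\mathsf v\in\mathcal E'[a,b]$ and a Łojasiewicz distribution $\mathsf V$ with $\mathsf V'=\mathsf v$, $\mathsf V(a)=0$, such that there exist a countable set $E$ and a null set $Z$ with $\mathsf v^+_{\phi,0}(x)\le f(x)$ for all $x\in[a,b]\setminus Z$, $\phi\in\mathcal T_0$, and $\mathsf v^+_{\phi,0}(x)<\infty$ for all $x\in[a,b]\setminus E$, $\phi\in\mathcal T_1$. The function $f$ is distributionally integrable over $[a,b]$ if it has both major and minor pairs and $\sup\mathsf V(b)=\inf\mathsf U(b)$ (sup over minor pairs, inf over major pairs); the common value is $(\mathfrak{dist})\int_a^bf(x)\,dx$. Integrability and the integral do not change if $f$ is modified on a null set; integrable functions are finite almost everywhere. *)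

(* Defs.v *)
From HB Require Import structures.
From mathcomp Require Import all_boot all_order all_algebra.
From mathcomp Require Import all_classical all_reals all_analysis.

Set Implicit Arguments.
Unset Strict Implicit.
Unset Printing Implicit Defensive.

Import Order.TTheory GRing.Theory Num.Theory.
Import numFieldTopology.Exports numFieldNormedType.Exports.

Local Open Scope ring_scope.
Local Open Scope classical_set_scope.

Definition smooth (R : realType) (phi : R -> R) : Prop :=
  forall (m : nat) (x : R), derivable (derive1n m phi) x 1.

Definition tsupp (R : realType) (phi : R -> R) : set R :=
  closure [set x | phi x != 0].

(* Membership in the space D(R). *)
Definition test_function (R : realType) (phi : R -> R) : Prop :=
  smooth phi /\ compact (tsupp phi).

(* An element of D'(R).  Only the values on test functions are constrained,
   and only those values are used below. *)
Record schwartz_distribution (R : realType) := SchwartzDistribution {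
  dpair :> (R -> R) -> R ;
  dpair_linear : forall (c : R) (phi psi : R -> R),
    test_function phi -> test_function psi ->
    dpair (fun x => c * phi x + psi x) = c * dpair phi + dpair psi ;
  dpair_continuous : forall K : set R, compact K ->
    exists (C : R) (N : nat), forall phi : R -> R,
      test_function phi -> tsupp phi `<=` K ->
      `|dpair phi| <=
        C * \sum_(m < N.+1) sup (range (fun x : R => `|derive1n m phi x|))
}.

Definition dvanishes_on (R : realType) (g : schwartz_distribution R) (O : set R) : Prop :=
  forall phi : R -> R, test_function phi -> tsupp phi `<=` O -> g phi = 0.

Definition dsupp (R : realType) (g : schwartz_distribution R) : set R :=
  ~` \bigcup_(O in [set O : set R | open O /\ dvanishes_on g O]) O.

(* Membership in E'[a, b]. *)
Definition supported_in (R : realType) (a b : R) (g : schwartz_distribution R) : Prop :=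
  dsupp g `<=` `[a, b].

(* The distributional derivative relation U' = u. *)
Definition is_dderiv (R : realType) (U u : schwartz_distribution R) : Prop :=
  forall phi : R -> R, test_function phi -> u phi = - U (derive1 phi).

(* The pairing of a compactly supported distribution with a smooth function
   psi that need not have compact support: the common value of <g, chi psi>
   over all test functions chi equal to 1 on a neighbourhood of supp g. *)
Definition epair (R : realType) (g : schwartz_distribution R) (psi : R -> R) : R :=
  get [set v : R | forall chi : R -> R, test_function chi ->
    (exists O : set R,
      [/\ open O, dsupp g `<=` O & forall x, O x -> chi x = 1]) ->
    g (fun x => chi x * psi x) = v].

(* <g(x + t y), phi(y)>, for t <> 0, where T is the pairing with g: either
   [dpair g] when phi has compact support, or [epair g] when g has. *)
Definition dilate (R : realType) (T : (R -> R) -> R) (x t : R) (phi : R -> R)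
    : R :=
  `|t|^-1 * T (fun y => phi ((y - x) / t)).

Definition has_point_value (R : realType) (g : schwartz_distribution R) (x0 gamma : R)
    : Prop :=
  forall phi : R -> R, test_function phi ->
    dilate (dpair g) x0 eps phi @[eps --> 0^'] -->
      gamma * (\int[lebesgue_measure]_(y in setT) phi y).

Definition Lojasiewicz (R : realType) (g : schwartz_distribution R) : Prop :=
  forall x : R, exists gamma : R, has_point_value g x gamma.

Definition test_class0 (R : realType) (phi : R -> R) : Prop :=
  [/\ smooth phi,
      forall x, 0 <= phi x,
      \int[lebesgue_measure]_(x in setT) phi x = 1 &
      exists2 alpha : R, alpha < -1 &
        forall m : nat, exists C M : R, forall x : R, M < `|x| ->
          `|derive1n m phi x| <= C * `|x| `^ (alpha - m%:R)].

Definition test_class1 (R : realType) (phi : R -> R) : Prop :=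
  test_class0 phi /\ forall x : R, x * derive1 phi x <= 0.

(* The upper and lower limits along t -> 0+ of <g(x + t y), phi(y)>. *)
Definition upper_val (R : realType) (g : schwartz_distribution R) (phi : R -> R) (x : R)
    : \bar R :=
  limf_esup (fun t : R => (dilate (epair g) x t phi)%:E) (0^'+).

Definition lower_val (R : realType) (g : schwartz_distribution R) (phi : R -> R) (x : R)
    : \bar R :=
  limf_einf (fun t : R => (dilate (epair g) x t phi)%:E) (0^'+).

(* A function [a, b] -> \bar R is represented by a total function of which
   only the values on [a, b] are used. *)
Definition major_pair (R : realType) (a b : R) (f : R -> \bar R)
    (u U : schwartz_distribution R) : Prop :=
  [/\ supported_in a b u, Lojasiewicz U, is_dderiv U u, has_point_value U a 0 &
    exists E Z : set R,
      [/\ countable E, lebesgue_measure.-negligible Z,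
        (forall x : R, a <= x <= b -> ~ Z x ->
          forall phi : R -> R, test_class0 phi -> (f x <= lower_val u phi x)%E) &
        (forall x : R, a <= x <= b -> ~ E x ->
          forall phi : R -> R, test_class1 phi -> (-oo < lower_val u phi x)%E)]].

Definition minor_pair (R : realType) (a b : R) (f : R -> \bar R)
    (v V : schwartz_distribution R) : Prop :=
  [/\ supported_in a b v, Lojasiewicz V, is_dderiv V v, has_point_value V a 0 &
    exists E Z : set R,
      [/\ countable E, lebesgue_measure.-negligible Z,
        (forall x : R, a <= x <= b -> ~ Z x ->
          forall phi : R -> R, test_class0 phi -> (upper_val v phi x <= f x)%E) &
        (forall x : R, a <= x <= b -> ~ E x ->
          forall phi : R -> R, test_class1 phi -> (upper_val v phi x < +oo)%E)]].

(* The sets of values U(b) and V(b), for (u, U) a major pair and (v, V) a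
   minor pair. *)
Definition major_values (R : realType) (a b : R) (f : R -> \bar R) : set R :=
  [set gamma | exists u U : schwartz_distribution R,
    major_pair a b f u U /\ has_point_value U b gamma].

Definition minor_values (R : realType) (a b : R) (f : R -> \bar R) : set R :=
  [set gamma | exists v V : schwartz_distribution R,
    minor_pair a b f v V /\ has_point_value V b gamma].

(* Extended-real bounds are used so that no boundedness is presupposed. *)
Definition dist_integrable (R : realType) (a b : R) (f : R -> \bar R) : Prop :=
  [/\ exists u U : schwartz_distribution R, major_pair a b f u U,
      exists v V : schwartz_distribution R, minor_pair a b f v V &
      ereal_sup (EFin @` minor_values a b f) =
      ereal_inf (EFin @` major_values a b f)].

(* Main.v *)
(* The pairs (u, U) are viewed as functionals P on smooth functions. Each such P is null at every point
   ([P (zoom x s f)] tends to 0), because U has a point value there; a gliding hump argument makes this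
   uniform, and summation over dyadic shells about e then lets P be multiplied by the singular weight
   |y - e|^be, the product again coming from a Lojasiewicz primitive. Away from e the weight acts on the
   lower limits of P as multiplication by its value, so weighted major and minor pairs of f are major and
   minor pairs of the weighted function.

   It remains to see that a small gap U(b) - V(b) stays small, which follows once the difference D of a
   major and a minor functional is known to be positive. Add to D a small measure mu with infinite density
   on the exceptional null set, so that the Gaussian averages of T = D + mu at x are nonnegative at small
   scales for all x outside a countable set. Let a point be bad if T is positive on none of its
   neighbourhoods. The bad set is closed and, as D is null at points, has no isolated point. By the Baire
   category theorem some interval meeting the bad set has a common scale below which the averages at bad
   points are nonnegative. The averages solve the heat equation, so the maximum principle in the gaps
   between bad points extends this to the whole interval, hence T is positive there, a contradiction. *)

Require Import Defs.
From mathcomp Require Import all_boot all_order all_algebra.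
From mathcomp Require Import all_classical all_reals all_analysis.
From mathcomp Require Import measurable_realfun ring lra.

Set Implicit Arguments.
Unset Strict Implicit.
Unset Printing Implicit Defensive.

Import Order.TTheory GRing.Theory Num.Theory.
Import numFieldTopology.Exports numFieldNormedType.Exports.

Local Open Scope classical_set_scope.
Local Open Scope ring_scope.

(* The running time of lra grows fast with the context and with the let-bound variables it unfolds. *)
Ltac keep_comparisons :=
  repeat match goal with
  | H : ?P |- _ => lazymatch type of P with Prop => lazymatch P with
      | is_true (Order.le _ _) => fail
      | is_true (Order.lt _ _) => fail
      | @eq _ _ _ => fail
      | _ => clear H
      end end
  end;
  repeat match goal with x := _ |- _ => clearbody x end.

Ltac slra := first [solve [keep_comparisons; lra] | lra].

(** A distribution acts through seminorms of an order that is not known, so every estimate has to be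
    available for all orders and to be invariant under change of scale; derivatives are therefore
    weighted by powers of the distance to the point at hand. This tames a singular weight: the shell
    of radius r around e contributes O(r^beta), and beta > 0 makes the sum over shells geometric. At
    a point other than e the weight differs from its value by a first Taylor term, which must vanish
    after division by the scale; it does because T_0 asks for decay with an exponent below -1.

    Positivity is tested with the Gaussian because it belongs to T_1, so that the bounds off the
    null set and off the countable set both apply to it, and because its averages obey a parabolic
    equation. The delicate point is the initial line of that equation in a gap: near an endpoint the
    kernel reaches over the bad point, where no sign is known. Nullness at the endpoint, made
    uniform in the centre of the kernel, bounds the possible negative part by a small multiple of a
    Gaussian bump, and a small point mass outweighs it. *)

(** * Calculus of smooth functions on open sets *)

Section SmoothOn.
Context {R : realType}.
Implicit Types (f g : R -> R) (O : set R) (x y c d M A B : R) (m n N : nat).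

Definition smooth_on O f : Prop :=
  forall m x, O x -> derivable (derive1n m f) x 1.

Definition derivs_le N M f y : Prop :=
  forall m, (m <= N)%N -> `|derive1n m f y| <= M.

Lemma smoothE f : smooth f <-> smooth_on setT f.
Proof. by split => [h m x _|h m x]; exact: h. Qed.

Lemma smooth_smooth_on O f : smooth f -> smooth_on O f.
Proof. by move=> h m x _; exact: h. Qed.

Lemma smooth_on_derive1 O f : smooth_on O f -> smooth_on O (derive1 f).
Proof. by move=> h m x Ox; have := h m.+1 x Ox; rewrite derive1Sn. Qed.

Lemma smooth_onS O f : (forall x, O x -> derivable f x 1) ->
  smooth_on O (derive1 f) -> smooth_on O f.
Proof. by move=> h0 h [|m] x Ox; [exact: h0 | rewrite derive1Sn; exact: h]. Qed.

Lemma derive1_local O f g x : open O -> (forall y, O y -> f y = g y) -> O x ->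
  derive1 f x = derive1 g x /\ (derivable f x 1 -> derivable g x 1).
Proof.
move=> oO fg Ox.
have nfg : \forall y \near x, f y = g y.
  by apply: (@filterS _ _ _ O) => //; exact: open_nbhs_nbhs.
rewrite !derive1E; split; first exact: near_eq_derive.
exact: (@near_eq_derivable _ _ _ f g x 1 nfg).
Qed.

Lemma derive1n_local O f g m : open O -> (forall y, O y -> f y = g y) ->
  forall x, O x -> derive1n m f x = derive1n m g x.
Proof.
move=> oO fg; elim: m => [|m IH] x Ox; first exact: fg.
by rewrite !derive1nS; have [-> _] := derive1_local oO IH Ox.
Qed.

Lemma smooth_on_local O f g : open O -> (forall y, O y -> f y = g y) ->
  smooth_on O f -> smooth_on O g.
Proof.
move=> oO fg h m x Ox.
have [_] := derive1_local oO (derive1n_local m oO fg) Ox.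
by apply; exact: h.
Qed.

Lemma derive1n_cst m c : derive1n m (fun _ : R => c) = fun _ => if m is 0%N then c else 0.
Proof.
elim: m => [|m IH] //; rewrite derive1nS IH; apply/funext => x.
exact: derive1_cst.
Qed.

Lemma smooth_cst O c : smooth_on O (fun _ => c).
Proof. by move=> m x _; rewrite derive1n_cst; exact: derivable_cst. Qed.

Lemma ck_add O f g n : open O ->
  (forall m, (m <= n)%N -> forall x, O x -> derivable (derive1n m f) x 1) ->
  (forall m, (m <= n)%N -> forall x, O x -> derivable (derive1n m g) x 1) ->
  forall m, (m <= n)%N -> forall x, O x ->
  derive1n m (fun y => f y + g y) x = derive1n m f x + derive1n m g x /\
  derivable (derive1n m (fun y => f y + g y)) x 1.
Proof.
move=> oO hf hg; elim => [|m IH] mn x Ox.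
  by split => //; apply: derivableD; [exact: (hf 0%N) | exact: (hg 0%N)].
have e z : O z -> derive1n m.+1 (fun y => f y + g y) z =
    derive1n m.+1 f z + derive1n m.+1 g z.
  move=> Oz; rewrite !derive1nS.
  have [-> _] := derive1_local oO (fun y Oy => (IH (ltnW mn) y Oy).1) Oz.
  by rewrite !derive1E deriveD //; [exact: (hf m (ltnW mn)) | exact: (hg m (ltnW mn))].
split; first exact: e.
have [_] := derive1_local oO (fun y Oy => esym (e y Oy)) Ox.
by apply; apply: derivableD; [exact: hf | exact: hg].
Qed.

Lemma derive1n_add O f g m : open O -> smooth_on O f -> smooth_on O g ->
  forall x, O x ->
  derive1n m (fun y => f y + g y) x = derive1n m f x + derive1n m g x.
Proof.
by move=> oO hf hg x Ox; apply: (ck_add oO _ _ (leqnn m) Ox).1 => j _; [exact: hf|exact: hg].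
Qed.

Lemma smooth_on_add O f g : open O -> smooth_on O f -> smooth_on O g ->
  smooth_on O (fun y => f y + g y).
Proof.
by move=> oO hf hg m x Ox; apply: (ck_add oO _ _ (leqnn m) Ox).2 => j _; [exact: hf|exact: hg].
Qed.

Lemma derive1n_scale O c f m : open O -> smooth_on O f ->
  forall x, O x -> derive1n m (fun y => c * f y) x = c * derive1n m f x.
Proof.
move=> oO hf; elim: m => [//|m IH] x Ox.
rewrite !derive1nS; have [-> _] := derive1_local oO IH Ox.
by rewrite !derive1E (deriveZ c) //; exact: hf.
Qed.

Lemma smooth_on_scale O c f : open O -> smooth_on O f ->
  smooth_on O (fun y => c * f y).
Proof.
move=> oO hf m x Ox.
have [_] := derive1_local oO (fun y Oy => esym (derive1n_scale c m oO hf Oy)) Ox.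
by apply; apply: derivableZ; exact: hf.
Qed.

Lemma derive1_mul f g x : derivable f x 1 -> derivable g x 1 ->
  derive1 (fun y => f y * g y) x = derive1 f x * g x + f x * derive1 g x.
Proof.
move=> hf hg; rewrite !derive1E; apply: (eq_trans (deriveM hf hg)).
by rewrite /GRing.scale /= addrC; congr (_ + _); rewrite mulrC.
Qed.

(** Induction on the order [n]: one derivative turns the product into [f' g + f g'], whose factors
    are differentiable to the remaining order. Finite orders are kept because [smooth_on_family] and
    [smooth_inv] use the rule inside their own inductions on the order. *)
Lemma ck_mul O f g n : open O ->
  (forall m, (m <= n)%N -> forall x, O x -> derivable (derive1n m f) x 1) ->
  (forall m, (m <= n)%N -> forall x, O x -> derivable (derive1n m g) x 1) ->
  forall m, (m <= n)%N -> forall x, O x ->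
  derivable (derive1n m (fun y => f y * g y)) x 1.
Proof.
move=> oO; elim: n f g => [|n IH] f g hf hg m mn x Ox.
  move: mn; rewrite leqn0 => /eqP ->.
  by apply: derivableM; [exact: (hf 0%N) | exact: (hg 0%N)].
case: m mn => [|m] mn.
  by apply: derivableM; [exact: (hf 0%N) | exact: (hg 0%N)].
have e y : O y -> derive1 f y * g y + f y * derive1 g y =
    derive1 (fun y => f y * g y) y.
  by move=> Oy; rewrite derive1_mul //; [exact: (hf 0%N) | exact: (hg 0%N)].
have [_] := derive1_local oO (derive1n_local m oO e) Ox.
move=> H; rewrite derive1Sn; apply: H.
apply: (@ck_add O (fun y => derive1 f y * g y) (fun y => f y * derive1 g y) n oO _ _
  m mn x Ox).2 => j jn y Oy.
  apply: IH jn y Oy => i ni z Oz; last by apply: hg => //; exact: leqW.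
  by have := hf i.+1 ni z Oz; rewrite derive1Sn.
apply: IH jn y Oy => i ni z Oz; first by apply: hf => //; exact: leqW.
by have := hg i.+1 ni z Oz; rewrite derive1Sn.
Qed.

Lemma smooth_on_mul O f g : open O -> smooth_on O f -> smooth_on O g ->
  smooth_on O (fun y => f y * g y).
Proof.
by move=> oO hf hg m x Ox; apply: (ck_mul oO _ _ (leqnn m) Ox) => j _; [exact: hf|exact: hg].
Qed.

Lemma derivs_leW N N' M M' f y : (N' <= N)%N -> M <= M' ->
  derivs_le N M f y -> derivs_le N' M' f y.
Proof. by move=> NN MM h m mN; apply: le_trans MM; apply: h; exact: leq_trans NN. Qed.

Lemma derivs_le_ge0 N M f y : derivs_le N M f y -> 0 <= M.
Proof. by move=> /(_ 0%N isT); exact: le_trans. Qed.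

Lemma derivs_le_derive1 N M f y : derivs_le N.+1 M f y -> derivs_le N M (derive1 f) y.
Proof. by move=> h m mN; rewrite -derive1Sn; exact: h. Qed.

Lemma derivs_le_add O N A B f g x : open O -> smooth_on O f -> smooth_on O g -> O x ->
  derivs_le N A f x -> derivs_le N B g x -> derivs_le N (A + B) (fun y => f y + g y) x.
Proof.
move=> oO hf hg Ox hA hB m mN; rewrite (derive1n_add _ oO) //.
by apply: le_trans (ler_normD _ _) _; apply: lerD; [exact: hA|exact: hB].
Qed.

Lemma derivs_le_scale O N A c f x : open O -> smooth_on O f -> O x ->
  derivs_le N A f x -> derivs_le N (`|c| * A) (fun y => c * f y) x.
Proof.
move=> oO hf Ox hA m mN; rewrite (derive1n_scale _ _ oO) // normrM.
by apply: ler_wpM2l => //; exact: hA.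
Qed.

(** Each differentiation of a product doubles the number of terms; the crude factor [2 ^+ N]
    replaces the binomial coefficients of Leibniz's rule. *)
Lemma derivs_le_mul O N A B f g x : open O -> smooth_on O f -> smooth_on O g -> O x ->
  derivs_le N A f x -> derivs_le N B g x ->
  derivs_le N (2 ^+ N * (A * B)) (fun y => f y * g y) x.
Proof.
move=> oO; elim: N f g => [|N IH] f g hf hg Ox hA hB [|m] // mN.
- by rewrite expr0 mul1r normrM; apply: ler_pM => //; [exact: (hA 0%N)|exact: (hB 0%N)].
- have A0 := derivs_le_ge0 hA; have B0 := derivs_le_ge0 hB.
  rewrite normrM; apply: (@le_trans _ _ (1 * (A * B))); last first.
    by apply: ler_wpM2r; [exact: mulr_ge0 | apply: exprn_ege1; rewrite ler1n].
  by rewrite mul1r; apply: ler_pM => //; [exact: (hA 0%N)|exact: (hB 0%N)].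
have e y : O y -> derive1 (fun y => f y * g y) y =
    derive1 f y * g y + f y * derive1 g y.
  by move=> Oy; rewrite derive1_mul //; [exact: (hf 0%N) | exact: (hg 0%N)].
have hf' := smooth_on_derive1 hf; have hg' := smooth_on_derive1 hg.
rewrite derive1Sn (derive1n_local _ oO e) //.
have h1 : derivs_le N (2 ^+ N * (A * B)) (fun y => derive1 f y * g y) x.
  by apply: IH => //; [exact: derivs_le_derive1|exact: derivs_leW hB].
have h2 : derivs_le N (2 ^+ N * (A * B)) (fun y => f y * derive1 g y) x.
  by apply: IH => //; [exact: derivs_leW hA|exact: derivs_le_derive1].
have := derivs_le_add oO (smooth_on_mul oO hf' hg) (smooth_on_mul oO hf hg') Ox h1 h2.
by move=> /(_ m mN) /le_trans -> //; rewrite exprS; slra.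
Qed.

Lemma is_derive_affine (h : R -> R) c d y l : is_derive (c * y + d) 1 h l ->
  is_derive y 1 (fun z => h (c * z + d)) (c * l).
Proof.
move=> dh.
have da : is_derive y 1 (fun y => c * y + d) c.
  apply: (is_derive_eq (@is_deriveD _ _ _ (fun y => c * y) (cst d) y 1 _ _
    (is_deriveZ c (is_derive_id y 1)) (is_derive_cst d y 1))).
  by rewrite /GRing.scale /= mulr1 addr0.
apply: (is_derive_eq (@is_derive1_comp R h (fun y => c * y + d) y _ _ dh da)).
exact: mulrC.
Qed.

Lemma derivable_is_derive1 (h : R -> R) y : derivable h y 1 -> is_derive y 1 h (derive1 h y).
Proof. by move=> dh; apply: DeriveDef => //; rewrite derive1E. Qed.

Lemma is_derive1_ex (h : R -> R) y l : is_derive y 1 h l -> derivable h y 1.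
Proof. by case. Qed.

Lemma is_derive1E (h : R -> R) y l : is_derive y 1 h l -> derive1 h y = l.
Proof. by move=> dh; rewrite derive1E; exact: derive_val. Qed.

Lemma derive1n_affine f c d : smooth f -> forall m,
  derive1n m (fun y => f (c * y + d)) = fun y => c ^+ m * derive1n m f (c * y + d).
Proof.
move=> hf; elim => [|m IH]; first by apply/funext => y; rewrite expr0 mul1r.
rewrite !derive1nS IH; apply/funext => y.
have dg := @is_derive_affine _ c d y _ (derivable_is_derive1 (hf m (c * y + d))).
rewrite (is_derive1E (@is_deriveZ _ _ _ _ (c ^+ m) y 1 _ dg)).
by rewrite /GRing.scale /= exprS; ring.
Qed.

Lemma smooth_affine f c d : smooth f -> smooth (fun y => f (c * y + d)).
Proof.
move=> hf m y; rewrite derive1n_affine //; apply: derivableZ.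
exact: is_derive1_ex (@is_derive_affine _ c d y _ (derivable_is_derive1 (hf m (c * y + d)))).
Qed.

End SmoothOn.

(** * Smooth functions on the whole line *)

Section SmoothGlobal.
Context {R : realType}.
Implicit Types (f g : R -> R) (O : set R) (x y c d M A B L s : R) (m n N : nat).

Lemma smooth_add f g : smooth f -> smooth g -> smooth (fun y => f y + g y).
Proof. by move=> /smoothE hf /smoothE hg; apply/smoothE; apply: smooth_on_add => //; exact: openT. Qed.

Lemma smooth_scale c f : smooth f -> smooth (fun y => c * f y).
Proof. by move=> /smoothE hf; apply/smoothE; apply: smooth_on_scale => //; exact: openT. Qed.

Lemma smooth_opp f : smooth f -> smooth (fun y => - f y).
Proof.
move=> /(@smooth_scale (-1) f); suff -> : (fun y => -1 * f y) = (fun y => - f y) by [].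
by apply/funext => y; rewrite mulN1r.
Qed.

Lemma smooth_sub f g : smooth f -> smooth g -> smooth (fun y => f y - g y).
Proof. by move=> hf /smooth_opp; exact: smooth_add. Qed.

Lemma smooth_mul f g : smooth f -> smooth g -> smooth (fun y => f y * g y).
Proof. by move=> /smoothE hf /smoothE hg; apply/smoothE; apply: smooth_on_mul => //; exact: openT. Qed.

Lemma smooth_const c : smooth (fun _ : R => c).
Proof. by apply/smoothE; exact: smooth_cst. Qed.

Lemma smooth_derive1 f : smooth f -> smooth (derive1 f).
Proof. by move=> /smoothE hf; apply/smoothE; exact: smooth_on_derive1. Qed.

Lemma smooth_derive1n m f : smooth f -> smooth (derive1n m f).
Proof. by move=> hf; elim: m => [|m IH]; [exact: hf|rewrite derive1nS; exact: smooth_derive1]. Qed.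

Lemma smooth_is_derive f y : smooth f -> is_derive y 1 f (derive1 f y).
Proof. by move=> hf; apply: derivable_is_derive1; exact: (hf 0%N). Qed.

Lemma smooth_by_derive f g : (forall x, is_derive x 1 f (g x)) -> smooth g -> smooth f.
Proof.
move=> h hg; apply/smoothE/smooth_onS; first by move=> x _; exact: is_derive1_ex (h x).
have -> : derive1 f = g by apply/funext => x; exact: is_derive1E (h x).
exact/smoothE.
Qed.

Lemma smooth_continuous f : smooth f -> continuous f.
Proof. by move=> hf x; apply: differentiable_continuous; apply/derivable1_diffP; exact: (hf 0%N). Qed.

Lemma derive1nD m f g : smooth f -> smooth g ->
  derive1n m (fun y => f y + g y) = fun y => derive1n m f y + derive1n m g y.
Proof.
by move=> /smoothE hf /smoothE hg; apply/funext => y; apply: (derive1n_add m openT hf hg).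
Qed.

Lemma derive1nZ m c f : smooth f ->
  derive1n m (fun y => c * f y) = fun y => c * derive1n m f y.
Proof. by move=> /smoothE hf; apply/funext => y; apply: (derive1n_scale c m openT hf). Qed.

Lemma derive1nN m f : smooth f ->
  derive1n m (fun y => - f y) = fun y => - derive1n m f y.
Proof.
move=> hf; have <- : (fun y => -1 * f y) = (fun y => - f y).
  by apply/funext => y; rewrite mulN1r.
by rewrite (derive1nZ m (-1) hf); apply/funext => y; rewrite mulN1r.
Qed.

Lemma derive1nB m f g : smooth f -> smooth g ->
  derive1n m (fun y => f y - g y) = fun y => derive1n m f y - derive1n m g y.
Proof. by move=> hf hg; rewrite (derive1nD m hf (smooth_opp hg)) (derive1nN m hg). Qed.

Lemma derivs_leZ N A c f x : smooth f ->
  derivs_le N A f x -> derivs_le N (`|c| * A) (fun y => c * f y) x.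
Proof. by move=> /smoothE hf; apply: derivs_le_scale openT hf _. Qed.

Lemma derivs_leM N A B f g x : smooth f -> smooth g ->
  derivs_le N A f x -> derivs_le N B g x ->
  derivs_le N (2 ^+ N * (A * B)) (fun y => f y * g y) x.
Proof. by move=> /smoothE hf /smoothE hg; apply: derivs_le_mul openT hf hg _. Qed.

Lemma derivs_le_local O N A f g x : open O -> (forall y, O y -> f y = g y) -> O x ->
  derivs_le N A f x -> derivs_le N A g x.
Proof. by move=> oO fg Ox h m mN; rewrite -(derive1n_local m oO fg Ox); exact: h. Qed.

Lemma derivs_le0 O N f x : open O -> (forall y, O y -> f y = 0) -> O x -> derivs_le N 0 f x.
Proof.
move=> oO f0 Ox; apply: (derivs_le_local oO (f := fun _ => 0)) => // [y Oy|m _].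
  by rewrite f0.
by rewrite derive1n_cst; case: m; rewrite normr0.
Qed.

Lemma derivs_le_cst N c x : derivs_le N `|c| (fun _ => c) x.
Proof. by move=> [|m] _; rewrite derive1n_cst // normr0. Qed.

Lemma derive1n_scal m x s f : smooth f ->
  derive1n m (fun y => f ((y - x) / s)) = fun y => (s^-1) ^+ m * derive1n m f ((y - x) / s).
Proof.
move=> hf; have e y : (y - x) / s = s^-1 * y + (- x / s) by ring.
transitivity (derive1n m (fun y => f (s^-1 * y + (- x / s)))).
  by congr derive1n; apply/funext => y; rewrite e.
by rewrite (derive1n_affine _ _ hf); apply/funext => y; rewrite e.
Qed.

Lemma smooth_scal x s f : smooth f -> smooth (fun y => f ((y - x) / s)).
Proof.
move=> hf; have -> : (fun y => f ((y - x) / s)) = (fun y => f (s^-1 * y + (- x / s))).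
  by apply/funext => y; congr f; ring.
exact: smooth_affine.
Qed.

Lemma derive1n_dil m x s f : smooth f ->
  derive1n m (fun z => f (x + s * z)) = fun z => s ^+ m * derive1n m f (x + s * z).
Proof.
move=> hf; transitivity (derive1n m (fun y => f (s * y + x))).
  by congr derive1n; apply/funext => y; rewrite addrC.
by rewrite (derive1n_affine _ _ hf); apply/funext => y; rewrite addrC.
Qed.

Lemma smooth_dil x s f : smooth f -> smooth (fun z => f (x + s * z)).
Proof.
move=> hf; have -> : (fun z => f (x + s * z)) = (fun z => f (s * z + x)).
  by apply/funext => y; rewrite addrC.
exact: smooth_affine.
Qed.

Lemma continuous_bounded_segment f L : 0 <= L -> continuous f ->
  exists2 M, 0 <= M & forall y, `|y| <= L -> `|f y| <= M.
Proof.
move=> L0 cf.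
have cn : continuous (fun y => `|f y|).
  by move=> x; apply: (@continuous_comp _ _ _ f (fun z => `|z|)); [exact: cf|exact: norm_continuous].
have LL : - L <= L by slra.
have [c _ hc] := EVT_max LL (continuous_subspaceT cn).
by exists `|f c| => // y yL; apply: hc; rewrite in_itv /= -ler_norml.
Qed.

Lemma smooth_bounded f N L : smooth f ->
  exists2 M, 0 <= M & forall y, `|y| <= L -> derivs_le N M f y.
Proof.
move=> hf; have [L0|L0] := leP 0 L; last first.
  by exists 0 => // y yL; have := le_lt_trans yL L0; rewrite ltNge normr_ge0.
elim: N => [|N [M M0 hM]].
  have [M M0 hM] := continuous_bounded_segment L0 (smooth_continuous hf).
  by exists M => // y yL m; rewrite leqn0 => /eqP ->; exact: hM.
have [M' M'0 hM'] := continuous_bounded_segment L0 (smooth_continuous (@smooth_derive1n N.+1 _ hf)).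
exists (Num.max M M'); first by rewrite le_max M0.
move=> y yL m; rewrite leq_eqVlt => /orP[/eqP ->|mN].
  by rewrite le_max hM' // orbT.
by rewrite le_max (hM y yL).
Qed.

(** A quadratic remainder is what Taylor's estimate gives, and unlike a difference quotient it
    survives limits of functions, application of a functional and integration; the differentiations
    with respect to a parameter below rest on this criterion. *)
Lemma is_derive_quad f x l C (e : R) : 0 < e ->
  (forall h, `|h| < e -> `|f (x + h) - f x - l * h| <= C * h ^+ 2) ->
  is_derive x 1 f l.
Proof.
move=> e0 hC.
have C0 : 0 <= C.
  have e2 : `|e / 2| < e by rewrite ger0_norm; slra.
  have := le_trans (normr_ge0 _) (hC _ e2).
  by rewrite pmulr_lge0 // exprn_gt0; slra.
suff H : h^-1 *: (f (h *: 1 + x) - f x) @[h --> 0^'] --> l.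
  have dv : derivable f x 1 by apply/cvg_ex; exists l.
  by apply: DeriveDef => //; apply: cvg_lim H.
apply/cvgrPdist_le => eps eps0.
near=> h.
have h0 : h != 0 by near: h; exact: nbhs_dnbhs_neq.
have he : `|h| < e by near: h; apply: dnbhs0_lt.
have hC' : `|h| <= eps / (C + 1) by near: h; apply: dnbhs0_le; apply: divr_gt0 => //; slra.
have hn : 0 < `|h| by rewrite normr_gt0.
have -> : l - h^-1 *: (f (h *: 1 + x) - f x) = - (h^-1 * (f (x + h) - f x - l * h)).
  by rewrite /GRing.scale /= mulr1 [h + x]addrC; field.
rewrite normrN normrM normfV mulrC ler_pdivrMr //.
apply: le_trans (hC _ he) _.
rewrite -normr_id -[h ^+ 2]ger0_norm ?sqr_ge0 // normrX expr2 mulrA normr_id.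
apply: ler_wpM2r => //; rewrite -(@ler_pM2l _ (C + 1)) in hC'; last by slra.
apply: le_trans (_ : (C + 1) * `|h| <= _); first by apply: ler_wpM2r; slra.
by apply: le_trans hC' _; rewrite mulrC divfK //; slra.
Unshelve. all: by end_near. Qed.

End SmoothGlobal.

Arguments smooth_add {R f g} _ _ _ _.
Arguments smooth_sub {R f g} _ _ _ _.
Arguments smooth_mul {R f g} _ _ _ _.
Arguments smooth_opp {R f} _ _ _.
Arguments smooth_scale {R} c {f} _ _ _.
Arguments smooth_const {R} c _ _.
Arguments smooth_derive1 {R f} _ _ _.
Arguments smooth_derive1n {R} m {f} _ _ _.
Arguments smooth_scal {R} x s {f} _ _ _.
Arguments smooth_dil {R} x s {f} _ _ _.
Arguments smooth_affine {R} {f} c d _ _ _.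

(** * Families closed under differentiation: flat functions, cutoffs, Gaussians *)

Section Families.
Context {R : realType}.
Implicit Types (f g : R -> R) (O : set R) (x y c d M A B L s : R) (m n N k : nat).

Lemma isdD f g x l l' : is_derive x 1 f l -> is_derive x 1 g l' ->
  is_derive x 1 (fun y => f y + g y) (l + l').
Proof. exact: is_deriveD. Qed.

Lemma isdM f g x l l' : is_derive x 1 f l -> is_derive x 1 g l' ->
  is_derive x 1 (fun y => f y * g y) (l * g x + f x * l').
Proof.
move=> hf hg; apply: (is_derive_eq (is_deriveM hf hg)).
by rewrite /GRing.scale /= addrC; congr (_ + _); exact: mulrC.
Qed.

Lemma isdZ c f x l : is_derive x 1 f l -> is_derive x 1 (fun y => c * f y) (c * l).
Proof. exact: is_deriveZ. Qed.

Lemma isdN f x l : is_derive x 1 f l -> is_derive x 1 (fun y => - f y) (- l).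
Proof. exact: is_deriveN. Qed.

Lemma isdV f x l : f x != 0 -> is_derive x 1 f l ->
  is_derive x 1 (fun y => (f y)^-1) (- l / f x ^+ 2).
Proof.
move=> fx hf; apply: (is_derive_eq (is_deriveV fx hf)).
by rewrite /GRing.scale /= mulNr mulNr mulrC.
Qed.

Lemma isdcomp f g x l l' : is_derive (g x) 1 f l -> is_derive x 1 g l' ->
  is_derive x 1 (fun y => f (g y)) (l * l').
Proof. exact: is_derive1_comp. Qed.

Lemma isdX f k x l : is_derive x 1 f l ->
  is_derive x 1 (fun y => f y ^+ k) (k%:R * f x ^+ k.-1 * l).
Proof.
move=> hf; have -> : (fun y => f y ^+ k) = f ^+ k by apply/funext => y; rewrite exprfctE.
exact: is_deriveX.
Qed.

Lemma isd_local O f g x l : open O -> O x -> (forall y, O y -> f y = g y) ->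
  is_derive x 1 f l -> is_derive x 1 g l.
Proof.
move=> oO Ox fg; apply: near_eq_is_derive; apply: (@filterS _ _ _ O) => //.
exact: open_nbhs_nbhs.
Qed.

(** Differentiability of a given order is proved for all indices at once, since the derivative of
    one member is a combination of two others. *)
Lemma smooth_on_family O (I : Type) (F : I -> R -> R) : open O ->
  (forall i, exists c j d j', forall x, O x -> is_derive x 1 (F i) (c * F j x + d * F j' x)) ->
  forall i, smooth_on O (F i).
Proof.
move=> oO hF.
have H n : forall i m, (m <= n)%N -> forall x, O x -> derivable (derive1n m (F i)) x 1.
  elim: n => [|n IH] i m mn x Ox; have [c [j [d [j' hd]]]] := hF i.
    by move: mn; rewrite leqn0 => /eqP ->; exact: is_derive1_ex (hd x Ox).
  case: m mn => [_|m mn]; first exact: is_derive1_ex (hd x Ox).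
  have e y : O y -> c * F j y + d * F j' y = derive1 (F i) y.
    by move=> Oy; rewrite (is_derive1E (hd y Oy)).
  have [_ h] := derive1_local oO (derive1n_local m oO e) Ox.
  rewrite derive1Sn; apply: h.
  have hc i' c' : forall m, (m <= n)%N -> forall x, O x ->
      derivable (derive1n m (fun y => c' * F i' y)) x 1.
    exact: ck_mul oO (fun m _ z Oz => @smooth_cst _ O c' m z Oz) (IH i').
  exact: (ck_add oO (hc j c) (hc j' d) (mn : (m <= n)%N) Ox).2.
by move=> i m x Ox; exact: H (leqnn m) x Ox.
Qed.

Lemma smooth_family (I : Type) (F : I -> R -> R) :
  (forall i, exists c j d j', forall x, is_derive x 1 (F i) (c * F j x + d * F j' x)) ->
  forall i, smooth (F i).
Proof.
move=> hF i; apply/smoothE; apply: smooth_on_family => // [|j]; first exact: openT.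
by have [c [j1 [d [j2 hd]]]] := hF j; exists c, j1, d, j2 => x _.
Qed.

(** The derivative [- g' (1/g) (1/g)] is again built from the reciprocal, so order n of the
    reciprocal yields order n + 1. *)
Lemma smooth_inv g : smooth g -> (forall x, g x != 0) -> smooth (fun y => (g y)^-1).
Proof.
move=> hg g0.
have e : derive1 (fun y => (g y)^-1) = fun y => (- derive1 g y) * ((g y)^-1 * (g y)^-1).
  apply/funext => y; rewrite (is_derive1E (isdV (g0 y) (smooth_is_derive y hg))).
  by rewrite expr2 invfM.
have hd x : derivable (fun y => (g y)^-1) x 1.
  exact: is_derive1_ex (isdV (g0 x) (smooth_is_derive x hg)).
have H n : forall m, (m <= n)%N -> forall x, setT x ->
    derivable (derive1n m (fun y => (g y)^-1)) x 1.
  elim: n => [|n IH] m mn x _.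
    by move: mn; rewrite leqn0 => /eqP ->; exact: hd.
  case: m mn => [_|m mn]; first exact: hd.
  have h1 j : (j <= n)%N -> forall z, setT z -> derivable (derive1n j (fun y => - derive1 g y)) z 1.
    by move=> _ z _; exact: smooth_opp (smooth_derive1 hg) j z.
  by rewrite derive1Sn e; exact: (ck_mul openT h1 (ck_mul openT IH IH) (mn : (m <= n)%N)).
by move=> m x; exact: H (leqnn m) x I.
Qed.

Lemma expR_ge_pow (u : R) n : 0 <= u -> u ^+ n <= n`!%:R * expR u.
Proof.
move=> u0; case: n => [|n]; first by rewrite fact0 mul1r expr0 -expR0 ler_expR.
rewrite mulrC -ler_pdivrMr ?ltr0n ?fact_gt0 //.
by apply: le_trans (expR_ge1Dxn n u0); rewrite lerDr ler01.
Qed.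

(* The factor x^-k makes the family closed under differentiation. *)
Definition flat k x : R := if 0 < x then x^-1 ^+ k * expR (- x^-1) else 0.

(** The exponential beats [k + 2] powers of [x^-1]; the two spare powers make every member
    quadratically small at 0, which is what [is_derive_quad] asks for there. *)
Lemma flat_le k x : 0 <= flat k x <= (k.+2)`!%:R * x ^+ 2.
Proof.
rewrite /flat; case: ifPn => x0; last by rewrite lexx mulr_ge0 ?sqr_ge0 ?ler0n.
have xi : 0 <= x^-1 by rewrite invr_ge0 ltW.
apply/andP; split; first by apply: mulr_ge0; [exact: exprn_ge0|exact: expR_ge0].
rewrite expRN ler_pdivrMr ?expR_gt0 // mulrAC -ler_pdivrMr ?exprn_gt0 //.
by apply: le_trans (expR_ge_pow k.+2 xi); rewrite -exprVn -exprD addn2.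
Qed.

Lemma is_derive_flat k x : is_derive x 1 (flat k) (1 * flat k.+2 x + (- k%:R) * flat k.+1 x).
Proof.
rewrite mul1r; have [x0|x0|<-] := ltgtP 0 x.
- have o : open [set y : R | 0 < y] by exact: open_gt.
  apply: (isd_local o x0 (f := fun y => y^-1 ^+ k * expR (- y^-1))).
    by move=> y /= y0; rewrite /flat y0.
  have dv : is_derive x 1 (fun y : R => y^-1) (- 1 / x ^+ 2).
    by apply: (@isdV id x 1 _ (is_derive_id x 1)); rewrite gt_eqF.
  apply: is_derive_eq (isdM (isdX k dv) (isdcomp (is_derive_expR _) (isdN dv))) _.
  rewrite /flat x0; case: k => [|k] /=; rewrite ?expr0 ?exprS; field; by rewrite gt_eqF.
- have o : open [set y : R | y < 0] by exact: open_lt.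
  apply: (isd_local o x0 (f := fun => 0)).
    by move=> y /= y0; rewrite /flat ltNge (ltW y0).
  by rewrite /flat ltNge (ltW x0) /= mulr0 addr0; exact: is_derive_cst.
- have f0 j : flat j 0 = 0 by rewrite /flat ltxx.
  rewrite !f0 mulr0 addr0; apply: (@is_derive_quad _ _ _ _ (k.+2)`!%:R 1) => // h _.
  rewrite add0r f0 subr0 mul0r subr0.
  by have /andP[? ?] := flat_le k h; rewrite ger0_norm.
Qed.

Lemma smooth_flat k : smooth (flat k).
Proof.
apply: smooth_family => j; exists 1, j.+2, (- j%:R), j.+1 => x.
exact: is_derive_flat.
Qed.

Definition step x : R := flat 0 x / (flat 0 x + flat 0 (1 - x)).

Lemma flat0_gt0 x : 0 < x -> 0 < flat 0 x.
Proof. by move=> x0; rewrite /flat x0 expr0 mul1r expR_gt0. Qed.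

Lemma flat0_ge0 x : 0 <= flat 0 x. Proof. by have /andP[] := flat_le 0 x. Qed.

Lemma step_den_gt0 x : 0 < flat 0 x + flat 0 (1 - x).
Proof.
have [x0|x0] := ltP 0 x; first by apply: ltr_pwDl; [exact: flat0_gt0|exact: flat0_ge0].
by apply: ltr_wpDl; [exact: flat0_ge0|apply: flat0_gt0; slra].
Qed.

Lemma smooth_step : smooth step.
Proof.
apply: smooth_mul; first exact: smooth_flat.
apply: smooth_inv => [|x]; last by rewrite gt_eqF // step_den_gt0.
apply: smooth_add; first exact: smooth_flat.
have -> : (fun y => flat 0 (1 - y)) = (fun y => flat 0 (-1 * y + 1)).
  by apply/funext => y; congr flat; ring.
exact/smooth_affine/smooth_flat.
Qed.

Lemma step_le0 x : x <= 0 -> step x = 0.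
Proof. by move=> x0; rewrite /step {1}/flat ltNge x0 mul0r. Qed.

Lemma step_ge1 x : 1 <= x -> step x = 1.
Proof.
move=> x1; rewrite /step [flat 0 (1 - x)]/flat ifF; last by apply/negbTE; rewrite -leNgt; slra.
by rewrite addr0 divff // gt_eqF // flat0_gt0 //; slra.
Qed.

Lemma step_itv x : 0 <= step x <= 1.
Proof.
rewrite /step divr_ge0 ?flat0_ge0 //=; last exact: ltW (step_den_gt0 x).
by rewrite ler_pdivrMr ?step_den_gt0 // mul1r lerDl flat0_ge0.
Qed.

Definition bump x : R := step (2 - x) * step (2 + x).

Lemma smooth_bump : smooth bump.
Proof.
apply: smooth_mul.
  have -> : (fun y => step (2 - y)) = (fun y => step (-1 * y + 2)).
    by apply/funext => y; congr step; ring.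
  exact/smooth_affine/smooth_step.
have -> : (fun y => step (2 + y)) = (fun y => step (1 * y + 2)).
  by apply/funext => y; congr step; ring.
exact/smooth_affine/smooth_step.
Qed.

Lemma bump1 x : `|x| <= 1 -> bump x = 1.
Proof. by rewrite ler_norml => /andP[? ?]; rewrite /bump !step_ge1 ?mulr1 //; slra. Qed.

Lemma bump0 x : 2 <= `|x| -> bump x = 0.
Proof.
have [x0|x0] := leP 0 x; first by rewrite ger0_norm // => ?; rewrite /bump step_le0 ?mul0r //; slra.
by rewrite ltr0_norm // => ?; rewrite /bump [step (2 + x)]step_le0 ?mulr0 //; slra.
Qed.

Lemma bump_itv x : 0 <= bump x <= 1.
Proof.
have /andP[? ?] := step_itv (2 - x); have /andP[? ?] := step_itv (2 + x).
by rewrite mulr_ge0 //= mulr_ile1.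
Qed.

(* The factor x^k makes the family closed under differentiation. *)
Definition gauss k x : R := x ^+ k * expR (- x ^+ 2 / 2).

Lemma is_derive_gauss k x :
  is_derive x 1 (gauss k) (k%:R * gauss k.-1 x + -1 * gauss k.+1 x).
Proof.
have d2 : is_derive x 1 (fun y : R => - y ^+ 2 / 2) (- x).
  have -> : (fun y : R => - y ^+ 2 / 2) = (fun y => - 2^-1 * y ^+ 2) by apply/funext => y; ring.
  apply: is_derive_eq (isdZ (- 2^-1) (@isdX id 2 x _ (is_derive_id x 1))) _.
  by rewrite /= expr1 mulr1; field.
apply: is_derive_eq (isdM (@isdX id k x _ (is_derive_id x 1)) (isdcomp (is_derive_expR _) d2)) _.
by rewrite /gauss /= [x ^+ k.+1]exprS; ring.
Qed.

Lemma smooth_gauss k : smooth (gauss k).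
Proof. by apply: smooth_family => j; exists j%:R, j.-1, (-1), j.+1 => x; exact: is_derive_gauss. Qed.

Lemma derive1_gauss k : derive1 (gauss k) = fun x => k%:R * gauss k.-1 x + -1 * gauss k.+1 x.
Proof. by apply/funext => x; exact: is_derive1E (is_derive_gauss k x). Qed.

Lemma pow_le_expR2 k (e : R) : 0 < e -> exists2 C, 0 <= C &
  forall x, `|x| ^+ k <= C * expR (e * x ^+ 2).
Proof.
move=> e0; exists (1 + e^-1 ^+ k * k`!%:R).
  by rewrite addr_ge0 // mulr_ge0 ?exprn_ge0 ?ler0n // invr_ge0 ltW.
move=> x; have u0 : 0 <= e * x ^+ 2 by apply: mulr_ge0; [exact: ltW|exact: sqr_ge0].
have h := expR_ge_pow k u0.
have e1 : 1 <= expR (e * x ^+ 2) by rewrite -expR0 ler_expR.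
rewrite mulrDl mul1r; apply: (@le_trans _ _ (1 + (x ^+ 2) ^+ k)).
  rewrite -[in leRHS](@real_normK _ x) ?num_real // exprAC.
  by have := sqr_ge0 (`|x| ^+ k - 1); nra.
apply: lerD => //; rewrite -mulrA exprVn ler_pdivlMl ?exprn_gt0 //.
by rewrite -exprMn.
Qed.

Lemma gauss_decay k : exists2 C, 0 <= C & forall x, `|gauss k x| <= C * expR (- x ^+ 2 / 4).
Proof.
have [//|C C0 hC] := @pow_le_expR2 k 4^-1; exists C => // x.
rewrite normrM [`|expR _|]ger0_norm ?expR_ge0 // normrX.
have -> : expR (- x ^+ 2 / 4) = expR (4^-1 * x ^+ 2) * expR (- x ^+ 2 / 2).
  by rewrite -expRD; congr expR; field.
by rewrite mulrA; apply: ler_wpM2r; [exact: expR_ge0|exact: hC].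
Qed.

Lemma gauss_derive_decay m k : exists2 C, 0 <= C &
  forall x, `|derive1n m (gauss k) x| <= C * expR (- x ^+ 2 / 4).
Proof.
elim: m k => [|m IH] k; first exact: gauss_decay.
have [C1 C10 h1] := IH k.-1; have [C2 C20 h2] := IH k.+1.
exists (k%:R * C1 + C2); first by rewrite addr_ge0 // mulr_ge0 ?ler0n.
move=> x; rewrite derive1Sn derive1_gauss.
rewrite (derive1nD m (smooth_scale _ (@smooth_gauss k.-1)) (smooth_scale _ (@smooth_gauss k.+1))).
rewrite (derive1nZ m _ (@smooth_gauss k.-1)) (derive1nZ m _ (@smooth_gauss k.+1)).
apply: le_trans (ler_normD _ _) _; rewrite mulrDl; apply: lerD.
  by rewrite normrM ger0_norm ?ler0n // -mulrA; apply: ler_wpM2l; rewrite ?ler0n.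
by rewrite mulN1r normrN.
Qed.

Lemma gauss_derive_decay_pow m j : exists2 C, 0 <= C &
  forall x, `|x| ^+ j * `|derive1n m (gauss 0) x| <= C * expR (- x ^+ 2 / 8).
Proof.
have [C C0 hC] := gauss_derive_decay m 0.
have [//|D D0 hD] := @pow_le_expR2 j 8^-1.
exists (C * D); first exact: mulr_ge0.
move=> x; apply: (@le_trans _ _ (D * expR (8^-1 * x ^+ 2) * (C * expR (- x ^+ 2 / 4)))).
  by apply: ler_pM => //; exact: exprn_ge0.
rewrite mulrACA [D * C]mulrC; apply: ler_wpM2l; first exact: mulr_ge0.
by rewrite -expRD ler_expR; slra.
Qed.

End Families.

Arguments smooth_gauss {R} k _ _.
Arguments smooth_flat {R} k _ _.

(** * Taylor estimates, geometric sequences and limits of smooth functions *)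

Section SmoothLimits.
Context {R : realType}.
Implicit Types (f g : R -> R) (x y c d M A B L s h : R) (m n N k : nat).

Lemma mean_value f x h : smooth f -> exists2 c, `|c - x| <= `|h| &
  f (x + h) - f x = h * derive1 f c.
Proof.
move=> hf; have cf := smooth_continuous hf.
have dd y : is_derive y 1 f (derive1 f y) by exact: smooth_is_derive.
have [h0|h0|h0] := ltgtP 0 h.
- have xh : x < x + h by slra.
  have [c] := MVT xh (fun y _ => dd y) (continuous_subspaceT cf).
  rewrite in_itv /= => /andP[c1 c2] e; exists c; last by rewrite e mulrC; congr (_ * _); ring.
  by rewrite !ger0_norm; slra.
- have xh : x + h < x by slra.
  have [c] := MVT xh (fun y _ => dd y) (continuous_subspaceT cf).
  rewrite in_itv /= => /andP[c1 c2] e; exists c; first by rewrite !ler0_norm; slra.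
  by rewrite -opprB e; ring.
- by exists x; rewrite -h0 ?subrr ?normr0 // addr0 subrr mul0r.
Qed.

Lemma smooth_lip f x h B : smooth f ->
  (forall c, `|c - x| <= `|h| -> `|derive1 f c| <= B) ->
  `|f (x + h) - f x| <= B * `|h|.
Proof.
move=> hf hB; have [c cx ->] := mean_value x h hf.
by rewrite normrM mulrC; apply: ler_wpM2r => //; exact: hB.
Qed.

Lemma smooth_taylor f x h B : smooth f ->
  (forall c, `|c - x| <= `|h| -> `|derive1n 2 f c| <= B) ->
  `|f (x + h) - f x - derive1 f x * h| <= B * h ^+ 2.
Proof.
move=> hf hB; have [c cx ->] := mean_value x h hf.
have -> : h * derive1 f c - derive1 f x * h = h * (derive1 f (x + (c - x)) - derive1 f x).
  by rewrite addrCA subrr addr0; ring.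
rewrite normrM -[h ^+ 2]ger0_norm ?sqr_ge0 // normrX expr2 mulrCA.
apply: ler_wpM2l => //; have B0 : 0 <= B.
  by apply: le_trans (hB x _); rewrite ?normr_ge0 // subrr normr0.
apply: le_trans (_ : B * `|c - x| <= _); last exact: ler_wpM2l.
apply: smooth_lip; first exact: smooth_derive1.
by move=> z zc; rewrite -[derive1 _ z]/(derive1n 2 f z); apply: hB; exact: le_trans cx.
Qed.

(** With [K = 1 / (1 - q)] the sequence [u - K e] increases, [u + K e] decreases, and they enclose
    the limit, which is taken as a supremum; this makes the error explicit. *)
Lemma ratio_limit (u e : nat -> R) (q : R) n0 : 0 <= q < 1 ->
  (forall n, (n0 <= n)%N -> `|u n.+1 - u n| <= e n) ->
  (forall n, (n0 <= n)%N -> e n.+1 <= q * e n) ->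
  exists l, forall n, (n0 <= n)%N -> `|u n - l| <= (1 - q)^-1 * e n.
Proof.
move=> /andP[q0 q1] hu he; set K := (1 - q)^-1.
have K0 : 0 < K by rewrite invr_gt0 subr_gt0.
have Kq : K * q = K - 1 by rewrite /K; field; rewrite subr_eq0 gt_eqF.
have e0 n : (n0 <= n)%N -> 0 <= e n by move=> /hu; exact: le_trans.
have K1 n : (n0 <= n)%N -> K * e n.+1 <= K * e n - e n.
  by move=> nn; have := ler_wpM2l (ltW K0) (he n nn); rewrite mulrA Kq mulrBl mul1r.
have mono (v : nat -> R) : (forall n, (n0 <= n)%N -> v n <= v n.+1) ->
    forall p q, (n0 <= p)%N -> (p <= q)%N -> v p <= v q.
  move=> hv p r p0; elim: r => [|r IH]; first by rewrite leqn0 => /eqP ->.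
  rewrite leq_eqVlt => /orP[/eqP -> //|pr].
  by apply: le_trans (IH pr) _; apply: hv; exact: leq_trans p0 pr.
have vm := mono (fun n => u n - K * e n) _.
have wm := mono (fun n => - (u n + K * e n)) _.
have {}vm p r : (n0 <= p)%N -> (p <= r)%N -> u p - K * e p <= u r - K * e r.
  apply: vm => n nn; have := hu n nn; have := K1 n nn; rewrite ler_norml => ? /andP[]; slra.
have {}wm p r : (n0 <= p)%N -> (p <= r)%N -> u r + K * e r <= u p + K * e p.
  move=> p0 pr; have := wm _ p r p0 pr; rewrite lerN2; apply => n nn.
  by have := hu n nn; have := K1 n nn; rewrite ler_norml => ? /andP[]; slra.
have vw p r : (n0 <= p)%N -> (n0 <= r)%N -> u p - K * e p <= u r + K * e r.
  move=> p0 r0; have := vm p (maxn p r) p0 (leq_maxl _ _).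
  have := wm r (maxn p r) r0 (leq_maxr _ _).
  by have := mulr_ge0 (ltW K0) (e0 (maxn p r) (leq_trans p0 (leq_maxl _ _))); slra.
pose A := [set u n - K * e n | n in [set n | (n0 <= n)%N]].
have hA : has_sup A.
  split; first by exists (u n0 - K * e n0); exists n0 => /=.
  by exists (u n0 + K * e n0) => _ [n /= nn <-]; exact: vw.
exists (sup A) => n nn; rewrite ler_norml; apply/andP; split.
  have : sup A <= u n + K * e n.
    by apply: ge_sup; [case: hA|move=> _ [p /= pp <-]; exact: vw].
  slra.
have : u n - K * e n <= sup A by apply: ub_le_sup; [case: hA|exists n].
slra.
Qed.

Lemma geometric_limit (u e : nat -> R) n0 :
  (forall n, (n0 <= n)%N -> `|u n.+1 - u n| <= e n) ->
  (forall n, (n0 <= n)%N -> e n.+1 <= e n / 2) ->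
  exists l, forall n, (n0 <= n)%N -> `|u n - l| <= 2 * e n.
Proof.
move=> hu he; have q1 : 0 <= (2^-1 : R) < 1 by slra.
have [l hl] := ratio_limit q1 hu (fun n nn => le_trans (he n nn) (eq_ind_r (fun z => _ <= z) (lexx _) (mulrC _ _))).
by exists l => n nn; apply: le_trans (hl n nn) _; rewrite le_eqVlt; apply/orP; left; apply/eqP; congr (_ * _); field.
Qed.

Lemma half_tends (e : nat -> R) n0 : (forall n, (n0 <= n)%N -> e n.+1 <= e n / 2) ->
  forall eps, 0 < eps -> forall k, exists2 n, (k <= n)%N && (n0 <= n)%N & e n <= eps.
Proof.
move=> he eps eps0 k.
have h n : e (n0 + n)%N <= `|e n0| / 2 ^+ n.
  elim: n => [|n IH]; first by rewrite addn0 expr0 divr1 ler_norm.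
  rewrite addnS; apply: le_trans (he _ (leq_addr _ _)) _.
  by rewrite exprS invfM mulrCA [leLHS]mulrC; apply: ler_wpM2l; rewrite ?invr_ge0.
have h2 n : n%:R <= 2 ^+ n :> R by rewrite -natrX ler_nat ltnW // ltn_expl.
have := archi_boundP (_ : 0 <= `|e n0| / eps).
set n := Num.bound _ => hn; have {}hn := hn (divr_ge0 (normr_ge0 _) (ltW eps0)).
exists (n0 + (n + k))%N; first by rewrite leq_addr andbT addnA leq_addl.
apply: le_trans (h _) _; rewrite ler_pdivrMr ?exprn_gt0 //.
move: hn; rewrite ltr_pdivrMr // => hn; apply: le_trans (ltW hn) _.
rewrite mulrC; apply: ler_wpM2l; first exact: ltW.
by apply: le_trans (h2 _); rewrite ler_nat leq_addr.
Qed.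

Lemma dist_tri3 (p q r B e1 e2 : R) : `|p - r| <= e1 -> `|q - r| <= e2 -> `|q| <= B ->
  `|p| <= B + e1 + e2.
Proof.
rewrite !ler_norml => /andP[? ?] /andP[? ?] /andP[? ?].
by apply/andP; split; slra.
Qed.

Lemma dist_tri4 (p q r p' q' r' B e1 : R) : `|p - q - r| <= B ->
  `|p - p'| <= e1 -> `|q - q'| <= e1 -> `|r - r'| <= e1 ->
  `|p' - q' - r'| <= B + 3 * e1.
Proof.
rewrite !ler_norml => /andP[? ?] /andP[? ?] /andP[? ?] /andP[? ?].
by apply/andP; split; slra.
Qed.

(** The order of differentiation is tied to the index ([m <= n]): from index n on, the corrections
    are controlled in every order up to n. This suits sums of humps tested against a functional of
    some fixed order. *)
Lemma smooth_limit (F : nat -> R -> R) (e : nat -> R) :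
  (forall n, smooth (F n)) ->
  (forall m n y, (m <= n)%N -> `|derive1n m (F n.+1) y - derive1n m (F n) y| <= e n) ->
  (forall n, e n.+1 <= e n / 2) ->
  exists2 G, smooth G &
    forall m n y, (m <= n)%N -> `|derive1n m (F n) y - derive1n m G y| <= 2 * e n.
Proof.
move=> sF hF he.
have hlim m y : exists l : R, forall n, (m <= n)%N -> `|derive1n m (F n) y - l| <= 2 * e n.
  by apply: geometric_limit => n mn; [exact: hF|exact: he].
have /choice[G' hG'] : forall p : nat * R, exists l : R, forall n, (p.1 <= n)%N ->
  `|derive1n p.1 (F n) p.2 - l| <= 2 * e n by case=> m y; exact: hlim.
pose G m y : R := G' (m, y).
have hG m y n : (m <= n)%N -> `|derive1n m (F n) y - G m y| <= 2 * e n by exact: hG' (m, y) n.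
have e0 n : 0 <= e n by apply: le_trans (hF 0%N n 0 (leq0n _)).
have e00 n : e n <= e 0%N.
  by elim: n => // n IH; apply: le_trans (he n) _; have := e0 n; slra.
have dG m y : is_derive y 1 (G m) (G m.+1 y).
  have [B B0 hB] := @smooth_bounded R (F m.+2) m.+2 (`|y| + 1) (sF m.+2).
  apply: (@is_derive_quad _ _ _ _ (B + 4 * e 0%N) 1) => // h h1.
  apply/ler_addgt0Pr => eps eps0.
  have eps8 : 0 < eps / 8 by slra.
  have [n /andP[mn _] en] := half_tends (fun n (_ : (0 <= n)%N) => he n) eps8 m.+2.
  have T : `|derive1n m (F n) (y + h) - derive1n m (F n) y - derive1n m.+1 (F n) y * h|
      <= (B + 4 * e 0%N) * h ^+ 2.
    apply: smooth_taylor; first exact: smooth_derive1n.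
    move=> c cy; have -> : derive1n 2 (derive1n m (F n)) c = derive1n m.+2 (F n) c by [].
    have cb : `|c| <= `|y| + 1.
      have := ler_normD (c - y) y; rewrite subrK => /le_trans; apply.
      by rewrite addrC; apply: lerD => //; apply: le_trans cy (ltW h1).
    have h2 := hG m.+2 c n mn; have h3 := hG m.+2 c m.+2 (leqnn _).
    have h4 := hB c cb m.+2 (leqnn _); have h5 := e00 n; have h6 := e00 m.+2.
    apply: le_trans (dist_tri3 h2 h3 h4) _; move: h5 h6; clear; lra.
  have h1' := hG m (y + h) n (ltnW (ltnW mn)); have h2 := hG m y n (ltnW (ltnW mn)).
  have h3 := hG m.+1 y n (ltnW mn).
  have h4 : `|derive1n m.+1 (F n) y * h - G m.+1 y * h| <= 2 * e n.
    by rewrite -mulrBl normrM -[leRHS]mulr1; apply: ler_pM => //; exact: ltW.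
  by apply: le_trans (dist_tri4 T h1' h2 h4) _; rewrite lerD2l; move: en eps0; clear; lra.
have dG' m : derive1 (G m) = G m.+1 by apply/funext => y; exact: is_derive1E (dG m y).
have nG m : derive1n m (G 0%N) = G m by elim: m => // m IH; rewrite derive1nS IH.
exists (G 0%N); first by move=> m y; rewrite nG; exact: is_derive1_ex (dG m y).
by move=> m n y mn; rewrite nG; exact: hG.
Qed.

End SmoothLimits.

(** * Compactly supported functionals and the gliding hump *)

Section Functionals.
Context {R : realType}.
Implicit Types (P : (R -> R) -> R) (f g psi : R -> R) (x y c d M A B L s h : R) (m n N k : nat).

(* Distributions with compact support, seen as functionals on smooth functions. *)
Definition cdist P : Prop :=
  (forall c f g, smooth f -> smooth g ->
    P (fun y => c * f y + g y) = c * P f + P g) /\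
  exists C N L, [/\ 0 <= C, 0 < L & forall f M, smooth f ->
    (forall y, `|y| <= L -> derivs_le N M f y) -> `|P f| <= C * M].

Definition zoom x s f : R -> R := fun y => f ((y - x) / s).

(* <P(x + s y), f(y)> = o(1/s): this is what a point value at x of a primitive of P gives. *)
Definition null_at P x : Prop := forall f L, smooth f -> (forall y, L < `|y| -> f y = 0) ->
  forall e, 0 < e -> exists2 d, 0 < d & forall s, 0 < s -> s < d -> `|P (zoom x s f)| <= e.

Lemma smooth_zoom x s f : smooth f -> smooth (zoom x s f).
Proof. exact: smooth_scal. Qed.
#[local] Arguments smooth_zoom x s {f} _ _ _.

Lemma cdistD P f g : cdist P -> smooth f -> smooth g -> P (fun y => f y + g y) = P f + P g.
Proof.
move=> [h _] sf sg; have := h 1 f g sf sg; rewrite mul1r => <-.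
by congr P; apply/funext => y; rewrite mul1r.
Qed.

Lemma cdist0 P : cdist P -> P (fun=> 0) = 0.
Proof.
move=> [h _]; have := h 1 _ _ (@smooth_const R 0) (@smooth_const R 0).
by rewrite mulr0 addr0 mul1r => /eqP; rewrite -subr_eq subrr => /eqP.
Qed.

Lemma cdistZ P c f : cdist P -> smooth f -> P (fun y => c * f y) = c * P f.
Proof.
move=> cP sf; have := cP.1 c f _ sf (@smooth_const R 0); rewrite cdist0 // addr0 => <-.
by congr P; apply/funext => y; rewrite addr0.
Qed.

Lemma cdistN P f : cdist P -> smooth f -> P (fun y => - f y) = - P f.
Proof.
move=> cP sf; rewrite -mulN1r -cdistZ //; congr P; apply/funext => y.
by rewrite mulN1r.
Qed.

Lemma cdistB P f g : cdist P -> smooth f -> smooth g -> P (fun y => f y - g y) = P f - P g.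
Proof. by move=> cP sf sg; rewrite (cdistD cP sf (smooth_opp sg)) cdistN. Qed.

Lemma cdist_far P : cdist P -> exists2 L, 0 < L &
  forall f, smooth f -> (forall y, `|y| < L -> f y = 0) -> P f = 0.
Proof.
(* One unit more than the radius in [cdist]: f then vanishes around each point of the closed ball of
   radius [L], and all its derivatives vanish there. *)
move=> [_ [C [N [L [C0 L0 h]]]]]; exists (L + 1); first slra.
move=> f sf f0; apply/eqP; rewrite -normr_le0; have := h f 0 sf; rewrite mulr0; apply.
move=> y yL; apply: (@derivs_le0 _ [set y | `|y| < L + 1]) => //=; last slra.
have -> : [set y : R | `|y| < L + 1] = ball 0 (L + 1).
  by apply/seteqP; split => z /=; rewrite -ball_normE /= sub0r normrN.
exact: ball_open.
Qed.

Lemma derivs_le_zoom N M f x s K y : smooth f -> 0 < s -> s^-1 <= K -> 1 <= K ->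
  derivs_le N M f ((y - x) / s) -> derivs_le N (K ^+ N * M) (zoom x s f) y.
Proof.
move=> sf s0 sK K1 hM m mN; rewrite /zoom (derive1n_scal m x s sf) normrM.
have si : 0 <= s^-1 by rewrite invr_ge0 ltW.
apply: ler_pM => //; last exact: hM.
rewrite normrX ger0_norm //; apply: (@le_trans _ _ (K ^+ m)).
  by apply: lerXn2r; rewrite ?nnegrE //; slra.
exact: ler_weXn2l.
Qed.

Lemma zoom_bound P x : cdist P -> exists C N, 0 <= C /\
  forall s K f M, smooth f -> 0 < s -> s^-1 <= K -> 1 <= K ->
  (forall y, derivs_le N M f y) -> `|P (zoom x s f)| <= C * K ^+ N * M.
Proof.
move=> [_ [C [N [L [C0 L0 h]]]]]; exists C, N; split => // s K f M sf s0 sK K1 hM.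
rewrite -mulrA; apply: h; first exact: smooth_zoom.
by move=> y _; apply: derivs_le_zoom.
Qed.

Section GlidingHump.
Variables (P : (R -> R) -> R) (x : R).
Hypotheses (cP : cdist P) (nP : null_at P x).

Let supp1 f := forall y, 1 < `|y| -> f y = 0.

(* Gliding hump: were there no uniform bound, a sum of bumps at rapidly decreasing scales would
   violate null_at. *)
Lemma null_at_bounded_small : exists C N d, [/\ 0 <= C, 0 < d &
  forall s f M, 0 < s -> s < d -> smooth f -> supp1 f ->
  (forall y, derivs_le N M f y) -> `|P (zoom x s f)| <= C * M].
Proof.
have [C0 [N0 [C00 hC0]]] := zoom_bound x cP.
apply: contrapT => contra.
(* A violation of the bound with constant [3 / eta], divided by the offending value: profiles with
   derivatives below [eta] on which P is exactly 3, at arbitrarily small scales. *)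
have H (N : nat) (eta d : R) : 0 < eta -> 0 < d -> exists (s : R) (f : R -> R),
    [/\ 0 < s < d, smooth f, supp1 f, (forall y, derivs_le N eta f y) & P (zoom x s f) = 3].
  move=> eta0 d0; apply: contrapT => no; apply: contra.
  exists (3 / eta), (maxn N N0), (Num.min d 1); split.
  - by apply: divr_ge0 => //; exact: ltW.
  - by rewrite lt_min d0 ltr01.
  move=> s f M s0; rewrite lt_min => /andP[sd s1] sf f1 hf.
  rewrite leNgt; apply/negP => big; apply: no.
  have M0 : 0 <= M by exact: derivs_le_ge0 (hf 0).
  set v := P (zoom x s f) in big *.
  have v0 : v != 0.
    apply/eqP => v0; move: big; rewrite v0 normr0 ltNge mulr_ge0 // divr_ge0 //; exact: ltW.
  have nv : 0 < `|v| by rewrite normr_gt0.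
  exists s, (fun y => (3 / v) * f y); split.
  - by rewrite s0.
  - exact: smooth_scale.
  - by move=> y y1; rewrite f1 ?mulr0.
  - move=> y; apply: (@derivs_leW _ N N (`|3 / v| * M)) => //; last first.
      by apply: derivs_leZ => //; apply: derivs_leW (hf y); rewrite ?leq_maxl.
    rewrite normrM normfV ger0_norm // mulrAC ler_pdivrMr //.
    by move: big; rewrite mulrAC ltr_pdivrMr // => /ltW; rewrite [eta * _]mulrC.
  - have -> : zoom x s (fun y => 3 / v * f y) = (fun y => 3 / v * zoom x s f y) by [].
    by rewrite (cdistZ _ cP (smooth_zoom x s sf)) -/v divfK.
have /choice[K hK] : forall p : nat * R * R, exists q : R * (R -> R),
    0 < p.1.2 -> 0 < p.2 -> [/\ 0 < q.1 < p.2, smooth q.2, supp1 q.2,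
      (forall y, derivs_le p.1.1 p.1.2 q.2 y) & P (zoom x q.1 q.2) = 3].
  case=> [[N eta] d]; have [[eta0 d0]|no] := pselect (0 < eta /\ 0 < d).
    by have [s [f hf]] := H N eta d eta0 d0; exists (s, f).
  by exists (0, fun=> 0) => e0 d0; exfalso; exact: no.
have /choice[D hD] : forall f : R -> R, exists d : R, smooth f -> supp1 f ->
    0 < d /\ forall s, 0 < s -> s < d -> `|P (zoom x s f)| <= 1.
  move=> f; have [[sf f1]|no] := pselect (smooth f /\ supp1 f).
    by have [d d0 hd] := nP sf f1 ltr01; exists d.
  by exists 0 => sf f1; exfalso; apply: no.
(* [st n] holds the sum of the profiles chosen so far and the tolerance for the next one. The next
   scale lies below [D] of that sum, so that the sum contributes at most 1 there, and below
   [1 / (n + 1)]. The new tolerance is halved for convergence and capped by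
   [s ^+ N0 / (2 (C0 + 1))], so that by [zoom_bound] all later profiles together contribute at most
   1 at scale s. *)
pose del (n : nat) (f : R -> R) : R := Num.min (Num.min 1 (D f)) (n.+1%:R^-1).
pose q (n : nat) (st : (R -> R) * R) := K (n, st.2, del n st.1).
pose nxt (n : nat) (st : (R -> R) * R) : (R -> R) * R :=
  (fun y => st.1 y + (q n st).2 y, Num.min (st.2 / 2) ((q n st).1 ^+ N0 / (2 * (C0 + 1)))).
pose st : nat -> (R -> R) * R := fix st n := if n is n'.+1 then nxt n' (st n') else (fun=> 0, 1).
have hst n : [/\ smooth (st n).1, supp1 (st n).1 & 0 < (st n).2] /\
   [/\ 0 < (q n (st n)).1 < del n (st n).1, smooth (q n (st n)).2, supp1 (q n (st n)).2,
      (forall y, derivs_le n (st n).2 (q n (st n)).2 y) & P (zoom x (q n (st n)).1 (q n (st n)).2) = 3].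
  have aux f e : smooth f -> supp1 f -> 0 < e ->
     [/\ 0 < (q n (f, e)).1 < del n f, smooth (q n (f, e)).2, supp1 (q n (f, e)).2,
      (forall y, derivs_le n e (q n (f, e)).2 y) & P (zoom x (q n (f, e)).1 (q n (f, e)).2) = 3].
    move=> sf f1 e0; apply: (hK (n, e, del n f)) => //=.
    by rewrite !lt_min ltr01 (hD f sf f1).1 invr_gt0 ltr0n.
  suff h : [/\ smooth (st n).1, supp1 (st n).1 & 0 < (st n).2].
    split => //; case: h; case: (st n) => f e /= *; exact: aux.
  clear aux; elim: n => [|n [sf f1 e0]] /=; first by split => //; exact: smooth_const.
  have [/andP[q0 _] sq q1 _ _] : [/\ 0 < (q n (st n)).1 < del n (st n).1, smooth (q n (st n)).2,
      supp1 (q n (st n)).2, (forall y, derivs_le n (st n).2 (q n (st n)).2 y) &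
      P (zoom x (q n (st n)).1 (q n (st n)).2) = 3].
    apply: (hK (n, (st n).2, del n (st n).1)) => //=.
    by rewrite !lt_min ltr01 (hD _ sf f1).1 invr_gt0 ltr0n.
  split; first exact: smooth_add.
    by move=> y y1; rewrite f1 // q1 // addr0.
  by rewrite lt_min divr_gt0 //= divr_gt0 ?exprn_gt0 //; slra.
have hhalf n : (st n.+1).2 <= (st n).2 / 2 by rewrite /= ge_min lexx.
have [G sG hG] : exists2 G, smooth G & forall m n y, (m <= n)%N ->
    `|derive1n m (st n).1 y - derive1n m G y| <= 2 * (st n).2.
  apply: (@smooth_limit R (fun n => (st n).1) (fun n => (st n).2)) => //.
    by move=> n; have [[]] := hst n.
  move=> m n y mn; have [[sf _ _] [_ sq _ hq _]] := hst n.
  by rewrite /= (derive1nD m sf sq) addrAC subrr add0r; exact: hq.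
have G1 : supp1 G.
  move=> y y1; apply/eqP; rewrite -normr_le0; apply/ler_addgt0Pr => eps eps0.
  have eps2 : 0 < eps / 2 by slra.
  have [n _ hn] := half_tends (fun n (_ : (0 <= n)%N) => hhalf n) eps2 0.
  have [[_ f1 _] _] := hst n.
  have := hG 0%N n y (leq0n _); rewrite !derive1n0 f1 // sub0r normrN add0r => /le_trans; apply.
  by move: hn; clear; lra.
have half0 : 0 < 1 / 2 :> R by slra.
have [d d0 hd] := nP sG G1 half0.
have di0 : 0 < d^-1 by rewrite invr_gt0.
have [n nN nd] : exists2 n, (N0 <= n)%N & n.+1%:R^-1 < d.
  have := archi_boundP (ltW di0); set b := Num.bound _ => hb; exists (maxn N0 b); first exact: leq_maxl.
  rewrite invf_plt ?posrE ?ltr0n //; apply: lt_le_trans hb _.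
  by rewrite ler_nat ltnW // ltnS leq_maxr.
have [[sf f1 e0] [/andP[q0 qd] sq q1 hq q3]] := hst n.
have [[sf' _ _] _] := hst n.+1.
move: qd; rewrite !lt_min => /andP[/andP[q11 qD] qn].
set s := (q n (st n)).1 in q0 q11 qD qn q3.
(* Earlier profiles, the current one, later ones: the modulus is at least 3 - 1 - 1, against the
   bound 1/2 that [null_at] gives for G. *)
have e : P (zoom x s G) = P (zoom x s (st n).1) + 3 + P (zoom x s (fun y => G y - (st n.+1).1 y)).
  rewrite -q3 -(cdistD cP (smooth_zoom x s sf) (smooth_zoom x s sq)).
  rewrite -(cdistD cP (smooth_add (smooth_zoom x s sf) (smooth_zoom x s sq))
    (smooth_zoom x s (smooth_sub sG sf'))).
  congr P; apply/funext => y; rewrite /zoom /=; ring.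
have b1 := (hD _ sf f1).2 s q0 qD.
have b2 := hd s q0 (lt_trans qn nd).
have b3 : `|P (zoom x s (fun y => G y - (st n.+1).1 y))| <= 1.
  have si : 1 <= s^-1 by rewrite invf_ge1 // ltW.
  have hdl y : derivs_le N0 (2 * (st n.+1).2) (fun y => G y - (st n.+1).1 y) y.
    by move=> m mN; rewrite (derive1nB m sG sf') distrC; apply: hG; apply: leqW; exact: leq_trans nN.
  have := hC0 s _ _ _ (smooth_sub sG sf') q0 (lexx _) si hdl => /le_trans; apply.
  have : (st n.+1).2 <= s ^+ N0 / (2 * (C0 + 1)) by rewrite /= ge_min lexx orbT.
  rewrite ler_pdivlMr; last slra; move=> hb.
  rewrite exprVn mulrAC ler_pdivrMr ?exprn_gt0 // mul1r; apply: le_trans hb.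
  have e10 : 0 < (st n.+1).2 by have [[]] := hst n.+1.
  by move: e10 C00; clear; nra.
move: b1 b2 b3; rewrite e !ler_norml => /andP[? ?] /andP[? ?] /andP[? ?]; slra.
Qed.

(** Small scales are covered by the gliding hump; at scales bounded below, zooming costs only a
    fixed factor in the seminorm of P. *)
Lemma null_at_bounded A : exists C N, 0 <= C /\
  forall s f M, 0 < s -> s <= A -> smooth f -> supp1 f ->
  (forall y, derivs_le N M f y) -> `|P (zoom x s f)| <= C * M.
Proof.
have [C [N [d [C0 d0 h]]]] := null_at_bounded_small.
have [C' [N' [C'0 h']]] := zoom_bound x cP.
pose K := Num.max 1 d^-1.
have K1 : 1 <= K by rewrite le_max lexx.
exists (C + C' * K ^+ N'), (maxn N N'); split.
  by rewrite addr_ge0 // mulr_ge0 // exprn_ge0 //; slra.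
move=> s f M s0 _ sf f1 hf; have M0 : 0 <= M by exact: derivs_le_ge0 (hf 0).
have C'K : 0 <= C' * K ^+ N' by rewrite mulr_ge0 // exprn_ge0 //; slra.
rewrite mulrDl; have [sd|ds] := ltP s d.
  apply: le_trans (h s f M s0 sd sf f1 _) _; last by rewrite lerDl mulr_ge0.
  by move=> y; apply: derivs_leW (hf y); rewrite ?leq_maxl.
apply: le_trans (h' s K f M sf s0 _ K1 _) _; last by rewrite lerDr mulr_ge0.
- by rewrite /K le_max lef_pV2 ?posrE // ds orbT.
- by move=> y; apply: derivs_leW (hf y); rewrite ?leq_maxr.
Qed.

End GlidingHump.

End Functionals.

Arguments smooth_zoom {R} x s {f} _ _ _.

(** * Localization by overlapping intervals and dyadic shells *)

Section Dyadic.
Context {R : realType}.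
Implicit Types (P : (R -> R) -> R) (f g psi : R -> R) (x y c d M A B L s h r t : R) (m n N k : nat).

Lemma pow_small (q e : R) : 0 <= q < 1 -> 0 < e -> exists n, forall m, (n <= m)%N -> q ^+ m <= e.
Proof.
move=> /andP[q0 q1] e0.
have /cvgrPdist_le/(_ e e0)[n _ hn] : q ^+ n @[n --> \oo] --> 0.
  by apply: cvg_expr; rewrite ger0_norm.
by exists n => m nm; have := hn m nm; rewrite /= sub0r normrN ger0_norm // exprn_ge0.
Qed.

(** Cousin's lemma with two pieces of length two thirds: they overlap in the middle third, which
    leaves room for a partition of unity when [hglue] is verified. If G fails on the whole it fails
    on one piece, and the nested pieces shrink to a point. *)
Lemma cousin (G : R -> R -> Prop) p q : p < q ->
  (forall u v, p <= u -> u < v -> v <= q ->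
    G u (u + 2 / 3 * (v - u)) -> G (v - 2 / 3 * (v - u)) v -> G u v) ->
  (forall x, p <= x <= q -> exists2 d, 0 < d & forall u v, p <= u -> v <= q ->
    x - d < u -> u < v -> v < x + d -> G u v) ->
  G p q.
Proof.
move=> pq hglue hloc; apply: contrapT => nG.
pose nxt (w : R * R) : R * R := if `[< G w.1 (w.1 + 2 / 3 * (w.2 - w.1)) >]
  then (w.2 - 2 / 3 * (w.2 - w.1), w.2) else (w.1, w.1 + 2 / 3 * (w.2 - w.1)).
pose w n := iter n nxt (p, q).
have hw n : [/\ p <= (w n).1, (w n).1 < (w n).2, (w n).2 <= q & ~ G (w n).1 (w n).2].
  elim: n => [|n [h1 h2 h3 h4]]; first by split => //=.
  rewrite /w iterS -/(w n) /nxt; case: asboolP => [g|ng] /=; split => //; try slra.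
  by move=> g'; apply: h4; exact: hglue.
have mon n : (w n).1 <= (w n.+1).1 /\ (w n.+1).2 <= (w n).2.
  have [h1 h2 h3 _] := hw n.
  by rewrite {2 3}/w iterS -/(w n) /nxt; case: asboolP => _ /=; split; slra.
have len n : (w n).2 - (w n).1 = (2 / 3) ^+ n * (q - p).
  elim: n => [|n IH]; first by rewrite expr0 mul1r.
  by rewrite exprS -mulrA -IH /w iterS -/(w n) /nxt; case: asboolP => _ /=; slra.
have mle i j : (i <= j)%N -> (w i).1 <= (w j).1 /\ (w j).2 <= (w i).2.
  elim: j => [|j IH]; first by rewrite leqn0 => /eqP ->.
  rewrite leq_eqVlt => /orP[/eqP -> //|/IH[a1 a2]].
  by have [b1 b2] := mon j; split; [exact: le_trans b1|exact: le_trans a2].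
have cross i j : (w i).1 <= (w j).2.
  have [a1 _] := mle i (maxn i j) (leq_maxl _ _).
  have [_ a2] := mle j (maxn i j) (leq_maxr _ _).
  have [_ b _ _] := hw (maxn i j).
  exact: le_trans a1 (le_trans (ltW b) a2).
pose S := range (fun n => (w n).1).
have hS : has_sup S.
  by split; [exists (w 0%N).1; exists 0%N|exists (w 0%N).2 => _ [n _ <-]; exact: cross].
have s1 n : (w n).1 <= sup S by apply: ub_le_sup; [case: hS|exists n].
have s2 n : sup S <= (w n).2.
  by apply: ge_sup; [case: hS|move=> _ [k _ <-]; exact: cross].
have pS : p <= sup S <= q by have := s1 0%N; have := s2 0%N; rewrite /= => -> ->.
have [d d0 hd] := hloc (sup S) pS.
have q23 : 0 <= (2 / 3 : R) < 1 by slra.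
have dl : 0 < d / 2 / (q - p) by rewrite !divr_gt0 // subr_gt0.
have [n hn] := pow_small q23 dl.
have ln : (w n).2 - (w n).1 <= d / 2.
  rewrite len -ler_pdivlMr ?subr_gt0 //; exact: hn.
have [h1 h2 h3 h4] := hw n; apply: h4; apply: hd => //; have := s1 n; have := s2 n; slra.
Qed.

Lemma continuous_dist c : continuous (fun y : R => `|y - c|).
Proof.
move=> z; apply: (@continuous_comp _ _ _ (fun y : R => y - c) (fun y => `|y|)).
  by apply: (@continuousB _ _ _ id (cst c)); [exact: cvg_id|exact: cst_continuous].
exact: norm_continuous.
Qed.

Lemma open_far c a : open [set y : R | a < `|y - c|].
Proof.
apply: (@open_comp _ _ (fun y : R => `|y - c|) [set z | a < z]); last exact: open_gt.
by move=> z _; exact: continuous_dist.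
Qed.

Lemma open_near c a : open [set y : R | `|y - c| < a].
Proof.
apply: (@open_comp _ _ (fun y : R => `|y - c|) [set z | z < a]); last exact: open_lt.
by move=> z _; exact: continuous_dist.
Qed.

Lemma open_far0 a : open [set y : R | a < `|y|].
Proof.
have -> : [set y : R | a < `|y|] = [set y : R | a < `|y - 0|].
  by apply/seteqP; split => z /=; rewrite subr0.
exact: open_far.
Qed.

Lemma open_near0 a : open [set y : R | `|y| < a].
Proof.
have -> : [set y : R | `|y| < a] = [set y : R | `|y - 0| < a].
  by apply/seteqP; split => z /=; rewrite subr0.
exact: open_near.
Qed.

Lemma bump_derivs N : exists2 B, 0 <= B & forall y : R, derivs_le N B bump y.
Proof.
have [B B0 hB] := @smooth_bounded R bump N 3 smooth_bump.
exists B => // y; have [y3|y3] := leP `|y| 3; first exact: hB.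
apply: (@derivs_leW _ N N 0 B) => //; apply: (@derivs_le0 R _ N _ y (@open_far0 2)) => /=; last slra.
by move=> z /ltW; exact: bump0.
Qed.

Section Shell.
Variables (P : (R -> R) -> R) (x : R).
Hypotheses (cP : cdist P) (nP : null_at P x).

(** Zooming by [2 * r] carries the shell into the unit ball, where [null_at_bounded] applies with
    constants free of r; the factors [r ^+ m] in the hypothesis are exactly what zooming
    produces. *)
Lemma shell_bound_gen A (W : R -> R) (lo : R) : smooth W ->
  (forall z, 2 <= `|z| -> W z = 0) -> (forall z, `|z| < lo -> W z = 0) ->
  exists C N, 0 <= C /\ forall r a psi, 0 < r -> r <= A -> 0 <= a -> smooth psi ->
    (forall m y, (m <= N)%N -> lo * r <= `|y - x| -> `|y - x| <= 2 * r ->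
      r ^+ m * `|derive1n m psi y| <= a) ->
    `|P (fun y => psi y * zoom x r W y)| <= C * a.
Proof.
move=> sW W2 W1; have [C [N [C0 hC]]] := null_at_bounded cP nP (2 * A).
have [B B0 hB] := @smooth_bounded R (fun z => W (0 + 2 * z)) N 1 (smooth_dil 0 2 sW).
exists (C * (2 ^+ N * (2 ^+ N * B))), N; split.
  by rewrite !mulr_ge0 // exprn_ge0.
move=> r a psi r0 rA a0 sp hp.
pose Psi z := psi (x + 2 * r * z) * W (0 + 2 * z).
have sPsi : smooth Psi by apply: smooth_mul; apply: smooth_dil.
have -> : (fun y => psi y * zoom x r W y) = zoom x (2 * r) Psi.
  apply/funext => y; rewrite /zoom /Psi; congr (psi _ * W _); field; rewrite ?gt_eqF //; slra.
have r2 : 0 < 2 * r by slra.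
have n2 (z : R) : `|0 + 2 * z| = 2 * `|z| by rewrite add0r normrM ger0_norm.
have zfar z : 1 < `|z| -> derivs_le N 0 Psi z.
  move=> z1; apply: (@derivs_le0 R _ N _ z (@open_far0 1)) => // w /= w1.
  by rewrite /Psi W2 ?mulr0 // n2; slra.
have znear z : `|z| < lo / 2 -> derivs_le N 0 Psi z.
  move=> z1; apply: (@derivs_le0 R _ N _ z (@open_near0 (lo / 2))) => // w /= w1.
  by rewrite /Psi W1 ?mulr0 // n2; slra.
have hmain z : derivs_le N (2 ^+ N * (2 ^+ N * a * B)) Psi z.
  have c0 : 0 <= 2 ^+ N * (2 ^+ N * a * B) by rewrite !mulr_ge0 // exprn_ge0.
  have [z1|z1] := ltP 1 `|z|; first exact: derivs_leW (zfar z z1).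
  have [z2|z2] := ltP `|z| (lo / 2); first exact: derivs_leW (znear z z2).
  apply: derivs_leM; [exact: smooth_dil|exact: smooth_dil| |exact: hB].
  move=> m mN; rewrite (derive1n_dil m x (2 * r) sp) normrM normrX [`|2 * r|]ger0_norm; last exact: ltW.
  have e : `|x + 2 * r * z - x| = 2 * r * `|z|.
    by rewrite addrAC subrr add0r normrM ger0_norm // ltW.
  set w := x + _ in e *; rewrite exprMn -[leLHS]mulrA; apply: ler_pM.
  - exact: exprn_ge0.
  - by rewrite mulr_ge0 // exprn_ge0 // ltW.
  - by apply: ler_weXn2l => //; rewrite ler1n.
  - by apply: hp => //; rewrite e; nra.
apply: le_trans (hC _ _ _ r2 _ sPsi _ hmain) _; first slra.
  by move=> y y1; have := zfar y y1 0%N (leq0n _); rewrite derive1n0 normr_le0 => /eqP.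
by rewrite le_eqVlt; apply/orP; left; apply/eqP; ring.
Qed.

Lemma core_bound A : exists C N, 0 <= C /\ forall r a psi, 0 < r -> r <= A -> 0 <= a ->
    smooth psi -> (forall m y, (m <= N)%N -> `|y - x| <= 2 * r ->
      r ^+ m * `|derive1n m psi y| <= a) ->
    `|P (fun y => psi y * zoom x r bump y)| <= C * a.
Proof.
have lo0 (z : R) : `|z| < 0 -> bump z = 0 by rewrite ltNge normr_ge0.
have [C [N [C0 h]]] := @shell_bound_gen A bump 0 smooth_bump (@bump0 R) lo0.
exists C, N; split => // r a psi r0 rA a0 sp hp; apply: h => // m y mN _; exact: hp.
Qed.

Lemma shell_bound A : exists C N, 0 <= C /\ forall r a psi, 0 < r -> r <= A -> 0 <= a ->
    smooth psi -> (forall m y, (m <= N)%N -> r / 2 <= `|y - x| -> `|y - x| <= 2 * r ->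
      r ^+ m * `|derive1n m psi y| <= a) ->
    `|P (fun y => psi y * (zoom x r bump y - zoom x (r / 2) bump y))| <= C * a.
Proof.
have sW : smooth (fun z : R => bump z - bump (0 + 2 * z)).
  by apply: smooth_sub; [exact: smooth_bump|apply: smooth_dil; exact: smooth_bump].
have n2 (z : R) : `|0 + 2 * z| = 2 * `|z| by rewrite add0r normrM ger0_norm.
have hi (z : R) : 2 <= `|z| -> bump z - bump (0 + 2 * z) = 0.
  by move=> z2; rewrite !bump0 ?subrr // n2; slra.
have lo (z : R) : `|z| < 2^-1 -> bump z - bump (0 + 2 * z) = 0.
  by move=> z2; rewrite !bump1 ?subrr // ?n2; slra.
have [C [N [C0 h]]] := @shell_bound_gen A _ 2^-1 sW hi lo.
exists C, N; split => // r a psi r0 rA a0 sp hp.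
have -> : (fun y => psi y * (zoom x r bump y - zoom x (r / 2) bump y)) =
   (fun y => psi y * zoom x r (fun z => bump z - bump (0 + 2 * z)) y).
  apply/funext => y; rewrite /zoom; congr (_ * (_ - bump _)).
  by field; rewrite gt_eqF.
by apply: h => // m y mN; rewrite mulrC; exact: hp.
Qed.

(** The cutoffs [bump] at the scales [t * 2 ^+ k] telescope into one core and finitely many shells.
    The constant depends neither on t nor on the number of shells, so a summable sequence [a] gives
    a bound uniform in the scale. *)
Lemma dyadic_bound T : exists C N, 0 <= C /\ forall t (a : nat -> R) psi, 0 < t -> t <= T ->
  smooth psi -> (forall k, 0 <= a k) ->
  (forall k m y, (m <= N)%N -> (k != 0)%N -> t * 2 ^+ k <= 2 * `|y - x| ->
     `|y - x| <= 2 * (t * 2 ^+ k) -> (t * 2 ^+ k) ^+ m * `|derive1n m psi y| <= a k) ->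
  (forall m y, (m <= N)%N -> `|y - x| <= 2 * t -> t ^+ m * `|derive1n m psi y| <= a 0%N) ->
  exists n, `|P psi| <= C * \sum_(k < n.+1) a k.
Proof.
have [L L0 hL] := cdist_far cP.
pose R0 := L + `|x|; pose A := Num.max T (2 * R0).
have R00 : 0 < R0 by rewrite /R0; have := normr_ge0 x; slra.
have [C1 [N1 [C10 h1]]] := core_bound A.
have [C2 [N2 [C20 h2]]] := shell_bound A.
exists (C1 + C2), (maxn N1 N2); split; first exact: addr_ge0.
move=> t a psi t0 tT sp a0 hs hc.
have p2 k : 0 < t * 2 ^+ k by rewrite mulr_gt0 // exprn_gt0.
pose kap k := zoom x (t * 2 ^+ k) bump.
have sk k : smooth (kap k) := smooth_zoom x _ smooth_bump.
have claim n : t * 2 ^+ n <= A ->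
    `|P (fun y => psi y * kap n y)| <= (C1 + C2) * \sum_(k < n.+1) a k.
  elim: n => [|n IH] nA.
    rewrite big_ord1 mulrDl; apply: ler_wpDr; first exact: mulr_ge0.
    rewrite /kap expr0 mulr1; apply: h1 => //; first by rewrite -[t]mulr1 -(expr0 2).
    by move=> m y mN; apply: hc; rewrite leq_max mN.
  have nA' : t * 2 ^+ n <= A by move: nA (p2 n); rewrite exprS; clear; lra.
  have e : (fun y => psi y * kap n.+1 y) =
      (fun y => psi y * kap n y + psi y * (kap n.+1 y - kap n y)).
    by apply/funext => y; ring.
  have s1 : smooth (fun y => psi y * kap n y) := smooth_mul sp (sk n).
  have s2 : smooth (fun y => psi y * (kap n.+1 y - kap n y)).
    exact: smooth_mul sp (smooth_sub (sk _) (sk _)).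
  rewrite e (cdistD cP s1 s2) big_ord_recr /= mulrDr.
  apply: le_trans (ler_normD _ _) _; apply: lerD; first exact: IH.
  rewrite mulrDl; apply: ler_wpDl; first exact: mulr_ge0.
  have -> : kap n = zoom x (t * 2 ^+ n.+1 / 2) bump.
    have e2 : t * 2 ^+ n.+1 / 2 = t * 2 ^+ n by rewrite exprS; field.
    by rewrite /kap e2.
  apply: h2 => // m y mN y1 y2; apply: hs => //; first by rewrite leq_max mN orbT.
  by move: y1; clear; lra.
(* The first scale that covers all that P and x involve; by minimality it is at most [2 * R0] (or
   equal to t), so the shell constants for scales up to [A] still apply. *)
have [n nA nR] : exists2 n, t * 2 ^+ n <= A & R0 <= t * 2 ^+ n.
  have [n0 hn0] : exists n, R0 <= t * 2 ^+ n.
    have q12 : 0 <= (2^-1 : R) < 1 by slra.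
    have tR : 0 < t / R0 by rewrite divr_gt0.
    have [n /(_ n (leqnn n))] := pow_small q12 tR.
    rewrite exprVn ler_pdivlMr // mulrC ler_pdivrMr ?exprn_gt0 // => h; by exists n.
  have [n hn nmin] := ex_minnP (ex_intro (fun n => R0 <= t * 2 ^+ n) n0 hn0).
  exists n => //; rewrite /A le_max; case: n hn nmin => [|n] hn nmin.
    by rewrite expr0 mulr1 tT.
  apply/orP; right; have : ~~ (R0 <= t * 2 ^+ n).
    by apply/negP => /nmin; rewrite ltnn.
  by rewrite -ltNge exprS; clear; lra.
exists n; suff -> : P psi = P (fun y => psi y * kap n y) by exact: claim.
apply/eqP; rewrite -subr_eq0 -(cdistB cP sp (smooth_mul sp (sk n))); apply/eqP.
apply: hL; first exact: smooth_sub sp (smooth_mul sp (sk n)).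
move=> y yL; rewrite /kap /zoom bump1 ?mulr1 ?subrr // normrM normfV.
have nn := p2 n; rewrite ler_pdivrMr ?normr_gt0 ?gt_eqF // mul1r.
rewrite [leRHS]ger0_norm; last exact: ltW.
apply: le_trans nR; apply: le_trans (ler_normB _ _) _.
by rewrite /R0; apply: lerD => //; exact: ltW.
Qed.

End Shell.

End Dyadic.

(** * Scale-invariant bounds and principal values at a singular point *)

Section Weighted.
Context {R : realType}.
Implicit Types (P : (R -> R) -> R) (f g psi : R -> R) (O : set R) (x y c d A B D L s h r t rho be : R) (m n N k j : nat).

(** Derivatives measured in units of the length [rho]; such bounds are invariant under a
    simultaneous zoom of function and unit. *)
Definition wderivs rho N A f y : Prop :=
  forall m, (m <= N)%N -> rho ^+ m * `|derive1n m f y| <= A.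

Lemma wderivs1 N A f y : wderivs 1 N A f y <-> derivs_le N A f y.
Proof. by split => h m mN; have := h m mN; rewrite expr1n mul1r. Qed.

Lemma wderivs_ge0 rho N A f y : wderivs rho N A f y -> 0 <= A.
Proof. by move=> /(_ 0%N isT); rewrite expr0 mul1r; exact: le_trans. Qed.

Lemma wderivsW rho N N' A A' f y : (N' <= N)%N -> A <= A' ->
  wderivs rho N A f y -> wderivs rho N' A' f y.
Proof. by move=> NN AA h m mN; apply: le_trans AA; apply: h; exact: leq_trans NN. Qed.

Lemma wderivs_derive1 rho N A f y : 0 < rho ->
  wderivs rho N.+1 A f y -> wderivs rho N (A / rho) (derive1 f) y.
Proof.
move=> r0 h m mN; rewrite -derive1Sn ler_pdivlMr // mulrAC -exprSr; exact: h.
Qed.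

Lemma wderivs_mul O rho N A B f g x : 0 < rho -> open O -> smooth_on O f -> smooth_on O g ->
  O x -> wderivs rho N A f x -> wderivs rho N B g x ->
  wderivs rho N (2 ^+ N * (A * B)) (fun y => f y * g y) x.
Proof.
move=> r0 oO; elim: N A B f g => [|N IH] A B f g hf hg Ox hA hB.
  move=> m; rewrite leqn0 => /eqP ->; rewrite !expr0 !mul1r normrM.
  have := hA 0%N isT; have := hB 0%N isT; rewrite expr0 !mul1r !derive1n0 => b a.
  exact: ler_pM.
have A0 := wderivs_ge0 hA; have B0 := wderivs_ge0 hB.
case=> [|m] mN.
  rewrite expr0 mul1r derive1n0 normrM; apply: (@le_trans _ _ (1 * (A * B))); last first.
    by apply: ler_wpM2r; [exact: mulr_ge0 | apply: exprn_ege1; rewrite ler1n].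
  have := hA 0%N isT; have := hB 0%N isT; rewrite expr0 !mul1r !derive1n0 => b a.
  exact: ler_pM.
have e y : O y -> derive1 (fun y => f y * g y) y =
    derive1 f y * g y + f y * derive1 g y.
  by move=> Oy; rewrite derive1_mul //; [exact: (hf 0%N) | exact: (hg 0%N)].
have hf' := smooth_on_derive1 hf; have hg' := smooth_on_derive1 hg.
rewrite derive1Sn (derive1n_local _ oO e) //.
have h1 : wderivs rho N (2 ^+ N * (A / rho * B)) (fun y => derive1 f y * g y) x.
  by apply: IH => //; [exact: wderivs_derive1|exact: wderivsW hB].
have h2 : wderivs rho N (2 ^+ N * (A * (B / rho))) (fun y => f y * derive1 g y) x.
  by apply: IH => //; [exact: wderivsW hA|exact: wderivs_derive1].
rewrite (@derive1n_add _ O (fun y => derive1 f y * g y) (fun y => f y * derive1 g y) m oO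
  (smooth_on_mul oO hf' hg) (smooth_on_mul oO hf hg') _ Ox).
have a1 := h1 m mN; have a2 := h2 m mN.
set u := derive1n m _ x in a1 *; set v := derive1n m _ x in a2 *.
rewrite exprS -mulrA; apply: (@le_trans _ _ (rho * (2 ^+ N * (A / rho * B) + 2 ^+ N * (A * (B / rho))))).
  apply: ler_wpM2l; first exact: ltW.
  apply: le_trans (_ : rho ^+ m * (`|u| + `|v|) <= _).
    by apply: ler_wpM2l; [rewrite exprn_ge0 // ltW|exact: ler_normD].
  by rewrite mulrDr; exact: lerD.
by rewrite le_eqVlt; apply/orP; left; apply/eqP; rewrite exprS; field; rewrite gt_eqF.
Qed.

Lemma wderivs_le rho N B f y K : 0 <= rho -> rho <= K -> 1 <= K -> derivs_le N B f y ->
  wderivs rho N (K ^+ N * B) f y.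
Proof.
move=> r0 rK K1 h m mN; apply: ler_pM => //; [exact: exprn_ge0| |exact: h].
apply: (@le_trans _ _ (K ^+ m)); last exact: ler_weXn2l.
by apply: lerXn2r; rewrite ?nnegrE //; slra.
Qed.

Lemma wderivs_zoom N B f x s rho y K : smooth f -> 0 < s -> 0 <= rho -> rho <= K * s -> 1 <= K ->
  derivs_le N B f ((y - x) / s) -> wderivs rho N (K ^+ N * B) (zoom x s f) y.
Proof.
move=> sf s0 r0 rK K1 h m mN; rewrite /zoom (derive1n_scal m x s sf) normrM normrX.
have si : 0 <= s^-1 by rewrite invr_ge0 ltW.
rewrite [`|s^-1|]ger0_norm // mulrA -exprMn.
have K0 : 0 <= rho / s by rewrite divr_ge0 // ltW.
have rs : rho / s <= K by rewrite ler_pdivrMr.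
exact: wderivs_le h m mN.
Qed.

Definition off x : set R := [set y | y != x].

Lemma open_off x : open (off x).
Proof. exact: open_neq. Qed.

Definition theta x j : R -> R := fun y => 1 - zoom x (2^-1 ^+ j) bump y.

Lemma rj0 j : 0 < (2^-1 : R) ^+ j. Proof. exact: exprn_gt0. Qed.

Lemma smooth_theta x j : smooth (theta x j).
Proof. by apply: smooth_sub; [exact: smooth_const|apply: smooth_zoom; exact: smooth_bump]. Qed.

Lemma theta0 x j y : `|y - x| <= 2^-1 ^+ j -> theta x j y = 0.
Proof.
move=> h; rewrite /theta /zoom bump1 ?subrr // normrM normfV.
by rewrite ler_pdivrMr ?normr_gt0 ?gt_eqF ?rj0 // mul1r [leRHS]ger0_norm // ltW ?rj0.
Qed.

Lemma theta1 x j y : 2 * 2^-1 ^+ j <= `|y - x| -> theta x j y = 1.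
Proof.
move=> h; rewrite /theta /zoom bump0 ?subr0 // normrM normfV.
by rewrite ler_pdivlMr ?normr_gt0 ?gt_eqF ?rj0 // [`|2^-1 ^+ j|]ger0_norm // ltW ?rj0.
Qed.

Lemma smooth_off_mul x M g r : smooth_on (off x) M -> smooth g -> 0 < r ->
  (forall y, `|y - x| < r -> g y = 0) -> smooth (fun y => M y * g y).
Proof.
move=> sM sg r0 g0; apply/smoothE => m y _; have [->|yx] := eqVneq y x.
  have o := @open_near R x r; have xo : [set y | `|y - x| < r] x by rewrite /= subrr normr0.
  apply: (@smooth_on_local R _ (fun=> 0) _ o _ _ m x xo) => [z zr|].
    by rewrite g0 ?mulr0.
  exact: smooth_cst.
by apply: (smooth_on_mul (@open_off x) sM (smooth_smooth_on sg)).
Qed.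

Lemma smooth_mul_theta x j M : smooth_on (off x) M -> smooth (fun y => M y * theta x j y).
Proof.
move=> sM; apply: (smooth_off_mul sM (@smooth_theta x j) (rj0 j)) => y yr.
by apply: theta0; exact: ltW.
Qed.

#[local] Arguments smooth_mul_theta {x} j {M} _ _ _.

(** A symbol-type bound: the derivative of order m may behave like [|y - x|] to the power
    [be - m]. *)
Definition sing x be N D M : Prop := smooth_on (off x) M /\
  forall y, y != x -> `|y - x| <= 2 -> wderivs `|y - x| N (D * `|y - x| `^ be) M y.

(* M may be singular at x; it is cut off there at scale 2^-j. *)
Definition pv_to P x M l : Prop :=
  forall e, 0 < e -> exists J, forall j, (J <= j)%N -> `|P (fun y => M y * theta x j y) - l| <= e.

Definition pv P x M : R := get [set l | pv_to P x M l].

Lemma pv_to_unique P x M l l' : pv_to P x M l -> pv_to P x M l' -> l = l'.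
Proof.
move=> h h'; apply/eqP; rewrite -subr_eq0 -normr_le0; apply/ler_addgt0Pr => e e0.
have e2 : 0 < e / 2 by slra.
have [J hJ] := h _ e2; have [J' hJ'] := h' _ e2.
have := hJ (maxn J J') (leq_maxl _ _); have := hJ' (maxn J J') (leq_maxr _ _).
set p := P _; rewrite add0r !ler_norml => /andP[? ?] /andP[? ?]; apply/andP; split; slra.
Qed.

Lemma pvE P x M l : pv_to P x M l -> pv P x M = l.
Proof.
move=> h; have := @getI _ [set l | pv_to P x M l] l h; rewrite -/(pv P x M) => h'.
exact: pv_to_unique h' h.
Qed.

Lemma pv_to_lin P x c M1 M2 l1 l2 : cdist P -> smooth_on (off x) M1 -> smooth_on (off x) M2 ->
  pv_to P x M1 l1 -> pv_to P x M2 l2 -> pv_to P x (fun y => c * M1 y + M2 y) (c * l1 + l2).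
Proof.
move=> cP s1 s2 h1 h2 e e0.
have e1 : 0 < e / (2 * (`|c| + 1)).
  by rewrite divr_gt0 // mulr_gt0 // ltr_wpDl.
have e2 : 0 < e / 2 by slra.
have [J1 hJ1] := h1 _ e1; have [J2 hJ2] := h2 _ e2.
exists (maxn J1 J2) => j; rewrite geq_max => /andP[j1 j2].
have a1 := hJ1 j j1; have a2 := hJ2 j j2.
have -> : (fun y => (c * M1 y + M2 y) * theta x j y) =
  (fun y => c * (M1 y * theta x j y) + M2 y * theta x j y) by apply/funext => y; ring.
rewrite (cP.1 c _ _ (smooth_mul_theta j s1) (smooth_mul_theta j s2)).
set p1 := P _ in a1 *; set p2 := P _ in a2 *.
have -> : c * p1 + p2 - (c * l1 + l2) = c * (p1 - l1) + (p2 - l2) by ring.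
apply: le_trans (ler_normD _ _) _; rewrite normrM.
have c1 : 0 < `|c| + 1 by rewrite ltr_wpDl.
have : `|c| * `|p1 - l1| <= e / 2.
  apply: (@le_trans _ _ ((`|c| + 1) * `|p1 - l1|)); first by apply: ler_wpM2r; rewrite // lerDl.
  move: a1; rewrite invfM mulrA ler_pdivlMr // mulrC; exact.
by move: a2; clear; lra.
Qed.

Lemma powR_half_pow be j : ((2^-1 : R) ^+ j) `^ be = (2^-1 `^ be) ^+ j.
Proof.
rewrite -powR_mulrn // -[in RHS]powR_mulrn; last exact: powR_ge0.
exact: powRAC.
Qed.

Lemma half_powR_lt1 be : 0 < be -> 0 <= (2^-1 : R) `^ be < 1.
Proof.
move=> b0; rewrite powR_ge0 /= [ltRHS](_ : 1 = 1 `^ be); last by rewrite powR1.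
by apply: gt0_ltr_powR; rewrite ?nnegrE //; slra.
Qed.

Section Singular.
Variables (P : (R -> R) -> R) (x be : R).
Hypotheses (cP : cdist P) (nP : null_at P x) (be0 : 0 < be).

(** Passing from [theta x j] to [theta x j.+1] adds one shell of radius [2^-j], worth at most a
    constant times [2^(- be j)]; since [be > 0] the additions are geometric. The resulting rate is
    as useful as the existence of the limit. *)
Lemma sing_pv : exists C N, 0 <= C /\ forall M D, 0 <= D -> sing x be N D M ->
  pv_to P x M (pv P x M) /\
  forall j, `|P (fun y => M y * theta x j y) - pv P x M| <= C * D * (2^-1 `^ be) ^+ j.
Proof.
have [C [N [C0 hC]]] := shell_bound cP nP 1.
pose q : R := 2^-1 `^ be.
have q01 : 0 <= q < 1 := half_powR_lt1 be0; have [q0 q1] := andP q01.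
have b2 : 0 <= (2 : R) `^ be := powR_ge0 _ _.
exists ((1 - q)^-1 * (C * (2 ^+ N * 2 `^ be))), N; split.
  by rewrite !mulr_ge0 // ?exprn_ge0 // invr_ge0 subr_ge0 ltW.
move=> M D D0 [sM hM].
pose u j := P (fun y => M y * theta x j y).
have stepj j : `|u j.+1 - u j| <= C * (2 ^+ N * 2 `^ be) * D * q ^+ j.
  (* The cutoff [theta x (j + 3)] is 1 beyond distance [r / 4], hence on the whole shell from
     [r / 2] to [2 r], and removes the singularity so that [shell_bound] accepts the function. *)
  pose g y := M y * theta x (j + 3)%N y.
  have sg : smooth g := smooth_mul_theta _ sM.
  pose r : R := 2^-1 ^+ j; have r0 : 0 < r := rj0 j.
  have r1 : r <= 1 by apply: exprn_ile1 => //; slra.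
  have rS : 2^-1 ^+ j.+1 = r / 2 by rewrite exprSr.
  have r3 : 2 * 2^-1 ^+ (j + 3)%N = r / 4 by rewrite exprD -/r; field.
  have -> : u j.+1 - u j = P (fun y => g y * (zoom x r bump y - zoom x (r / 2) bump y)).
    rewrite /u -(cdistB cP (smooth_mul_theta _ sM) (smooth_mul_theta _ sM)).
    congr P; apply/funext => y; rewrite /g /theta rS -/r.
    have [yr|yr] := leP (r / 4) `|y - x|.
      by rewrite -/(theta x (j + 3) y) theta1 ?r3 //; ring.
    have z1 (r' : R) : r / 2 <= r' -> zoom x r' bump y = 1.
      move=> rr; rewrite /zoom bump1 // normrM normfV ler_pdivrMr ?normr_gt0 ?gt_eqF; try slra.
      by rewrite mul1r [`|r'|]ger0_norm; slra.
    have zr : zoom x r bump y = 1 by apply: z1; slra.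
    by rewrite zr (z1 (r / 2)) //; ring.
  have a0 : 0 <= (2 ^+ N * 2 `^ be) * D * q ^+ j by rewrite !mulr_ge0 // exprn_ge0.
  apply: le_trans (hC r _ g r0 r1 a0 sg _) _; last by rewrite !mulrA.
  move=> m y mN y1 y2.
  have yx : y != x by apply: contraTN y1 => /eqP ->; rewrite subrr normr0 -ltNge; slra.
  have gM : derive1n m g y = derive1n m M y.
    apply: (derive1n_local m (@open_far R x (r / 4))) => [z /= zr|/=]; last slra.
    by rewrite /g theta1 ?mulr1 // r3 ltW.
  rewrite gM; have y3 : `|y - x| <= 2 by slra.
  have hm := hM y yx y3 m mN.
  apply: (@le_trans _ _ (2 ^+ m * (`|y - x| ^+ m * `|derive1n m M y|))).
    rewrite mulrA -exprMn; apply: ler_wpM2r => //.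
    by apply: lerXn2r; rewrite ?nnegrE; slra.
  have -> : 2 ^+ N * 2 `^ be * D * q ^+ j = 2 ^+ N * (D * (2 * r) `^ be).
    by rewrite powRM //; [rewrite /r powR_half_pow -/q; ring|exact: ltW].
  apply: ler_pM => //.
  - by apply: ler_weXn2l => //; slra.
  - apply: le_trans hm _; apply: ler_wpM2l => //.
    have r20 : 0 <= 2 * r by slra.
    by apply: ge0_ler_powR; rewrite ?nnegrE ?(ltW be0).
have [l hl] : exists l, forall n, (0 <= n)%N ->
    `|u n - l| <= (1 - q)^-1 * (C * (2 ^+ N * 2 `^ be) * D * q ^+ n).
  apply: (ratio_limit q01) => n _; first exact: stepj.
  by rewrite exprS mulrCA.
have to_l : pv_to P x M l.
  move=> e e0; pose K := (1 - q)^-1 * (C * (2 ^+ N * 2 `^ be) * D).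
  have K0 : 0 <= K by rewrite !mulr_ge0 // ?exprn_ge0 // invr_ge0 subr_ge0 ltW.
  have [n hn] := pow_small q01 (divr_gt0 e0 (ltr_wpDl K0 ltr01)).
  exists n => j nj; apply: le_trans (hl j (leq0n _)) _; rewrite mulrA -/K.
  have := hn j nj; rewrite ler_pdivlMr ?ltr_wpDl // => h.
  have : 0 <= q ^+ j by exact: exprn_ge0.
  by move: h; clear; nra.
rewrite (pvE to_l); split => // j; apply: le_trans (hl j (leq0n _)) _.
by rewrite -/q !mulrA.
Qed.

End Singular.

End Weighted.

Arguments open_off {R} x _ _.
Arguments smooth_theta {R} x j _ _.
Arguments smooth_mul_theta {R x} j {M} _ _ _.

(** * The power weight, and point values of primitives in terms of functionals *)

Section PowerWeight.
Context {R : realType}.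
Implicit Types (P : (R -> R) -> R) (f g psi : R -> R) (O : set R) (x y c d e A B D L s h r t rho be ga : R) (m n N k j : nat).

(* Differentiation flips b, which keeps the family closed. *)
Definition spow e (b : bool) ga y : R := (if b then Num.sg (y - e) else 1) * `|y - e| `^ ga.

Lemma is_derive_spow e b ga y : y != e ->
  is_derive y 1 (spow e b ga) (ga * spow e (~~ b) (ga - 1) y).
Proof.
move=> ye; have [h|h|h] := ltgtP e y; last by rewrite h eqxx in ye.
- have o : open [set z : R | e < z] by exact: open_gt.
  have d1 : is_derive y 1 (fun z : R => 1 * z + - e) (1 * 1).
    by have := is_derive_affine (is_derive_id (1 * y - e) 1).
  apply: (isd_local o h (f := fun z => (1 * z - e) `^ ga)).
    move=> z /= ez; rewrite /spow mul1r ger0_norm; last slra.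
    by case: b; rewrite ?gtr0_sg ?mul1r //; slra.
  have y0 : 0 < 1 * y - e by slra.
  apply: (is_derive_eq (@isdcomp R (fun u => u `^ ga) (fun z => 1 * z - e) y _ _ (is_derive1_powR ga y0) d1)).
  rewrite /spow !mul1r mulr1 ger0_norm; last slra.
  by case: b; rewrite /= ?gtr0_sg ?mul1r //; slra.
- have o : open [set z : R | z < e] by exact: open_lt.
  have d1 : is_derive y 1 (fun z : R => -1 * z + e) (-1 * 1).
    by have := @is_derive_affine _ id (-1) e y _ (is_derive_id (-1 * y + e) 1).
  have y0 : 0 < -1 * y + e by slra.
  have ds := isdZ (if b then -1 else 1)
    (@isdcomp R (fun u => u `^ ga) (fun z => -1 * z + e) y _ _ (is_derive1_powR ga y0) d1).
  apply: (isd_local o h (f := fun z => (if b then -1 else 1) * (-1 * z + e) `^ ga)).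
    move=> z /= ez; rewrite /spow ltr0_norm; last slra.
    have -> : -1 * z + e = - (z - e) by ring.
    by case: b {ds} => //; rewrite ltr0_sg //; slra.
  apply: (is_derive_eq ds).
  rewrite /spow ltr0_norm; last slra.
  have -> : -1 * y + e = - (y - e) by ring.
  case: b {ds} => /=; first by ring.
  by rewrite ltr0_sg; [ring|slra].
Qed.

Lemma smooth_spow e b ga : smooth_on (off e) (spow e b ga).
Proof.
apply: (@smooth_on_family R (off e) (bool * R)%type (fun i => spow e i.1 i.2) (open_off e) _ (b, ga)).
case=> [b' g]; exists g, (~~ b', g - 1), 0, (b', g) => y ye.
by rewrite /= mul0r addr0; exact: is_derive_spow.
Qed.

Lemma spow_wderivs N e b ga : exists2 C, 0 <= C &
  forall y, y != e -> wderivs `|y - e| N (C * `|y - e| `^ ga) (spow e b ga) y.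
Proof.
have one m : forall b ga, exists2 C, 0 <= C & forall y, y != e ->
    `|y - e| ^+ m * `|derive1n m (spow e b ga) y| <= C * `|y - e| `^ ga.
  elim: m => [|m IH] {}b {}ga.
    exists 1 => // y ye; rewrite expr0 !mul1r /spow normrM [`|_ `^ _|]ger0_norm ?powR_ge0 //.
    rewrite -[leRHS]mul1r; apply: ler_wpM2r; first exact: powR_ge0.
    by case: b; rewrite ?normr1 // normr_sg; case: (_ != _).
  have [C C0 hC] := IH (~~ b) (ga - 1); exists (`|ga| * C); first exact: mulr_ge0.
  move=> y ye; rewrite derive1Sn.
  have eqn z : off e z -> derive1 (spow e b ga) z = ga * spow e (~~ b) (ga - 1) z.
    by move=> ze; exact: is_derive1E (is_derive_spow _ _ ze).
  rewrite (derive1n_local m (open_off e) eqn ye).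
  rewrite (derive1n_scale ga m (open_off e) (@smooth_spow e (~~ b) (ga - 1)) ye).
  have r0 : 0 < `|y - e| by rewrite normr_gt0 subr_eq0.
  rewrite normrM exprS mulrACA.
  apply: le_trans (_ : `|y - e| * `|ga| * (C * `|y - e| `^ (ga - 1)) <= _).
    by apply: ler_wpM2l; [rewrite mulr_ge0|exact: hC].
  rewrite powRB ?(gt_eqF r0) ?implybT // powRr1; last exact: ltW.
  by rewrite le_eqVlt; apply/orP; left; apply/eqP; field; rewrite gt_eqF.
elim: N => [|N [C C0 hC]].
  have [C C0 hC] := one 0%N b ga; exists C => // y ye m; rewrite leqn0 => /eqP ->; exact: hC.
have [C' C'0 hC'] := one N.+1 b ga; exists (C + C'); first exact: addr_ge0.
move=> y ye m; rewrite leq_eqVlt mulrDl => /orP[/eqP ->|mN].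
  by apply: ler_wpDl; [rewrite mulr_ge0 // powR_ge0|exact: hC'].
by apply: ler_wpDr; [rewrite mulr_ge0 // powR_ge0|exact: hC].
Qed.

Definition pw e be y : R := `|y - e| `^ be.

Lemma pwE e be : pw e be = spow e false be.
Proof. by apply/funext => y; rewrite /spow mul1r. Qed.

Lemma smooth_pw e be : smooth_on (off e) (pw e be).
Proof. by rewrite pwE; exact: smooth_spow. Qed.

Lemma sing_pw_mul N e be : exists2 C, 0 <= C & forall psi B, smooth_on (off e) psi ->
  (forall y, y != e -> `|y - e| <= 2 -> wderivs `|y - e| N B psi y) ->
  sing e be N (C * B) (fun y => pw e be y * psi y).
Proof.
have [C C0 hC] := spow_wderivs N e false be.
exists (2 ^+ N * C); first by rewrite mulr_ge0 // exprn_ge0.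
move=> psi B sp hB; split.
  exact: smooth_on_mul (open_off e) (@smooth_pw e be) sp.
move=> y ye y2; have r0 : 0 < `|y - e| by rewrite normr_gt0 subr_eq0.
have -> : 2 ^+ N * C * B * `|y - e| `^ be = 2 ^+ N * (C * `|y - e| `^ be * B) by ring.
have hpw : wderivs `|y - e| N (C * `|y - e| `^ be) (pw e be) y by rewrite pwE; exact: hC.
exact: (wderivs_mul r0 (open_off e) (@smooth_pw e be) sp ye hpw (hB y ye y2)).
Qed.

Lemma right0P (u : R -> R) (l : R) : (u s @[s --> 0^'+] --> l) <->
  (forall e, 0 < e -> exists2 d, 0 < d & forall s, 0 < s -> s < d -> `|u s - l| <= e).
Proof.
split => [/cvgrPdist_le h e /h|h].
  rewrite near_withinE => -[d /= d0 hd]; exists d => // s s0 sd.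
  by rewrite distrC; apply: hd => //=; rewrite sub0r normrN gtr0_norm.
apply/cvgrPdist_le => e /h[d d0 hd]; rewrite near_withinE; exists d => //= s.
by rewrite /ball_ /= sub0r normrN => sd s0; rewrite distrC; apply: hd => //; rewrite gtr0_norm in sd.
Qed.

Lemma null_atP P x : (forall f, smooth f -> (forall y, 1 < `|y| -> f y = 0) ->
    P (zoom x s f) @[s --> 0^'+] --> 0) -> null_at P x.
Proof.
move=> h f L sf fL e e0; pose K := Num.max 1 L.
have K0 : 0 < K by rewrite lt_max ltr01.
have g1 y : 1 < `|y| -> f (0 + K * y) = 0.
  move=> y1; apply: fL; rewrite add0r normrM (ger0_norm (ltW K0)).
  apply: le_lt_trans (_ : K * 1 < _); first by rewrite mulr1 le_max lexx orbT.
  by rewrite ltr_pM2l.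
have /right0P/(_ e e0)[d d0 hd] := h _ (smooth_dil 0 K sf) g1.
exists (d / K); first exact: divr_gt0.
move=> s s0 sd; have -> : zoom x s f = zoom x (K * s) (fun z => f (0 + K * z)).
  by apply/funext => y; rewrite /zoom; congr f; field; rewrite !gt_eqF.
have := hd (K * s); rewrite subr0; apply; first exact: mulr_gt0.
by rewrite mulrC -ltr_pdivlMr.
Qed.

Lemma null_atE P x f L : null_at P x -> smooth f -> (forall y, L < `|y| -> f y = 0) ->
  P (zoom x s f) @[s --> 0^'+] --> 0.
Proof.
move=> nP sf fL; apply/right0P => e /(nP _ _ sf fL)[d d0 hd]; exists d => // s s0 sd.
by rewrite subr0; exact: hd.
Qed.

(* The zooms of f tend to c times the indicator of ]-oo, x[, so ga is the value at x of the
   primitive of P that vanishes near -oo. *)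
Definition has_lim P x ga : Prop := forall f c L, smooth f ->
  (forall y, y < - L -> f y = c) -> (forall y, L < y -> f y = 0) ->
  P (zoom x s f) @[s --> 0^'+] --> ga * c.

Definition hstep y : R := step (- y).

Lemma smooth_hstep : smooth hstep.
Proof.
have -> : hstep = (fun y => step (-1 * y + 0)).
  by apply/funext => y; rewrite /hstep; congr step; ring.
exact/smooth_affine/smooth_step.
Qed.

Lemma hstep1 y : y <= -1 -> hstep y = 1. Proof. by move=> ?; rewrite /hstep step_ge1 //; slra. Qed.
Lemma hstep0 y : 0 <= y -> hstep y = 0. Proof. by move=> ?; rewrite /hstep step_le0 //; slra. Qed.

(** A profile with limits c and 0 differs from [c * hstep] by one with bounded support, on which
    nullness gives the limit 0. One step function therefore decides the matter. *)
Lemma has_limI P x ga : cdist P -> null_at P x ->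
  (P (zoom x s hstep) @[s --> 0^'+] --> ga) -> has_lim P x ga.
Proof.
move=> cP nP hH f c L sf f1 f0.
have sg : smooth (fun y => f y - c * hstep y).
  exact: smooth_sub sf (smooth_scale c smooth_hstep).
have g0 y : Num.max 1 L < `|y| -> f y - c * hstep y = 0.
  move=> yL; have [y0|y0] := leP 0 y.
    by rewrite hstep0 // f0 ?mulr0 ?subrr //; move: yL; rewrite ger0_norm // gt_max => /andP[].
  move: yL; rewrite ltr0_norm // gt_max => /andP[? ?].
  by rewrite hstep1 ?f1 ?mulr1 ?subrr //; slra.
have := null_atE nP sg g0.
move=> h0; have h1 := cvgD h0 (cvgM (cvg_cst c) hH).
have -> : (fun s => P (zoom x s f)) =
    (fun s => P (zoom x s (fun y => f y - c * hstep y)) + c * P (zoom x s hstep)).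
  apply/funext => s; rewrite -(cdistZ c cP (smooth_zoom x s smooth_hstep)).
  have sz := smooth_scale c (smooth_zoom x s smooth_hstep).
  have s1 : smooth (zoom x s (fun y => f y - c * hstep y)) := smooth_zoom x s sg.
  by rewrite -(cdistD cP s1 sz); congr P; apply/funext => y; rewrite /zoom; ring.
by rewrite add0r mulrC in h1; exact: h1.
Qed.

End PowerWeight.

(** * Singular multipliers and their effect on point values *)

Section Multipliers.
Context {R : realType}.
Implicit Types (P : (R -> R) -> R) (f g psi : R -> R) (O : set R) (x y c d A B D L s h r t rho ga : R) (m n N k j : nat).

Lemma cvg_right_lin (u v w : R -> R) c (lu lv : R) :
  u s @[s --> 0^'+] --> lu -> v s @[s --> 0^'+] --> lv ->
  (forall s, 0 < s -> w s = u s + c * v s) -> w s @[s --> 0^'+] --> lu + c * lv.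
Proof.
move=> hu hv hw.
have h : (fun s => u s + c * v s) s @[s --> 0^'+] --> lu + c * lv.
  by apply: cvgD => //; apply: cvgM => //; exact: cvg_cst.
apply/right0P => e e0; have /right0P/(_ e e0)[d d0 hd] := h.
by exists d => // s s0 sd; rewrite hw //; exact: hd.
Qed.

Definition ind x y : R := if y < x then 1 else 0.

Lemma smooth_ind x : smooth_on (off x) (ind x).
Proof.
move=> m y /= yx; have [yx'|xy] := ltP y x.
  have o : open [set z : R | z < x] by exact: open_lt.
  apply: (@smooth_on_local R _ (fun=> 1) _ o _ _ m y yx') => [z /= zx|].
    by rewrite /ind zx.
  exact: smooth_cst.
have o : open [set z : R | x < z] by exact: open_gt.
have xy' : x < y by rewrite lt_neqAle eq_sym yx.
apply: (@smooth_on_local R _ (fun=> 0) _ o _ _ m y xy') => [z /= zx|].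
  by rewrite /ind ltNge ltW.
exact: smooth_cst.
Qed.

Lemma ind_derivs N x y : y != x -> derivs_le N 1 (ind x) y.
Proof.
move=> yx; have [yx'|xy] := ltP y x.
  have o : open [set z : R | z < x] by exact: open_lt.
  apply: (@derivs_le_local R _ N 1 (fun=> 1) _ y o) => // [z /= zx|]; first by rewrite /ind zx.
  by have := @derivs_le_cst R N 1 y; rewrite normr1.
have o : open [set z : R | x < z] by exact: open_gt.
apply: (@derivs_leW _ N N 0 1) => //; apply: (derivs_le0 o) => [z /= zx|/=].
  by rewrite /ind ltNge ltW.
by rewrite lt_neqAle eq_sym yx.
Qed.

Lemma hstep_derivs N : exists2 B, 0 <= B & forall y : R, derivs_le N B hstep y.
Proof.
have [B B0 hB] := @smooth_bounded R hstep N 2 smooth_hstep.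
exists (B + 1); first by rewrite addr_ge0.
move=> y; have [y2|y2] := leP `|y| 2; first by apply: derivs_leW (hB y y2); rewrite // lerDl.
have [y0|y0] := leP 0 y.
  have o : open [set z : R | 1 < z] by exact: open_gt.
  apply: (@derivs_leW _ N N 0) (derivs_le0 o (f := hstep) _ _) => //; first by rewrite addr_ge0.
    by move=> z /= z1; rewrite hstep0 //; slra.
  by rewrite /=; move: y2; rewrite ger0_norm //; slra.
have o : open [set z : R | z < -1] by exact: open_lt.
apply: (@derivs_le_local R _ N _ (fun=> 1) _ y o) => [z /= z1||].
- by rewrite hstep1 // ltW.
- by rewrite /=; move: y2; rewrite ltr0_norm //; slra.
- by apply: derivs_leW (@derivs_le_cst R N 1 y); rewrite // normr1 lerDr.
Qed.

Section AtPoint.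
Variables (P : (R -> R) -> R) (x : R).
Hypotheses (cP : cdist P) (nP : null_at P x).

(** What the power weight at e shares, with exponent 1, with a smooth function vanishing at x. One
    argument for the existence of limits thus serves at e and at all other points. *)
Definition sing_mult be G : Prop := smooth_on (off x) G /\
  forall N, exists2 C, 0 <= C & forall psi B, smooth_on (off x) psi ->
    (forall y, y != x -> `|y - x| <= 2 -> wderivs `|y - x| N B psi y) ->
    sing x be N (C * B) (fun y => G y * psi y).

Lemma sing_mult_pv be G : 0 < be -> sing_mult be G -> exists C N, 0 <= C /\
  forall psi B, 0 <= B -> smooth_on (off x) psi ->
    (forall y, y != x -> `|y - x| <= 2 -> wderivs `|y - x| N B psi y) ->
    pv_to P x (fun y => G y * psi y) (pv P x (fun y => G y * psi y)) /\
    forall j, `|P (fun y => G y * psi y * theta x j y) - pv P x (fun y => G y * psi y)|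
      <= C * B * (2^-1 `^ be) ^+ j.
Proof.
move=> be0 [sG hG]; have [C [N [C0 hC]]] := sing_pv cP nP be0.
have [C' C'0 hC'] := hG N; exists (C * C'), N; split; first exact: mulr_ge0.
move=> psi B B0 sp hB; have := hC _ _ (mulr_ge0 C'0 B0) (hC' psi B sp hB).
by rewrite !mulrA.
Qed.

Lemma smooth_wderivs N psi : smooth psi -> exists2 B, 0 <= B &
  forall y, `|y - x| <= 2 -> wderivs `|y - x| N B psi y.
Proof.
move=> sp; have [B B0 hB] := @smooth_bounded R psi N (`|x| + 2) sp.
exists (2 ^+ N * B); first by rewrite mulr_ge0 // exprn_ge0.
move=> y y2; apply: wderivs_le => //; first slra.
apply: hB; rewrite addrC; apply: le_trans (_ : `|y - x| + `|x| <= _).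
  by apply: le_trans (ler_normD _ _); rewrite subrK.
by rewrite lerD2r.
Qed.

(** The cutoff [theta x j] annihilates the product, so the principal value is nothing but its own
    error term. *)
Lemma sing_mult_small be G : 0 < be -> sing_mult be G -> exists C N, 0 <= C /\
  forall psi B j, 0 <= B -> smooth_on (off x) psi ->
    (forall y, y != x -> `|y - x| <= 2 -> wderivs `|y - x| N B psi y) ->
    (forall y, y != x -> 2^-1 ^+ j < `|y - x| -> psi y = 0) ->
    `|pv P x (fun y => G y * psi y)| <= C * B * (2^-1 `^ be) ^+ j.
Proof.
move=> be0 hG; have [C [N [C0 hC]]] := sing_mult_pv be0 hG.
exists C, N; split => // psi B j B0 sp hB h0.
have [_ /(_ j)] := hC psi B B0 sp hB.
have -> : (fun y => G y * psi y * theta x j y) = fun=> 0.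
  apply/funext => y; have [yj|yj] := leP `|y - x| (2^-1 ^+ j); first by rewrite theta0 ?mulr0.
  have yx : y != x by apply: contraTN yj => /eqP ->; rewrite subrr normr0 -leNgt ltW // rj0.
  by rewrite h0 // mulr0 mul0r.
by rewrite (cdist0 cP) sub0r normrN.
Qed.

(** The bound is uniform in s: within distance s of x the weighted derivative of order m gains
    [(|y - x| / s) ^+ m <= 1], and beyond distance s the zoomed step coincides locally with the
    indicator. *)
Lemma step_zoom_derivs N : exists2 B, 0 <= B & forall s y, 0 < s -> y != x -> `|y - x| <= 2 ->
  wderivs `|y - x| N B (zoom x s hstep) y /\
  wderivs `|y - x| N B (fun y => -1 * ind x y + zoom x s hstep y) y.
Proof.
have [B B0 hB] := hstep_derivs N.
have B10 : 0 <= 2 ^+ N * 1 + B by rewrite addr_ge0 // mulr1 exprn_ge0.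
exists (2 ^+ N * 1 + B) => // s y s0 yx y2.
have sz := smooth_smooth_on (smooth_zoom x s (@smooth_hstep R)) (O := off x).
have wi : wderivs `|y - x| N (2 ^+ N * 1) (ind x) y.
  by apply: wderivs_le (ind_derivs yx) => //; slra.
have dz := derive1n_add _ (open_off x) (smooth_on_scale (c := -1) (open_off x) (@smooth_ind x)) sz yx.
have ds := derive1n_scale (-1) _ (open_off x) (@smooth_ind x) yx.
have [ys|ys] := leP `|y - x| s.
  have wz : wderivs `|y - x| N B (zoom x s hstep) y.
    rewrite -[X in wderivs _ _ X]mul1r -(expr1n _ N).
    by apply: wderivs_zoom; rewrite ?mul1r //; exact: smooth_hstep.
  split; first by apply: wderivsW wz; rewrite // lerDr mulr1 exprn_ge0.
  move=> m mN; rewrite dz ds; have := wi m mN; have := wz m mN.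
  set u := derive1n m _ y; set v := derive1n m _ y => a1 a2.
  apply: le_trans (lerD a2 a1); rewrite -mulrDr; apply: ler_wpM2l; first exact: exprn_ge0.
  by apply: le_trans (ler_normD _ _) _; rewrite mulN1r normrN.
have o := @open_far R x s.
have zE z : s < `|z - x| -> zoom x s hstep z = ind x z.
  rewrite /zoom /ind => zs; case: ifPn => [zx|]; last rewrite -leNgt => xz.
    by rewrite hstep1 // ler_pdivrMr //; move: zs; rewrite ltr0_norm; slra.
  by rewrite hstep0 // divr_ge0 // ?subr_ge0 // ltW.
split.
  apply: (@wderivsW _ _ N N (2 ^+ N * 1)) => //; first by rewrite lerDl.
  move=> m mN; rewrite (derive1n_local m o (g := ind x) (fun z (hz : [set z | s < `|z - x|] z) => zE z hz) ys).
  exact: wi.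
move=> m mN.
have -> : derive1n m (fun z => -1 * ind x z + zoom x s hstep z) y = derive1n m (fun=> 0) y.
  by apply: (derive1n_local m o) => // z /zE ->; rewrite mulN1r addNr.
by rewrite derive1n_cst; case: m mN => [|m] mN; rewrite normr0 mulr0.
Qed.

(** The zoomed step and the indicator differ only within distance s of x, where [sing_mult_small]
    makes the contribution of the multiplier tend to 0. *)
Lemma pv_step_cvg be G : 0 < be -> sing_mult be G ->
  pv P x (fun y => G y * zoom x s hstep y) @[s --> 0^'+] --> pv P x (fun y => G y * ind x y).
Proof.
move=> be0 hG; have [C [N [C0 hC]]] := sing_mult_small be0 hG.
have [C' [N' [C'0 hC']]] := sing_mult_pv be0 hG.
have [B B0 hB] := step_zoom_derivs N; have [B' B'0 hB'] := step_zoom_derivs N'.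
apply/right0P => e e0.
have CB : 0 < C * B + 1 by rewrite ltr_wpDl // mulr_ge0.
have [j hj] := pow_small (half_powR_lt1 be0) (divr_gt0 e0 CB).
exists (2^-1 ^+ j); first exact: rj0.
move=> s s0 sj.
have si := @smooth_ind x.
have sz := smooth_smooth_on (smooth_zoom x s (@smooth_hstep R)) (O := off x).
have wz y : y != x -> `|y - x| <= 2 -> wderivs `|y - x| N' B' (zoom x s hstep) y.
  by move=> yx y2; exact: (hB' s y s0 yx y2).1.
have [p1 _] := hC' _ B' B'0 sz wz.
have wi y : y != x -> `|y - x| <= 2 -> wderivs `|y - x| N' (2 ^+ N' * 1) (ind x) y.
  by move=> yx y2; apply: wderivs_le (ind_derivs yx) => //; slra.
have i0 : 0 <= (2 : R) ^+ N' * 1 by rewrite mulr1 exprn_ge0.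
have [p2 _] := hC' _ _ i0 si wi.
have sGz := smooth_on_mul (open_off x) hG.1 sz.
have sGi := smooth_on_mul (open_off x) hG.1 si.
have := pvE (pv_to_lin (-1) cP sGi sGz p2 p1).
have -> : (fun y => -1 * (G y * ind x y) + G y * zoom x s hstep y) =
  (fun y => G y * (-1 * ind x y + zoom x s hstep y)) by apply/funext => y; ring.
move=> e1; rewrite addrC -mulN1r -e1.
have ss : smooth_on (off x) (fun y => -1 * ind x y + zoom x s hstep y).
  by apply: smooth_on_add (open_off x) (smooth_on_scale (open_off x) si) sz.
have h0 y : y != x -> 2^-1 ^+ j < `|y - x| -> -1 * ind x y + zoom x s hstep y = 0.
  move=> yx yj; have ys := lt_trans sj yj.
  rewrite /zoom /ind; case: ifPn => [zx|]; last rewrite -leNgt => xz.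
    by rewrite hstep1 ?mulr1 ?addNr // ler_pdivrMr //; move: ys; rewrite ltr0_norm; slra.
  by rewrite hstep0 ?mulr0 ?addr0 // divr_ge0 // ?subr_ge0 // ltW.
have ws y : y != x -> `|y - x| <= 2 ->
    wderivs `|y - x| N B (fun y => -1 * ind x y + zoom x s hstep y) y.
  by move=> yx y2; exact: (hB s y s0 yx y2).2.
apply: le_trans (hC _ B j B0 ss ws h0) _.
have := hj j (leqnn j); rewrite ler_pdivlMr // => h.
have : 0 <= (2^-1 `^ be : R) ^+ j by rewrite exprn_ge0 // powR_ge0.
by move: h; clear; nra.
Qed.

Lemma zoom_mul_small V f : smooth V -> V x = 0 -> smooth f -> (forall y, 1 < `|y| -> f y = 0) ->
  exists2 C, 0 <= C & forall s, 0 < s -> s <= 1 -> `|P (fun y => V y * zoom x s f y)| <= C * s.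
Proof.
move=> sV V0 sf f1; have [C [N [C0 hC]]] := null_at_bounded cP nP 1.
have [BV BV0 hV] := @smooth_bounded R V N.+1 (`|x| + 1) sV.
have [B B0 hB] := @smooth_bounded R f N 1 sf.
exists (C * (2 ^+ N * (BV * B))); first by rewrite ?mulr_ge0 ?exprn_ge0.
move=> s s0 s1.
have -> : (fun y => V y * zoom x s f y) = zoom x s (fun z => V (x + s * z) * f z).
  apply/funext => y; rewrite /zoom; congr (V _ * _); field; by rewrite gt_eqF.
have -> : C * (2 ^+ N * (BV * B)) * s = C * (2 ^+ N * (BV * s * B)) by ring.
apply: (hC _ _ _ s0 s1 (smooth_mul (smooth_dil x s sV) sf)).
  by move=> y y1; rewrite f1 ?mulr0.
move=> z; have BVs : 0 <= BV * s by rewrite mulr_ge0 // ltW.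
have [z1|z1] := ltP 1 `|z|.
  apply: (@derivs_leW _ N N 0); rewrite ?leqnn ?mulr_ge0 ?exprn_ge0 ?(ltW s0) //.
  by apply: (derivs_le0 (@open_far0 R 1)) => // w w1; rewrite f1 ?mulr0.
apply: derivs_leM; [exact: smooth_dil|exact: sf| |exact: hB].
have xz y : `|y - x| <= `|s * z| -> `|y| <= `|x| + 1.
  move=> yz; rewrite addrC; apply: le_trans (_ : `|y - x| + `|x| <= _).
    by apply: le_trans (ler_normD _ _); rewrite subrK.
  rewrite lerD2r; apply: le_trans yz _; rewrite normrM gtr0_norm //.
  by rewrite -[leRHS]mulr1; apply: ler_pM => //; exact: ltW.
move=> m mN; rewrite (derive1n_dil m x s sV) normrM normrX gtr0_norm //.
case: m mN => [|m] mN.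
  rewrite expr0 mul1r derive1n0 -[V _]subr0 -V0.
  apply: le_trans (smooth_lip (B := BV) sV _) _.
    by move=> c /xz cx; have := hV c cx 1%N isT.
  rewrite normrM gtr0_norm // mulrA -[leRHS]mulr1; apply: ler_wpM2l => //.
rewrite exprS mulrC; apply: (@le_trans _ _ (BV * (s * 1))); last by rewrite mulr1.
apply: ler_pM => //; first by rewrite mulr_ge0 ?exprn_ge0 // ltW.
  have := hV (x + s * z) _ m.+1 (leqW mN); apply.
  by apply: xz; rewrite addrAC subrr add0r.
by apply: ler_wpM2l; [exact: ltW|apply: exprn_ile1 => //; exact: ltW].
Qed.

Lemma null_at_mul V : smooth V -> null_at (fun psi => P (fun y => V y * psi y)) x.
Proof.
move=> sV; apply: null_atP => f sf f1.
have sV0 : smooth (fun y => V y - V x) := smooth_sub sV (smooth_const (V x)).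
have [C C0 hC] := @zoom_mul_small (fun y => V y - V x) f sV0 (subrr _) sf f1.
have h1 : P (fun y => (V y - V x) * zoom x s f y) @[s --> 0^'+] --> 0.
  apply/right0P => e e0; exists (Num.min 1 (e / (C + 1))).
    by rewrite lt_min ltr01 divr_gt0 // ltr_wpDl.
  move=> s s0; rewrite lt_min subr0 => /andP[s1 se].
  apply: le_trans (hC s s0 (ltW s1)) _; move: se; rewrite ltr_pdivlMr ?ltr_wpDl //.
  by move: s0; clear; nra.
rewrite -[X in _ --> X](_ : 0 + V x * 0 = 0); last by rewrite mulr0 addr0.
apply: (cvg_right_lin h1 (null_atE nP sf f1)) => s s0.
have sz := smooth_zoom x s sf.
rewrite -(cdistZ (V x) cP sz) -(cdistD cP (smooth_mul sV0 sz) (smooth_scale (V x) sz)).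
by congr P; apply/funext => y; ring.
Qed.

(** What the cutoff removes is V times a zoom at scale comparable to [2^-j]; as [V x = 0], P of it
    is [O(2^-j)]. *)
Lemma pv_smooth V : smooth V -> V x = 0 -> pv P x V = P V.
Proof.
move=> sV V0; apply: pvE => e e0.
have sb := smooth_dil 0 2 (@smooth_bump R).
have b1 (y : R) : 1 < `|y| -> bump (0 + 2 * y) = 0.
  by move=> y1; rewrite bump0 // add0r normrM ger0_norm //; slra.
have [C C0 hC] := zoom_mul_small sV V0 sb b1.
have q12 : 0 <= (2^-1 : R) < 1 by slra.
have C1 : 0 < 2 * C + 1 by slra.
have [J hJ] := pow_small q12 (divr_gt0 e0 C1); exists (maxn J 1) => j; rewrite geq_max => /andP[jJ j1].
have := hJ j jJ; rewrite ler_pdivlMr // => hj.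
have r0 := @rj0 R j.
have r1 : 2 * 2^-1 ^+ j <= 1 :> R.
  case: j j1 {jJ hj r0} => // j _; rewrite exprS mulrA mulfV // mul1r.
  by apply: exprn_ile1; slra.
have -> : P (fun y => V y * theta x j y) - P V = - P (fun y => V y * zoom x (2 * 2^-1 ^+ j) (fun z => bump (0 + 2 * z)) y).
  have sz := smooth_zoom x (2 * 2^-1 ^+ j) sb.
  rewrite -(cdistN cP (smooth_mul sV sz)) -(cdistB cP (smooth_mul sV (smooth_theta x j)) sV).
  congr P; apply/funext => y; rewrite /theta /zoom.
  have -> : 0 + 2 * ((y - x) / (2 * 2^-1 ^+ j)) = (y - x) / 2^-1 ^+ j.
    by rewrite add0r; field; rewrite gt_eqF.
  by ring.
rewrite normrN; apply: le_trans (hC _ _ r1) _; first by rewrite mulr_gt0.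
by move: hj r0; clear; nra.
Qed.

Lemma sing_mult_smooth V : smooth V -> V x = 0 -> sing_mult 1 V.
Proof.
move=> sV V0; split; first exact: smooth_smooth_on.
move=> N; have [B B0 hB] := @smooth_bounded R V N.+1 (`|x| + 2) sV.
exists (2 ^+ N * (2 ^+ N * B)); first by rewrite ?mulr_ge0 ?exprn_ge0.
move=> psi D sp hD; split; first exact: smooth_on_mul (open_off x) (smooth_smooth_on sV) sp.
move=> y yx y2; have r0 : 0 < `|y - x| by rewrite normr_gt0 subr_eq0.
have yb c : `|c - x| <= `|y - x| -> `|c| <= `|x| + 2.
  move=> cy; rewrite addrC; apply: le_trans (_ : `|c - x| + `|x| <= _).
    by apply: le_trans (ler_normD _ _); rewrite subrK.
  by rewrite lerD2r; exact: le_trans y2.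
have -> : 2 ^+ N * (2 ^+ N * B) * D * `|y - x| `^ 1 = 2 ^+ N * (2 ^+ N * B * `|y - x| * D).
  by rewrite powRr1 //; ring.
apply: (wderivs_mul r0 (open_off x) (smooth_smooth_on sV) sp yx); last exact: hD.
move=> m mN; case: m mN => [|m] mN.
  have hl : `|V (x + (y - x)) - V x| <= B * `|y - x|.
    by apply: smooth_lip => // c /yb cx; have := hB c cx 1%N isT.
  rewrite expr0 mul1r derive1n0; move: hl; rewrite V0 subr0 addrC subrK => /le_trans; apply.
  by rewrite -mulrA; apply: ler_peMl; [rewrite mulr_ge0|apply: exprn_ege1; slra].
rewrite exprSr mulrAC; apply: ler_wpM2r => //; apply: ler_pM => //.
  apply: (@le_trans _ _ (2 ^+ m)); last by apply: ler_weXn2l; [slra|exact: ltnW].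
  by apply: lerXn2r; rewrite ?nnegrE.
by apply: hB; [exact: yb|exact: leqW].
Qed.

(** Splitting V into [V - V x] and the constant [V x]: the first is a multiplier of order 1 and
    leads to a principal value, the second rescales the given limit. *)
Lemma has_lim_mul V ga : smooth V -> has_lim P x ga ->
  exists l, has_lim (fun psi => P (fun y => V y * psi y)) x l.
Proof.
move=> sV hP; pose W y := V y - V x.
have sW : smooth W := smooth_sub sV (smooth_const (V x)).
have W0 : W x = 0 by rewrite /W subrr.
exists (pv P x (fun y => W y * ind x y) + V x * ga); apply: has_limI.
- split.
    move=> c f g sf sg; rewrite -(cP.1 c _ _ (smooth_mul sV sf) (smooth_mul sV sg)).
    by congr P; apply/funext => y; ring.
  have [_ [C [N [L [C0 L0 h]]]]] := cP; have [B B0 hB] := @smooth_bounded R V N L sV.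
  exists (C * (2 ^+ N * B)), N, L; split => //; first by rewrite ?mulr_ge0 ?exprn_ge0.
  move=> f M sf hf; rewrite -2!mulrA; apply: h; first exact: smooth_mul.
  by move=> y yL; apply: derivs_leM; [exact: sV|exact: sf|exact: hB|exact: hf].
- exact: null_at_mul.
have h1 := pv_step_cvg (@ltr01 R) (sing_mult_smooth sW W0).
have h2 : P (zoom x s hstep) @[s --> 0^'+] --> ga * 1.
  apply: (hP hstep 1 1); first exact: smooth_hstep.
    by move=> y y1; rewrite hstep1 // ltW.
  by move=> y y1; rewrite hstep0 //; slra.
rewrite mulr1 in h2; apply: (cvg_right_lin h1 h2) => s s0.
have sz := smooth_zoom x s (@smooth_hstep R).
rewrite (pv_smooth (smooth_mul sW sz)); last by rewrite W0 mul0r.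
rewrite -(cdistZ (V x) cP sz) -(cdistD cP (smooth_mul sW sz) (smooth_scale (V x) sz)).
by congr P; apply/funext => y; rewrite /W; ring.
Qed.

End AtPoint.

End Multipliers.

(** * The product of a functional with the power weight *)

Section MulPower.
Context {R : realType}.
Implicit Types (f g psi : R -> R) (x y c d A B D L s h r t rho ga : R) (m n N k j : nat).

Definition suppin (P : (R -> R) -> R) (a b : R) : Prop :=
  forall f d, smooth f -> 0 < d -> (forall y, a - d < y -> y < b + d -> f y = 0) -> P f = 0.

Variables (P : (R -> R) -> R) (e be : R).
Hypotheses (cP : cdist P) (nP : forall x, null_at P x) (be0 : 0 < be).

Definition mulP psi : R := pv P e (fun y => pw e be y * psi y).

Lemma sing_mult_pw : sing_mult e be (pw e be).
Proof. by split => [|N]; [exact: smooth_pw|exact: sing_pw_mul]. Qed.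

Lemma mulP_pv psi : smooth psi -> pv_to P e (fun y => pw e be y * psi y) (mulP psi).
Proof.
move=> sp; have [C [N [C0 hC]]] := sing_mult_pv cP (nP e) be0 sing_mult_pw.
have [B B0 hB] := smooth_wderivs e N sp.
by have [] := hC psi B B0 (smooth_smooth_on sp) (fun y _ => hB y).
Qed.

Lemma smooth_pw_mul psi : smooth psi -> smooth_on (off e) (fun y => pw e be y * psi y).
Proof. by move=> sp; exact: smooth_on_mul (open_off e) (@smooth_pw R e be) (smooth_smooth_on sp). Qed.

Lemma mulP_cdist : cdist mulP.
Proof.
split.
  move=> c f g sf sg.
  have -> : c * mulP f + mulP g = pv P e (fun y => c * (pw e be y * f y) + pw e be y * g y).
    apply/esym/pvE/(pv_to_lin c cP); [exact: smooth_pw_mul|exact: smooth_pw_mul| | ]; exact: mulP_pv.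
  by congr pv; apply/funext => y; ring.
have [_ [C [N [L [C0 L0 h]]]]] := cP.
have [C' [N' [C'0 hC']]] := sing_mult_pv cP (nP e) be0 sing_mult_pw.
(* Cut once at unit distance from e: the far part is P applied to a smooth multiple of f, and the
   near part is the error of the principal value at [j = 0]. *)
pose g y := pw e be y * theta e 0 y.
have sg : smooth g := smooth_mul_theta 0 (@smooth_pw R e be).
have [B B0 hB] := @smooth_bounded R g N L sg.
pose L' := Num.max L (`|e| + 2).
exists (C * (2 ^+ N * B) + C' * 2 ^+ N'), (maxn N N'), L'; split.
- by rewrite addr_ge0 ?mulr_ge0 ?exprn_ge0.
- by rewrite lt_max L0.
move=> f M sf hf.
have M0 : 0 <= M.
  by apply: (@derivs_le_ge0 R (maxn N N') M f 0); apply: hf; rewrite normr0 le_max (ltW L0).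
have hf' y : y != e -> `|y - e| <= 2 -> wderivs `|y - e| N' (2 ^+ N' * M) f y.
  move=> _ y2; apply: wderivs_le => //; first by rewrite ler1n.
  apply: (@derivs_leW _ (maxn N N') N' M M); rewrite ?leq_maxr //; apply: hf.
  rewrite le_max; apply/orP; right; rewrite addrC.
  apply: le_trans (_ : `|y - e| + `|e| <= _); last by rewrite lerD2r.
  by apply: le_trans (ler_normD _ _); rewrite subrK.
have M2 : 0 <= 2 ^+ N' * M by rewrite mulr_ge0 ?exprn_ge0.
have [_ /(_ 0%N)] := hC' f _ M2 (smooth_smooth_on sf) hf'.
rewrite expr0 mulr1 mulrA -/(mulP f).
have h1 : `|P (fun y => pw e be y * f y * theta e 0 y)| <= C * (2 ^+ N * B) * M.
  have -> : (fun y => pw e be y * f y * theta e 0 y) = (fun y => g y * f y).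
    by apply/funext => y; rewrite /g; ring.
  rewrite -2!mulrA; apply: h; first exact: smooth_mul.
  move=> y yL; apply: derivs_leM; [exact: sg|exact: sf|exact: hB|].
  by apply: (@derivs_leW _ (maxn N N') N M M); rewrite ?leq_maxl //; apply: hf; rewrite le_max yL.
rewrite mulrDl distrC => h2; rewrite addrC -[mulP f](subrK (P (fun y => pw e be y * f y * theta e 0 y))).
by rewrite !mulrA in h1 h2 *; apply: le_trans (ler_normD _ _) _; exact: lerD.
Qed.

Lemma mulP_supp a b : suppin P a b -> suppin mulP a b.
Proof.
move=> sP f d sf d0 f0; apply: pvE => eps eps0; exists 0%N => j _.
have -> : P (fun y => pw e be y * f y * theta e j y) = 0.
  apply: (sP _ d _ d0) => [|y y1 y2]; first exact: smooth_mul_theta (smooth_pw_mul sf).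
  by rewrite f0 // mulr0 mul0r.
by rewrite subrr normr0 ltW.
Qed.

Lemma mulP_near0 f r : smooth f -> 0 < r -> (forall y, `|y - e| < r -> f y = 0) ->
  mulP f = P (fun y => pw e be y * f y).
Proof.
move=> sf r0 f0; apply: pvE => eps eps0.
have q12 : 0 <= (2^-1 : R) < 1 by slra.
have r4 : 0 < r / 4 by slra.
have [J hJ] := pow_small q12 r4; exists J => j jJ.
have -> : (fun y => pw e be y * f y * theta e j y) = (fun y => pw e be y * f y).
  apply/funext => y; have [yr|yr] := ltP `|y - e| r; first by rewrite f0 // mulr0 mul0r.
  by rewrite theta1 ?mulr1 //; have := hJ j jJ; slra.
by rewrite subrr normr0 ltW.
Qed.

Definition pwcut r y : R := pw e be y * (1 - zoom e r bump y).

Lemma smooth_pwcut r : 0 < r -> smooth (pwcut r).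
Proof.
move=> r0; have sb : smooth (fun y => 1 - zoom e r bump y).
  by apply: smooth_sub; [exact: smooth_const|apply: smooth_zoom; exact: smooth_bump].
apply: (smooth_off_mul (@smooth_pw R e be) sb r0) => y yr.
by rewrite /zoom bump1 ?subrr // normrM normfV (gtr0_norm r0) ler_pdivrMr // mul1r ltW.
Qed.

(** Statements at a point x other than e use this splitting with r small against [|x - e|]: the
    first term is multiplication by a smooth function, and the second only sees f near e, far from
    x. *)
Lemma mulP_split r f : 0 < r -> smooth f ->
  mulP f = P (fun y => pwcut r y * f y) + mulP (fun y => zoom e r bump y * f y).
Proof.
move=> r0 sf; have sz := smooth_zoom e r (@smooth_bump R).
have sb : smooth (fun y => 1 - zoom e r bump y) := smooth_sub (smooth_const 1) sz.
have s1 := smooth_mul sb sf; have s2 := smooth_mul sz sf.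
have -> : (fun y => pwcut r y * f y) = (fun y => pw e be y * ((1 - zoom e r bump y) * f y)).
  by apply/funext => y; rewrite /pwcut; ring.
rewrite -(@mulP_near0 _ r s1 r0) => [|y yr]; last first.
  by rewrite /zoom bump1 ?subrr ?mul0r // normrM normfV (gtr0_norm r0) ler_pdivrMr // mul1r ltW.
rewrite -(cdistD mulP_cdist s1 s2); congr mulP; apply/funext => y; ring.
Qed.

Lemma pwcutE r y : 0 < r -> 2 * r <= `|y - e| -> pwcut r y = pw e be y.
Proof.
move=> r0 h; rewrite /pwcut /zoom bump0 ?subr0 ?mulr1 // normrM normfV (gtr0_norm r0).
by rewrite ler_pdivlMr.
Qed.

Lemma mulP_far f r : smooth f -> 0 < r -> (forall y, `|y - e| <= 2 * r -> f y = 0) ->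
  mulP (fun y => zoom e r bump y * f y) = 0.
Proof.
move=> sf r0 f0; rewrite -[RHS](cdist0 mulP_cdist); congr mulP; apply/funext => y.
have [h|h] := leP `|y - e| (2 * r); first by rewrite f0 ?mulr0.
by rewrite /zoom bump0 ?mul0r // normrM normfV (gtr0_norm r0) ler_pdivlMr // ltW.
Qed.

Lemma mulP_small f : smooth f -> (forall y, 1 < `|y| -> f y = 0) ->
  mulP (zoom e s f) @[s --> 0^'+] --> 0.
Proof.
move=> sf f1; have [C [N [C0 hC]]] := sing_mult_small cP (nP e) be0 sing_mult_pw.
have [B B0 hB] := @smooth_bounded R f N 1 sf.
apply/right0P => eps eps0.
have CB : 0 < C * B + 1 by rewrite ltr_wpDl // mulr_ge0.
have [j hj] := pow_small (half_powR_lt1 be0) (divr_gt0 eps0 CB).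
exists (2^-1 ^+ j); first exact: rj0.
move=> s s0 sj; rewrite subr0.
have zero y : s < `|y - e| -> zoom e s f y = 0.
  by move=> h; rewrite /zoom f1 // normrM normfV (gtr0_norm s0) ltr_pdivlMr // mul1r.
apply: le_trans (hC (zoom e s f) B j B0 _ _ _) _.
- exact: smooth_smooth_on (smooth_zoom e s sf).
- move=> y ye y2; have [ys|ys] := leP `|y - e| s.
    rewrite -[B]mul1r -(expr1n _ N); apply: (wderivs_zoom sf s0); rewrite ?mul1r //.
    by apply: hB; rewrite normrM normfV (gtr0_norm s0) ler_pdivrMr // mul1r.
  move=> m mN; rewrite (derive1n_local m (@open_far R e s) (g := fun=> 0) zero ys).
  by rewrite derive1n_cst; case: m {mN} => [|m]; rewrite normr0 mulr0.
- by move=> y ye yj; apply: zero; exact: lt_trans yj.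
have := hj j (leqnn j); rewrite ler_pdivlMr // => h.
have : 0 <= (2^-1 `^ be : R) ^+ j by rewrite exprn_ge0 // powR_ge0.
by move: h; clear; nra.
Qed.

Lemma far_radius x : x != e -> exists2 r, 0 < r & 4 * r <= `|x - e|.
Proof.
move=> xe; have h : 0 < `|x - e| by rewrite normr_gt0 subr_eq0.
by exists (`|x - e| / 4); slra.
Qed.

Lemma mulP_null x : null_at mulP x.
Proof.
have [->|xe] := eqVneq x e; first by apply: null_atP => f; exact: mulP_small.
have [r r0 rx] := far_radius xe.
apply: null_atP => f sf f1.
have := null_atE (null_at_mul cP (nP x) (smooth_pwcut r0)) sf f1.
move=> /right0P h; apply/right0P => eps /h[d d0 hd].
exists (Num.min d r); first by rewrite lt_min d0.
move=> s s0; rewrite lt_min => /andP[sd sr].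
rewrite (mulP_split r0 (smooth_zoom x s sf)) mulP_far ?addr0; [exact: hd|exact: smooth_zoom|exact: r0|].
move=> y ye; rewrite /zoom f1 // normrM normfV (gtr0_norm s0) ltr_pdivlMr // mul1r.
apply: lt_le_trans sr _; have := ler_normD (x - y) (y - e); rewrite addrA subrK.
by rewrite [`|x - y|]distrC; slra.
Qed.

Lemma mulP_lim x ga : has_lim P x ga -> exists l, has_lim mulP x l.
Proof.
move=> hP; have [xe|xe] := eqVneq x e.
  rewrite xe; exists (pv P e (fun y => pw e be y * ind e y)).
  apply: (has_limI mulP_cdist (@mulP_null e)).
  exact: (pv_step_cvg cP (nP e) be0 sing_mult_pw).
have [r r0 rx] := far_radius xe.
have [l hl] := has_lim_mul cP (nP x) (smooth_pwcut r0) hP.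
(* On the ball around e the step zoomed at x is already constant: 1 if e lies to the left of x, and
   0 otherwise. *)
pose c : R := if e < x then 1 else 0.
exists (l + 1 * mulP (fun y => zoom e r bump y * c)); apply: (has_limI mulP_cdist (@mulP_null x)).
have h1 : P (fun y => pwcut r y * zoom x s hstep y) @[s --> 0^'+] --> l * 1.
  apply: (hl hstep 1 1); first exact: smooth_hstep.
    by move=> y y1; rewrite hstep1 // ltW.
  by move=> y y1; rewrite hstep0 //; slra.
rewrite mulr1 in h1.
have h2 : mulP (fun y => zoom e r bump y * zoom x s hstep y) @[s --> 0^'+] -->
    mulP (fun y => zoom e r bump y * c).
  apply/right0P => eps eps0; exists r => // s s0 sr.
  have -> : (fun y => zoom e r bump y * zoom x s hstep y) = (fun y => zoom e r bump y * c).
    apply/funext => y; have [h|h] := leP `|y - e| (2 * r); last first.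
      by rewrite {1 3}/zoom bump0 ?mul0r // normrM normfV (gtr0_norm r0) ler_pdivlMr // ltW.
    congr (_ * _); rewrite /zoom /c; move: h rx; rewrite ler_norml => /andP[y1 y2].
    case: ifPn => [ex|]; last rewrite -leNgt => ex.
      by rewrite gtr0_norm ?subr_gt0 // => h; rewrite hstep1 // ler_pdivrMr //; slra.
    by rewrite ler0_norm ?subr_le0 // => h; rewrite hstep0 // divr_ge0 //; slra.
  by rewrite subrr normr0 ltW.
apply: (cvg_right_lin h1 h2) => s s0.
by rewrite mul1r (mulP_split r0 (smooth_zoom x s (@smooth_hstep R))).
Qed.

End MulPower.

(** * Averages with slowly decaying profiles *)

Section Tails.
Context {R : realType}.
Implicit Types (f g psi phi G V : R -> R) (x y z c d A B D K L s h r t rho ga al : R) (m n N k j : nat).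

Definition decays al phi : Prop :=
  forall m, exists C M : R, forall x, M < `|x| -> `|derive1n m phi x| <= C * `|x| `^ (al - m%:R).

(** Uniform form of [decays]: a single constant for all orders up to N, valid from radius 1 on. *)
Definition tdec al N C phi : Prop :=
  forall z, 1 <= `|z| -> wderivs `|z| N (C * `|z| `^ al) phi z.

Lemma decays_tdec al phi N : smooth phi -> al < 0 -> decays al phi ->
  exists2 C, 0 <= C & tdec al N C phi.
Proof.
move=> sp al0 dp.
have one m : exists2 C, 0 <= C & forall z, 1 <= `|z| ->
    `|z| ^+ m * `|derive1n m phi z| <= C * `|z| `^ al.
  have [C [M hM]] := dp m; pose K := Num.max 1 M.
  have K1 : 1 <= K by rewrite le_max lexx.
  have K0 : 0 < K by slra.
  have [B B0 hB] := @smooth_bounded R phi m K sp.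
  have Kal : 0 < K `^ al by rewrite powR_gt0.
  exists (`|C| + K ^+ m * B / K `^ al).
    by rewrite addr_ge0 // divr_ge0 ?mulr_ge0 ?exprn_ge0 // ltW.
  move=> z z1; have z0 : 0 < `|z| by slra.
  have zal : 0 <= `|z| `^ al by exact: powR_ge0.
  have [zK|Kz] := leP `|z| K.
    rewrite mulrDl; apply: ler_wpDl; first exact: mulr_ge0.
    apply: (@le_trans _ _ (K ^+ m * B)).
      by apply: ler_pM => //; [apply: lerXn2r; rewrite ?nnegrE //; slra|exact: hB].
    rewrite mulrAC ler_pdivlMr //; apply: ler_wpM2l; first by rewrite mulr_ge0 ?exprn_ge0 // ltW.
    have p1 : 0 < `|z| `^ (- al) by rewrite powR_gt0.
    have e1 : `|z| `^ (- al) <= K `^ (- al).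
      by apply: ge0_ler_powR; rewrite ?nnegrE ?oppr_ge0 ?(ltW al0) ?(ltW K0).
    by rewrite !powRN lef_pV2 ?posrE ?powR_gt0 in e1.
  have Mz : M < `|z| by apply: le_lt_trans Kz; rewrite le_max lexx orbT.
  rewrite mulrDl; apply: ler_wpDr; first by rewrite mulr_ge0 // divr_ge0 ?mulr_ge0 ?exprn_ge0 // ltW.
  apply: (@le_trans _ _ (`|z| ^+ m * (`|C| * `|z| `^ (al - m%:R)))).
    apply: ler_wpM2l; first exact: exprn_ge0.
    by apply: le_trans (hM z Mz) _; apply: ler_wpM2r; [exact: powR_ge0|exact: ler_norm].
  rewrite powRB ?(gt_eqF z0) ?implybT // powR_mulrn //.
  by rewrite le_eqVlt; apply/orP; left; apply/eqP; field; rewrite expf_neq0 // gt_eqF.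
elim: N => [|N [C C0 hC]].
  have [C C0 hC] := one 0%N; exists C => // z z1 m; rewrite leqn0 => /eqP ->; exact: hC.
have [C' C'0 hC'] := one N.+1; exists (C + C'); first exact: addr_ge0.
move=> z z1 m; rewrite leq_eqVlt mulrDl => /orP[/eqP ->|mN].
  by apply: ler_wpDl; [rewrite mulr_ge0 // powR_ge0|exact: hC'].
by apply: ler_wpDr; [rewrite mulr_ge0 // powR_ge0|exact: hC].
Qed.

Lemma tail_sum (q D : R) k0 n : 0 <= q < 1 -> 0 <= D ->
  \sum_(k < n) (if (k < k0)%N then 0 else D * q ^+ k) <= (1 - q)^-1 * D * q ^+ k0.
Proof.
move=> /andP[q0 q1] D0.
have q1' : 0 < 1 - q by slra.
suff h : \sum_(k < n) (if (k < k0)%N then 0 else D * q ^+ k) <=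
    (1 - q)^-1 * D * (q ^+ k0 - q ^+ maxn k0 n).
  apply: le_trans h _; apply: ler_wpM2l; first by rewrite mulr_ge0 // invr_ge0 ltW.
  by rewrite gerBl exprn_ge0.
elim: n => [|n IH]; first by rewrite big_ord0 maxn0 subrr mulr0.
rewrite big_ord_recr /=; case: ltnP => nk.
  by rewrite addr0; move: IH; rewrite (maxn_idPl (ltnW nk)) (maxn_idPl nk).
rewrite (maxn_idPr (leqW nk)); move: IH; rewrite (maxn_idPr nk) => IH.
apply: le_trans (lerD IH (lexx _)) _.
by rewrite le_eqVlt; apply/orP; left; apply/eqP; rewrite exprS; field; rewrite gt_eqF.
Qed.

Lemma pow2R k (al : R) : (2 ^+ k : R) `^ al = (2 `^ al) ^+ k.
Proof.
rewrite -powR_mulrn // -[in RHS]powR_mulrn; last exact: powR_ge0.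
exact: powRAC.
Qed.

Lemma one_powR (al : R) : 1 `^ al = 1.
Proof. by rewrite powR1. Qed.

Lemma pow2_lt1 (al : R) : al < 0 -> 0 <= (2 : R) `^ al < 1.
Proof.
move=> al0; rewrite powR_ge0 /= -[al]opprK powRN invf_lt1 ?powR_gt0 //.
rewrite -[ltLHS](one_powR (- al)).
by apply: gt0_ltr_powR; rewrite ?nnegrE ?oppr_gt0 //; slra.
Qed.

(** The dyadic bound with coefficients [D q^k] from [k0] on. For [k0 = 0] the core is included; for
    [k0 > 0] the function vanishes up to radius [t * 2 ^+ k0.+1], and the bound gains the factor
    [q ^+ k0]. *)
Lemma tail_bound P x : cdist P -> null_at P x -> exists C N, 0 <= C /\
  forall psi t (q D : R) k0, 0 < t -> t <= 1 -> 0 <= q < 1 -> 0 <= D -> smooth psi ->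
  (forall y, (0 < k0)%N -> `|y - x| < t * 2 ^+ k0.+1 -> psi y = 0) ->
  (forall y, k0 = 0%N -> `|y - x| <= 2 * t -> wderivs t N D psi y) ->
  (forall k y, (k0 <= k)%N -> (0 < k)%N -> t * 2 ^+ k <= 2 * `|y - x| -> `|y - x| <= 2 * (t * 2 ^+ k) ->
     wderivs (t * 2 ^+ k) N (D * q ^+ k) psi y) ->
  `|P psi| <= C * ((1 - q)^-1 * D * q ^+ k0).
Proof.
move=> cP nP; have [C [N [C0 hC]]] := dyadic_bound cP nP 1.
exists C, N; split => // psi t q D k0 t0 t1 q01 D0 sp hz hc hs.
pose a k := if (k < k0)%N then 0 else D * q ^+ k.
have [q0 q1] := andP q01.
have a0 k : 0 <= a k by rewrite /a; case: ifP => // _; rewrite mulr_ge0 ?exprn_ge0.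
have z0 k y : (k < k0)%N -> `|y - x| <= 2 * (t * 2 ^+ k) -> derivs_le N 0 psi y.
  move=> kk yk; have k00 : (0 < k0)%N by exact: leq_ltn_trans kk.
  apply: (derivs_le0 (@open_near R x (t * 2 ^+ k0.+1))) => [z /= zr|/=]; first exact: hz.
  apply: le_lt_trans yk _; rewrite mulrCA -exprS ltr_pM2l // ltr_eXn2l ?ltr1n //.
have h1 k m y : (m <= N)%N -> (k != 0)%N -> t * 2 ^+ k <= 2 * `|y - x| ->
    `|y - x| <= 2 * (t * 2 ^+ k) -> (t * 2 ^+ k) ^+ m * `|derive1n m psi y| <= a k.
  move=> mN k00 y1 y2; rewrite /a; case: ltnP => kk; last by apply: hs; rewrite ?lt0n.
  by have := z0 k y kk y2 m mN; rewrite normr_le0 => /eqP ->; rewrite normr0 mulr0.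
have h2 m y : (m <= N)%N -> `|y - x| <= 2 * t -> t ^+ m * `|derive1n m psi y| <= a 0%N.
  move=> mN yt; rewrite /a; case: ltnP => kk.
    have := z0 0%N y kk; rewrite expr0 mulr1 => /(_ yt m mN); rewrite normr_le0 => /eqP ->.
    by rewrite normr0 mulr0.
  by rewrite expr0 mulr1; apply: hc => //; apply/eqP; rewrite -leqn0.
have [n hn] := hC t a psi t0 t1 sp a0 h1 h2.
by apply: le_trans hn _; apply: ler_wpM2l => //; exact: tail_sum.
Qed.

Lemma tdec_zoom x t N C al phi k y : smooth phi -> al < 0 -> 0 < t -> 0 <= C -> tdec al N C phi ->
  (0 < k)%N -> t * 2 ^+ k <= 2 * `|y - x| ->
  wderivs `|y - x| N (C * 2 `^ (- al) * (2 `^ al) ^+ k) (zoom x t phi) y.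
Proof.
move=> sp al0 t0 C0 hd k0 yk m mN.
pose z := (y - x) / t.
have zE : `|z| = `|y - x| / t by rewrite normrM normfV (gtr0_norm t0).
have zk : 2 ^+ k / 2 <= `|z|.
  by rewrite zE ler_pdivlMr // mulrAC ler_pdivrMr // mulrC [leRHS]mulrC.
have k2 : 1 <= (2 : R) ^+ k / 2.
  by case: k k0 {yk zk} => // k _; rewrite exprS mulrAC mulfV // mul1r exprn_ege1 // ler1n.
have z1 : 1 <= `|z| by exact: le_trans zk.
have e : `|y - x| ^+ m * `|derive1n m (zoom x t phi) y| = `|z| ^+ m * `|derive1n m phi z|.
  rewrite /zoom (derive1n_scal m x t sp) normrM normrX normfV (gtr0_norm t0) -/z.
  by rewrite mulrA -exprMn zE.
rewrite e; apply: le_trans (hd z z1 m mN) _; rewrite -mulrA; apply: ler_wpM2l => //.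
have zk0 : 0 < (2 : R) ^+ k / 2 by slra.
have -> : 2 `^ (- al) * (2 `^ al) ^+ k = ((2 : R) ^+ k / 2) `^ al.
  rewrite powRM ?exprn_ge0 ?invr_ge0 // pow2R mulrC; congr (_ * _).
  by rewrite -powR_inv1 // -powRrM mulN1r.
have p1 : 0 < `|z| `^ (- al) by rewrite powR_gt0 //; slra.
have e1 : ((2 : R) ^+ k / 2) `^ (- al) <= `|z| `^ (- al).
  by apply: ge0_ler_powR; rewrite ?nnegrE ?oppr_ge0 ?(ltW al0) ?(ltW zk0).
have z0 : 0 < `|z| by slra.
by rewrite !powRN lef_pV2 ?posrE ?powR_gt0 in e1.
Qed.

Lemma wderivs_scale rho r N K A f y : 0 <= rho -> 0 <= r -> r <= K * rho -> 1 <= K -> wderivs rho N A f y ->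
  wderivs r N (K ^+ N * A) f y.
Proof.
move=> rho0 r0 rK K1 h m mN; have := h m mN; set u := `|_| => hu.
apply: (@le_trans _ _ (K ^+ m * (rho ^+ m * u))).
  rewrite mulrA -exprMn; apply: ler_wpM2r; first exact: normr_ge0.
  by apply: lerXn2r; rewrite ?nnegrE // mulr_ge0 //; slra.
apply: ler_pM => //; first by rewrite exprn_ge0 //; slra.
  by rewrite mulr_ge0 ?exprn_ge0 ?normr_ge0.
exact: ler_weXn2l.
Qed.

(** The profile is cut at a large dyadic radius: the outer part is small uniformly in the scale by
    [tail_bound], and the inner part has bounded support and falls under nullness at x. *)
Lemma decay_cvg0 P x psi al : cdist P -> null_at P x -> smooth psi -> al < 0 ->
  (forall N, exists2 C, 0 <= C & tdec al N C psi) -> P (zoom x s psi) @[s --> 0^'+] --> 0.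
Proof.
move=> cP nP sp al0 hp; have [C [N [C0 hC]]] := tail_bound cP nP.
have [D D0 hD] := hp N; have [B B0 hB] := @bump_derivs R N.
pose E := 2 ^+ N * (2 ^+ N * (D * 2 `^ (- al) * (1 + 4 ^+ N * B))).
have E0 : 0 <= E by rewrite !mulr_ge0 ?exprn_ge0 ?powR_ge0 ?addr_ge0 ?mulr_ge0 ?exprn_ge0.
pose q : R := 2 `^ al; have q01 : 0 <= q < 1 := pow2_lt1 al0; have [q0 q1] := andP q01.
have split_tail k0 s : (0 < k0)%N -> 0 < s -> s <= 1 ->
    `|P (zoom x s (fun z => psi z * (1 - bump (z / 2 ^+ k0.+1))))| <= C * ((1 - q)^-1 * E * q ^+ k0).
  move=> k00 s0 s1.
  have sb : smooth (fun z : R => 1 - zoom 0 (2 ^+ k0.+1) bump z).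
    exact: smooth_sub (smooth_const 1) (smooth_zoom 0 _ (@smooth_bump R)).
  have -> : (fun z => psi z * (1 - bump (z / 2 ^+ k0.+1))) =
    (fun z => psi z * (1 - zoom 0 (2 ^+ k0.+1) bump z)).
    by apply/funext => z; rewrite /zoom subr0.
  have sb' := smooth_zoom x s sb; have sp' := smooth_zoom x s sp.
  apply: (hC _ s q E k0 s0 s1 q01 E0).
  - exact: smooth_zoom (smooth_mul sp sb).
  - move=> y _ yk; rewrite /zoom subr0 bump1 ?subrr ?mulr0 //.
    rewrite !normrM !normfV (gtr0_norm s0) [`|2 ^+ _|]gtr0_norm ?exprn_gt0 //.
    by rewrite ler_pdivrMr ?exprn_gt0 // mul1r ler_pdivrMr // mulrC ltW.
  - by move=> y k0E; rewrite k0E in k00.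
  move=> k y k0k kk y1 y2.
  have yx : 0 < `|y - x|.
    have : 0 < s * 2 ^+ k by rewrite mulr_gt0 // exprn_gt0.
    slra.
  have yx' : y != x by apply: contraTneq yx => ->; rewrite subrr normr0 ltxx.
  have w1 := tdec_zoom sp al0 s0 D0 hD kk y1.
  have w2 : wderivs `|y - x| N (1 + 4 ^+ N * B) (zoom x s (fun z => 1 - zoom 0 (2 ^+ k0.+1) bump z)) y.
    have -> : zoom x s (fun z => 1 - zoom 0 (2 ^+ k0.+1) bump z) =
        (fun y => 1 - zoom x (s * 2 ^+ k0.+1) bump y).
      apply/funext => z; rewrite /zoom subr0; congr (1 - bump _); field.
      by rewrite expf_neq0 // gt_eqF.
    have r0 : 0 < s * 2 ^+ k0.+1 by rewrite mulr_gt0 ?exprn_gt0.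
    have [yr|yr] := leP `|y - x| (4 * (s * 2 ^+ k0.+1)).
      have wb : wderivs `|y - x| N (4 ^+ N * B) (zoom x (s * 2 ^+ k0.+1) bump) y.
        by apply: (wderivs_zoom (@smooth_bump R) r0) => //; rewrite ler1n.
      move=> m mN; rewrite (derive1nB m (smooth_const 1) (smooth_zoom x _ (@smooth_bump R))) derive1n_cst.
      have := wb m mN; set u := derive1n m _ y => hu.
      case: m mN @u hu => [|m] mN u hu; last by rewrite sub0r normrN ler_wpDl.
      rewrite expr0 mul1r in hu; rewrite expr0 mul1r; apply: le_trans (ler_normB _ _) _.
      by rewrite normr1 lerD2l.
    move=> m mN; rewrite (derive1n_local m (@open_far R x (4 * (s * 2 ^+ k0.+1))) (g := fun=> 1) _ yr); last first.
      move=> z /= zr; rewrite /zoom bump0 ?subr0 // normrM normfV (gtr0_norm r0) ler_pdivlMr //.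
      by move: zr r0; clear; lra.
    rewrite derive1n_cst; case: m {mN} => [|m]; last first.
      by rewrite normr0 mulr0 addr_ge0 ?mulr_ge0 ?exprn_ge0.
    by rewrite expr0 mul1r normr1 lerDl mulr_ge0 ?exprn_ge0.
  have w3 := wderivs_mul yx (open_off x) (smooth_smooth_on sp') (smooth_smooth_on sb') yx' w1 w2.
  have y1' : s * 2 ^+ k <= 2 * `|y - x| by [].
  have s2 : 0 <= s * 2 ^+ k by rewrite mulr_ge0 ?exprn_ge0 // ltW.
  have := wderivs_scale (ltW yx) s2 y1' (_ : 1 <= 2) w3; rewrite ler1n => /(_ isT).
  apply: wderivsW => //; rewrite le_eqVlt; apply/orP; left; apply/eqP; rewrite /E -/q; ring.
apply/right0P => e e0.
have Q0 : 0 <= C * ((1 - q)^-1 * E) by apply: mulr_ge0 => //; apply: mulr_ge0 => //; rewrite invr_ge0 subr_ge0 ltW.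
have Q1 : 0 < 2 * (C * ((1 - q)^-1 * E) + 1) by slra.
have [k0 hk0] := pow_small q01 (divr_gt0 e0 Q1).
have sbk : smooth (fun z : R => bump (z / 2 ^+ k0.+2)).
  have -> : (fun z : R => bump (z / 2 ^+ k0.+2)) = zoom 0 (2 ^+ k0.+2) bump.
    by apply/funext => z; rewrite /zoom subr0.
  exact: smooth_zoom (@smooth_bump R).
have sc := smooth_mul sp sbk.
have c0 y : 2 * 2 ^+ k0.+2 < `|y| -> psi y * bump (y / 2 ^+ k0.+2) = 0.
  move=> yk; rewrite bump0 ?mulr0 // normrM normfV [`|2 ^+ _|]gtr0_norm ?exprn_gt0 //.
  by rewrite ler_pdivlMr ?exprn_gt0 // ltW.
have e2 : 0 < e / 2 by slra.
have /right0P/(_ _ e2)[d d0 hd] := null_atE nP sc c0.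
exists (Num.min d 1); first by rewrite lt_min d0 ltr01.
move=> s s0; rewrite lt_min => /andP[sd s1].
have h1 := hd s s0 sd; have h2 := split_tail k0.+1 s isT s0 (ltW s1).
have s1m : smooth (fun z : R => psi z * (1 - bump (z / 2 ^+ k0.+2))).
  exact: smooth_mul sp (smooth_sub (smooth_const 1) sbk).
have eP : P (zoom x s psi) = P (zoom x s (fun z => psi z * bump (z / 2 ^+ k0.+2))) +
    P (zoom x s (fun z => psi z * (1 - bump (z / 2 ^+ k0.+2)))).
  rewrite -(cdistD cP (smooth_zoom x s sc) (smooth_zoom x s s1m)).
  by congr P; apply/funext => y; rewrite /zoom; ring.
rewrite subr0 in h1; rewrite subr0 eP; apply: le_trans (ler_normD _ _) _.
have hq := hk0 k0.+1 (leqnSn _); rewrite ler_pdivlMr // in hq.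
have qq : 0 <= q ^+ k0.+1 by exact: exprn_ge0.
have : C * ((1 - q)^-1 * E * q ^+ k0.+1) <= e / 2.
  by rewrite mulrA; move: hq qq; set w := C * _; set v := q ^+ _; clear; nra.
move: h1 h2; set u := P _; set v := P _; clear; lra.
Qed.

Lemma powR_small (C eta e : R) : 0 <= C -> 0 < eta -> 0 < e ->
  exists2 d, 0 < d & forall s, 0 < s -> s < d -> C * s `^ eta <= e.
Proof.
move=> C0 eta0 e0; have C1 : 0 < C + 1 by slra.
have q0 : 0 < e / (C + 1) by rewrite divr_gt0.
exists ((e / (C + 1)) `^ eta^-1); first by rewrite powR_gt0.
move=> s s0 sd; have h : s `^ eta < e / (C + 1).
  rewrite [ltRHS](_ : _ = ((e / (C + 1)) `^ eta^-1) `^ eta); last first.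
    by rewrite -powRrM mulVf ?gt_eqF // powRr1 // ltW.
  by apply: gt0_ltr_powR; rewrite ?nnegrE ?powR_ge0 // ltW.
rewrite ltr_pdivlMr // in h; have := powR_ge0 s eta.
by move: h; clear; nra.
Qed.

(** At scale s the k-th shell contributes about [(s 2^k)^(1 + eta) 2^(al k)]. The condition
    [1 + eta + al < 0] makes the shells summable and leaves [s^(1 + eta)], which beats the division
    by s. *)
Lemma weighted_tail P x G phi al eta : cdist P -> null_at P x -> smooth phi -> smooth G ->
  al < 0 -> 0 < eta -> 1 + eta + al < 0 -> (forall N, exists2 C, 0 <= C & tdec al N C phi) ->
  (forall N, exists2 K, 0 <= K & forall r y, 0 < r -> `|y - x| <= 2 * r ->
     (r <= 1) || (r <= 2 * `|y - x|) -> wderivs r N (K * r `^ (1 + eta)) G y) ->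
  s^-1 * P (fun y => G y * zoom x s phi y) @[s --> 0^'+] --> 0.
Proof.
move=> cP nP sp sG al0 eta0 ea hp hG.
have [C [N [C0 hC]]] := tail_bound cP nP.
have [D D0 hD] := hp N; have [K K0 hK] := hG N.
have [Bp Bp0 hBp] := @smooth_bounded R phi N 2 sp.
pose q : R := 2 `^ (1 + eta + al); have q01 : 0 <= q < 1 := pow2_lt1 ea; have [q0 q1] := andP q01.
pose F := 2 ^+ N * K * (2 ^+ N * (D * 2 `^ (- al)) + Bp).
have F0 : 0 <= F by rewrite !mulr_ge0 ?exprn_ge0 ?addr_ge0 ?mulr_ge0 ?exprn_ge0 ?powR_ge0.
have main s : 0 < s -> s <= 1 -> `|P (fun y => G y * zoom x s phi y)| <=
    C * ((1 - q)^-1 * F) * s `^ (1 + eta).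
  move=> s0 s1; have sz := smooth_zoom x s sp.
  have p0 : 0 <= s `^ (1 + eta) by exact: powR_ge0.
  apply: le_trans (hC _ s q (F * s `^ (1 + eta)) 0%N s0 s1 q01 _ (smooth_mul sG sz) _ _ _) _.
  - exact: mulr_ge0.
  - by [].
  - move=> y _ ys.
    have w1 := hK s y s0 ys (introT orP (or_introl s1)).
    have w2 : wderivs s N (1 ^+ N * Bp) (zoom x s phi) y.
      apply: (wderivs_zoom sp s0) => //; rewrite ?mul1r //; first exact: ltW.
      by apply: hBp; rewrite normrM normfV (gtr0_norm s0) ler_pdivrMr.
    have w3 := wderivs_mul s0 openT (smooth_smooth_on sG) (smooth_smooth_on sz) I w1 w2.
    apply: wderivsW w3 => //; rewrite expr1n mul1r /F.
    have -> : 2 ^+ N * (K * s `^ (1 + eta) * Bp) = 2 ^+ N * K * Bp * s `^ (1 + eta) by ring.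
    apply: ler_wpM2r => //; apply: ler_wpM2l; first by rewrite mulr_ge0 ?exprn_ge0.
    by rewrite lerDr !mulr_ge0 ?exprn_ge0 ?powR_ge0.
  - move=> k y _ k0 y1 y2; set r := s * 2 ^+ k in y1 y2 *.
    have r0 : 0 < r by rewrite mulr_gt0 ?exprn_gt0.
    have w1 := hK r y r0 y2 (introT orP (or_intror y1)).
    have w2 := tdec_zoom sp al0 s0 D0 hD k0 y1.
    have w2' : wderivs r N (2 ^+ N * (D * 2 `^ (- al) * (2 `^ al) ^+ k)) (zoom x s phi) y.
      by apply: wderivs_scale w2 => //; [exact: ltW|rewrite ler1n].
    have w3 := wderivs_mul r0 openT (smooth_smooth_on sG) (smooth_smooth_on sz) I w1 w2'.
    apply: wderivsW w3 => //; rewrite /r powRM ?exprn_ge0 ?(ltW s0) // pow2R.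
    have -> : q ^+ k = (2 `^ (1 + eta)) ^+ k * (2 `^ al) ^+ k.
      by rewrite -exprMn /q [in LHS]powRD // pnatr_eq0 implybT.
    have -> : 2 ^+ N * (K * (s `^ (1 + eta) * 2 `^ (1 + eta) ^+ k) *
        (2 ^+ N * (D * 2 `^ (- al) * 2 `^ al ^+ k))) =
      2 ^+ N * K * (2 ^+ N * (D * 2 `^ (- al))) * s `^ (1 + eta) *
        (2 `^ (1 + eta) ^+ k * 2 `^ al ^+ k) by ring.
    apply: ler_wpM2r; first by rewrite mulr_ge0 ?exprn_ge0 ?powR_ge0.
    apply: ler_wpM2r => //; apply: ler_wpM2l; first by rewrite mulr_ge0 ?exprn_ge0.
    by rewrite lerDl.
  - by rewrite expr0 mulr1 !mulrA.
apply/right0P => e e0.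
have Q0 : 0 <= C * ((1 - q)^-1 * F) by apply: mulr_ge0 => //; apply: mulr_ge0 => //; rewrite invr_ge0 subr_ge0 ltW.
have [d d0 hd] := powR_small Q0 eta0 e0.
exists (Num.min d 1); first by rewrite lt_min d0 ltr01.
move=> s s0; rewrite lt_min => /andP[sd s1]; rewrite subr0 normrM normfV (gtr0_norm s0).
rewrite ler_pdivrMl //; apply: le_trans (main s s0 (ltW s1)) _.
rewrite powRD ?(gt_eqF s0) ?implybT // powRr1; last exact: ltW.
rewrite mulrCA; apply: ler_wpM2l; first exact: ltW.
exact: hd.
Qed.

(** Vanishing to second order gives [r ^+ 2] for [r <= 1]. This is weakened to the power [1 + eta]
    because the summability condition of [weighted_tail] fails for the exponent 2 when [al] is close
    to -1. *)
Lemma quadratic_weight x G eta L : smooth G -> (forall y, L < `|y| -> G y = 0) ->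
  G x = 0 -> derive1 G x = 0 -> 0 < eta -> eta <= 1 -> 
  forall N, exists2 K, 0 <= K & forall r y, 0 < r -> `|y - x| <= 2 * r ->
     (r <= 1) || (r <= 2 * `|y - x|) -> wderivs r N (K * r `^ (1 + eta)) G y.
Proof.
move=> sG hL G0 G1 eta0 eta1 N.
pose T := `|L| + 2 + 2 * `|x|.
have [B B0 hB] := @smooth_bounded R G N.+2 (T + 2) sG.
have L0 := normr_ge0 L; have x0 := normr_ge0 x.
have far y : `|L| + 1 < `|y| -> derivs_le N 0 G y.
  move=> yL; apply: (derivs_le0 (@open_far0 R (`|L|))) => [z /= zL|/=]; last slra.
  by apply: hL; apply: le_lt_trans zL; exact: ler_norm.
have T1 : 1 <= 2 * T by rewrite /T; slra.
exists ((2 * T) ^+ N * B + 4 * B); first by rewrite addr_ge0 ?mulr_ge0 ?exprn_ge0 //; slra.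
move=> r y r0 yr hr.
have p0 : 0 <= r `^ (1 + eta) by exact: powR_ge0.
have [r1|r1] := leP r 1; last first.
  have p1 : 1 <= r `^ (1 + eta).
    rewrite -[leLHS](one_powR (1 + eta)).
    by apply: ge0_ler_powR; rewrite ?nnegrE; slra.
  have {}hr : r <= 2 * `|y - x| by move: hr; rewrite leNgt r1.
  have [yL|yL] := leP `|y| (`|L| + 1); last first.
    apply: (wderivsW (N := N) (A := 0)) => //.
      by rewrite !mulr_ge0 ?addr_ge0 ?mulr_ge0 ?exprn_ge0 //; slra.
    move=> m mN; have := far y yL m mN; rewrite normr_le0 => /eqP ->.
    by rewrite normr0 mulr0.
  have rT : r <= 2 * T.
    by rewrite /T; have := ler_normB y x; slra.
  apply: (wderivsW (N := N) (A := (2 * T) ^+ N * B)) => //.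
    rewrite -[leLHS]mulr1; apply: ler_pM => //.
    - by rewrite mulr_ge0 ?exprn_ge0 //; slra.
    - by rewrite lerDl; slra.
  apply: wderivs_le => //; first exact: ltW.
  apply: (derivs_leW (N := N.+2)) (hB y _) => //; first by rewrite -addn2 leq_addr.
  by rewrite /T; slra.
have r2 : r ^+ 2 <= r `^ (1 + eta).
  rewrite powRD ?(gt_eqF r0) ?implybT // powRr1; last exact: ltW.
  rewrite expr2; apply: ler_wpM2l; first exact: ltW.
  rewrite -[leLHS]powRr1; last exact: ltW.
  have -> : (1 : R) = eta + (1 - eta) by ring.
  rewrite [leLHS]powRD ?(gt_eqF r0) ?implybT // -[leRHS]mulr1.
  apply: ler_wpM2l; first exact: powR_ge0.
  rewrite -[leRHS](one_powR (1 - eta)); apply: ge0_ler_powR; rewrite ?nnegrE ?subr_ge0 //.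
  exact: ltW.
have mid c : `|c - x| <= `|y - x| -> `|c| <= T + 2.
  move=> cy; have := ler_normD (c - x) x; rewrite subrK /T; slra.
have yE : y = x + (y - x) by rewrite addrC subrK.
have ymid := mid y (lexx _).
apply: (wderivsW (N := N) (A := 4 * B * r ^+ 2)) => //.
  apply: (@le_trans _ _ (4 * B * r `^ (1 + eta))); first by apply: ler_wpM2l => //; slra.
  by apply: ler_wpM2r => //; rewrite lerDr mulr_ge0 ?exprn_ge0 //; slra.
have rr0 : 0 <= r ^+ 2 by exact: sqr_ge0.
move=> m mN; case: m mN => [|[|m]] mN.
- rewrite expr0 mul1r derive1n0.
  have := @smooth_taylor R G x (y - x) B sG (fun c cy => hB c (mid c cy) 2%N isT).
  rewrite -yE G0 G1 mul0r !subr0 => /le_trans; apply.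
  have -> : 4 * B * r ^+ 2 = B * (2 * r) ^+ 2 by ring.
  apply: ler_wpM2l => //; rewrite -[leLHS]ger0_norm ?sqr_ge0 // normrX.
  by apply: lerXn2r; rewrite ?nnegrE ?normr_ge0 //; slra.
- rewrite expr1 derive1n1.
  have := @smooth_lip R (derive1 G) x (y - x) B (smooth_derive1 sG) (fun c cy => hB c (mid c cy) 2%N isT).
  rewrite -yE G1 subr0 => h; apply: (@le_trans _ _ (r * (B * (2 * r)))).
    by apply: ler_wpM2l; [exact: ltW|apply: le_trans h _; exact: ler_wpM2l].
  have -> : r * (B * (2 * r)) = 2 * B * r ^+ 2 by ring.
  by apply: ler_wpM2r => //; slra.
rewrite -addn2 exprD mulrAC; apply: ler_wpM2r => //.
apply: (@le_trans _ _ (1 * B)); last slra.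
apply: ler_pM => //; first by rewrite exprn_ge0 // ltW.
  by apply: exprn_ile1; rewrite ?(ltW r0).
by apply: (hB y ymid); rewrite addn2 leqW // leqW.
Qed.

End Tails.

(** * The weight acts on averages as multiplication by its value *)

Section MulPowerTail.
Context {R : realType}.
Implicit Types (f g psi phi G V : R -> R) (x y z c d A B D K L s h r t rho ga al : R) (m n N k j : nat).

Lemma id_wderivs N z : wderivs `|z| N `|z| (fun y : R => y) z.
Proof.
have e : derive1 (fun y : R => y) = fun=> 1.
  by apply/funext => y; exact: is_derive1E (is_derive_id y 1).
case=> [|m] mN; first by rewrite expr0 mul1r.
rewrite derive1Sn e derive1n_cst; case: m {mN} => [|m]; last by rewrite normr0 mulr0.
by rewrite expr1 normr1 mulr1.
Qed.

Lemma smooth_id : smooth (fun y : R => y).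
Proof. exact: smooth_by_derive (fun y => is_derive_id y 1) (smooth_const 1). Qed.

Lemma tdec_id al N C phi : smooth phi -> tdec al N C phi ->
  tdec (al + 1) N (2 ^+ N * C) (fun z => z * phi z).
Proof.
move=> sp hp z z1; have z0 : 0 < `|z| by slra.
have := wderivs_mul z0 openT (smooth_smooth_on smooth_id) (smooth_smooth_on sp) I (@id_wderivs N z) (hp z z1).
apply: wderivsW => //; rewrite powRD ?(gt_eqF z0) ?implybT // powRr1; last exact: ltW.
by rewrite le_eqVlt; apply/orP; left; apply/eqP; ring.
Qed.

Variables (P : (R -> R) -> R) (e be : R).
Hypotheses (cP : cdist P) (nP : forall x, null_at P x) (be0 : 0 < be).

(** First-order Taylor expansion: the linear term is s times the zoom of [z * phi z], which decays
    with exponent [al + 1 < 0] and falls under [decay_cvg0]; the remainder is quadratic and falls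
    under [weighted_tail]. This uses the full strength of [al < -1]. *)
Lemma smooth_tail W x phi al : smooth W -> smooth phi -> al < -1 ->
  (forall N, exists2 C, 0 <= C & tdec al N C phi) ->
  s^-1 * P (fun y => (W y - W x) * zoom x s phi y) @[s --> 0^'+] --> 0.
Proof.
move=> sW sp al1 hp; have [L L0 hL] := cdist_far cP.
pose c := derive1 W x.
pose G0 y := W y - W x - c * (y - x).
(* [quadratic_weight] wants bounded support; K supplies it and equals 1 wherever P can see. *)
pose K : R -> R := zoom 0 L bump.
have sK : smooth K := smooth_zoom 0 L (@smooth_bump R).
have sV : smooth (fun y => W y - W x) := smooth_sub sW (smooth_const _).
have sl : smooth (fun y => y - x) := smooth_sub smooth_id (smooth_const x).
have sG0 : smooth G0 := smooth_sub sV (smooth_scale c sl).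
have sG := smooth_mul sG0 sK.
have G00 : G0 x = 0 by rewrite /G0 !subrr mulr0 subr0.
have dG0 : is_derive x 1 G0 0.
  have d1 : is_derive x 1 (fun y => W y - W x) c.
    by have := isdD (smooth_is_derive x sW) (is_derive_cst (- W x) x 1); rewrite addr0.
  have d2 : is_derive x 1 (fun y => y - x) 1.
    by have := isdD (is_derive_id x 1) (is_derive_cst (- x) x 1); rewrite addr0.
  have d3 := isdD d1 (isdN (isdZ c d2)).
  by rewrite mulr1 subrr in d3.
have G1 : derive1 (fun y => G0 y * K y) x = 0.
  have := is_derive1E (isdM dG0 (smooth_is_derive x sK)).
  by rewrite G00 mul0r => ->; rewrite ?mulr0 ?mul0r ?addr0.
have Gfar y : 2 * L < `|y| -> G0 y * K y = 0.
  move=> yL; rewrite /K /zoom subr0 bump0 ?mulr0 // normrM normfV (gtr0_norm L0).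
  by rewrite ler_pdivlMr // ltW.
(* Half of the excess of the decay over exponent -1, so that [1 + eta + al] stays negative. *)
pose eta : R := Num.min 1 ((-1 - al) / 2).
have eta0 : 0 < eta by rewrite lt_min ltr01 divr_gt0 //; slra.
have eta1 : eta <= 1 by rewrite ge_min lexx.
have eta2 : eta <= (-1 - al) / 2 by rewrite ge_min lexx orbT.
have ea : 1 + eta + al < 0 by slra.
have al0 : al < 0 by slra.
have G0K : G0 x * K x = 0 by rewrite G00 mul0r.
have h1 := weighted_tail cP (nP x) sp sG al0 eta0 ea hp
  (quadratic_weight sG Gfar G0K G1 eta0 eta1).
have szp : smooth (fun z => z * phi z) := smooth_mul smooth_id sp.
have al10 : al + 1 < 0 by slra.
have h2 : P (zoom x s (fun z => z * phi z)) @[s --> 0^'+] --> 0.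
  apply: (decay_cvg0 cP (nP x) szp al10) => N; have [C C0 hC] := hp N.
  by exists (2 ^+ N * C); [rewrite mulr_ge0 ?exprn_ge0|exact: tdec_id].
rewrite -[X in _ --> X](_ : 0 + c * 0 = 0); last by rewrite mulr0 addr0.
apply: (cvg_right_lin h1 h2) => s s0.
have sz := smooth_zoom x s sp; have szz := smooth_zoom x s szp.
have e1 : P (fun y => G0 y * K y * zoom x s phi y) = P (fun y => G0 y * zoom x s phi y).
  apply/eqP; rewrite -subr_eq0 -(cdistB cP (smooth_mul sG sz) (smooth_mul sG0 sz)); apply/eqP.
  apply: hL; first exact: smooth_sub (smooth_mul sG sz) (smooth_mul sG0 sz).
  move=> y yL; rewrite /K {1}/zoom subr0 bump1 ?mulr1 ?subrr //.
  by rewrite normrM normfV (gtr0_norm L0) ler_pdivrMr // mul1r ltW.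
rewrite e1 -(cdistZ c cP szz) -[X in _ = _ + X](mulKf (lt0r_neq0 s0)).
rewrite -mulrDr; congr (_ * _).
have sc := smooth_scale s (smooth_scale c szz).
rewrite -(cdistZ s cP (smooth_scale c szz)) -(cdistD cP (smooth_mul sG0 sz) sc).
congr P; apply/funext => y; rewrite /G0 /zoom; field; exact: lt0r_neq0.
Qed.

(** Near e only the tail of the zoomed profile is seen; it is [O(s^(- al))] with its derivatives,
    and [- al > 1] beats the division by s. *)
Lemma mulP_tail_far x phi al : x != e -> smooth phi -> al < -1 ->
  (forall N, exists2 C, 0 <= C & tdec al N C phi) -> forall r, 0 < r -> 4 * r <= `|x - e| ->
  s^-1 * mulP P e be (fun y => zoom e r bump y * zoom x s phi y) @[s --> 0^'+] --> 0.
Proof.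
move=> xe sp al1 hp r r0 rx.
have [_ [C [N [L [C0 L0 hC]]]]] := mulP_cdist e cP nP be0.
have [D D0 hD] := hp N; have [B B0 hB] := @bump_derivs R N.
pose K := Num.max 1 r^-1; have K1 : 1 <= K by rewrite le_max lexx.
have Kr : r^-1 <= K by rewrite le_max lexx orbT.
have K0 : 0 <= K by slra.
pose F := C * (2 ^+ N * (K ^+ N * B * (K ^+ N * (D * r `^ al)))).
have F0 : 0 <= F by rewrite !mulr_ge0 ?exprn_ge0 ?powR_ge0.
have r00 := ltW r0.
have main s : 0 < s -> s <= r ->
    `|mulP P e be (fun y => zoom e r bump y * zoom x s phi y)| <= F * s `^ (- al).
  move=> s0 sr; rewrite /F -!mulrA; apply: hC.
    exact: smooth_mul (smooth_zoom _ _ (@smooth_bump R)) (smooth_zoom _ _ sp).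
  move=> y _; have [yr|yr] := ltP (2 * r) `|y - e|.
    apply: (@derivs_leW _ N N 0) => //.
      by rewrite !mulr_ge0 ?exprn_ge0 ?powR_ge0.
    apply: (derivs_le0 (@open_far R e (2 * r))) => // z /= zr.
    by rewrite {1}/zoom bump0 ?mul0r // normrM normfV (gtr0_norm r0) ler_pdivlMr // ltW.
  have yx : r <= `|y - x|.
    have := ler_normB (y - e) (y - x).
    have -> : y - e - (y - x) = x - e by ring.
    by slra.
  have y0 : 0 < `|y - x| by slra.
  rewrite [K ^+ N * (B * _)]mulrA; apply: derivs_leM.
  - exact: smooth_zoom (@smooth_bump R).
  - exact: smooth_zoom.
  - exact: (derivs_le_zoom (@smooth_bump R) r0 Kr K1 (hB _)).
  have Ky : 1 <= K * `|y - x|.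
    rewrite -(mulVf (lt0r_neq0 r0)); apply: ler_pM => //.
    by rewrite invr_ge0.
  apply/wderivs1; apply: (wderivs_scale (ltW y0) ler01 Ky K1).
  set z := (y - x) / s; have zE : `|z| = `|y - x| / s by rewrite normrM normfV (gtr0_norm s0).
  have z1 : r / s <= `|z| by rewrite zE ler_pM2r ?invr_gt0.
  have rs1 : 1 <= r / s by rewrite ler_pdivlMr // mul1r.
  have rs0 : 0 < r / s by slra.
  have z2 : 1 <= `|z| by slra.
  have z0 : 0 < `|z| by slra.
  move=> m mN; rewrite /zoom (derive1n_scal m x s sp) normrM normrX normfV (gtr0_norm s0) -/z.
  rewrite [leLHS]mulrA -exprMn -zE; apply: le_trans (hD z z2 m mN) _.
  apply: ler_wpM2l => //.
  have -> : r `^ al * s `^ (- al) = (r / s) `^ al.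
    rewrite powRM ?invr_ge0 ?(ltW s0) //; congr (_ * _).
    by rewrite -powR_inv1 ?(ltW s0) // -powRrM mulN1r.
  have e1 : (r / s) `^ (- al) <= `|z| `^ (- al).
    by apply: ge0_ler_powR; rewrite ?nnegrE ?(ltW rs0) //; slra.
  by rewrite !powRN lef_pV2 ?posrE ?powR_gt0 in e1.
have eta0 : 0 < - al - 1 by slra.
apply/right0P => eps eps0; have [d d0 hd] := powR_small F0 eta0 eps0.
exists (Num.min d r); first by rewrite lt_min d0.
move=> s s0; rewrite lt_min => /andP[sd sr]; rewrite subr0 normrM normfV (gtr0_norm s0).
rewrite ler_pdivrMl //; apply: le_trans (main s s0 (ltW sr)) _.
have -> : - al = 1 + (- al - 1) by ring.
rewrite powRD ?(gt_eqF s0) ?implybT // powRr1; last exact: ltW.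
rewrite mulrCA; apply: ler_wpM2l; first exact: ltW.
exact: hd.
Qed.

Lemma mulP_tail x phi al : x != e -> smooth phi -> al < -1 ->
  (forall N, exists2 C, 0 <= C & tdec al N C phi) ->
  s^-1 * (mulP P e be (zoom x s phi) - pw e be x * P (zoom x s phi)) @[s --> 0^'+] --> 0.
Proof.
move=> xe sp al1 hp; have [r r0 rx] := far_radius xe.
have sW := smooth_pwcut (e := e) (be := be) r0.
have h1 := smooth_tail x sW sp al1 hp; have h2 := mulP_tail_far xe sp al1 hp r0 rx.
rewrite -[X in _ --> X](_ : 0 + 1 * 0 = 0); last by rewrite mulr0 addr0.
apply: (cvg_right_lin h1 h2) => s s0; have sz := smooth_zoom x s sp.
rewrite mul1r -mulrDr; congr (_ * _).
rewrite (mulP_split e cP nP be0 r0 sz) -(@pwcutE R e be r x r0); last slra.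
have sWx := smooth_scale (pwcut e be r x) sz.
rewrite -(cdistZ _ cP sz) addrAC; congr (_ + _).
rewrite -(cdistB cP (smooth_mul sW sz) sWx); congr P; apply/funext => y; ring.
Qed.

End MulPowerTail.

(** * Test functions and their primitives *)

Section Primitives.
Context {R : realType}.
Implicit Types (f g psi phi F G : R -> R) (x y z c d A B D K L s h r t : R) (m n N k j : nat).

Definition bsupp f : Prop := exists L, forall y, L < `|y| -> f y = 0.

Lemma test_functionP phi : test_function phi <-> smooth phi /\ bsupp phi.
Proof.
split => [[sp cs]|[sp [L hL]]]; split => //.
  have [L [_ hL]] := compact_bounded cs; exists (Num.max (L + 1) 0) => y yL.
  apply/eqP; apply: contraTT yL => py; rewrite -leNgt le_max; apply/orP; left.
  by apply: (hL (L + 1)); [rewrite ltrDl|exact: subset_closure].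
have cK : compact `[- `|L|, `|L|] := @segment_compact R _ _.
apply: (subclosed_compact _ cK); first exact: closed_closure.
have -> : `[- `|L|, `|L|]%classic = closure `[- `|L|, `|L|] :> set R.
  by apply/closure_id; exact: interval_closed.
apply: closureS => y /= py; rewrite in_itv /= -ler_norml leNgt; apply/negP => yL.
by move/eqP: py; apply; apply: hL; apply: le_lt_trans yL; exact: ler_norm.
Qed.

Lemma zero_derive_const F : smooth F -> (forall x, derive1 F x = 0) -> forall x y, F x = F y.
Proof.
move=> sF d0 x y; have [c _] := mean_value y (x - y) sF.
by rewrite d0 mulr0 [y + _]addrC subrK => /eqP; rewrite subr_eq0 => /eqP.
Qed.

Lemma const_right F L : smooth F -> (forall x, L < x -> derive1 F x = 0) ->
  forall x y, L < x -> L < y -> F x = F y.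
Proof.
move=> sF d0 x y Lx Ly; wlog xy : x y Lx Ly / x <= y.
  by move=> h; have [xy|/ltW yx] := leP x y; [exact: h|rewrite (h y x)].
rewrite le_eqVlt in xy; case/orP: xy => [/eqP -> //|xy].
have [c] := MVT xy (fun z _ => smooth_is_derive z sF) (continuous_subspaceT (smooth_continuous sF)).
rewrite in_itv /= => /andP[xc _]; rewrite d0; last exact: lt_trans xc.
by rewrite mul0r => /eqP; rewrite subr_eq0 => /eqP.
Qed.

Lemma const_left F L : smooth F -> (forall x, x < L -> derive1 F x = 0) ->
  forall x y, x < L -> y < L -> F x = F y.
Proof.
move=> sF d0 x y Lx Ly; wlog xy : x y Lx Ly / x <= y.
  by move=> h; have [xy|/ltW yx] := leP x y; [exact: h|rewrite (h y x)].
rewrite le_eqVlt in xy; case/orP: xy => [/eqP -> //|xy].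
have [c] := MVT xy (fun z _ => smooth_is_derive z sF) (continuous_subspaceT (smooth_continuous sF)).
rewrite in_itv /= => /andP[_ cy]; rewrite d0; last exact: lt_trans cy Ly.
by rewrite mul0r => /eqP; rewrite subr_eq0 => /eqP.
Qed.

Definition prim_spec phi F : Prop :=
  [/\ smooth F, forall x, derive1 F x = - phi x & exists L, forall y, L < y -> F y = 0].

(* prim phi y is the integral of phi over [y, +oo[. *)
Definition prim phi : R -> R := get (prim_spec phi).

Lemma prim_spec_ex phi : smooth phi -> bsupp phi -> exists F, prim_spec phi F.
Proof.
move=> sp [L0 hL0]; pose L := Num.max L0 0.
have hL y : L < `|y| -> phi y = 0.
  by move=> h; apply: hL0; apply: le_lt_trans h; rewrite le_max lexx.
have Lge : 0 <= L by rewrite le_max lexx orbT.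
have cphi := smooth_continuous sp.
pose F x := (\int[lebesgue_measure]_(t in `[(- L - 1)%R, x]) phi t)%R.
have F0 x : x < - L -> F x = 0.
  move=> xL; rewrite /F /Rintegral integral0_eq // => t /=; rewrite in_itv /= => /andP[_ tx].
  by rewrite hL // ltr0_norm; slra.
have dF x : is_derive x 1 F (phi x).
  have [xL|Lx] := ltP x (- L).
    have o : open [set z : R | z < - L] by exact: open_lt.
    rewrite hL; last by rewrite ltr0_norm; slra.
    by apply: (isd_local o xL (f := fun=> 0)) => z /= zL; rewrite F0.
  have xu : x < x + 1 by slra.
  have ax : - L - 1 < x by slra.
  have int : lebesgue_measure.-integrable `[(- L - 1)%R, (x + 1)%R] (EFin \o phi).
    apply: continuous_compact_integrable; first exact: segment_compact.
    exact: continuous_subspaceT.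
  have [d1 d2] := continuous_FTC1_closed xu int ax (cphi x).
  by rewrite -d2; exact: derivable_is_derive1.
have sF : smooth F := smooth_by_derive dF sp.
exists (fun y => F (L + 1) - F y); split.
- exact: smooth_sub (smooth_const _) sF.
- move=> x; apply: is_derive1E.
  by have := isdD (is_derive_cst (F (L + 1)) x 1) (isdN (dF x)); rewrite add0r.
exists L => y yL; rewrite (@const_right F L sF _ (L + 1) y) ?subrr //; last slra.
by move=> x Lx; rewrite (is_derive1E (dF x)) hL // gtr0_norm //; slra.
Qed.

Lemma primP phi : smooth phi -> bsupp phi -> prim_spec phi (prim phi).
Proof. by move=> sp bp; have [F hF] := prim_spec_ex sp bp; exact: (getI hF). Qed.

Lemma prim_uniq phi F : prim_spec phi F -> prim phi = F.
Proof.
move=> hF; have [s1 d1 [L1 h1]] := getI hF; have [s2 d2 [L2 h2]] := hF.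
apply/funext => y; apply/eqP; rewrite -subr_eq0; apply/eqP.
have sD := smooth_sub s1 s2; rewrite -/(prim phi) in s1 d1 h1 sD *.
pose M := Num.max L1 L2 + 1.
have ML1 : L1 < M by apply: (@le_lt_trans _ _ (Num.max L1 L2)); rewrite ?le_max ?lexx // ltrDl.
have ML2 : L2 < M by apply: (@le_lt_trans _ _ (Num.max L1 L2)); rewrite ?le_max ?lexx ?orbT // ltrDl.
rewrite (zero_derive_const sD _ y M) ?h1 ?h2 ?subrr // => x.
have -> : derive1 (fun y => prim phi y - F y) x = derive1 (prim phi) x - derive1 F x.
  by have := derive1nB 1 s1 s2; rewrite !derive1n1 => ->.
by rewrite d1 d2 subrr.
Qed.

Lemma prim_right phi F L : (forall y, L < `|y| -> phi y = 0) -> prim_spec phi F ->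
  forall y, 0 <= L -> L < y -> F y = 0.
Proof.
move=> hL [sF dF [L' h']] y L0 Ly.
rewrite (@const_right F L sF _ y (Num.max L L' + 1)) //.
- by rewrite h' //; apply: (@le_lt_trans _ _ (Num.max L L')); rewrite ?le_max ?lexx ?orbT // ltrDl.
- by move=> x Lx; rewrite dF hL ?oppr0 // gtr0_norm //; apply: le_lt_trans Lx.
- by apply: (@le_lt_trans _ _ (Num.max L L')); rewrite ?le_max ?lexx // ltrDl.
Qed.

Lemma prim_left phi F L : smooth phi -> 0 <= L -> (forall y, L < `|y| -> phi y = 0) -> prim_spec phi F ->
  forall y, y < - L -> F y = (\int[lebesgue_measure]_(t in setT) phi t)%R.
Proof.
move=> sp L0 hL pF y yL; have [sF dF _] := pF.
have F0 := prim_right hL pF L0.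
have L1 : - L - 1 < L + 1 by slra.
have e : (\int[lebesgue_measure]_(t in setT) phi t)%R =
    (\int[lebesgue_measure]_(t in `[(- L - 1)%R, (L + 1)%R]) phi t)%R.
  rewrite [RHS]Rintegral_mkcond; congr Rintegral; apply/funext => t; rewrite patchE.
  case: ifPn => //; rewrite notin_setE /= in_itv /= => h; apply: hL; rewrite ltNge; apply/negP => tL.
  by apply: h; move: tL; rewrite ler_norml => /andP[? ?]; apply/andP; split; slra.
rewrite e; pose G z := - F z; have sG : smooth G := smooth_opp sF.
have dG z : derive1 G z = phi z.
  by rewrite /G -derive1n1 (derive1nN 1 sF) derive1n1 dF opprK.
rewrite /Rintegral (@continuous_FTC2 _ phi G) //.
- have -> : G (L + 1) = 0 by rewrite /G F0 ?oppr0 //; slra.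
  rewrite /= /G sub0r opprK; apply: (@const_left F (- L) sF) => //; last slra.
  by move=> x xL; rewrite dF hL ?oppr0 // ltr0_norm //; slra.
- exact: continuous_subspaceT (smooth_continuous sp).
- have cG := smooth_continuous sG; split.
  + by move=> z _; exact: (sG 0%N).
  + exact: cvg_at_right_filter (cG _).
  + exact: cvg_at_left_filter (cG _).
Qed.

Lemma prim_add c phi psi : smooth phi -> bsupp phi -> smooth psi -> bsupp psi ->
  prim (fun y => c * phi y + psi y) = fun y => c * prim phi y + prim psi y.
Proof.
move=> s1 b1 s2 b2; have [S1 D1 [L1 H1]] := primP s1 b1; have [S2 D2 [L2 H2]] := primP s2 b2.
have sc := smooth_scale c S1.
apply: prim_uniq; split; first exact: smooth_add sc S2.
  move=> x; have := derive1nD 1 sc S2; rewrite !derive1n1 => ->.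
  by have := derive1nZ 1 c S1; rewrite !derive1n1 => ->; rewrite D1 D2; ring.
exists (Num.max L1 L2) => y; rewrite gt_max => /andP[y1 y2].
by rewrite H1 // H2 // mulr0 addr0.
Qed.

Lemma prim_derive1 phi : smooth phi -> bsupp phi -> prim (derive1 phi) = fun y => - phi y.
Proof.
move=> sp [L hL]; apply: prim_uniq; split; first exact: smooth_opp.
  by move=> x; have := derive1nN 1 sp; rewrite !derive1n1 => ->.
exists `|L| => y yL; rewrite hL ?oppr0 //.
exact: le_lt_trans (ler_norm L) (lt_le_trans yL (ler_norm y)).
Qed.

Lemma prim_zoom x s phi : 0 < s -> smooth phi -> bsupp phi ->
  prim (zoom x s phi) = fun y => s * zoom x s (prim phi) y.
Proof.
move=> s0 sp bp; have [sF dF [L hL]] := primP sp bp.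
apply: prim_uniq; split; first exact: smooth_scale (smooth_zoom x s sF).
  move=> y; have := derive1nZ 1 s (smooth_zoom x s sF); rewrite !derive1n1 => ->.
  have := derive1n_scal 1 x s sF; rewrite !derive1n1 /zoom => ->.
  by rewrite expr1 mulrA mulfV ?gt_eqF // mul1r dF.
exists (x + s * L) => y yL; rewrite /zoom hL ?mulr0 //.
by rewrite ltr_pdivlMr // mulrC; slra.
Qed.

Lemma bsupp_zoom x s phi : 0 < s -> bsupp phi -> bsupp (zoom x s phi).
Proof.
move=> s0 [L hL]; exists (`|x| + s * L) => y yL; apply: hL.
rewrite normrM normfV (gtr0_norm s0) ltr_pdivlMr // mulrC.
by have := ler_normB (y - x) (- x); rewrite opprK subrK normrN; slra.
Qed.

Lemma bsupp_derive1 phi : bsupp phi -> bsupp (derive1 phi).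
Proof.
move=> [L hL]; exists L => y yL.
have := @derive1n_local R _ phi (fun=> 0) 1 (@open_far0 R L) (fun z zL => hL z zL) y yL.
by rewrite derive1n1 => ->; rewrite derive1n_cst.
Qed.

Lemma bsupp_mul f phi : bsupp phi -> bsupp (fun y => f y * phi y).
Proof. by move=> [L hL]; exists L => y yL; rewrite hL // mulr0. Qed.

Lemma bsupp_lin c phi psi : bsupp phi -> bsupp psi -> bsupp (fun y => c * phi y + psi y).
Proof.
move=> [L hL] [L' hL']; exists (Num.max L L') => y; rewrite gt_max => /andP[y1 y2].
by rewrite hL // hL' // mulr0 addr0.
Qed.

End Primitives.

(** * Partitions of unity and the support of a distribution *)

Section Distributions.
Context {R : realType}.
Implicit Types (g u U : schwartz_distribution R) (P : (R -> R) -> R) (f psi phi chi F G : R -> R) (O : set R) (x y z c d a b A B D K L s h r t : R) (m n N k j : nat).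

Lemma tsupp_segment phi L : (forall y, L < `|y| -> phi y = 0) -> tsupp phi `<=` `[- `|L|, `|L|].
Proof.
move=> hL; have -> : `[- `|L|, `|L|]%classic = closure `[- `|L|, `|L|] :> set R.
  by apply/closure_id; exact: interval_closed.
apply: closureS => y /= py; rewrite in_itv /= -ler_norml leNgt; apply/negP => yL.
by move/eqP: py; apply; apply: hL; apply: le_lt_trans yL; exact: ler_norm.
Qed.

Lemma dist_bound g L : exists C N, 0 <= C /\ forall phi M, smooth phi ->
  (forall y, L < `|y| -> phi y = 0) -> (forall y, derivs_le N M phi y) -> `|g phi| <= C * M.
Proof.
have [C [N hC]] := dpair_continuous g (@segment_compact R (- `|L|) `|L|).
exists (`|C| * N.+1%:R), N; split; first exact: mulr_ge0.
move=> phi M sp hL hM; have tp : test_function phi by apply/test_functionP; split => //; exists L.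
apply: le_trans (hC phi tp (tsupp_segment hL)) _.
have hs m : (m <= N)%N -> 0 <= sup (range (fun x : R => `|derive1n m phi x|)) <= M.
  move=> mN; have ub : ubound (range (fun x : R => `|derive1n m phi x|)) M.
    by move=> _ [z _ <-]; exact: hM.
  apply/andP; split.
    apply: (@le_trans _ _ `|derive1n m phi 0|) => //.
    by apply: ub_le_sup; [exists M|exists 0].
  by apply: ge_sup => //; exists `|derive1n m phi 0|, 0.
rewrite -mulrA; apply: (@le_trans _ _ (`|C| * \sum_(m < N.+1) sup (range (fun x : R => `|derive1n m phi x|)))).
  apply: ler_wpM2r; last exact: ler_norm.
  by apply: sumr_ge0 => m _; have /andP[] := hs m (ltn_ord m).
apply: ler_wpM2l => //.
have -> : N.+1%:R * M = \sum_(m < N.+1) M by rewrite sumr_const card_ord mulr_natl.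
by apply: ler_sum => m _; have /andP[] := hs m (ltn_ord m).
Qed.

Lemma dist_lin g c phi psi : smooth phi -> bsupp phi -> smooth psi -> bsupp psi ->
  g (fun x => c * phi x + psi x) = c * g phi + g psi.
Proof. by move=> s1 b1 s2 b2; apply: dpair_linear; apply/test_functionP. Qed.

Lemma bsupp0 : bsupp (fun _ : R => 0). Proof. by exists 0. Qed.

Lemma dist0 g : g (fun=> 0) = 0.
Proof.
have s0 := @smooth_const R 0; have := dist_lin g 1 s0 bsupp0 s0 bsupp0.
have -> : (fun _ : R => 1 * 0 + 0) = (fun _ : R => 0 : R) by apply/funext => y; rewrite mulr0 addr0.
by rewrite mul1r => /eqP; rewrite -subr_eq subrr => /eqP.
Qed.

Lemma distB g phi psi : smooth phi -> bsupp phi -> smooth psi -> bsupp psi ->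
  g (fun x => phi x - psi x) = g phi - g psi.
Proof.
move=> s1 b1 s2 b2; have := dist_lin g (-1) s2 b2 s1 b1; rewrite mulN1r addrC => <-.
by congr (Defs.dpair g _); apply/funext => y; rewrite mulN1r addrC.
Qed.

Definition ramp (p q : R) y : R := step ((y - p) / (q - p)).

Lemma smooth_ramp p q : smooth (ramp p q).
Proof. exact: (smooth_zoom p (q - p) (@smooth_step R)). Qed.

Lemma ramp0 p q y : p < q -> y <= p -> ramp p q y = 0.
Proof. by move=> pq yp; rewrite /ramp step_le0 // ler_pdivrMr ?mul0r; slra. Qed.

Lemma ramp1 p q y : p < q -> q <= y -> ramp p q y = 1.
Proof. by move=> pq yp; rewrite /ramp step_ge1 // ler_pdivlMr ?mul1r; slra. Qed.

Lemma ramp_itv p q y : 0 <= ramp p q y <= 1.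
Proof. exact: step_itv. Qed.

(** [cousin] with a ramp across each overlap as partition of unity. T is left abstract because two
    properties are glued this way: vanishing of a distribution, and positivity of a functional. *)
Lemma local_gluing (T : (R -> R) -> Prop) (p q : R) : p < q ->
  (forall f F, smooth f -> smooth F -> (forall y, 0 <= F y <= 1) ->
     T (fun y => f y * (1 - F y)) -> T (fun y => f y * F y) -> T f) ->
  (forall x, p <= x <= q -> exists2 d, 0 < d & forall psi, smooth psi ->
     (forall y, d <= `|y - x| -> psi y = 0) -> T psi) ->
  forall psi, smooth psi -> (forall y, (y <= p) || (q <= y) -> psi y = 0) -> T psi.
Proof.
move=> pq Tadd Tloc.
pose Gl (u v : R) := forall psi, smooth psi -> (forall y, (y <= u) || (v <= y) -> psi y = 0) -> T psi.
apply: (@cousin R Gl p q pq).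
  move=> u v pu uv vq G1 G2 psi sp h0.
  set c1 := v - 2 / 3 * (v - u); set c2 := u + 2 / 3 * (v - u).
  have c12 : c1 < c2 by rewrite /c1 /c2; slra.
  have sr := @smooth_ramp c1 c2; have s1r := smooth_sub (smooth_const 1) sr.
  apply: (Tadd psi (ramp c1 c2) sp sr); first by move=> y; exact: ramp_itv.
    apply: G1; first exact: smooth_mul sp s1r.
    move=> y /orP[yu|yv]; first by rewrite h0 ?mul0r // yu.
    by rewrite ramp1 ?subrr ?mulr0.
  apply: G2; first exact: smooth_mul sp sr.
  move=> y /orP[yu|yv]; first by rewrite ramp0 ?mulr0.
  by rewrite h0 ?mul0r // yv orbT.
move=> x px; have [d d0 hd] := Tloc x px; exists d => // u v pu vq xu uv vx psi sp h0.
apply: hd => // y; rewrite ler_normr => /orP[|] yd; apply: h0; apply/orP; [right|left]; slra.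
Qed.

Lemma open_dist O x : open O -> O x -> exists2 d, 0 < d & forall y, `|y - x| < d -> O y.
Proof.
move=> oO Ox; have /nbhs_ballP[d /= d0 hd] := open_nbhs_nbhs (conj oO Ox).
by exists d => // y yd; apply: hd; rewrite -ball_normE /= distrC.
Qed.

(** The complement of the support is a union of open sets on which g vanishes separately; passing to
    the union requires a partition of unity. *)
Lemma dist_support g O phi : open O -> dsupp g `<=` O -> smooth phi -> bsupp phi ->
  (forall y, O y -> phi y = 0) -> g phi = 0.
Proof.
move=> oO gO sp [L0 hL0] h0; pose L := Num.max L0 0 + 1.
have hL y : L <= `|y| -> phi y = 0.
  by move=> h; apply: hL0; apply: lt_le_trans h; rewrite ltr_pwDr // le_max lexx.
have L1 : 1 <= L by rewrite lerDr le_max lexx orbT.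
pose T psi := g (fun y => psi y * phi y) = 0.
have bp : bsupp phi by exists L0.
pose chi : R -> R := zoom 0 L bump.
have schi : smooth chi := smooth_zoom 0 L (@smooth_bump R).
have LL : 0 < L by slra.
have -> : phi = (fun y => chi y * phi y).
  apply/funext => y; have [yL|yL] := leP `|y| L; last by rewrite hL ?mulr0 // ltW.
  rewrite /chi /zoom subr0 bump1 ?mul1r // normrM normfV (gtr0_norm LL) ler_pdivrMr // mul1r //.
apply: (@local_gluing T (- (2 * L)) (2 * L)) => //; last first.
- move=> y hy; rewrite /chi /zoom subr0 bump0 // normrM normfV (gtr0_norm LL) ler_pdivlMr //.
  by rewrite ler_normr; case/orP: hy => h; apply/orP; [right|left]; slra.
- move=> x _; have [gx|ngx] := pselect (dsupp g x).
    have [d d0 hd] := open_dist oO (gO x gx); exists d => // psi s0 p0; rewrite /T.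
    rewrite [X in g X](_ : _ = fun=> 0) ?dist0 //; apply/funext => y.
    by have [yd|yd] := ltP `|y - x| d; [rewrite h0 ?mulr0 //; exact: hd|rewrite p0 ?mul0r].
  have [V [oV vV] Vx] : exists2 V, open V /\ dvanishes_on g V & V x.
    by apply: contrapT => no; apply: ngx => -[V [? ?] ?]; apply: no; exists V.
  have [d d0 hd] := open_dist oV Vx; exists (d / 2); first by rewrite divr_gt0.
  move=> psi s0 p0; have sm := smooth_mul s0 sp.
  apply: vV; first by apply/test_functionP; split => //; exact: bsupp_mul.
  have cl : closed [set y : R | `|y - x| <= d / 2].
    have -> : [set y : R | `|y - x| <= d / 2] = ~` [set y : R | d / 2 < `|y - x|].
      by apply/seteqP; split => y /=; [move=> ? ; apply/negP; rewrite -leNgt|move/negP; rewrite -leNgt].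
    exact/open_closedC/open_far.
  have sub : tsupp (fun y => psi y * phi y) `<=` [set y : R | `|y - x| <= d / 2].
    rewrite [X in _ `<=` X]((closure_id _).1 cl); apply: closureS => y /= py.
    by rewrite leNgt; apply/negP => yd; move/eqP: py; apply; rewrite p0 ?mul0r // ltW.
  by move=> y /sub /= yd; apply: hd; apply: le_lt_trans yd _; slra.
- move=> f r sf sr _ Tf Th; rewrite /T.
  have s1r := smooth_sub (smooth_const 1) sr.
  have -> : (fun y => f y * phi y) = (fun y => 1 * (f y * (1 - r y) * phi y) + f y * r y * phi y).
    by apply/funext => y; ring.
  have s1 := smooth_mul (smooth_mul sf s1r) sp; have s2 := smooth_mul (smooth_mul sf sr) sp.
  rewrite (dist_lin g 1 s1 (bsupp_mul _ bp) s2 (bsupp_mul _ bp)).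
  by rewrite Tf Th mulr0 addr0.
- by slra.
Qed.

End Distributions.

(** * From pairs (u, U) to functionals on smooth functions *)

Section GoodFunctionals.
Context {R : realType}.
Implicit Types (g u U : schwartz_distribution R) (P : (R -> R) -> R) (f psi phi chi F G : R -> R) (O : set R) (x y z c d a b A B D K L s h r t ga : R) (m n N k j : nat).

(* The compactly supported u whose primitive U is a Lojasiewicz distribution, seen as functionals. *)
Definition good P a b : Prop :=
  [/\ cdist P, suppin P a b, forall x, null_at P x & forall x, exists ga, has_lim P x ga].

Lemma open_around a b d : open [set y : R | (a - d < y) /\ (y < b + d)].
Proof. by apply: openI; [exact: open_gt|exact: open_lt]. Qed.

Lemma around_sub a b d : 0 < d -> `[a, b] `<=` [set y : R | (a - d < y) /\ (y < b + d)].
Proof. by move=> d0 y /=; rewrite in_itv /= => /andP[? ?]; split; slra. Qed.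

Definition cutoff a b : R -> R := zoom 0 (`|a| + `|b| + 1) bump.

Lemma smooth_cutoff a b : smooth (cutoff a b).
Proof. exact: (smooth_zoom 0 _ (@smooth_bump R)). Qed.

Lemma cutoff_gt0 a b : 0 < `|a| + `|b| + 1 :> R.
Proof. by rewrite ltr_wpDl // addr_ge0. Qed.

Lemma cutoff0 a b y : 2 * (`|a| + `|b| + 1) <= `|y| -> cutoff a b y = 0.
Proof.
move=> h; rewrite /cutoff /zoom subr0 bump0 // normrM normfV (gtr0_norm (cutoff_gt0 a b)).
by rewrite ler_pdivlMr ?cutoff_gt0.
Qed.

Lemma cutoff1 a b y : a - 1 < y -> y < b + 1 -> cutoff a b y = 1.
Proof.
move=> h1 h2; rewrite /cutoff /zoom subr0 bump1 // normrM normfV (gtr0_norm (cutoff_gt0 a b)).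
rewrite ler_pdivrMr ?cutoff_gt0 // mul1r ler_norml.
have := ler_norm (- a); have := ler_norm b; rewrite normrN; have := normr_ge0 a; have := normr_ge0 b.
by move=> *; apply/andP; split; slra.
Qed.

Lemma bsupp_cutoff a b : bsupp (cutoff a b).
Proof. by exists (2 * (`|a| + `|b| + 1)) => y /ltW; exact: cutoff0. Qed.

Lemma bsuppM f psi : bsupp f -> bsupp (fun y => f y * psi y).
Proof. by move=> [L hL]; exists L => y yL; rewrite hL // mul0r. Qed.

Section Pairing.
Variables (g : schwartz_distribution R) (a b : R).
Hypothesis hs : supported_in a b g.

Lemma dist_eq phi psi d : smooth phi -> bsupp phi -> smooth psi -> bsupp psi -> 0 < d ->
  (forall y, a - d < y -> y < b + d -> phi y = psi y) -> g phi = g psi.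
Proof.
move=> s1 b1 s2 b2 d0 h; apply/eqP; rewrite -subr_eq0 -distB //; apply/eqP.
apply: (dist_support (@open_around a b d)).
- exact: subset_trans hs (around_sub d0).
- exact: smooth_sub.
- have [L hL] := bsupp_lin (-1) b2 b1; exists L => y /hL; rewrite mulN1r addrC => ->//.
- by move=> y [y1 y2]; rewrite h // subrr.
Qed.

Lemma epairE chi psi d : smooth chi -> bsupp chi -> smooth psi -> 0 < d ->
  (forall y, a - d < y -> y < b + d -> chi y = 1) -> epair g psi = g (fun y => chi y * psi y).
Proof.
move=> sc bc sp d0 h1.
have hv : [set v : R | forall chi : R -> R, test_function chi ->
    (exists O : set R, [/\ open O, dsupp g `<=` O & forall x, O x -> chi x = 1]) ->
    g (fun x => chi x * psi x) = v] (g (fun y => chi y * psi y)).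
  move=> chi' /test_functionP[sc' bc'] [V [oO gO h1']].
  have s1 := smooth_mul sc' sp; have s2 := smooth_mul sc sp.
  have b1 := bsuppM psi bc'; have b2 := bsuppM psi bc.
  apply/eqP; rewrite -subr_eq0 -distB //; apply/eqP.
  apply: (dist_support (openI oO (@open_around a b d))).
  - by move=> y gy; split; [exact: gO|exact: around_sub d0 _ (hs gy)].
  - exact: smooth_sub.
  - have [L hL] := bsupp_lin (-1) b2 b1; exists L => y /hL; rewrite mulN1r addrC => ->//.
  - by move=> y [Oy [y1 y2]]; rewrite h1' // h1 // subrr.
have h := getI hv; rewrite -/(epair g psi) in h; apply/esym/h; first exact/test_functionP.
exists [set y : R | (a - d < y) /\ (y < b + d)]; split; first exact: open_around.
  exact: subset_trans hs (around_sub d0).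
by move=> y []; exact: h1.
Qed.

Lemma epair_cutoff psi : smooth psi -> epair g psi = g (fun y => cutoff a b y * psi y).
Proof.
by move=> sp; apply: (epairE (@smooth_cutoff a b) (@bsupp_cutoff a b) sp ltr01); exact: cutoff1.
Qed.

Lemma epair_test psi : smooth psi -> bsupp psi -> epair g psi = g psi.
Proof.
move=> sp bp; rewrite epair_cutoff //; apply: (dist_eq (d := 1) _ _ sp bp ltr01).
- exact: smooth_mul (@smooth_cutoff a b) sp.
- exact: bsupp_mul.
- by move=> y y1 y2; rewrite cutoff1 ?mul1r.
Qed.

Lemma epair_cdist : cdist (epair g).
Proof.
have sc := @smooth_cutoff a b.
split.
  move=> c f h sf sh; have sl := smooth_add (smooth_scale c sf) sh.
  rewrite !epair_cutoff // -dist_lin.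
  - by congr (Defs.dpair g _); apply/funext => y; ring.
  - exact: smooth_mul sc sf.
  - exact: bsuppM (@bsupp_cutoff a b).
  - exact: smooth_mul sc sh.
  - exact: bsuppM (@bsupp_cutoff a b).
pose L := 2 * (`|a| + `|b| + 1).
have L0 : 0 < L by rewrite mulr_gt0 ?cutoff_gt0.
have [C [N [C0 hC]]] := dist_bound g L.
have [B B0 hB] := @smooth_bounded R (cutoff a b) N (L + 1) sc.
exists (C * (2 ^+ N * B)), N, (L + 1); split; rewrite ?mulr_ge0 ?exprn_ge0 //; first by slra.
move=> f M sf hM; rewrite epair_cutoff //.
have M0 : 0 <= M by apply: (derivs_le_ge0 (hM 0 _)); rewrite normr0; slra.
have -> : C * (2 ^+ N * B) * M = C * (2 ^+ N * (B * M)) by ring.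
apply: hC; first exact: smooth_mul sc sf.
  by move=> y yL; rewrite cutoff0 ?mul0r // ltW.
move=> y; have [yL|yL] := leP `|y| (L + 1).
  by apply: derivs_leM => //; [exact: hB|exact: hM].
apply: (@derivs_leW _ N N 0) => //; first by rewrite !mulr_ge0 ?exprn_ge0.
apply: (derivs_le0 (@open_far0 R L)) => [z /= zL|/=]; last slra.
by rewrite cutoff0 ?mul0r // ltW.
Qed.

Lemma epair_suppin : suppin (epair g) a b.
Proof.
move=> f d sf d0 f0; rewrite epair_cutoff //.
apply: (dist_support (@open_around a b d)).
- exact: subset_trans hs (around_sub d0).
- exact: smooth_mul (@smooth_cutoff a b) sf.
- exact: bsuppM (@bsupp_cutoff a b).
- by move=> y [y1 y2]; rewrite f0 ?mulr0.
Qed.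

End Pairing.

Lemma dnbhs0P (v : R -> R) (l : R) : (v s @[s --> 0^']) --> l <->
  (forall e, 0 < e -> exists2 d, 0 < d & forall s, s != 0 -> `|s| < d -> `|v s - l| <= e).
Proof.
split => [/cvgrPdist_le h e /h|h].
  rewrite near_withinE => -[d /= d0 hd]; exists d => // s s0 sd.
  by rewrite distrC; apply: hd => //=; rewrite sub0r normrN.
apply/cvgrPdist_le => e /h[d d0 hd]; rewrite near_withinE; exists d => //= s.
by rewrite /ball_ /= sub0r normrN => sd s0; rewrite distrC; apply: hd.
Qed.

Lemma point_value_right U x ga phi : has_point_value U x ga -> smooth phi -> bsupp phi ->
  s^-1 * U (zoom x s phi) @[s --> 0^'+] --> ga * (\int[lebesgue_measure]_(y in setT) phi y)%R.
Proof.
move=> hU sp bp; have := hU phi (iffRL (test_functionP phi) (conj sp bp)).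
move=> /dnbhs0P h; apply/right0P => e /h[d d0 hd]; exists d => // s s0 sd.
by have := hd s (lt0r_neq0 s0); rewrite /dilate (gtr0_norm s0) => /(_ sd).
Qed.

Lemma derive1_zoom x s f : smooth f -> derive1 (zoom x s f) = fun y => s^-1 * zoom x s (derive1 f) y.
Proof.
move=> sf; apply/funext => y; have := derive1n_scal 1 x s sf; rewrite !derive1n1 /zoom => ->.
by rewrite expr1.
Qed.

Lemma dist_scale g c phi : smooth phi -> bsupp phi -> g (fun y => c * phi y) = c * g phi.
Proof.
move=> sp bp; have := dist_lin g c sp bp (@smooth_const R 0) bsupp0; rewrite dist0 addr0 => <-.
by congr (Defs.dpair g _); apply/funext => y; rewrite addr0.
Qed.

Section Pair.
Variables (u U : schwartz_distribution R) (a b : R).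
Hypotheses (hs : supported_in a b u) (hU : Lojasiewicz U) (hd : is_dderiv U u)
  (ha : has_point_value U a 0).

Let P := epair u.

Lemma pair_derive phi : smooth phi -> bsupp phi -> U (derive1 phi) = - P phi.
Proof.
move=> sp bp; rewrite /P (epair_test hs sp bp) hd ?opprK //; exact/test_functionP.
Qed.

Lemma pair_null x : null_at P x.
Proof.
apply: null_atP => f sf f1; have [ga hga] := hU x.
have bf : bsupp f by exists 1.
have sd := smooth_derive1 sf; have bd := bsupp_derive1 bf.
have := point_value_right hga sd bd.
have -> : (\int[lebesgue_measure]_(y in setT) (derive1 f) y)%R = 0.
  have f1' y : 1 < `|y| -> derive1 f y = 0.
    move=> y1; have := @derive1n_local R _ f (fun=> 0) 1 (@open_far0 R 1) (fun z zL => f1 z zL) y y1.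
    by rewrite derive1n1 => ->; rewrite derive1n_cst.
  rewrite -(@prim_left R (derive1 f) _ 1 sd ler01 f1' (primP sd bd) (-2)); last slra.
  by rewrite prim_derive1 // f1 ?oppr0 // normrN ger0_norm; slra.
rewrite mulr0 => h; rewrite -[X in _ --> X](_ : 0 + -1 * 0 = 0); last by rewrite mulr0 addr0.
apply: (cvg_right_lin (cvg_cst 0) h) => s s0.
have sz := smooth_zoom x s sf; have bz := bsupp_zoom x s0 bf.
have e := pair_derive sz bz; rewrite (derive1_zoom x s sf) in e.
rewrite dist_scale in e; [|exact: smooth_zoom|exact: bsupp_zoom].
by rewrite add0r mulN1r e opprK.
Qed.

(** U is constant to the left of a because its derivative is supported in [a, b]; in terms of test
    functions, U does not distinguish those with the same integral. *)
Lemma pair_left F G d L c : 0 < d -> smooth F -> smooth G ->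
  (forall y, y < - L -> F y = c) -> (forall y, y < - L -> G y = c) ->
  (forall y, a - d < y -> F y = 0) -> (forall y, a - d < y -> G y = 0) ->
  U (derive1 F) = U (derive1 G).
Proof.
move=> d0 sF sG FL GL F0 G0.
have bd H : (forall y, y < - L -> H y = c) -> (forall y, a - d < y -> H y = 0) -> bsupp (derive1 H).
  move=> HL H0; exists (`|L| + `|a - d|) => y yL.
  have := ler_norm L; have := ler_norm (a - d); have := normr_ge0 L; have := normr_ge0 (a - d) => n1 n2 n3 n4.
  have [y0|y0] := leP 0 y.
    have o : open [set z : R | a - d < z] by exact: open_gt.
    have oy : [set z : R | a - d < z] y by move: yL => /=; rewrite [`|y|]ger0_norm //; slra.
    have := @derive1n_local R _ H (fun=> 0) 1 o H0 y oy.
    by rewrite derive1n1 => ->; rewrite derive1n_cst.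
  have o : open [set z : R | z < - L] by exact: open_lt.
  have oy : [set z : R | z < - L] y by move: yL => /=; rewrite [`|y|]ltr0_norm //; slra.
  have := @derive1n_local R _ H (fun=> c) 1 o HL y oy.
  by rewrite derive1n1 => ->; rewrite derive1n_cst.
have sB := smooth_sub sF sG.
have bB : bsupp (fun y => F y - G y).
  exists (`|L| + `|a - d|) => y yL.
  have := ler_norm L; have := ler_norm (a - d); have := normr_ge0 L; have := normr_ge0 (a - d) => n1 n2 n3 n4.
  have [y0|y0] := leP 0 y.
    by rewrite F0 ?G0 ?subrr //; move: yL; rewrite [`|y|]ger0_norm //; slra.
  by rewrite FL ?GL ?subrr //; move: yL; rewrite [`|y|]ltr0_norm //; slra.
have e := pair_derive sB bB.
have P0 : P (fun y => F y - G y) = 0.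
  by apply: (epair_suppin hs sB d0) => y y1 _; rewrite F0 // G0 // subrr.
rewrite P0 oppr0 in e; apply/eqP; rewrite -subr_eq0 -distB.
- apply/eqP; rewrite -e; congr (Defs.dpair U _); apply/funext => y.
  by have := derive1nB 1 sF sG; rewrite !derive1n1 => ->.
- exact: smooth_derive1.
- exact: bd.
- exact: smooth_derive1.
- exact: bd.
Qed.

(** The constant value of U left of a is 0 since [U(a) = 0]: the test function can be replaced by
    one concentrated just left of a at any scale s, where the point value at a is computed. *)
Lemma pair_left0 F L c : smooth F -> (forall y, y < - L -> F y = c) ->
  (forall y, a - 1 < y -> F y = 0) -> U (derive1 F) = 0.
Proof.
move=> sF FL F0.
pose h y := c * hstep (y + 1).
have sh : smooth h.
  have -> : h = (fun y => c * hstep (1 * y + 1)) by apply/funext => y; rewrite mul1r.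
  exact: (smooth_scale c (@smooth_affine R _ 1 1 (@smooth_hstep R))).
have h0 y : -1 <= y -> h y = 0 by move=> y1; rewrite /h hstep0 ?mulr0 //; slra.
have hc y : y <= -2 -> h y = c by move=> y1; rewrite /h hstep1 ?mulr1 //; slra.
have dh := smooth_derive1 sh.
have bh : bsupp (derive1 h).
  exists 2 => y; rewrite ltr_normr => /orP[|] y2.
    have o : open [set z : R | -1 < z] by exact: open_gt.
    have oy : [set z : R | -1 < z] y by move=> /=; slra.
    have := @derive1n_local R _ h (fun=> 0) 1 o (fun z zz => h0 z (ltW zz)) y oy.
    by rewrite derive1n1 => ->; rewrite derive1n_cst.
  have o : open [set z : R | z < -2] by exact: open_lt.
  have oy : [set z : R | z < -2] y by move=> /=; slra.
  have := @derive1n_local R _ h (fun=> c) 1 o (fun z zz => hc z (ltW zz)) y oy.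
  by rewrite derive1n1 => ->; rewrite derive1n_cst.
have := point_value_right ha dh bh; rewrite mul0r => /right0P cv.
apply/eqP; rewrite -normr_le0; apply/ler_addgt0Pr => e e0.
have [d d0 hdd] := cv e e0; pose s := Num.min (d / 2) 1.
have s0 : 0 < s by rewrite lt_min ltr01 divr_gt0.
have sd : s < d by rewrite gt_min; apply/orP; left; slra.
have s1 : s <= 1 by rewrite ge_min lexx orbT.
have := hdd s s0 sd; rewrite subr0 add0r.
suff -> : U (derive1 F) = s^-1 * U (zoom a s (derive1 h)) by [].
rewrite -dist_scale; [|exact: smooth_zoom|exact: bsupp_zoom].
rewrite -(derive1_zoom a s sh).
pose L' := Num.max L (- (a - 2)).
have LL : L <= L' by rewrite le_max lexx.
have La : - (a - 2) <= L' by rewrite le_max lexx orbT.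
apply: (@pair_left F (zoom a s h) s L' c s0 sF (smooth_zoom a s sh)).
- by move=> y yL; apply: FL; slra.
- move=> y yL; apply: hc; rewrite ler_pdivrMr //.
  slra.
- by move=> y ys; apply: F0; slra.
- by move=> y ys; apply: h0; rewrite ler_pdivlMr //; slra.
Qed.

(** The primitive of phi is compared with a step [F1] that has the same limit at -oo and vanishes
    right of [a - 1]. Their difference has bounded support, so [pair_derive] applies to it, while U
    kills the derivative of [F1] and P kills [F1]. *)
Lemma pair_prim phi : smooth phi -> bsupp phi -> U phi = P (prim phi).
Proof.
move=> sp bp; have [sF dF _] := primP sp bp; have [L0 hL0] := bp.
pose L := Num.max L0 0; have L0' : 0 <= L by rewrite le_max lexx orbT.
have hL y : L < `|y| -> phi y = 0.
  by move=> h; apply: hL0; apply: le_lt_trans h; rewrite le_max lexx.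
have Fr := prim_right hL (primP sp bp) L0'; have Fl := prim_left sp L0' hL (primP sp bp).
set c := (\int[lebesgue_measure]_(y in setT) phi y)%R in Fl.
pose F1 y := c * hstep (y - (a - 1)).
have s1 : smooth F1.
  have -> : F1 = (fun y => c * hstep (1 * y + - (a - 1))) by apply/funext => y; rewrite mul1r.
  exact: (smooth_scale c (@smooth_affine R _ 1 _ (@smooth_hstep R))).
have F10 y : a - 1 <= y -> F1 y = 0 by move=> y1; rewrite /F1 hstep0 ?mulr0 //; slra.
have F1c y : y <= a - 2 -> F1 y = c by move=> y1; rewrite /F1 hstep1 ?mulr1 //; slra.
have sD := smooth_sub s1 sF.
have na := normr_ge0 a.
have bD : bsupp (fun y => F1 y - prim phi y).
  exists (L + `|a| + 2) => y; rewrite ltr_normr => /orP[|] yL.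
    by rewrite F10 ?Fr ?subrr //; have := ler_norm a; slra.
  by rewrite F1c ?Fl ?subrr //; have := ler_norm (- a); rewrite normrN; slra.
have e := pair_derive sD bD.
have U1 : U (derive1 F1) = 0.
  apply: (@pair_left0 F1 (`|a| + 2) c s1) => y y1; last by rewrite F10 // ltW.
  by rewrite F1c //; have := ler_norm (- a); rewrite normrN; slra.
have P1 : P F1 = 0.
  by apply: (epair_suppin hs s1 ltr01) => y y1 _; rewrite F10 // ltW.
have dD y : derive1 (fun y => F1 y - prim phi y) y = derive1 F1 y + phi y.
  by have := derive1nB 1 s1 sF; rewrite !derive1n1 => ->; rewrite dF opprK.
have -> : phi = (fun y => derive1 (fun y => F1 y - prim phi y) y - derive1 F1 y).
  by apply/funext => y; rewrite dD addrC addKr.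
have b1 : bsupp (derive1 F1).
  have [M hM] := bsupp_derive1 bD; exists (Num.max M L) => y; rewrite gt_max => /andP[y1 y2].
  by have := hM y y1; rewrite dD hL // addr0.
rewrite distB; [|exact: smooth_derive1|exact: bsupp_derive1|exact: smooth_derive1|exact: b1].
rewrite U1 subr0 e; rewrite /P (cdistB (epair_cdist hs) s1 sF) -/P P1 sub0r opprK.
congr (P (prim _)); apply/funext => y.
by rewrite dD addrC addKr.
Qed.

Lemma pair_has_lim x ga : has_point_value U x ga -> has_lim P x ga.
Proof.
move=> hga f c L0 sf fl fr; pose L := Num.max L0 0.
have L0' : 0 <= L by rewrite le_max lexx orbT.
have LL : L0 <= L by rewrite le_max lexx.
pose phi y := - derive1 f y.
have sp : smooth phi := smooth_opp (smooth_derive1 sf).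
have hL y : L < `|y| -> phi y = 0.
  move=> yL; rewrite /phi; suff -> : derive1 f y = 0 by rewrite oppr0.
  move: yL; rewrite ltr_normr => /orP[|] yL.
    have o : open [set z : R | L0 < z] by exact: open_gt.
    have oy : [set z : R | L0 < z] y by move=> /=; slra.
    have := @derive1n_local R _ f (fun=> 0) 1 o fr y oy.
    by rewrite derive1n1 => ->; rewrite derive1n_cst.
  have o : open [set z : R | z < - L0] by exact: open_lt.
  have oy : [set z : R | z < - L0] y by move=> /=; slra.
  have := @derive1n_local R _ f (fun=> c) 1 o fl y oy.
  by rewrite derive1n1 => ->; rewrite derive1n_cst.
have bp : bsupp phi by exists L.
have pf : prim_spec phi f by split => //; [by move=> y; rewrite opprK|exists L0].
have ec : (\int[lebesgue_measure]_(y in setT) phi y)%R = c.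
  by rewrite -(prim_left sp L0' hL pf (y := - L - 1)) ?fl //; slra.
have := point_value_right hga sp bp; rewrite ec => /right0P h.
apply/right0P => e /h[d d0 hdd]; exists d => // s s0 sd.
have := hdd s s0 sd; rewrite pair_prim; [|exact: smooth_zoom|exact: bsupp_zoom].
rewrite prim_zoom // (prim_uniq pf) /P (cdistZ _ (epair_cdist hs)); last exact: smooth_zoom.
by rewrite mulKf ?gt_eqF.
Qed.

Lemma pair_good : good P a b.
Proof.
split; [exact: epair_cdist hs|exact: epair_suppin hs|exact: pair_null|].
by move=> x; have [ga hga] := hU x; exists ga; exact: pair_has_lim.
Qed.

End Pair.

Lemma right0_unique (v : R -> R) (l l' : R) : v s @[s --> 0^'+] --> l -> v s @[s --> 0^'+] --> l' -> l = l'.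
Proof.
move=> /right0P h /right0P h'; apply/eqP; rewrite -subr_eq0 -normr_le0; apply/ler_addgt0Pr => e e0.
have e2 : 0 < e / 2 by slra.
have [d d0 hd] := h _ e2; have [d' d'0 hd'] := h' _ e2; pose s := Num.min d d' / 2.
have m0 : 0 < Num.min d d' by rewrite lt_min d0.
have s0 : 0 < s by rewrite /s; slra.
have : Num.min d d' <= d by rewrite ge_min lexx.
have : Num.min d d' <= d' by rewrite ge_min lexx orbT.
move=> m1 m2; have sd : s < d by rewrite /s; slra.
have sd' : s < d' by rewrite /s; slra.
have := hd s s0 sd; have := hd' s s0 sd'; rewrite add0r !ler_norml => /andP[? ?] /andP[? ?].
by apply/andP; split; slra.
Qed.

Lemma good_value_right P a b ga : good P a b -> has_lim P b ga -> ga = P (fun=> 1).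
Proof.
(* Shifted so that the zoomed step is 1 up to [b + s]; on functionals supported in [a, b] it cannot
   be told from the constant 1. *)
move=> [cP sP _ _] h; pose f y : R := hstep (y - 2).
have sf : smooth f.
  have -> : f = (fun y => hstep (1 * y + - 2)) by apply/funext => y; rewrite mul1r.
  exact: (@smooth_affine R _ 1 _ (@smooth_hstep R)).
have f1 y : y <= 1 -> f y = 1 by move=> y1; rewrite /f hstep1 //; slra.
have f0 y : 2 <= y -> f y = 0 by move=> y1; rewrite /f hstep0 //; slra.
have := h f 1 2 sf (fun y yy => f1 y (ltac:(slra))) (fun y yy => f0 y (ltW yy)).
rewrite mulr1 => cv; apply: right0_unique cv _.
apply/right0P => e e0; exists 1 => // s s0 s1; rewrite -(cdistB cP (smooth_zoom b s sf) (smooth_const 1)).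
rewrite (sP _ s (smooth_sub (smooth_zoom b s sf) (smooth_const 1)) s0) ?normr0; first exact: ltW.
by move=> y _ y2; rewrite /zoom f1 ?subrr // ler_pdivrMr // mul1r; slra.
Qed.

Lemma good_value_left P a b ga : good P a b -> has_lim P a ga -> ga = 0.
Proof.
move=> [cP sP _ _] h; pose f y : R := hstep (y + 1).
have sf : smooth f.
  have -> : f = (fun y => hstep (1 * y + 1)) by apply/funext => y; rewrite mul1r.
  exact: (@smooth_affine R _ 1 _ (@smooth_hstep R)).
have f1 y : y <= -2 -> f y = 1 by move=> y1; rewrite /f hstep1 //; slra.
have f0 y : -1 <= y -> f y = 0 by move=> y1; rewrite /f hstep0 //; slra.
have := h f 1 2 sf (fun y yy => f1 y (ltW yy)) (fun y yy => f0 y (ltac:(slra))).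
rewrite mulr1 => cv; apply: right0_unique cv _.
apply/right0P => e e0; exists 1 => // s s0 s1; rewrite subr0.
rewrite (sP _ s (smooth_zoom a s sf) s0) ?normr0; first exact: ltW.
by move=> y y2 _; rewrite /zoom f0 // ler_pdivlMr //; slra.
Qed.

End GoodFunctionals.

(** * From functionals back to distributions *)

Section Realization.
Context {R : realType}.
Implicit Types (g u U v V : schwartz_distribution R) (P Q : (R -> R) -> R) (psi phi chi F G : R -> R) (O : set R) (x y z c d a b A B D K L s h r t ga : R) (m n N k j : nat).

Lemma test_derivs_le N phi : smooth phi -> bsupp phi ->
  forall y, derivs_le N (\sum_(m < N.+1) sup (range (fun x : R => `|derive1n m phi x|))) phi y.
Proof.
move=> sp [L hL] y.
have hm m : has_ubound (range (fun x : R => `|derive1n m phi x|)).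
  have [B B0 hB] := @smooth_bounded R phi m (`|L| + 1) sp.
  exists B => _ [z _ <-]; have [zL|zL] := leP `|z| (`|L| + 1); first exact: (hB z zL m (leqnn m)).
  have o : [set z : R | `|L| < `|z|] z by move=> /=; slra.
  rewrite (@derive1n_local R _ phi (fun=> 0) m (@open_far0 R `|L|) _ z o).
    by rewrite derive1n_cst; case: m {hB}; rewrite normr0.
  by move=> w /= wL; apply: hL; apply: le_lt_trans wL; exact: ler_norm.
have h0 m : 0 <= sup (range (fun x : R => `|derive1n m phi x|)).
  apply: (@le_trans _ _ `|derive1n m phi 0|) => //.
  by apply: ub_le_sup; [exact: hm|exists 0].
move=> m mN; apply: (@le_trans _ _ (sup (range (fun x : R => `|derive1n m phi x|)))).
  by apply: ub_le_sup; [exact: hm|exists y].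
have mN' : (m < N.+1)%N by [].
rewrite (bigD1 (Ordinal mN')) //= lerDl; apply: sumr_ge0 => k _; exact: h0.
Qed.

Lemma functional_dist Q : cdist Q -> exists v, forall phi, v phi = Q phi.
Proof.
move=> cQ.
have lin c phi psi : test_function phi -> test_function psi ->
    Q (fun x => c * phi x + psi x) = c * Q phi + Q psi.
  by move=> /test_functionP[s1 _] /test_functionP[s2 _]; exact: cQ.1.
have cont (K : set R) : compact K -> exists (C : R) (N : nat), forall phi : R -> R,
      test_function phi -> tsupp phi `<=` K ->
      `|Q phi| <= C * \sum_(m < N.+1) sup (range (fun x : R => `|derive1n m phi x|)).
  have [_ [C [N [L [C0 L0 h]]]]] := cQ.
  move=> _; exists C, N => phi /test_functionP[sp bp] _.
  by apply: h => // y _; exact: test_derivs_le.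
by exists (SchwartzDistribution lin cont).
Qed.

Lemma prim_dist Q : cdist Q -> exists V, forall phi, V phi = Q (prim phi).
Proof.
move=> cQ.
have lin c phi psi : test_function phi -> test_function psi ->
    Q (prim (fun x => c * phi x + psi x)) = c * Q (prim phi) + Q (prim psi).
  move=> /test_functionP[s1 b1] /test_functionP[s2 b2]; rewrite prim_add //.
  have [? _ _] := primP s1 b1; have [? _ _] := primP s2 b2; exact: cQ.1.
have cont (K : set R) : compact K -> exists (C : R) (N : nat), forall phi : R -> R,
      test_function phi -> tsupp phi `<=` K ->
      `|Q (prim phi)| <= C * \sum_(m < N.+1) sup (range (fun x : R => `|derive1n m phi x|)).
  have [_ [C [N [L [C0 L0 h]]]]] := cQ.
  move=> cK; have [B0 [_ hB0]] := compact_bounded cK.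
  pose B := Num.max (B0 + 1) 0; have B1 : 0 <= B by rewrite le_max lexx orbT.
  exists (C * (L + B + 2)), N => phi /test_functionP[sp bp] tK.
  have pB y : B < `|y| -> phi y = 0.
    move=> yB; apply/eqP; apply: contraTT yB => py; rewrite -leNgt le_max; apply/orP; left.
    by apply: (hB0 (B0 + 1)); [rewrite ltrDl|apply: tK; exact: subset_closure].
  have hS := @test_derivs_le N _ sp bp; set S := \sum_(m < N.+1) _ in hS *.
  have S0 : 0 <= S := derivs_le_ge0 (hS 0).
  have pF := primP sp bp; have [sF dF _] := pF.
  rewrite -mulrA; apply: h => // y yL; case=> [|m] mN.
    have F0 : prim phi (B + 1) = 0 by rewrite (prim_right pB pF) //; slra.
    have := @smooth_lip R (prim phi) (B + 1) (y - (B + 1)) S sF.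
    have -> : B + 1 + (y - (B + 1)) = y by ring.
    rewrite F0 subr0 => hl; rewrite derive1n0; apply: le_trans (hl _) _.
      by move=> c _; rewrite dF normrN; exact: (hS c 0%N).
    rewrite mulrC; apply: ler_wpM2r => //; apply: le_trans (ler_normB _ _) _.
    by rewrite [`|B + 1|]ger0_norm; slra.
  have -> : derive1n m.+1 (prim phi) y = - derive1n m phi y.
    rewrite derive1Sn (_ : derive1 (prim phi) = fun y => - phi y); last exact/funext.
    by rewrite derive1nN.
  rewrite normrN; apply: le_trans (hS y m (ltnW mN)) _.
  by rewrite -[leLHS]mul1r; apply: ler_wpM2r => //; slra.
by exists (SchwartzDistribution lin cont).
Qed.

(** [has_lim] speaks of positive scales only. A negative scale amounts to the reflected test
    function, whose primitive is [c - prim phi (- y)] and has the same limits at both ends. *)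
Lemma has_lim_point_value Q V x ga : has_lim Q x ga -> cdist Q -> (forall phi, V phi = Q (prim phi)) ->
  has_point_value V x ga.
Proof.
move=> hQ cQ hV phi /test_functionP[sp [L0 hL0]]; pose L := Num.max L0 0.
have L0' : 0 <= L by rewrite le_max lexx orbT.
have hL y : L < `|y| -> phi y = 0.
  by move=> h; apply: hL0; apply: le_lt_trans h; rewrite le_max lexx.
have bp : bsupp phi by exists L.
have pF := primP sp bp; have [sF dF _] := pF.
have Fr := prim_right hL pF L0'; have Fl := prim_left sp L0' hL pF.
set c := (\int[lebesgue_measure]_(y in setT) phi y)%R in Fl *.
pose phi' y := phi (- y).
have sp' : smooth phi'.
  have -> : phi' = (fun y => phi (-1 * y + 0)) by apply/funext => y; rewrite mulN1r addr0.
  exact: (@smooth_affine R _ (-1) 0 sp).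
have bp' : bsupp phi' by exists L => y yL; rewrite /phi' hL // normrN.
pose F' y := c - prim phi (- y).
have eF' : (fun y => prim phi (-1 * y + 0)) = (fun y => prim phi (- y)).
  by apply/funext => y; rewrite mulN1r addr0.
have sN : smooth (fun y => prim phi (- y)) by rewrite -eF'; exact: (@smooth_affine R _ (-1) 0 sF).
have sF' : smooth F' := smooth_sub (smooth_const c) sN.
have pF' : prim_spec phi' F'.
  split => // [y|].
    apply: is_derive1E; have d1 := @is_derive_affine R (prim phi) (-1) 0 y _ (smooth_is_derive (-1 * y + 0) sF).
    rewrite eF' in d1; have := isdD (is_derive_cst c y 1) (isdN d1).
    by rewrite add0r dF mulN1r addr0 mulN1r !opprK.
  by exists L => y yL; rewrite /F' Fl ?subrr // ltrN2.
have eF'' : prim phi' = F' := prim_uniq pF'.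
have h1 := hQ _ c L sF Fl (fun y yL => Fr y yL).
have F'l y : y < - L -> F' y = c.
  by move=> yL; rewrite /F' Fr ?subr0 //; slra.
have F'r y : L < y -> F' y = 0.
  by move=> yL; rewrite /F' Fl ?subrr // ltrN2.
have h2 := hQ _ c L sF' F'l F'r.
have pos s psi : 0 < s -> smooth psi -> bsupp psi -> s^-1 * V (zoom x s psi) = Q (zoom x s (prim psi)).
  move=> s0 s1 b1; have [s2 _ _] := primP s1 b1.
  by rewrite hV (prim_zoom _ s0 s1 b1) (cdistZ _ cQ (smooth_zoom x s s2)) mulKf ?gt_eqF.
apply/dnbhs0P => e e0; have /right0P/(_ e e0)[d1 d10 hd1] := h1; have /right0P/(_ e e0)[d2 d20 hd2] := h2.
exists (Num.min d1 d2); first by rewrite lt_min d10.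
move=> s; rewrite lt_min neq_lt => /orP[s0|s0] /andP[sd1 sd2].
  have s0' : 0 < - s by rewrite oppr_gt0.
  rewrite /dilate; have -> : (fun y => phi ((y - x) / s)) = zoom x (- s) phi'.
    by apply/funext => y; rewrite /zoom /phi' invrN mulrN opprK.
  rewrite [`|s|]ltr0_norm // (pos _ _ s0' sp' bp') eF''; apply: hd2 => //.
  by rewrite ltr0_norm in sd2.
rewrite /dilate [`|s|]gtr0_norm // -/(zoom x s phi) (pos _ _ s0 sp bp); apply: hd1 => //.
by rewrite gtr0_norm in sd1.
Qed.

Lemma dist_supported Q v a b : suppin Q a b -> (forall phi, v phi = Q phi) -> supported_in a b v.
Proof.
move=> sQ hv x; apply: contraPP; rewrite /= in_itv /= => /negP; rewrite negb_and -!ltNge => xab [].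
have tsub phi (V : set R) y : tsupp phi `<=` V -> ~ V y -> phi y = 0.
  move=> tV nV; apply/eqP; apply: contra_notT nV => py; apply: tV; exact: subset_closure.
case/orP: xab => [xa|bx].
  exists [set y | y < (x + a) / 2]; last by move=> /=; slra.
  split; first exact: open_lt.
  move=> phi /test_functionP[sp _] tV; rewrite hv.
  apply: (sQ phi ((a - x) / 2) sp) => [|y y1 _]; first by slra.
  by apply: (tsub phi _ y tV) => /=; apply/negP; rewrite -leNgt; slra.
exists [set y | (x + b) / 2 < y]; last by move=> /=; slra.
split; first exact: open_gt.
move=> phi /test_functionP[sp _] tV; rewrite hv.
apply: (sQ phi ((x - b) / 2) sp) => [|y _ y1]; first by slra.
by apply: (tsub phi _ y tV) => /=; apply/negP; rewrite -leNgt; slra.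
Qed.

(** Converse of [pair_good]: constructions can be carried out on functionals and then turned back
    into admissible pairs. *)
Lemma good_realized Q a b : good Q a b -> exists v V,
  [/\ supported_in a b v, Lojasiewicz V, is_dderiv V v, has_point_value V a 0 &
    has_point_value V b (Q (fun=> 1)) /\ forall psi, smooth psi -> epair v psi = Q psi].
Proof.
move=> gQ; have [cQ sQ nQ lQ] := gQ.
have [v hv] := functional_dist cQ; have [V hV] := prim_dist cQ.
have hs := dist_supported sQ hv.
have pvV x : exists2 ga, has_lim Q x ga & has_point_value V x ga.
  by have [ga hga] := lQ x; exists ga => //; exact: has_lim_point_value hga cQ hV.
exists v, V; split => //.
- by move=> x; have [ga _ h] := pvV x; exists ga.
- move=> phi /test_functionP[sp bp]; rewrite hv hV prim_derive1 // cdistN ?opprK //.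
- by have [ga h1 h2] := pvV a; rewrite -(good_value_left gQ h1).
split; first by have [ga h1 h2] := pvV b; rewrite -(good_value_right gQ h1).
move=> psi sp; rewrite (epair_cutoff hs sp) hv; apply/eqP; rewrite -subr_eq0.
have sc := smooth_mul (@smooth_cutoff R a b) sp.
rewrite -(cdistB cQ sc sp) (sQ _ 1 (smooth_sub sc sp) ltr01) //.
by move=> y y1 y2; rewrite cutoff1 // mul1r subrr.
Qed.

End Realization.

(** * Major and minor pairs as functionals with lower bounds *)

Section Majorants.
Context {R : realType}.
Implicit Types (u U v V : schwartz_distribution R) (P Q : (R -> R) -> R) (f : R -> \bar R) (psi phi : R -> R) (x y z d a b e r s t ga be : R) (c : \bar R).

Lemma right0_nbhsP (A : set R) : 0^'+ A <-> exists2 d : R, 0 < d & forall t, 0 < t -> t < d -> A t.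
Proof.
split => [|[d d0 hd]].
  move=> [d /= d0 hd]; exists d => // t t0 td; apply: hd => //=.
  by rewrite sub0r normrN gtr0_norm.
exists d => //= t; rewrite /ball_ /= sub0r normrN => td t0; apply: hd => //.
by rewrite gtr0_norm in td.
Qed.

Lemma ereal_dense (c c' : \bar R) : (c < c')%E -> exists r, (c < r%:E)%E /\ (r%:E < c')%E.
Proof.
case: c => [c| |]; case: c' => [c'| |] //=.
- by rewrite lte_fin => h; exists ((c + c') / 2); rewrite !lte_fin; slra.
- by move=> _; exists (c + 1); rewrite lte_fin ltry ltrDl.
- by move=> _; exists (c' - 1); rewrite lte_fin ltNyr ltrBlDr ltrDl.
- by move=> _; exists 0; rewrite ltNyr ltry.
Qed.

Lemma liminf_ge (h : R -> R) c : (c <= limf_einf (fun t => (h t)%:E) 0^'+)%E <->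
  forall r, (r%:E < c)%E -> exists2 d, 0 < d & forall t, 0 < t -> t < d -> r <= h t.
Proof.
rewrite limf_einfE; split => [hc r rc|hr].
  have [_ [A FA <-] rA] := ereal_sup_gt (lt_le_trans rc hc).
  have [d d0 hd] := (right0_nbhsP A).1 FA; exists d => // t t0 td.
  rewrite -lee_fin; apply: le_trans (ltW rA) _; apply: ereal_inf_lbound.
  by exists t => //; exact: hd.
rewrite leNgt; apply/negP => /ereal_dense[r [r1 r2]]; have [d d0 hd] := hr r r2.
move: r1; rewrite ltNge => /negP; apply.
apply: (@le_trans _ _ (ereal_inf [set (h t)%:E | t in [set t | 0 < t < d]])).
  by apply: le_ereal_inf_tmp => _ [t /= /andP[t0 td] <-]; rewrite lee_fin; exact: hd.
apply: ereal_sup_ubound; exists [set t | 0 < t < d] => //.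
by apply/right0_nbhsP; exists d => // t t0 td /=; rewrite t0.
Qed.

Lemma liminf_gtNy (h : R -> R) : (-oo < limf_einf (fun t => (h t)%:E) 0^'+)%E <->
  exists r, exists2 d, 0 < d & forall t, 0 < t -> t < d -> r <= h t.
Proof.
split => [hl|[r [d d0 hd]]].
  have [r [_ hr]] := ereal_dense hl.
  by exists r; apply: ((liminf_ge h (limf_einf (fun t => (h t)%:E) 0^'+)).1 (lexx _)).
apply: (@lt_le_trans _ _ r%:E); first exact: ltNyr.
apply/liminf_ge => r' rr; exists d => // t t0 td; apply: le_trans (hd t t0 td).
by rewrite lte_fin in rr; exact: ltW.
Qed.

Lemma limsup_opp (h : R -> R) :
  limf_esup (fun t => (h t)%:E) 0^'+ = (- limf_einf (fun t => (- h t)%:E) 0^'+)%E.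
Proof.
rewrite /limf_einf oppeK; congr (limf_esup _ _); apply/funext => t.
by rewrite EFinN oppeK.
Qed.

Definition lower_bounds P f a b (E Z : set R) : Prop :=
  (forall x, a <= x <= b -> ~ Z x -> forall phi, test_class0 phi -> forall r, (r%:E < f x)%E ->
     exists2 d, 0 < d & forall t, 0 < t -> t < d -> r <= t^-1 * P (zoom x t phi)) /\
  (forall x, a <= x <= b -> ~ E x -> forall phi, test_class1 phi -> exists r,
     exists2 d, 0 < d & forall t, 0 < t -> t < d -> r <= t^-1 * P (zoom x t phi)).

Definition majorant P f a b : Prop := good P a b /\
  exists E Z, [/\ countable E, lebesgue_measure.-negligible Z & lower_bounds P f a b E Z].

(** Turns minor functionals of f into majorants of [- f], so that only lower limits have to be
    studied. *)
Definition opp_fun P : (R -> R) -> R := fun psi => - P psi.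

Lemma good_opp P a b : good P a b -> good (opp_fun P) a b.
Proof.
move=> [[Pl [C [N [L [C0 L0 hC]]]]] sP nP lP]; split.
- split; first by move=> c f g sf sg; rewrite /opp_fun Pl //; ring.
  by exists C, N, L; split => // f M sf hM; rewrite /opp_fun normrN; exact: hC.
- by move=> f d sf d0 hf; rewrite /opp_fun (sP f d) ?oppr0.
- by move=> x f L' sf fL e e0; have [d d0 hd] := nP x f L' sf fL e e0; exists d => // s s0 sd;
    rewrite /opp_fun normrN; exact: hd.
move=> x; have [ga hga] := lP x; exists (- ga) => f c L' sf fc f0.
rewrite -[X in _ --> X](_ : 0 + -1 * (ga * c) = - ga * c); last by ring.
by apply: (cvg_right_lin (cvg_cst 0) (hga f c L' sf fc f0)) => s _; rewrite /opp_fun; ring.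
Qed.

Lemma opp_funK P : opp_fun (opp_fun P) = P.
Proof. by apply/funext => psi; rewrite /opp_fun opprK. Qed.

Lemma dilate_zoom v Q x t phi : smooth phi -> (forall psi, smooth psi -> epair v psi = Q psi) -> 0 < t ->
  dilate (epair v) x t phi = t^-1 * Q (zoom x t phi).
Proof. by move=> sp h t0; rewrite /dilate gtr0_norm // -(h _ (smooth_zoom x t sp)). Qed.

Lemma smooth_class0 phi : test_class0 phi -> smooth phi. Proof. by case. Qed.
Lemma smooth_class1 phi : test_class1 phi -> smooth phi. Proof. by case => -[]. Qed.

Lemma lower_val_ge v Q x phi c : smooth phi -> (forall psi, smooth psi -> epair v psi = Q psi) ->
  (c <= lower_val v phi x)%E <-> forall r, (r%:E < c)%E ->
    exists2 d, 0 < d & forall t, 0 < t -> t < d -> r <= t^-1 * Q (zoom x t phi).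
Proof.
move=> sp h; rewrite /lower_val liminf_ge; split => H r /H[d d0 hd]; exists d => // t t0 td.
  by rewrite -(dilate_zoom x sp h t0); exact: hd.
by rewrite (dilate_zoom x sp h t0); exact: hd.
Qed.

Lemma lower_val_gt v Q x phi : smooth phi -> (forall psi, smooth psi -> epair v psi = Q psi) ->
  (-oo < lower_val v phi x)%E <-> exists r,
    exists2 d, 0 < d & forall t, 0 < t -> t < d -> r <= t^-1 * Q (zoom x t phi).
Proof.
move=> sp h; rewrite /lower_val liminf_gtNy; split => -[r [d d0 hd]]; exists r, d => // t t0 td.
  by rewrite -(dilate_zoom x sp h t0); exact: hd.
by rewrite (dilate_zoom x sp h t0); exact: hd.
Qed.

Lemma upper_val_le v Q x phi c : smooth phi -> (forall psi, smooth psi -> epair v psi = Q psi) ->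
  (upper_val v phi x <= c)%E <-> forall r, (r%:E < - c)%E ->
    exists2 d, 0 < d & forall t, 0 < t -> t < d -> r <= t^-1 * opp_fun Q (zoom x t phi).
Proof.
move=> sp h; rewrite /upper_val limsup_opp leeNl liminf_ge.
split => H r /H[d d0 hd]; exists d => // t t0 td; rewrite /opp_fun ?mulrN.
  by rewrite -(dilate_zoom x sp h t0); exact: hd.
by rewrite (dilate_zoom x sp h t0) -mulrN; exact: hd.
Qed.

Lemma upper_val_lt v Q x phi : smooth phi -> (forall psi, smooth psi -> epair v psi = Q psi) ->
  (upper_val v phi x < +oo)%E <-> exists r,
    exists2 d, 0 < d & forall t, 0 < t -> t < d -> r <= t^-1 * opp_fun Q (zoom x t phi).
Proof.
move=> sp h; rewrite /upper_val limsup_opp lteNl /= liminf_gtNy.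
split => -[r [d d0 hd]]; exists r, d => // t t0 td; rewrite /opp_fun ?mulrN.
  by rewrite -(dilate_zoom x sp h t0); exact: hd.
by rewrite (dilate_zoom x sp h t0) -mulrN; exact: hd.
Qed.

Lemma major_valuesE a b f ga : major_values a b f ga <->
  exists P, majorant P f a b /\ ga = P (fun=> 1).
Proof.
split.
  move=> [u [U [[hs hU hd ha [E [Z [cE nZ hZ hE]]]] hb]]].
  have gP := pair_good hs hU hd ha.
  have hlim := pair_has_lim hs hd ha hb.
  exists (epair u); split; last exact: good_value_right gP hlim.
  split => //; exists E, Z; split => //; split.
    move=> x xab nZx phi p0 r rf.
    exact: ((@lower_val_ge u (epair u) x phi (f x) (smooth_class0 p0) (fun _ _ => erefl)).1
      (hZ x xab nZx phi p0) r rf).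
  move=> x xab nEx phi p1.
  exact: ((@lower_val_gt u (epair u) x phi (smooth_class1 p1) (fun _ _ => erefl)).1 (hE x xab nEx phi p1)).
move=> [P [[gP [E [Z [cE nZ [hZ hE]]]]] ->]].
have [v [V [hs hV hd ha [hb he]]]] := good_realized gP.
exists v, V; split => //; split => //; exists E, Z; split => //.
  by move=> x xab nZx phi p0; apply/(lower_val_ge x (f x) (smooth_class0 p0) he); exact: hZ.
by move=> x xab nEx phi p1; apply/(lower_val_gt x (smooth_class1 p1) he); exact: hE.
Qed.

Lemma minor_valuesE a b f ga : minor_values a b f ga <->
  exists P, majorant (opp_fun P) (fun x => - f x)%E a b /\ ga = P (fun=> 1).
Proof.
split.
  move=> [u [U [[hs hU hd ha [E [Z [cE nZ hZ hE]]]] hb]]].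
  have gP := pair_good hs hU hd ha.
  have hlim := pair_has_lim hs hd ha hb.
  exists (epair u); split; last exact: good_value_right gP hlim.
  split; first exact: good_opp.
  exists E, Z; split => //; split.
    move=> x xab nZx phi p0 r rf.
    exact: ((@upper_val_le u (epair u) x phi (f x) (smooth_class0 p0) (fun _ _ => erefl)).1
      (hZ x xab nZx phi p0) r rf).
  move=> x xab nEx phi p1.
  exact: ((@upper_val_lt u (epair u) x phi (smooth_class1 p1) (fun _ _ => erefl)).1 (hE x xab nEx phi p1)).
move=> [P [[gP [E [Z [cE nZ [hZ hE]]]]] ->]].
have := good_opp gP; rewrite opp_funK => {}gP.
have [v [V [hs hV hd ha [hb he]]]] := good_realized gP.
exists v, V; split => //; split => //; exists E, Z; split => //.
  by move=> x xab nZx phi p0; apply/(upper_val_le x (f x) (smooth_class0 p0) he); exact: hZ.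
by move=> x xab nEx phi p1; apply/(upper_val_lt x (smooth_class1 p1) he); exact: hE.
Qed.

Lemma class0_tdec phi : test_class0 phi -> exists2 al : R, al < -1 &
  forall N, exists2 C, 0 <= C & tdec al N C phi.
Proof.
move=> [sp _ _ [al al1 hd]]; exists al => // N; apply: decays_tdec => //; slra.
Qed.

(** As c may be infinite, a real bound below the weighted value is traded for a real bound below c
    itself, with a strict margin that absorbs the error of [mulP_tail]. *)
Lemma mule_lt_split (w r : R) c : 0 < w -> (r%:E < w%:E * c)%E ->
  exists r', (r'%:E < c)%E /\ r < w * r'.
Proof.
move=> w0; case: c => [c| |].
- rewrite -EFinM lte_fin => h; exists ((r / w + c) / 2).
  have rw : r / w < c by rewrite ltr_pdivrMr // mulrC.
  rewrite lte_fin; split; first slra.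
  have -> : w * ((r / w + c) / 2) = (r + w * c) / 2 by field; exact: lt0r_neq0.
  slra.
- move=> _; exists ((r + 1) / w); rewrite ltry; split => //.
  by rewrite mulrC divfK ?gt_eqF // ltrDl.
- by rewrite gt0_muleNy ?lte_fin // ltNge leNye.
Qed.

Lemma majorant_mul P f a b e be : 0 < be -> majorant P f a b ->
  majorant (mulP P e be) (fun x => (`|x - e| `^ be)%:E * f x)%E a b.
Proof.
move=> be0 [[cP sP nP lP] [E [Z [cE nZ [hZ hE]]]]]; split.
  split; [exact: mulP_cdist|exact: mulP_supp|by move=> x; exact: mulP_null|].
  by move=> x; have [ga hga] := lP x; exact: mulP_lim hga.
(* [mulP_tail] says nothing at e; a single point is both countable and null. *)
exists (E `|` [set e]), (Z `|` [set e]); split.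
- rewrite -bigcup2E; apply: bigcup_countable => [|[|[|i]] _ /=]; first exact: countableP.
  + exact: cE.
  + exact: countable1.
  + exact: countable0.
- apply: negligibleU => //; exists [set e]; split => //; exact: lebesgue_measure_set1.
have key x phi r' r : x != e -> test_class0 phi -> r < `|x - e| `^ be * r' ->
   (exists2 d, 0 < d & forall t, 0 < t -> t < d -> r' <= t^-1 * P (zoom x t phi)) ->
   exists2 d, 0 < d & forall t, 0 < t -> t < d -> r <= t^-1 * mulP P e be (zoom x t phi).
  move=> xe p0 hr [d d0 hd]; have [al al1 htd] := class0_tdec p0.
  have /right0P cv := mulP_tail cP nP be0 xe (smooth_class0 p0) al1 htd.
  have e0 : 0 < `|x - e| `^ be * r' - r by rewrite subr_gt0.
  have [d' d'0 hd'] := cv _ e0; exists (Num.min d d'); first by rewrite lt_min d0.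
  move=> t t0; rewrite lt_min => /andP[td td'].
  have := hd' t t0 td'; rewrite subr0 mulrBr ler_norml => /andP[h1 _].
  have h2 : `|x - e| `^ be * r' <= t^-1 * (pw e be x * P (zoom x t phi)).
    by rewrite mulrCA; apply: ler_wpM2l; [exact: powR_ge0|exact: hd].
  by move: h1 h2; clear; lra.
split=> x xab; move=> /not_orP[nx /eqP xe] phi p0.
  move=> r rf; have w0 : 0 < `|x - e| `^ be by rewrite powR_gt0 // normr_gt0 subr_eq0.
  have [r' [r1 r2]] := mule_lt_split w0 rf.
  exact: key xe p0 r2 (hZ x xab nx phi p0 r' r1).
have [r' hr] := hE x xab nx phi p0; exists (`|x - e| `^ be * r' - 1).
by apply: key xe p0.1 _ hr; rewrite ltrBlDr ltrDl.
Qed.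

Lemma majorant_eq P f f' a b : (forall x, a <= x <= b -> f x = f' x) ->
  majorant P f a b -> majorant P f' a b.
Proof.
move=> ff [gP [E [Z [cE nZ [hZ hE]]]]]; split => //; exists E, Z; split => //; split => //.
by move=> x xab nZx phi p0 r; rewrite -ff //; exact: hZ.
Qed.

End Majorants.

(** * Derivatives of averages in centre and scale *)

Section ParameterDerivatives.
Context {R : realType}.
Implicit Types (T : (R -> R) -> R) (h psi phi : R -> R) (x y z c d B C L S W X e w sg : R) (m n N k : nat).

Definition bounded_derivs h : Prop := forall m, exists2 B, 0 <= B & forall z, `|derive1n m h z| <= B.

Lemma bounded_derivs_le N h : bounded_derivs h -> exists2 B, 0 <= B & forall z, derivs_le N B h z.
Proof.
move=> hb; elim: N => [|N [B B0 hB]].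
  by have [B B0 hB] := hb 0%N; exists B => // z m; rewrite leqn0 => /eqP ->; exact: hB.
have [B' B'0 hB'] := hb N.+1; exists (B + B'); first exact: addr_ge0.
move=> z m; rewrite leq_eqVlt => /orP[/eqP -> |mN].
  by apply: le_trans (hB' z) _; rewrite lerDr.
by apply: le_trans (hB z m mN) _; rewrite lerDl.
Qed.

Lemma bounded_derivs_gauss k : bounded_derivs (@gauss R k).
Proof.
move=> m; have [C C0 hC] := @gauss_derive_decay R m k; exists C => // z.
apply: le_trans (hC z) _; rewrite -[leRHS]mulr1; apply: ler_wpM2l => //.
by rewrite -[leRHS]expR0 ler_expR; have := sqr_ge0 z; slra.
Qed.

Lemma bounded_derivs1 h : bounded_derivs h -> bounded_derivs (derive1 h).
Proof. by move=> hb m; have [B B0 hB] := hb m.+1; exists B => // z; rewrite -derive1Sn. Qed.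

(** The scale enters through its inverse [sg], so that differentiation in [sg] yields
    [(y - x) * h' (sg * (y - x))] without quotients. *)
Definition dil x sg h : R -> R := fun y => h (sg * (y - x)).

Lemma dilE x sg h : dil x sg h = fun y => h (sg * y + (- (sg * x))).
Proof. by apply/funext => y; rewrite /dil mulrBr. Qed.

Lemma smooth_dil_at x sg h : smooth h -> smooth (dil x sg h).
Proof. by move=> sh; rewrite dilE; exact: (smooth_affine sg _ sh). Qed.

#[local] Arguments smooth_dil_at x sg {h} _ _ _.

Lemma derive1n_dil_at m x sg h y : smooth h -> derive1n m (dil x sg h) y = sg ^+ m * derive1n m h (sg * (y - x)).
Proof. by move=> sh; rewrite dilE derive1n_affine // mulrBr. Qed.

Lemma zoom_dil x s h : zoom x s h = dil x s^-1 h.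
Proof. by apply/funext => y; rewrite /zoom /dil mulrC. Qed.

(** A second-order remainder in the parameter, uniform on bounded sets together with its derivatives
    in y, is controlled by the seminorm of T. *)
Lemma is_derive_functional T (Phi : R -> R -> R) psi (p : R) : cdist T -> (forall p, smooth (Phi p)) -> smooth psi ->
  (forall N L, exists C e0, 0 < e0 /\ forall e y, `|e| <= e0 -> `|y| <= L ->
     derivs_le N (C * e ^+ 2) (fun y => Phi (p + e) y - Phi p y - e * psi y) y) ->
  is_derive p 1 (fun p => T (Phi p)) (T psi).
Proof.
move=> cT sP sp hq; have [_ [C [N [L [C0 L0 hC]]]]] := cT.
have [C' [e0 [e00 hC']]] := hq N L.
apply: (@is_derive_quad R _ p _ (C * C') e0 e00) => e ee.
have s1 := smooth_sub (sP (p + e)) (sP p); have s2 := smooth_scale e sp.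
rewrite -(cdistB cT (sP _) (sP _)) mulrC -(cdistZ e cT sp) -(cdistB cT s1 s2) -mulrA.
by apply: hC => [|y yL]; [exact: smooth_sub s1 s2|apply: hC' => //; exact: ltW].
Qed.

Lemma derive1n_sub3 m (F G H : R -> R) e y : smooth F -> smooth G -> smooth H ->
  derive1n m (fun y => F y - G y - e * H y) y = derive1n m F y - derive1n m G y - e * derive1n m H y.
Proof.
move=> sF sG sH; rewrite (derive1nB m (smooth_sub sF sG) (smooth_scale e sH)).
by rewrite (derive1nB m sF sG) (derive1nZ m e sH).
Qed.

Lemma is_derive_center T x sg h : cdist T -> smooth h -> bounded_derivs h ->
  is_derive x 1 (fun x => T (dil x sg h)) (- sg * T (dil x sg (derive1 h))).
Proof.
move=> cT sh bh; have sh' := smooth_derive1 sh.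
rewrite -(cdistZ (- sg) cT (smooth_dil_at x sg sh')).
apply: (@is_derive_functional T (fun x => dil x sg h) _ x cT (fun p => smooth_dil_at p sg sh)
  (smooth_scale (- sg) (smooth_dil_at x sg sh'))).
move=> N L; have [B B0 hB] := bounded_derivs_le N.+2 bh.
pose S := `|sg| + 1; have S1 : 1 <= S by rewrite lerDr.
exists (S ^+ N * (B * sg ^+ 2)), 1; split => // e y _ _ m mN.
have sd := smooth_dil_at x sg sh'.
have -> : derive1n m (fun y => dil (x + e) sg h y - dil x sg h y - e * (- sg * dil x sg (derive1 h) y)) y =
    sg ^+ m * (derive1n m h (sg * (y - x) + (- (sg * e))) - derive1n m h (sg * (y - x))
       - derive1 (derive1n m h) (sg * (y - x)) * (- (sg * e))).
  rewrite (derive1n_sub3 m e y (smooth_dil_at _ sg sh) (smooth_dil_at x sg sh) (smooth_scale (- sg) sd)).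
  rewrite (derive1nZ m (- sg) sd) !derive1n_dil_at // -derive1Sn -[in RHS]derive1nS.
  have -> : sg * (y - (x + e)) = sg * (y - x) + - (sg * e) by ring.
  ring.
rewrite normrM -mulrA; apply: ler_pM => //.
  rewrite normrX; apply: (@le_trans _ _ (S ^+ m)); last exact: ler_weXn2l.
  by apply: lerXn2r; rewrite ?nnegrE // ?lerDl //; slra.
have -> : B * sg ^+ 2 * e ^+ 2 = B * (- (sg * e)) ^+ 2 by ring.
apply: smooth_taylor; first exact: smooth_derive1n.
move=> c _; have -> : derive1n 2 (derive1n m h) c = derive1n m.+2 h c by [].
by apply: (hB c); rewrite ltnS.
Qed.

Lemma smooth_pow a : smooth (fun y : R => y ^+ a).
Proof.
elim: a => [|a IH].
  have -> : (fun y : R => y ^+ 0) = fun=> 1 by apply/funext => y; rewrite expr0.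
  exact: smooth_const.
have -> : (fun y : R => y ^+ a.+1) = fun y => y * y ^+ a by apply/funext => y; rewrite exprS.
exact: smooth_mul (@smooth_id R) IH.
Qed.

Lemma derive1n_mul_lin m x f y : smooth f ->
  derive1n m (fun y => (y - x) * f y) y = m%:R * derive1n m.-1 f y + (y - x) * derive1n m f y.
Proof.
move=> sf; have sl : smooth (fun y => y - x) := smooth_sub (@smooth_id R) (smooth_const x).
elim: m y => [|m IH] y; first by rewrite !derive1n0 mul0r add0r.
rewrite derive1nS (_ : derive1n m (fun y => (y - x) * f y) = fun y => m%:R * derive1n m.-1 f y + (y - x) * derive1n m f y); last exact/funext.
have d1 := isdZ m%:R (smooth_is_derive y (smooth_derive1n m.-1 sf)).
have d2 := isdM (isdD (is_derive_id y 1) (is_derive_cst (- x) y 1)) (smooth_is_derive y (smooth_derive1n m sf)).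
rewrite (is_derive1E (isdD d1 d2)) -!derive1nS addr0 mul1r.
by case: m {IH d1 d2} => [|m] /=; rewrite ?derive1nS -?natr1; ring.
Qed.

Lemma is_derive_pow_dil a m w h sg : smooth h ->
  is_derive sg 1 (fun s => s ^+ a * derive1n m h (w * s + 0))
    (a%:R * sg ^+ a.-1 * derive1n m h (w * sg + 0) + w * (sg ^+ a * derive1n m.+1 h (w * sg + 0))).
Proof.
move=> sh; have d1 := @isdX R id a sg _ (is_derive_id sg 1).
have d2 := @is_derive_affine R _ w 0 sg _ (smooth_is_derive (w * sg + 0) (smooth_derive1n m sh)).
apply: (is_derive_eq (isdM d1 d2)); rewrite -derive1nS /=; ring.
Qed.

Lemma is_derive_dilation T x sg h : cdist T -> smooth h -> bounded_derivs h ->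
  is_derive sg 1 (fun sg => T (dil x sg h)) (T (fun y => (y - x) * dil x sg (derive1 h) y)).
Proof.
move=> cT sh bh; have sh' := smooth_derive1 sh.
have sl : smooth (fun y => y - x) := smooth_sub (@smooth_id R) (smooth_const x).
have sd := smooth_dil_at x sg sh'.
apply: (@is_derive_functional T (fun sg => dil x sg h) _ sg cT (fun p => smooth_dil_at x p sh) (smooth_mul sl sd)).
move=> N L; have [B B0 hB] := bounded_derivs_le N.+2 bh.
pose S := `|sg| + 1; have S1 : 1 <= S by rewrite lerDr.
pose W := `|L| + `|x| + 1; have W1 : 1 <= W by rewrite lerDr addr_ge0.
exists ((N%:R + W) ^+ 2 * (S ^+ N * B)), 1; split => // e y e1 yL m mN.
rewrite (derive1n_sub3 m e y (smooth_dil_at x _ sh) (smooth_dil_at x sg sh) (smooth_mul sl sd)).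
rewrite (derive1n_mul_lin m x y sd) !derive1n_dil_at // -!derive1Sn.
(* The m-th derivative in y of the dilated function, read as a function of the inverse scale: the
   remainder to be estimated is its Taylor remainder at [sg]. *)
pose w := y - x; pose q s := s ^+ m * derive1n m h (w * s + 0).
have wW : `|w| <= W by apply: le_trans (ler_normB _ _) _; have := ler_norm L; rewrite /W; slra.
have sq : smooth q.
  exact: (smooth_mul (@smooth_pow m) (smooth_affine w 0 (smooth_derive1n m sh))).
have qE s : s ^+ m * derive1n m h (s * (y - x)) = q s by rewrite /q addr0 mulrC [w * s]mulrC mulrC.
have dq : derive1 q = fun s => m%:R * (s ^+ m.-1 * derive1n m h (w * s + 0)) + w * (s ^+ m * derive1n m.+1 h (w * s + 0)).
  by apply/funext => s; rewrite (is_derive1E (is_derive_pow_dil m m w s sh)) [in RHS]mulrA.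
have ddq s : derive1n 2 q s =
    m%:R * (m.-1%:R * s ^+ m.-2 * derive1n m h (w * s + 0) + w * (s ^+ m.-1 * derive1n m.+1 h (w * s + 0))) +
    w * (m%:R * s ^+ m.-1 * derive1n m.+1 h (w * s + 0) + w * (s ^+ m * derive1n m.+2 h (w * s + 0))).
  rewrite derive1nS derive1n1 dq.
  exact: is_derive1E (isdD (isdZ m%:R (is_derive_pow_dil m.-1 m w s sh)) (isdZ w (is_derive_pow_dil m m.+1 w s sh))).
have q1 : derive1 q sg = m%:R * (sg ^+ m.-1 * derive1n m.-1.+1 h (sg * w)) + w * (sg ^+ m * derive1n m.+1 h (sg * w)).
  rewrite dq addr0 [w * sg]mulrC; congr (_ + _); case: m {mN q sq qE dq ddq} => [|m] //.
  by rewrite !mul0r.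
rewrite !qE (_ : _ - _ - _ = q (sg + e) - q sg - derive1 q sg * e); last by rewrite q1 /w; ring.
apply: smooth_taylor => // c ce.
have cS : `|c| <= S by have := ler_normD (c - sg) sg; rewrite subrK /S; slra.
have cp j : (j <= N)%N -> `|c ^+ j| <= S ^+ N.
  move=> jN; rewrite normrX; apply: (@le_trans _ _ (S ^+ j)); last exact: ler_weXn2l.
  by apply: lerXn2r; rewrite ?nnegrE //; slra.
have hG j : (j <= N.+2)%N -> `|derive1n j h (w * c + 0)| <= B by move=> jN; exact: hB.
have hm j k : (j <= N)%N -> (k <= N.+2)%N -> `|c ^+ j * derive1n k h (w * c + 0)| <= S ^+ N * B.
  by move=> jN kN; rewrite normrM; apply: ler_pM => //; [exact: cp|exact: hG].
set K := S ^+ N * B in hm *; have K0 : 0 <= K by rewrite mulr_ge0 ?exprn_ge0 //; slra.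
have mN1 : (m.-1 <= N)%N := leq_trans (leq_pred _) mN.
have mN2 : (m.-2 <= N)%N := leq_trans (leq_pred _) mN1.
have t1 := hm m.-2 m mN2 (leqW (leqW mN)); have t2 := hm m.-1 m.+1 mN1 (leqW (mN : (m.+1 <= N.+1)%N)).
have t3 := hm m m.+2 mN mN.
rewrite ddq; move: t1 t2 t3; rewrite -!mulrA.
set u1 := c ^+ m.-2 * _; set u2 := c ^+ m.-1 * _; set u3 := c ^+ m * _ => t1 t2 t3.
have a1 : m%:R <= N%:R :> R by rewrite ler_nat.
have a2 : m.-1%:R <= N%:R :> R by rewrite ler_nat.
have n0 : 0 <= N%:R :> R by [].
have w0 : 0 <= W by slra.
have bM (p p' z z' : R) : 0 <= p' -> `|p| <= p' -> `|z| <= z' -> `|p * z| <= p' * z'.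
  by move=> ? ? ?; rewrite normrM; apply: ler_pM.
have nm (j : nat) : j%:R <= N%:R :> R -> `|j%:R : R| <= N%:R by rewrite ger0_norm.
have -> : (N%:R + W) * ((N%:R + W) * K) = N%:R * (N%:R * K + W * K) + W * (N%:R * K + W * K) by ring.
apply: le_trans (ler_normD _ _) _; apply: lerD; apply: (bM); rewrite ?nm //.
  by apply: le_trans (ler_normD _ _) _; apply: lerD; apply: (bM); rewrite ?nm.
by apply: le_trans (ler_normD _ _) _; apply: lerD; apply: (bM); rewrite ?nm.
Qed.

Lemma dil_bound T h X S : cdist T -> smooth h -> bounded_derivs h -> exists2 C, 0 <= C &
  forall x sg, `|x| <= X -> `|sg| <= S ->
    `|T (dil x sg h)| <= C /\ `|T (fun y => (y - x) * dil x sg h y)| <= C.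
Proof.
move=> cT sh bh; have [_ [C [N [L [C0 L0 hC]]]]] := cT.
have [B B0 hB] := bounded_derivs_le N bh.
pose S' := `|S| + 1; have S1 : 1 <= S' by rewrite lerDr.
pose W := N%:R + (L + `|X|) + 1.
have W1 : 1 <= W by rewrite lerDr !addr_ge0 //; exact: ltW.
have W0 : 0 <= W by slra.
exists (C * (W * (S' ^+ N * B))); first by rewrite !mulr_ge0 ?exprn_ge0 //; slra.
move=> x sg xX sS; have sS' : `|sg| <= S' by have := ler_norm S; rewrite /S'; slra.
have sd := smooth_dil_at x sg sh.
have sl : smooth (fun y => y - x) := smooth_sub (@smooth_id R) (smooth_const x).
have hd j y : (j <= N)%N -> `|derive1n j (dil x sg h) y| <= S' ^+ N * B.
  move=> jN; rewrite derive1n_dil_at // normrM; apply: ler_pM => //; last exact: hB.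
  rewrite normrX; apply: (@le_trans _ _ (S' ^+ j)); last exact: ler_weXn2l.
  by apply: lerXn2r; rewrite ?nnegrE //; slra.
have K0 : 0 <= S' ^+ N * B by rewrite mulr_ge0 ?exprn_ge0 //; slra.
split.
  apply: hC => [|y _ m mN]; first exact: sd.
  by apply: le_trans (hd m y mN) _; rewrite -[leLHS]mul1r; apply: ler_wpM2r.
apply: hC => [|y yL m mN]; first exact: smooth_mul sl sd.
rewrite (derive1n_mul_lin _ _ _ sd); apply: le_trans (ler_normD _ _) _.
rewrite !normrM ger0_norm //.
apply: (@le_trans _ _ (N%:R * (S' ^+ N * B) + (L + `|X|) * (S' ^+ N * B))); last first.
  by rewrite -mulrDl; apply: ler_wpM2r => //; rewrite /W lerDl.
apply: lerD; apply: ler_pM => //.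
- by rewrite ler_nat.
- by apply: hd; exact: leq_trans (leq_pred _) mN.
- by apply: le_trans (ler_normB _ _) _; have := ler_norm X; slra.
- exact: hd.
Qed.

End ParameterDerivatives.

Arguments smooth_dil_at {R} x sg {h} _ _ _.
Arguments smooth_pow {R} a _ _.

(** * The heat equation for Gaussian averages and its maximum principle *)

Section MaximumPrinciple.
Context {R : realType}.
Implicit Types (T : (R -> R) -> R) (f psi phi : R -> R) (x y z h c d B C L S W X e w sg l : R) (m n N k : nat).

Lemma is_derive_eps f x l e : is_derive x 1 f l -> 0 < e -> exists2 d, 0 < d &
  forall h, `|h| < d -> `|f (x + h) - f x - l * h| <= e * `|h|.
Proof.
move=> df e0; have dv : derivable f x 1 := is_derive1_ex df.
have h : h^-1 *: (f (h *: 1 + x) - f x) @[h --> 0^'] --> l.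
  by have := dv; rewrite /derivable => /cvgP cv; rewrite -(derive_val (is_derive := df)); exact: dv.
have /dnbhs0P/(_ e e0)[d d0 hd] := h; exists d => // u ud.
have [->|u0] := eqVneq u 0; first by rewrite addr0 subrr mulr0 subr0 normr0 mulr0.
have := hd u u0 ud; rewrite /GRing.scale /= mulr1 [u + x]addrC => hu.
have -> : f (x + u) - f x - l * u = (u^-1 * (f (x + u) - f x) - l) * u by field.
by rewrite normrM; apply: ler_wpM2r.
Qed.

Lemma min_right f x l d : is_derive x 1 f l -> 0 < d -> (forall h, 0 < h -> h < d -> f x <= f (x + h)) -> 0 <= l.
Proof.
move=> df d0 hf; rewrite leNgt; apply/negP => l0.
have [//|d' d'0 hd] := is_derive_eps df (_ : 0 < - l / 2); first slra.
pose h := Num.min d d' / 2.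
have m0 : 0 < Num.min d d' by rewrite lt_min d0.
have m1 : Num.min d d' <= d by rewrite ge_min lexx.
have m2 : Num.min d d' <= d' by rewrite ge_min lexx orbT.
have h0 : 0 < h by rewrite /h; slra.
have hd1 : h < d by rewrite /h; slra.
have hd2 : `|h| < d' by rewrite gtr0_norm // /h; slra.
have := hd h hd2; have := hf h h0 hd1; rewrite [`|h|]gtr0_norm // ler_norml => u1 /andP[_ u2].
by have : 0 < - l * h by [rewrite mulr_gt0 //; slra]; move: u1 u2; clear; lra.
Qed.

Lemma min_left f x l d : is_derive x 1 f l -> 0 < d -> (forall h, 0 < h -> h < d -> f x <= f (x - h)) -> l <= 0.
Proof.
move=> df d0 hf; rewrite leNgt; apply/negP => l0.
have [//|d' d'0 hd] := is_derive_eps df (_ : 0 < l / 2); first slra.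
pose h := Num.min d d' / 2.
have m0 : 0 < Num.min d d' by rewrite lt_min d0.
have m1 : Num.min d d' <= d by rewrite ge_min lexx.
have m2 : Num.min d d' <= d' by rewrite ge_min lexx orbT.
have h0 : 0 < h by rewrite /h; slra.
have hd1 : h < d by rewrite /h; slra.
have hd2 : `|- h| < d' by rewrite normrN gtr0_norm // /h; slra.
have := hd (- h) hd2; have := hf h h0 hd1; rewrite normrN [`|h|]gtr0_norm // ler_norml => u1 /andP[_ u2].
by have : 0 < l * h by [rewrite mulr_gt0 //; slra]; move: u1 u2; clear; lra.
Qed.

(** With [f' x = 0] and a negative second derivative, [f'] would be negative just right of x and f
    would drop below its minimum there. *)
Lemma second_derivative_test f f' x l d : (forall y, is_derive y 1 f (f' y)) -> is_derive x 1 f' l ->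
  0 < d -> (forall y, `|y - x| < d -> f x <= f y) -> 0 <= l.
Proof.
move=> df dl d0 hf; rewrite leNgt; apply/negP => l0.
have f0 : f' x = 0.
  apply/eqP; rewrite eq_le; apply/andP; split.
    by apply: (min_left (df x) d0) => h h0 hd; apply: hf; rewrite addrAC subrr add0r normrN gtr0_norm.
  by apply: (min_right (df x) d0) => h h0 hd; apply: hf; rewrite addrAC subrr add0r gtr0_norm.
have [//|d' d'0 hd] := is_derive_eps dl (_ : 0 < - l / 2); first slra.
pose h := Num.min d d' / 2.
have m0 : 0 < Num.min d d' by rewrite lt_min d0.
have m1 : Num.min d d' <= d by rewrite ge_min lexx.
have m2 : Num.min d d' <= d' by rewrite ge_min lexx orbT.
have h0 : 0 < h by rewrite /h; slra.
have hd1 : h < d by rewrite /h; slra.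
have cf : {within `[x, x + h], continuous f}.
  apply: continuous_subspaceT => y; apply: differentiable_continuous.
  by apply/derivable1_diffP; exact: is_derive1_ex (df y).
have [|c] := MVT (_ : x < x + h) (fun y _ => df y) cf; first slra.
rewrite in_itv /= => /andP[c1 c2] e.
have cx0 : 0 < c - x by slra.
have cd : `|c - x| < d' by rewrite gtr0_norm // /h; move: c2; rewrite /h; slra.
have := hd (c - x) cd; rewrite (_ : x + (c - x) = c); last by ring.
rewrite f0 subr0 [`|c - x|]gtr0_norm // ler_norml => /andP[_ u2].
have f'c : f' c < 0.
  have : 0 < - l * (c - x) by rewrite mulr_gt0 //; slra.
  by move: u2; clear; lra.
have : f x <= f (x + h) by apply: hf; rewrite addrAC subrr add0r gtr0_norm.
have : f' c * (x + h - x) < 0 by rewrite addrAC subrr add0r nmulr_rlt0.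
by move: e; clear; lra.
Qed.

Lemma lipschitz_of_derive f f' C p q : (forall y, is_derive y 1 f (f' y)) ->
  (forall z, p <= z <= q -> `|f' z| <= C) ->
  forall x y, p <= x <= q -> p <= y <= q -> `|f y - f x| <= C * `|y - x|.
Proof.
move=> df hC x y px py; have cf u v : {within `[u, v], continuous f}.
  apply: continuous_subspaceT => z; apply: differentiable_continuous.
  by apply/derivable1_diffP; exact: is_derive1_ex (df z).
wlog xy : x y px py / x < y.
  have [xy|yx|->] := ltgtP x y; last by rewrite !subrr normr0 mulr0.
    by apply.
  by rewrite distrC [`|y - x|]distrC; apply.
have [z] := MVT xy (fun y _ => df y) (cf x y).
rewrite in_itv /= => /andP[z1 z2] ->; rewrite normrM; apply: ler_wpM2r => //; apply: hC.
by case/andP: px => ? ?; case/andP: py => ? ?; apply/andP; split; slra.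
Qed.

Notation g := (@gauss R 0).

Lemma gauss_heat z : g z + z * derive1 g z = - derive1 (derive1 g) z.
Proof.
have e1 : derive1 g = fun x => -1 * gauss 1 x by apply/funext => x; rewrite derive1_gauss mul0r add0r.
rewrite {2}e1 (is_derive1E (isdZ (-1) (is_derive_gauss 1 z))) e1 /gauss /=; ring.
Qed.

(** The second derivative in x of the same quantity is [s ^+ 3 * T (dil x s g'')]. So it solves a
    heat equation that runs backward in the inverse scale s, that is forward in the scale. *)
Lemma is_derive_heat T x (s : R) : cdist T ->
  is_derive s 1 (fun s => s * T (dil x s g)) (- T (dil x s (derive1 (derive1 g)))).
Proof.
move=> cT; have sg := @smooth_gauss R 0; have bg := @bounded_derivs_gauss R 0.
have d1 := isdM (is_derive_id s 1) (is_derive_dilation x s cT sg bg).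
apply: (is_derive_eq d1); rewrite mul1r.
have sl : smooth (fun y => y - x) := smooth_sub (@smooth_id R) (smooth_const x).
have sm := smooth_mul sl (smooth_dil_at x s (smooth_derive1 sg)).
have sd := smooth_dil_at x s (smooth_derive1 (smooth_derive1 sg)).
rewrite -(cdistZ s cT sm) -(cdistD cT (smooth_dil_at x s sg) (smooth_scale s sm)) -(cdistN cT sd).
by congr T; apply/funext => y; rewrite /dil -gauss_heat; ring.
Qed.

(** Time runs with the scale, so the initial line is the largest inverse scale [s2]. At a negative
    minimum of the perturbed function, the second derivative in x forces [T (dil x s g'') >= 0],
    while the derivative in s forces it below [- th < 0]. *)
Lemma maximum_principle T c d (s1 s2 : R) : cdist T -> c < d -> 0 < s1 -> s1 <= s2 ->
  (forall s, s1 <= s -> s <= s2 -> 0 <= T (dil c s g)) ->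
  (forall s, s1 <= s -> s <= s2 -> 0 <= T (dil d s g)) ->
  (forall x, c <= x -> x <= d -> 0 <= T (dil x s2 g)) ->
  forall x (s : R), c <= x -> x <= d -> s1 <= s -> s <= s2 -> 0 <= T (dil x s g).
Proof.
move=> cT cd s10 s12 left_ge0 right_ge0 init_ge0 x s cx xd ss1 ss2; rewrite leNgt; apply/negP => neg.
have s0 : 0 < s := lt_le_trans s10 ss1.
(* Chosen so that the perturbation [th * (s2 - s)] uses up at most half of the assumed negative
   value. *)
pose th := - (s * T (dil x s g)) / (2 * (s2 - s1 + 1)).
have sg := @smooth_gauss R 0; have bg := @bounded_derivs_gauss R 0.
have p0 : 0 < - (s * T (dil x s g)) by rewrite oppr_gt0 pmulr_rlt0.
have th0 : 0 < th by rewrite divr_gt0 //; slra.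
pose V (p : R * R) := p.2 * T (dil p.1 p.2 g) + th * (s2 - p.2).
have Vneg : V (x, s) < 0.
  rewrite /V /=; have : th * (s2 - s) <= th * (s2 - s1 + 1) by apply: ler_wpM2l; [exact: ltW|slra].
  have -> : th * (s2 - s1 + 1) = - (s * T (dil x s g)) / 2.
    by rewrite /th; field; rewrite gt_eqF //; slra.
  by move: p0; clear; lra.
pose A : set (R * R) := `[c, d]%classic `*` `[s1, s2]%classic.
have Axs : A (x, s) by split; rewrite /= in_itv /= ?cx ?ss1.
have cA : compact A by apply: compact_setX; exact: segment_compact.
have [Cx Cx0 hCx] := @dil_bound R T (derive1 g) (`|c| + `|d|) s2 cT (smooth_derive1 sg) (bounded_derivs1 bg).
have [Cs Cs0 hCs] := @dil_bound R T (derive1 (derive1 g)) (`|c| + `|d|) s2 cT (smooth_derive1 (smooth_derive1 sg)) (bounded_derivs1 (bounded_derivs1 bg)).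
have inx z : c <= z -> z <= d -> `|z| <= `|c| + `|d|.
  move=> z1 z2; have := ler_norm d; have := ler_norm (- c); rewrite normrN => ? ?.
  by have := normr_ge0 c; have := normr_ge0 d; rewrite ler_norml => *; apply/andP; split; slra.
have ins z : s1 <= z -> z <= s2 -> `|z| <= s2 by move=> z1 z2; rewrite gtr0_norm //; slra.
have dVx s' y : is_derive y 1 (fun y => V (y, s')) (s' * (- s' * T (dil y s' (derive1 g)))).
  have d1 := isdD (isdZ s' (is_derive_center y s' cT sg bg)) (is_derive_cst (th * (s2 - s')) y 1).
  by rewrite addr0 in d1.
have dVs (y s' : R) : is_derive s' 1 (fun s' => V (y, s')) (- T (dil y s' (derive1 (derive1 g))) - th).
  have d1 := isdD (is_derive_heat y s' cT) (isdZ th (isdD (is_derive_cst s2 s' 1) (isdN (is_derive_id s' 1)))).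
  by rewrite add0r mulrN mulr1 in d1.
have lipV y s' y' s'' : A (y, s') -> A (y', s'') ->
    `|V (y', s'') - V (y, s')| <= s2 * (s2 * Cx) * `|y' - y| + (Cs + th) * `|s'' - s'|.
  rewrite /A /= !in_itv /= => -[/andP[a1 a2] /andP[a3 a4]] [/andP[a5 a6] /andP[a7 a8]].
  have -> : V (y', s'') - V (y, s') = (V (y', s'') - V (y, s'')) + (V (y, s'') - V (y, s')) by ring.
  apply: le_trans (ler_normD _ _) _; apply: lerD.
    have hb z : c <= z <= d -> `|s'' * (- s'' * T (dil z s'' (derive1 g)))| <= s2 * (s2 * Cx).
      move=> /andP[z1 z2]; rewrite !normrM normrN; have b1 := ins _ a7 a8.
      have [b2 _] := hCx z s'' (inx z z1 z2) b1.
      by apply: ler_pM => //; apply: ler_pM.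
    by apply: (lipschitz_of_derive (dVx s'') hb); apply/andP.
  have hb z : s1 <= z <= s2 -> `|- T (dil y z (derive1 (derive1 g))) - th| <= Cs + th.
    move=> /andP[z1 z2]; have [b2 _] := hCs y z (inx y a1 a2) (ins z z1 z2).
    apply: le_trans (ler_normB _ _) _; rewrite normrN [`|th|]gtr0_norm //; exact: lerD.
  by apply: (lipschitz_of_derive (dVs y) hb); apply/andP.
have cV : {within A, continuous V}.
  apply/subspace_continuousP => -[y s'] Ay; apply/cvgrPdist_lt => e e0.
  pose K := s2 * (s2 * Cx) + (Cs + th) + 1.
  have s20 : 0 <= s2 by slra.
  have Kx : 0 <= s2 * (s2 * Cx) by rewrite !mulr_ge0.
  have K0 : 0 < K by rewrite /K; slra.
  have eK : 0 < e / K by rewrite divr_gt0.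
  rewrite near_withinE; exists (ball y (e / K), ball s' (e / K)); first by split; exact: nbhsx_ballx.
  move=> [y' s''] [/=]; rewrite -!ball_normE /= => h1 h2 Ap.
  rewrite distrC; apply: le_lt_trans (lipV _ _ _ _ Ay Ap) _.
  rewrite distrC in h1; rewrite distrC in h2.
  have h3 : s2 * (s2 * Cx) * `|y' - y| <= s2 * (s2 * Cx) * (e / K).
    by apply: ler_wpM2l => //; exact: ltW.
  have h4 : (Cs + th) * `|s'' - s'| <= (Cs + th) * (e / K).
    by apply: ler_wpM2l; [rewrite addr_ge0 //; slra|exact: ltW].
  apply: le_lt_trans (lerD h3 h4) _.
  have e1 : K * (e / K) = e by rewrite mulrC divfK // gt_eqF.
  move: e1 eK; rewrite {1}/K; set q := e / K; rewrite [(_ + 1) * q]mulrDl [(_ + (Cs + th)) * q]mulrDl mul1r.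
  by move=> e1 q0; rewrite -[ltRHS]e1 ltrDl.
have [[x0 s0'] /set_mem A0 hmin] := compact_EVT_min (ex_intro _ _ Axs) cA cV.
have {}hmin y s' : A (y, s') -> V (x0, s0') <= V (y, s') by move=> /mem_set; exact: hmin.
have V0 := le_lt_trans (hmin _ _ Axs) Vneg.
have := A0; rewrite /A /= !in_itv /= => -[/andP[a1 a2] /andP[a3 a4]].
have Vge y s' : s1 <= s' -> s' <= s2 -> 0 <= T (dil y s' g) -> 0 <= V (y, s').
  move=> u1 u2 u3; rewrite /V /=; apply: addr_ge0; apply: mulr_ge0 => //.
  - exact: ltW (lt_le_trans s10 u1).
  - exact: ltW.
  - by rewrite subr_ge0.
have n1 : c < x0.
  rewrite lt_neqAle a1 andbT; apply: contraTneq V0 => <-; rewrite -leNgt; exact: (Vge _ _ a3 a4 (left_ge0 _ a3 a4)).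
have n2 : x0 < d.
  rewrite lt_neqAle a2 andbT; apply: contraTneq V0 => ->; rewrite -leNgt; exact: (Vge _ _ a3 a4 (right_ge0 _ a3 a4)).
have n3 : s0' < s2.
  rewrite lt_neqAle a4 andbT; apply: contraTneq V0 => ->; rewrite -leNgt.
  by apply: Vge => //; exact: init_ge0.
have s00 : 0 < s0' by slra.
have dd : is_derive x0 1 (fun y => s0' * (- s0' * T (dil y s0' (derive1 g))))
    (s0' * (- s0' * (- s0' * T (dil x0 s0' (derive1 (derive1 g)))))).
  exact: isdZ (isdZ _ (is_derive_center x0 s0' cT (smooth_derive1 sg) (bounded_derivs1 bg))).
have dm : 0 < Num.min (x0 - c) (d - x0) by rewrite lt_min !subr_gt0 n1.
have t1 : 0 <= s0' * (- s0' * (- s0' * T (dil x0 s0' (derive1 (derive1 g))))).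
  apply: (second_derivative_test (dVx s0') dd dm) => y; rewrite lt_min ltr_norml => yx.
  apply: hmin; rewrite /A /= !in_itv /= a3 a4; split => //.
  move: yx; rewrite -!andbA => /andP[y1 y2]; move: y2; rewrite ltr_norml => /andP[y2 /andP[y3 y4]].
  by move: y1 y2 y3 y4; clear; move=> *; apply/andP; split; slra.
(* The minimum may lie on the edge [s1], so only increments to the right in s are compared. *)
have t2 : 0 <= - T (dil x0 s0' (derive1 (derive1 g))) - th.
  have dm' : 0 < s2 - s0' by rewrite subr_gt0.
  apply: (min_right (dVs x0 s0') dm') => h h0 hd; apply: hmin.
  rewrite /A /= !in_itv /= a1 a2; split => //.
  by move: a3 h0 hd; clear; move=> *; apply/andP; split; slra.
move: t1; rewrite !mulNr mulrN opprK !mulrA pmulr_rge0; last by rewrite !mulr_gt0.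
by move: t2 th0; clear; lra.
Qed.

End MaximumPrinciple.

(** * Concentration of the normal density *)

Section GaussianConvolution.
Context {R : realType}.
Implicit Types (T : (R -> R) -> R) (f h psi phi : R -> R) (x y z b c d B C K L M S W X e w s sg l p q : R) (m n N k : nat).

Notation g := (@gauss R 0).

Lemma gauss_normal_pdf y s x : s != 0 -> normal_peak s * g (s^-1 * (y - x)) = normal_pdf y s x.
Proof.
move=> s0; rewrite normal_pdfE //; congr (_ * _).
rewrite /gauss expr0 mul1r /normal_fun; congr expR; rewrite -[_ *+ 2]mulr_natr; field.
by rewrite s0.
Qed.

Lemma normal_peak2 s : 0 < s -> normal_peak s = 2 * normal_peak (2 * s).
Proof.
move=> s0; rewrite /normal_peak; have -> : (2 * s) ^+ 2 * pi *+ 2 = 2 ^+ 2 * (s ^+ 2 * pi *+ 2).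
  by rewrite exprMn -mulrA mulrnAr.
by rewrite sqrtrM ?exprn_ge0 // sqrtr_sqr ger0_norm // invfM mulrA mulfV // mul1r.
Qed.

(** The factor [|x - y|] is absorbed into a density of twice the width, so the first moment is
    bounded by normalization alone and no further integral is computed. *)
Lemma pdf_first_moment : exists2 C : R, 0 <= C & forall s y x, 0 < s ->
  `|x - y| * normal_pdf y s x <= C * s * normal_pdf y (2 * s) x.
Proof.
(* [3 / 8 = 1 / 2 - 1 / 8] is the difference between the rates of [g v] and [g (v / 2)]. *)
have [|C C0 hC] := @pow_le_expR2 R 1 (3 / 8); first by slra.
exists (2 * C); first exact: mulr_ge0.
move=> s y x s0; have s20 : 2 * s != 0 by rewrite mulf_neq0 // gt_eqF.
rewrite -!gauss_normal_pdf ?(lt0r_neq0 s0) // (normal_peak2 s0).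
pose v := s^-1 * (y - x).
have -> : (2 * s)^-1 * (y - x) = v / 2 by rewrite /v invfM; field; exact: lt0r_neq0.
have -> : `|x - y| = s * `|v|.
  by rewrite /v normrM normfV (gtr0_norm s0) mulrA mulfV ?gt_eqF // mul1r distrC.
rewrite -/v; have p0 : 0 <= normal_peak (2 * s) := normal_peak_ge0 _.
have -> : s * `|v| * (2 * normal_peak (2 * s) * g v) = 2 * s * normal_peak (2 * s) * (`|v| * g v) by ring.
have -> : 2 * C * s * (normal_peak (2 * s) * g (v / 2)) = 2 * s * normal_peak (2 * s) * (C * g (v / 2)) by ring.
apply: ler_wpM2l; first by rewrite !mulr_ge0 // ltW.
have := hC v; rewrite expr1 => h; rewrite /gauss !expr0 !mul1r.
have -> : expR (- (v / 2) ^+ 2 / 2) = expR (3 / 8 * v ^+ 2) * expR (- v ^+ 2 / 2).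
  by rewrite -expRD; congr expR; field.
by rewrite mulrA; apply: ler_wpM2r; [exact: expR_ge0|].
Qed.

Lemma bsupp_bounded_derivs phi : smooth phi -> bsupp phi -> bounded_derivs phi.
Proof.
move=> sp bp m; exists (\sum_(k < m.+1) sup (range (fun x : R => `|derive1n k phi x|))) => [|z].
  exact: derivs_le_ge0 (test_derivs_le sp bp (N := m) 0).
exact: (test_derivs_le sp bp z (leqnn m)).
Qed.

Lemma integrable_bsupp_pdf phi y s : 0 < s -> smooth phi -> bsupp phi ->
  lebesgue_measure.-integrable setT (EFin \o (fun x => phi x * normal_pdf y s x)).
Proof.
move=> s0 sp bp; have [B B0 hB] := bsupp_bounded_derivs sp bp 0%N.
have iB : lebesgue_measure.-integrable setT (fun x => B%:E * (normal_pdf y s x)%:E)%E.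
  apply: integrableZl => //; exact: integrable_normal_pdf.
apply: (le_integrable _ _ _ iB) => //.
  apply/measurable_EFinP; apply: measurable_funM; last exact: measurable_normal_pdf.
  exact: continuous_measurable_fun (smooth_continuous sp).
move=> x _; rewrite /= lee_fin !normrM; apply: ler_wpM2r => //.
by apply: le_trans (hB x) _; exact: ler_norm.
Qed.

Lemma pdf_concentration phi : smooth phi -> bsupp phi -> exists2 K, 0 <= K & forall s y, 0 < s ->
  `|(\int[lebesgue_measure]_(x in setT) (phi x * normal_pdf y s x))%R - phi y| <= K * s.
Proof.
move=> sp bp; have [B B0 hB] := bsupp_bounded_derivs sp bp 1%N.
have [C C0 hC] := pdf_first_moment; exists (B * C); first exact: mulr_ge0.
move=> s y s0.
have i1 := integrable_bsupp_pdf y s0 sp bp.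
have ip r := @integrable_normal_pdf R y r.
have i3 c r : lebesgue_measure.-integrable setT (EFin \o (fun x => c * normal_pdf y r x)).
  have -> : EFin \o (fun x => c * normal_pdf y r x) = (fun x => c%:E * (normal_pdf y r x)%:E)%E by [].
  by apply: integrableZl.
have i2 c c' : lebesgue_measure.-integrable setT
   (EFin \o (fun x => c * normal_pdf y s x + c' * normal_pdf y (2 * s) x)).
  have -> : EFin \o (fun x => c * normal_pdf y s x + c' * normal_pdf y (2 * s) x) =
    (fun x => c%:E * (normal_pdf y s x)%:E + c'%:E * (normal_pdf y (2 * s) x)%:E)%E by [].
  by apply: integrableD => //; apply: integrableZl.
have e2 c c' : (\int[lebesgue_measure]_(x in setT) (c * normal_pdf y s x + c' * normal_pdf y (2 * s) x))%R = c + c'.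
  rewrite (@RintegralD _ _ R lebesgue_measure setT _ _ measurableT (i3 c s) (i3 c' (2 * s))).
  rewrite (@RintegralZl _ _ R lebesgue_measure setT _ _ measurableT (ip s)) (@RintegralZl _ _ R lebesgue_measure setT _ _ measurableT (ip (2 * s))).
  by rewrite /Rintegral !integral_normal_pdf /= !mulr1.
have key x : `|phi x * normal_pdf y s x - phi y * normal_pdf y s x| <= B * C * s * normal_pdf y (2 * s) x.
  rewrite -mulrBl normrM [`|normal_pdf _ _ _|]ger0_norm ?normal_pdf_ge0 //.
  apply: (@le_trans _ _ (B * `|x - y| * normal_pdf y s x)).
    apply: ler_wpM2r; first exact: normal_pdf_ge0.
    have := @smooth_lip R phi y (x - y) B sp (fun c _ => hB c).
    by rewrite (_ : y + (x - y) = x) //; ring.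
  by rewrite -!mulrA; apply: ler_wpM2l => //; rewrite !mulrA; exact: hC.
rewrite ler_norml; apply/andP; split.
  have := @le_Rintegral _ _ R lebesgue_measure setT _ _ measurableT (i2 (phi y) (- (B * C * s))) i1 _.
  rewrite e2 => h; rewrite lerBrDr addrC; apply: h => x _.
  by have := key x; rewrite ler_norml => /andP[]; slra.
have := @le_Rintegral _ _ R lebesgue_measure setT _ _ measurableT i1 (i2 (phi y) (B * C * s)) _.
rewrite e2 => h; rewrite lerBlDr addrC; apply: h => x _.
by have := key x; rewrite ler_norml => /andP[]; slra.
Qed.

End GaussianConvolution.

(** * Positivity from nonnegative Gaussian averages *)

Section ConvolutionPositivity.
Context {R : realType}.
Implicit Types (T : (R -> R) -> R) (f h psi phi : R -> R) (x y z b c d B C K L M S W X e w s sg l p q : R) (m n N k : nat).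

Notation g := (@gauss R 0).

Definition fiber phi h sg y : R -> R := fun x => phi x * h (sg * (y - x)).
(** The convolution integral restricted to [[b, +oo[]; with the endpoint as a parameter, its
    derivative in b is a multiple of a single dilated kernel. *)
Definition conv phi h sg b : R -> R := fun y => prim (fiber phi h sg y) b.

Lemma smooth_fiber phi h sg y : smooth phi -> smooth h -> smooth (fiber phi h sg y).
Proof.
move=> sp sh; rewrite /fiber.
have -> : (fun x => phi x * h (sg * (y - x))) = (fun x => phi x * h (- sg * x + sg * y)).
  by apply/funext => x; congr (_ * h _); ring.
exact: smooth_mul sp (smooth_affine (- sg) (sg * y) sh).
Qed.
#[local] Arguments smooth_fiber {phi h} sg y _ _ _ _.

Lemma bsupp_fiber phi h sg y : bsupp phi -> bsupp (fiber phi h sg y).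
Proof. exact: bsuppM. Qed.

Lemma is_derive_fiber phi h sg y x : smooth phi -> smooth h ->
  is_derive x 1 (fiber phi h sg y) (fiber (derive1 phi) h sg y x - sg * fiber phi (derive1 h) sg y x).
Proof.
move=> sp sh; have d1 := @is_derive_affine R h (- sg) (sg * y) x _ (smooth_is_derive _ sh).
have e : (fun x => h (- sg * x + sg * y)) = (fun x => h (sg * (y - x))).
  by apply/funext => z; congr h; ring.
rewrite e in d1; apply: (is_derive_eq (isdM (smooth_is_derive x sp) d1)).
have -> : - sg * x + sg * y = sg * (y - x) by ring.
rewrite /fiber; ring.
Qed.

Lemma prim_bound f L M b : smooth f -> 0 <= L -> (forall x, L < `|x| -> f x = 0) -> (forall x, `|f x| <= M) ->
  `|prim f b| <= M * `|b - (L + 1)|.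
Proof.
move=> sf L0 fL fM; have bf : bsupp f by exists L.
have pF := primP sf bf; have [sF dF _] := pF.
have F0 : prim f (L + 1) = 0 by rewrite (prim_right fL pF) //; slra.
have := @smooth_lip R (prim f) (L + 1) (b - (L + 1)) M sF (fun c _ => _).
rewrite F0 subr0 (_ : L + 1 + (b - (L + 1)) = b); last by ring.
by apply => c; rewrite dF normrN.
Qed.

(** The remainder in y is the primitive of phi times a Taylor remainder of h, so [prim_bound]
    justifies differentiation under the integral. *)
Lemma is_derive_conv phi h sg b y : smooth phi -> bsupp phi -> smooth h -> bounded_derivs h ->
  is_derive y 1 (conv phi h sg b) (sg * conv phi (derive1 h) sg b y).
Proof.
move=> sp bp sh bh; have sh' := smooth_derive1 sh.
have [L0 hL0] := bp; pose L := Num.max L0 0; have L0' : 0 <= L by rewrite le_max lexx orbT.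
have hL z : L < `|z| -> phi z = 0.
  by move=> hz; apply: hL0; apply: le_lt_trans hz; rewrite le_max lexx.
have [B B0 hB] := bh 2%N; have [Bp Bp0 hBp] := bsupp_bounded_derivs sp bp 0%N.
apply: (@is_derive_quad R _ y _ (Bp * (B * sg ^+ 2) * `|b - (L + 1)|) 1) => // e _.
have s1 := smooth_fiber sg y sp sh; have s2 := smooth_fiber sg (y + e) sp sh.
have s3 := smooth_fiber sg y sp sh'.
have b1 := bsupp_fiber h sg y bp; have b2 := bsupp_fiber h sg (y + e) bp.
have b3 := bsupp_fiber (derive1 h) sg y bp.
have s12 := smooth_add (smooth_scale (-1) s1) s2; have b12 := bsupp_lin (-1) b1 b2.
have -> : conv phi h sg b (y + e) - conv phi h sg b y - sg * conv phi (derive1 h) sg b y * e =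
    prim (fun x => - (sg * e) * fiber phi (derive1 h) sg y x + (-1 * fiber phi h sg y x + fiber phi h sg (y + e) x)) b.
  by rewrite (prim_add _ s3 b3 s12 b12) (prim_add _ s1 b1 s2 b2) /conv; ring.
rewrite mulrAC; apply: (prim_bound b (smooth_add (smooth_scale _ s3) s12) L0') => x.
  by move=> xL; rewrite /fiber hL //; ring.
have -> : - (sg * e) * fiber phi (derive1 h) sg y x + (-1 * fiber phi h sg y x + fiber phi h sg (y + e) x) =
    phi x * (h (sg * (y - x) + sg * e) - h (sg * (y - x)) - derive1 h (sg * (y - x)) * (sg * e)).
  by rewrite /fiber (_ : sg * (y + e - x) = sg * (y - x) + sg * e); ring.
have -> : Bp * (B * sg ^+ 2) * e ^+ 2 = Bp * (B * (sg * e) ^+ 2) by ring.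
rewrite normrM; apply: (ler_pM (normr_ge0 _) (normr_ge0 _) (hBp x)).
 exact: smooth_taylor sh (fun c _ => hB c).
Qed.

Lemma bounded_derivsn m h : bounded_derivs h -> bounded_derivs (derive1n m h).
Proof. by elim: m => [//|m IH] /IH hb; rewrite derive1nS; exact: bounded_derivs1. Qed.

Lemma smooth_conv phi h sg b : smooth phi -> bsupp phi -> smooth h -> bounded_derivs h ->
  smooth (conv phi h sg b).
Proof.
move=> sp bp sh bh.
have := @smooth_family R nat (fun m => conv phi (derive1n m h) sg b) _ 0%N; apply => m.
exists sg, m.+1, 0, 0%N => y; rewrite mul0r addr0 [X in conv _ X _ _ y]derive1nS.
exact: is_derive_conv (smooth_derive1n m sh) (bounded_derivsn m bh).
Qed.

#[local] Arguments smooth_conv {phi h} sg b _ _ _ _ _ _.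

Lemma derive1n_conv m phi h sg b y : smooth phi -> bsupp phi -> smooth h -> bounded_derivs h ->
  derive1n m (conv phi h sg b) y = sg ^+ m * conv phi (derive1n m h) sg b y.
Proof.
move=> sp bp; elim: m h y => [|m IH] h y sh bh; first by rewrite expr0 mul1r.
have e : derive1 (conv phi h sg b) = fun y => sg * conv phi (derive1 h) sg b y.
  by apply/funext => z; exact: is_derive1E (is_derive_conv sg b z sp bp sh bh).
have sh' := smooth_derive1 sh; have bh' := bounded_derivs1 bh.
rewrite !derive1Sn e (derive1nZ m sg (smooth_conv sg b sp bp sh' bh')) IH //.
by rewrite exprS mulrA.
Qed.

Lemma conv_parts phi h sg b y : smooth phi -> bsupp phi -> smooth h -> phi b = 0 ->
  sg * conv phi (derive1 h) sg b y = conv (derive1 phi) h sg b y.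
Proof.
move=> sp bp sh pb; have sh' := smooth_derive1 sh; have sp' := smooth_derive1 sp.
have bp' := bsupp_derive1 bp.
have s1 := smooth_fiber sg y sp sh; have b1 := bsupp_fiber h sg y bp.
have s2 := smooth_fiber sg y sp sh'; have b2 := bsupp_fiber (derive1 h) sg y bp.
have s3 := smooth_fiber sg y sp' sh; have b3 := bsupp_fiber h sg y bp'.
have e : derive1 (fiber phi h sg y) = fun x => - sg * fiber phi (derive1 h) sg y x + fiber (derive1 phi) h sg y x.
  by apply/funext => x; rewrite (is_derive1E (is_derive_fiber sg y x sp sh)); ring.
have := congr1 (fun F => F b) (prim_derive1 s1 b1).
rewrite e (prim_add _ s2 b2 s3 b3) /fiber pb mul0r oppr0 => /eqP.
by rewrite mulNr addrC subr_eq0 => /eqP <-.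
Qed.

(** Derivatives are moved onto phi, so that each derivative of an average is an average of a
    derivative; [pdf_concentration] then gives convergence in all orders. Flatness of phi at b
    removes the boundary terms. *)
Lemma derive1n_conv_parts m phi h sg b y : smooth phi -> bsupp phi -> smooth h -> bounded_derivs h ->
  (forall j, derive1n j phi b = 0) -> derive1n m (conv phi h sg b) y = conv (derive1n m phi) h sg b y.
Proof.
elim: m phi y => [//|m IH] phi y sp bp sh bh pb.
have e : derive1 (conv phi h sg b) = conv (derive1 phi) h sg b.
  apply/funext => z; rewrite (is_derive1E (is_derive_conv sg b z sp bp sh bh)).
  by apply: conv_parts => //; have := pb 0%N.
rewrite !derive1Sn e (IH _ y (smooth_derive1 sp) (bsupp_derive1 bp) sh bh) //.
by move=> j; rewrite -derive1Sn.
Qed.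

(** This takes the place of interchanging T with an integral: the mean value theorem in b recovers T
    of the average from the signs of [T (dil b sg h)]. *)
Lemma is_derive_conv_center T phi h sg b : cdist T -> smooth phi -> bsupp phi -> smooth h -> bounded_derivs h ->
  is_derive b 1 (fun b => T (conv phi h sg b)) (- phi b * T (dil b sg h)).
Proof.
move=> cT sp bp sh bh; rewrite -(cdistZ (- phi b) cT (smooth_dil_at b sg sh)).
have sd := smooth_scale (- phi b) (smooth_dil_at b sg sh).
apply: (@is_derive_functional R T (fun b => conv phi h sg b) _ b cT (fun c => smooth_conv sg c sp bp sh bh) sd).
move=> N L; have [B B0 hB] := bounded_derivs_le N.+1 bh.
have [A A0 hA] := bounded_derivs_le 1 (bsupp_bounded_derivs sp bp).
pose S := `|sg| + 1; have S1 : 1 <= S by rewrite lerDr.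
exists (S ^+ N * (A * B + S * (A * B))), 1; split => // e y _ _ m mN.
rewrite (derive1n_sub3 m e y (smooth_conv sg _ sp bp sh bh) (smooth_conv sg b sp bp sh bh) sd).
rewrite (derive1nZ m (- phi b) (smooth_dil_at b sg sh)) derive1n_dil_at // !derive1n_conv //.
have sf := smooth_fiber sg y sp (smooth_derive1n m sh).
have bf := bsupp_fiber (derive1n m h) sg y bp.
have [sF dF _] := primP sf bf; set F := prim (fiber phi (derive1n m h) sg y) in sF dF.
have -> : sg ^+ m * conv phi (derive1n m h) sg (b + e) y - sg ^+ m * conv phi (derive1n m h) sg b y -
    e * (- phi b * (sg ^+ m * derive1n m h (sg * (y - b)))) =
    sg ^+ m * (F (b + e) - F b - derive1 F b * e).
  by rewrite dF /fiber /conv -/F; ring.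
rewrite normrM -mulrA; apply: ler_pM => //.
  rewrite normrX; apply: (@le_trans _ _ (S ^+ m)); last exact: ler_weXn2l.
  by apply: lerXn2r; rewrite ?nnegrE // ?lerDl //; slra.
apply: smooth_taylor => // c _.
have -> : derive1n 2 F c = - (fiber (derive1 phi) (derive1n m h) sg y c - sg * fiber phi (derive1n m.+1 h) sg y c).
  rewrite derive1nS derive1n1 (_ : derive1 F = fun x => - fiber phi (derive1n m h) sg y x); last exact/funext.
  rewrite (is_derive1E (isdN (is_derive_fiber sg y c sp (smooth_derive1n m sh)))).
  by rewrite derive1nS.
rewrite normrN; apply: le_trans (ler_normB _ _) _; apply: lerD.
  rewrite normrM; apply: ler_pM => //; first exact: (hA c 1%N).
  by apply: (hB _ m); exact: leqW.
rewrite normrM; apply: ler_pM => //; first by rewrite /S lerDl.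
rewrite normrM; apply: ler_pM => //; first exact: (hA c 0%N).
exact: hB.
Qed.

Definition pos_on T p q : Prop := forall psi, smooth psi -> (forall y, 0 <= psi y) ->
  (forall y, (y <= p) || (q <= y) -> psi y = 0) -> 0 <= T psi.

(* psi is the limit of its Gaussian averages; differentiating in the endpoint b shows that T is
   nonnegative on them. *)
Lemma heat_positive T p q s0 : cdist T -> 0 < s0 ->
  (forall x s, p < x -> x < q -> 0 < s -> s < s0 -> 0 <= T (zoom x s g)) -> pos_on T p q.
Proof.
move=> cT s00 hpos psi sp psi0 psipq.
have sg := @smooth_gauss R 0; have bg := @bounded_derivs_gauss R 0.
pose L := `|p| + `|q|; have L0 : 0 <= L by rewrite addr_ge0.
have pL y : L < `|y| -> psi y = 0.
  move=> yL; apply: psipq; rewrite -(negbK (_ || _)) negb_or -!ltNge; apply/negP => /andP[y1 y2].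
  move: yL; rewrite ltNge => /negP; apply; rewrite ler_norml /L.
  have := ler_norm q; have := ler_norm (- p); rewrite normrN => ? ?.
  by have := normr_ge0 p; have := normr_ge0 q => *; apply/andP; split; slra.
have bp : bsupp psi by exists L.
have pd0 j : derive1n j psi (- (L + 1)) = 0.
  have o : [set z : R | L < `|z|] (- (L + 1)) by rewrite /= normrN ger0_norm; slra.
  rewrite (@derive1n_local R _ psi (fun=> 0) j (@open_far0 R L) pL _ o).
  by rewrite derive1n_cst; case: j.
have Apos s : 0 < s -> s < s0 -> 0 <= T (conv psi g s^-1 (- (L + 1))).
  move=> sp0 ss; have dA c := is_derive_conv_center s^-1 c cT sp bp sg bg.
  have A1 : T (conv psi g s^-1 (L + 1)) = 0.
    rewrite -[RHS](cdist0 cT); congr T; apply/funext => y.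
    have sf := smooth_fiber s^-1 y sp sg; have bf := bsupp_fiber g s^-1 y bp.
    apply: (@prim_right R (fiber psi g s^-1 y) _ L _ (primP sf bf)) => //; last slra.
    by move=> x xL; rewrite /fiber pL // mul0r.
  have cf : {within `[- (L + 1), L + 1], continuous (fun b => T (conv psi g s^-1 b))}.
    apply: continuous_subspaceT => z; apply: differentiable_continuous.
    by apply/derivable1_diffP; exact: is_derive1_ex (dA z).
  (* With endpoint [L + 1] the average is 0, so T of the full average is a positive multiple of
     [psi c] times the Gaussian average at a single point c. *)
  have [|c] := MVT (_ : - (L + 1) < L + 1) (fun y _ => dA y) cf; first slra.
  rewrite A1 sub0r => _ /eqP; rewrite eqr_oppLR => /eqP ->.
  rewrite mulNr mulNr opprK; apply: mulr_ge0; last slra.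
  have [pc|pc] := leP c p; first by rewrite psipq ?mul0r // pc.
  have [qc|qc] := leP q c; first by rewrite psipq ?mul0r // qc orbT.
  by apply: mulr_ge0 => //; rewrite -zoom_dil; exact: hpos.
have [_ [C [N [X [C0 X0 hC]]]]] := cT.
have [K K0 hK] : exists2 K, 0 <= K & forall m s y, (m <= N)%N -> 0 < s ->
    `|(\int[lebesgue_measure]_(x in setT) (derive1n m psi x * normal_pdf y s x))%R - derive1n m psi y| <= K * s.
  have bpm m : bsupp (derive1n m psi).
    by elim: m => [//|m IH]; rewrite derive1nS; exact: bsupp_derive1.
  elim: (N) => [|n [K K0 hK]].
    have [K K0 hK] := pdf_concentration sp bp; exists K => // m s y; rewrite leqn0 => /eqP ->; exact: hK.
  have [K' K'0 hK'] := pdf_concentration (smooth_derive1n n.+1 sp) (bpm n.+1).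
  exists (K + K'); first exact: addr_ge0.
  move=> m s y; rewrite leq_eqVlt mulrDl => /orP[/eqP ->|mn] ss.
    by apply: ler_wpDl; [rewrite mulr_ge0 // ltW|exact: hK'].
  by apply: ler_wpDr; [rewrite mulr_ge0 // ltW|exact: hK].
have close s : 0 < s -> `|normal_peak s * T (conv psi g s^-1 (- (L + 1))) - T psi| <= C * (K * s).
  move=> ss; have sc := smooth_conv s^-1 (- (L + 1)) sp bp sg bg.
  rewrite -(cdistZ _ cT sc) -(cdistB cT (smooth_scale _ sc) sp).
  apply: hC; first exact: smooth_sub (smooth_scale _ sc) sp.
  move=> y _ m mN; rewrite (derive1nB m (smooth_scale _ sc) sp) (derive1nZ m _ sc).
  rewrite (derive1n_conv_parts m s^-1 y sp bp sg bg pd0).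
  have spm := smooth_derive1n m sp.
  have pLm x : L < `|x| -> derive1n m psi x = 0.
    move=> xL; rewrite (@derive1n_local R _ psi (fun=> 0) m (@open_far0 R L) pL _ xL).
    by rewrite derive1n_cst; case: (m).
  have sf := smooth_fiber s^-1 y spm sg.
  have fL x : L < `|x| -> fiber (derive1n m psi) g s^-1 y x = 0.
    by move=> xL; rewrite /fiber pLm // mul0r.
  have bf : bsupp (fiber (derive1n m psi) g s^-1 y) by exists L.
  rewrite /conv (@prim_left R _ _ L sf L0 fL (primP sf bf)); last slra.
  rewrite (_ : _ * _ = (\int[lebesgue_measure]_(x in setT) (derive1n m psi x * normal_pdf y s x))%R).
    exact: hK.
  have -> : fiber (derive1n m psi) g s^-1 y = fun x => (normal_peak s)^-1 * (derive1n m psi x * normal_pdf y s x).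
    apply/funext => x; rewrite -(@gauss_normal_pdf R y s x) ?(lt0r_neq0 ss) // /fiber [in RHS]mulrCA mulKf //.
    exact: lt0r_neq0 (normal_peak_gt0 (lt0r_neq0 ss)).
  have ip := integrable_bsupp_pdf y ss spm (ex_intro _ L pLm : bsupp _).
  rewrite (@RintegralZl _ _ R lebesgue_measure setT _ _ measurableT ip) mulVKf //.
  exact: lt0r_neq0 (normal_peak_gt0 (lt0r_neq0 ss)).
rewrite leNgt; apply/negP => neg.
have CK : 0 <= C * K by exact: mulr_ge0.
have q0 : 0 < - T psi / (C * K + 1) by rewrite divr_gt0 ?oppr_gt0 //; slra.
pose s := Num.min s0 (- T psi / (C * K + 1)) / 2.
have m0 : 0 < Num.min s0 (- T psi / (C * K + 1)) by rewrite lt_min s00.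
have m1 : Num.min s0 (- T psi / (C * K + 1)) <= s0 by rewrite ge_min lexx.
have m2 : Num.min s0 (- T psi / (C * K + 1)) <= - T psi / (C * K + 1) by rewrite ge_min lexx orbT.
have ss : 0 < s by rewrite /s; slra.
have s1 : s < s0 by rewrite /s; slra.
have s2 : s < - T psi / (C * K + 1) by rewrite /s; slra.
have := close s ss; rewrite ler_norml => /andP[_ c1].
have a0 : 0 <= normal_peak s * T (conv psi g s^-1 (- (L + 1))).
  by apply: mulr_ge0; [exact: normal_peak_ge0|exact: Apos].
rewrite ltr_pdivlMr in s2; last slra.
have : C * K * s <= s * (C * K + 1) by rewrite mulrDr mulr1 [s * _]mulrC lerDl ltW.
by move: c1 a0 s2; rewrite mulrA; clear; lra.
Qed.

End ConvolutionPositivity.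

(** * Gaussian kernels cut off near an endpoint of a gap *)

Section CornerEstimate.
Context {R : realType}.
Implicit Types (D : (R -> R) -> R) (f h psi phi : R -> R) (x y z u b c d B C K L M X e w s xi tau eta v : R) (m n N k j : nat).

Notation g := (@gauss R 0).

(** One power more than the order: on the shell of radius [2^k] the weighted derivatives are then
    [O(2^-k)], which is summable. *)
Definition sdec N M f z : Prop := forall m, (m <= N)%N -> (1 + `|z|) ^+ N.+1 * `|derive1n m f z| <= M.

Lemma weight_ge1 N z : 1 <= (1 + `|z|) ^+ N.
Proof. by apply: exprn_ege1; rewrite lerDl. Qed.

Lemma sdec_derivs N M f z : sdec N M f z <-> derivs_le N (M / (1 + `|z|) ^+ N.+1) f z.
Proof.
have w0 : 0 < (1 + `|z|) ^+ N.+1 by apply: lt_le_trans (weight_ge1 N.+1 z).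
by split => h m mN; have := h m mN; rewrite ler_pdivlMr // mulrC.
Qed.

Lemma sdec_mul N M B f h z : smooth f -> smooth h -> sdec N M f z -> derivs_le N B h z ->
  sdec N (2 ^+ N * (M * B)) (fun y => f y * h y) z.
Proof.
move=> sf sh /sdec_derivs hf hh; apply/sdec_derivs.
apply: derivs_leW (derivs_leM sf sh hf hh) => //.
by rewrite le_eqVlt; apply/orP; left; apply/eqP; ring.
Qed.

Lemma sdec_le N M f z : 0 <= M -> sdec N M f z -> derivs_le N M f z.
Proof.
move=> M0 h m mN; apply: le_trans (h m mN); rewrite -[leLHS]mul1r.
by apply: ler_wpM2r => //; exact: weight_ge1.
Qed.

Lemma sdec_dil N M f ep z : `|ep| = 1 -> smooth f -> sdec N M f (ep * z) -> sdec N M (dil 0 ep f) z.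
Proof.
move=> e1 sf h m mN; rewrite derive1n_dil_at // subr0 normrM normrX e1 expr1n mul1r.
by have := h m mN; rewrite normrM e1 mul1r.
Qed.

Lemma sdec_bound D c : cdist D -> null_at D c -> exists C N, 0 <= C /\ forall tau f M,
  0 < tau -> tau <= 1 -> smooth f -> 0 <= M -> (forall z, sdec N M f z) -> `|D (zoom c tau f)| <= C * M.
Proof.
move=> cD nD; have [C [N [C0 hC]]] := tail_bound cD nD.
exists (C * (2 * 2 ^+ N.+1)), N; split; first by rewrite !mulr_ge0 ?exprn_ge0.
move=> tau f M t0 t1 sf M0 hf.
have q01 : 0 <= (2^-1 : R) < 1 by slra.
have M2 : 0 <= 2 ^+ N.+1 * M by rewrite mulr_ge0 ?exprn_ge0.
apply: le_trans (hC _ tau 2^-1 (2 ^+ N.+1 * M) 0%N t0 t1 q01 M2 (smooth_zoom c tau sf) _ _ _) _.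
- by [].
- move=> y _ yt; apply: (@wderivsW _ _ N N (1 ^+ N * M)) => //.
    by rewrite expr1n mul1r ler_peMl // exprn_ege1 // ler1n.
  apply: (wderivs_zoom sf t0) => //; rewrite ?mul1r //; first exact: ltW.
  exact: sdec_le.
- move=> k y _ k0 y1 y2 m mN; pose z := (y - c) / tau.
  have zE : `|z| = `|y - c| / tau by rewrite normrM normfV (gtr0_norm t0).
  have zk : 2 ^+ k / 2 <= `|z| by rewrite zE ler_pdivlMr // mulrAC ler_pdivrMr // mulrC [leRHS]mulrC.
  have -> : (tau * 2 ^+ k) ^+ m * `|derive1n m (zoom c tau f) y| = (2 ^+ k) ^+ m * `|derive1n m f z|.
    rewrite /zoom (derive1n_scal m c tau sf) normrM normrX normfV (gtr0_norm t0) -/z exprMn exprVn.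
    by field; rewrite expf_neq0 // gt_eqF.
  have kp : 0 < (2 : R) ^+ k by rewrite exprn_gt0.
  have k1 : 1 <= (2 : R) ^+ k by rewrite exprn_ege1 // ler1n.
  have h1 := hf z m mN.
  have h2 : (2 ^+ k / 2) ^+ N.+1 * `|derive1n m f z| <= M.
    apply: le_trans h1; apply: ler_wpM2r => //; apply: lerXn2r; rewrite ?nnegrE ?divr_ge0 //; slra.
  apply: (@le_trans _ _ ((2 ^+ k) ^+ N * `|derive1n m f z|)).
    by apply: ler_wpM2r => //; exact: ler_weXn2l.
  rewrite exprVn; have -> : (2 ^+ k) ^+ N * `|derive1n m f z| =
      2 ^+ N.+1 * ((2 ^+ k / 2) ^+ N.+1 * `|derive1n m f z|) * (2 ^+ k)^-1.
    by rewrite exprMn exprVn [(2 ^+ k) ^+ N.+1]exprS; field; rewrite ?expf_neq0 //= gt_eqF.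
  by apply: ler_wpM2r; [rewrite invr_ge0 ltW|apply: ler_wpM2l => //; rewrite exprn_ge0].
- rewrite expr0 mulr1; rewrite le_eqVlt; apply/orP; left; apply/eqP; field.
by [].
Qed.

Lemma gauss_derive_poly m k : exists2 C, 0 <= C & forall u,
  `|derive1n m (@gauss R k) u| <= C * (1 + `|u|) ^+ (m + k) * expR (- u ^+ 2 / 2).
Proof.
elim: m k => [|m IH] k.
  exists 1 => // u; rewrite mul1r normrM [`|expR _|]ger0_norm ?expR_ge0 // normrX.
  apply: ler_wpM2r; first exact: expR_ge0.
  by apply: lerXn2r; rewrite ?nnegrE ?addr_ge0 // lerDr.
have [C1 C10 h1] := IH k.-1; have [C2 C20 h2] := IH k.+1.
exists (k%:R * C1 + C2); first by rewrite addr_ge0 // mulr_ge0.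
move=> u; rewrite derive1Sn derive1_gauss.
rewrite (derive1nD m (smooth_scale _ (@smooth_gauss R k.-1)) (smooth_scale _ (@smooth_gauss R k.+1))).
rewrite (derive1nZ m _ (@smooth_gauss R k.-1)) (derive1nZ m _ (@smooth_gauss R k.+1)).
have E0 := expR_ge0 (- u ^+ 2 / 2).
have w1 : 1 <= 1 + `|u| by rewrite lerDl.
apply: le_trans (ler_normD _ _) _; rewrite !mulrDl; apply: lerD.
  rewrite normrM ger0_norm // -!mulrA; apply: ler_wpM2l => //.
  apply: le_trans (h1 u) _; rewrite -!mulrA; apply: ler_wpM2l => //; apply: ler_wpM2r => //.
  apply: ler_weXn2l => //; rewrite addSn; apply: leqW; rewrite leq_add2l; exact: leq_pred.
rewrite mulN1r normrN; apply: le_trans (h2 u) _.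
by rewrite addnS addSn.
Qed.

Lemma gauss_schwartz j m : exists2 C, 0 <= C & forall u, (1 + `|u|) ^+ j * `|derive1n m g u| <= C.
Proof.
have [C C0 hC] := @gauss_derive_decay_pow R m j; have [C' C'0 hC'] := @gauss_derive_decay_pow R m 0.
exists (2 ^+ j * (C + C')); first by rewrite mulr_ge0 ?exprn_ge0 ?addr_ge0.
move=> u; have E1 : expR (- u ^+ 2 / 8) <= 1.
  by rewrite -[leRHS]expR0 ler_expR; have := sqr_ge0 u; slra.
have h1 : `|u| ^+ j * `|derive1n m g u| <= C.
  by apply: le_trans (hC u) _; rewrite -[leRHS]mulr1; exact: ler_wpM2l.
have h2 : `|derive1n m g u| <= C'.
  by have := hC' u; rewrite expr0 mul1r => /le_trans; apply; rewrite -[leRHS]mulr1; exact: ler_wpM2l.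
have [u1|u1] := leP `|u| 1.
  apply: ler_pM => //.
    by apply: lerXn2r; rewrite ?nnegrE ?addr_ge0 //; slra.
  by apply: le_trans h2 _; rewrite lerDr.
apply: (@le_trans _ _ ((2 * `|u|) ^+ j * `|derive1n m g u|)).
  by apply: ler_wpM2r => //; apply: lerXn2r; rewrite ?nnegrE ?addr_ge0 ?mulr_ge0 //; slra.
rewrite exprMn -mulrA; apply: ler_wpM2l; first exact: exprn_ge0.
by apply: le_trans h1 _; rewrite lerDl.
Qed.

(** In units of the scale, with the endpoint of the gap at 0: the part of a Gaussian centred at [xi]
    that lies left of 2, which is what an average taken at distance [xi] inside the gap sees near
    the endpoint and beyond it. *)
Definition prof xi : R -> R := fun z => g (z - xi) * hstep (z - 2).

Definition shift xi f : R -> R := fun z => f (z - xi).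

Lemma smooth_shift xi f : smooth f -> smooth (shift xi f).
Proof.
move=> sf; have -> : shift xi f = fun z => f (1 * z + (- xi)) by apply/funext => z; rewrite /shift mul1r.
exact: smooth_affine 1 (- xi) sf.
Qed.
#[local] Arguments smooth_shift xi {f} _ _ _.

Lemma derive1n_shift m xi f z : smooth f -> derive1n m (shift xi f) z = derive1n m f (z - xi).
Proof.
move=> sf; have -> : shift xi f = fun z => f (1 * z + (- xi)) by apply/funext => y; rewrite /shift mul1r.
by rewrite derive1n_affine // expr1n !mul1r.
Qed.

Lemma shift_hstep_derivs N : exists2 B, 0 <= B & forall z, derivs_le N B (shift 2 (@hstep R)) z.
Proof.
have [B B0 hB] := @hstep_derivs R N; exists B => // z m mN.
by rewrite (derive1n_shift _ _ _ (@smooth_hstep R)); exact: hB.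
Qed.

Lemma smooth_prof xi : smooth (prof xi).
Proof. exact: smooth_mul (smooth_shift xi (@smooth_gauss R 0)) (smooth_shift 2 (@smooth_hstep R)). Qed.

Lemma prof_lip N X : 0 <= X -> exists2 C, 0 <= C & forall xi xi' z, 0 <= xi <= X -> 0 <= xi' <= X ->
  sdec N (C * `|xi - xi'|) (fun y => prof xi y - prof xi' y) z.
Proof.
move=> X0; have [B B0 hB] := shift_hstep_derivs N.
have [C C0 hC] : exists2 C, 0 <= C & forall m u, (m <= N)%N -> (1 + `|u|) ^+ N.+1 * `|derive1n m.+1 g u| <= C.
  elim: {-2}N => [|n [C C0 hC]].
    by have [C C0 hC] := gauss_schwartz N.+1 1; exists C => // m u; rewrite leqn0 => /eqP ->; exact: hC.
  have [C' C'0 hC'] := gauss_schwartz N.+1 n.+2; exists (C + C'); first exact: addr_ge0.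
  move=> m u; rewrite leq_eqVlt => /orP[/eqP ->|mn].
    by apply: le_trans (hC' u) _; rewrite lerDr.
  by apply: le_trans (hC m u mn) _; rewrite lerDl.
pose K := (1 + 2 * X) ^+ N.+1; have K0 : 0 <= K by rewrite exprn_ge0 //; slra.
exists (2 ^+ N * (K * C * B)); first by apply: mulr_ge0; [exact: exprn_ge0|apply: mulr_ge0 => //; exact: mulr_ge0].
move=> xi xi' z /andP[x0 xX] /andP[x'0 x'X].
have sg := @smooth_gauss R 0.
have s1 := smooth_sub (smooth_shift xi sg) (smooth_shift xi' sg).
have -> : (fun y => prof xi y - prof xi' y) = fun y => (shift xi g y - shift xi' g y) * shift 2 (@hstep R) y.
  by apply/funext => y; rewrite /prof /shift; ring.
have -> : 2 ^+ N * (K * C * B) * `|xi - xi'| = 2 ^+ N * (K * C * `|xi - xi'| * B) by ring.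
apply: (sdec_mul s1 (smooth_shift 2 (@smooth_hstep R))) (hB z) => m mN.
rewrite (derive1nB m (smooth_shift xi sg) (smooth_shift xi' sg)) !derive1n_shift //.
have [c cx e] := @mean_value R (derive1n m g) (z - xi') (xi' - xi) (smooth_derive1n m sg).
rewrite (_ : z - xi' + (xi' - xi) = z - xi) in e; last by ring.
rewrite e -derive1nS normrM [`|xi' - xi|]distrC mulrCA mulrC; apply: ler_wpM2r => //.
have zc : `|z| <= `|c| + 2 * X.
  have -> : z = c - (c - (z - xi')) + xi' by ring.
  apply: le_trans (ler_normD _ _) _; rewrite [`|xi'|]ger0_norm //.
  have := ler_normB c (c - (z - xi')); have : `|xi' - xi| <= X by rewrite ler_norml; apply/andP; split; slra.
  by move: cx x'X; clear; lra.
apply: (@le_trans _ _ (K * ((1 + `|c|) ^+ N.+1 * `|derive1n m.+1 g c|))).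
  rewrite mulrA /K -exprMn; apply: ler_wpM2r => //; apply: lerXn2r; rewrite ?nnegrE ?mulr_ge0 ?addr_ge0 ?mulr_ge0 //.
  by have := normr_ge0 c; nra.
by apply: ler_wpM2l => //; exact: hC.
Qed.

Lemma prof_dec N xi : exists2 M, 0 <= M & forall z, sdec N M (prof xi) z.
Proof.
have [B B0 hB] := shift_hstep_derivs N.
have [C C0 hC] : exists2 C, 0 <= C & forall m u, (m <= N)%N -> (1 + `|u|) ^+ N.+1 * `|derive1n m g u| <= C.
  elim: {-2}N => [|n [C C0 hC]].
    by have [C C0 hC] := gauss_schwartz N.+1 0; exists C => // m u; rewrite leqn0 => /eqP ->; exact: hC.
  have [C' C'0 hC'] := gauss_schwartz N.+1 n.+1; exists (C + C'); first exact: addr_ge0.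
  move=> m u; rewrite leq_eqVlt => /orP[/eqP ->|mn].
    by apply: le_trans (hC' u) _; rewrite lerDr.
  by apply: le_trans (hC m u mn) _; rewrite lerDl.
exists (2 ^+ N * ((1 + `|xi|) ^+ N.+1 * C * B)).
  by rewrite !mulr_ge0 ?exprn_ge0 ?addr_ge0.
move=> z; apply: (sdec_mul (smooth_shift xi (@smooth_gauss R 0)) (smooth_shift 2 (@smooth_hstep R))) (hB z) => m mN.
rewrite derive1n_shift; last exact: smooth_gauss.
apply: (@le_trans _ _ ((1 + `|xi|) ^+ N.+1 * ((1 + `|z - xi|) ^+ N.+1 * `|derive1n m g (z - xi)|))).
  rewrite mulrA -exprMn; apply: ler_wpM2r => //; apply: lerXn2r; rewrite ?nnegrE ?mulr_ge0 ?addr_ge0 //.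
  have := ler_normD (z - xi) xi; rewrite subrK; have := normr_ge0 xi; have := normr_ge0 (z - xi); nra.
by apply: ler_wpM2l; [rewrite exprn_ge0 ?addr_ge0|exact: hC].
Qed.

Lemma sdec_tdec N M f : 0 <= M -> (forall z, sdec N M f z) -> tdec (-1) N M f.
Proof.
move=> M0 h z z1 m mN; have z0 : 0 < `|z| by slra.
rewrite powR_inv1; last exact: ltW.
rewrite ler_pdivlMr //; apply: le_trans (h z m mN).
rewrite mulrAC; apply: ler_wpM2r => //; rewrite -exprSr.
apply: (@le_trans _ _ (`|z| ^+ N.+1)); first exact: ler_weXn2l.
by apply: lerXn2r; rewrite ?nnegrE ?addr_ge0 // lerDr.
Qed.

Lemma expR_poly N : exists2 C, 0 <= C & forall v, 0 <= v -> (1 + v) ^+ N <= C * expR (v / 2).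
Proof.
exists (2 ^+ N * (N`!%:R * expR (1 / 2))); first by rewrite !mulr_ge0 ?exprn_ge0 ?expR_ge0.
move=> v v0; have h := @expR_ge_pow R ((1 + v) / 2) N _.
have -> : (1 + v) ^+ N = 2 ^+ N * ((1 + v) / 2) ^+ N by rewrite -exprMn; congr (_ ^+ _); field.
rewrite -!mulrA; apply: ler_wpM2l; first exact: exprn_ge0.
rewrite -expRD (_ : 1 / 2 + v / 2 = (1 + v) / 2); last by field.
by apply: h; slra.
Qed.

Lemma gauss_poly k : exists2 C, 0 <= C & forall w, 1 <= w -> (1 + w) ^+ k * expR (- w ^+ 2 / 2) <= C.
Proof.
have [|C C0 hC] := @pow_le_expR2 R k (1 / 2); first by slra.
exists (2 ^+ k * C); first by rewrite mulr_ge0 ?exprn_ge0.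
move=> w w1; have := hC w; rewrite ger0_norm; last slra; move=> h.
apply: (@le_trans _ _ ((2 * w) ^+ k * expR (- w ^+ 2 / 2))).
  by apply: ler_wpM2r; [exact: expR_ge0|apply: lerXn2r; rewrite ?nnegrE; slra].
rewrite exprMn -mulrA; apply: ler_wpM2l; first exact: exprn_ge0.
apply: (@le_trans _ _ (C * expR (1 / 2 * w ^+ 2) * expR (- w ^+ 2 / 2))).
  by apply: ler_wpM2r => //; exact: expR_ge0.
rewrite -mulrA -expRD (_ : _ + _ = 0) ?expR0 ?mulr1 //; by field.
Qed.

(** With [v = xi - 3] and [w = 3 - z] the cutoff leaves only [w >= 1], so
    [(v + w)^2 >= v^2 + w^2 + 2 v]. Of the resulting factor [exp(- v)], one half absorbs the
    polynomial in v and the other half is kept as a gain. *)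
Lemma prof_far N : exists2 C, 0 <= C & forall xi z, 3 <= xi ->
  sdec N (C * expR (- (xi - 3) / 2) * expR (- (xi - 3) ^+ 2 / 2)) (prof xi) z.
Proof.
have [B B0 hB] := shift_hstep_derivs N.
have [A A0 hA] : exists2 A, 0 <= A & forall m u, (m <= N)%N ->
    `|derive1n m g u| <= A * (1 + `|u|) ^+ N * expR (- u ^+ 2 / 2).
  have w1 u : 1 <= 1 + `|u| by rewrite lerDl.
  have one m : (m <= N)%N -> exists2 A, 0 <= A & forall u, `|derive1n m g u| <= A * (1 + `|u|) ^+ N * expR (- u ^+ 2 / 2).
    move=> mN; have [A A0 hA] := gauss_derive_poly m 0; exists A => // u; apply: le_trans (hA u) _.
    apply: ler_wpM2r; first exact: expR_ge0.
    by apply: ler_wpM2l => //; apply: ler_weXn2l => //; rewrite addn0.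
  have : forall n, (n <= N)%N -> exists2 A, 0 <= A & forall m u, (m <= n)%N ->
    `|derive1n m g u| <= A * (1 + `|u|) ^+ N * expR (- u ^+ 2 / 2).
    elim => [|n IH] nN.
      by have [A A0 hA] := one 0%N nN; exists A => // m u; rewrite leqn0 => /eqP ->; exact: hA.
    have [A A0 hA] := IH (ltnW nN); have [A' A'0 hA'] := one n.+1 nN.
    exists (A + A'); first exact: addr_ge0.
    move=> m u; rewrite leq_eqVlt => /orP[/eqP ->|mn].
      apply: le_trans (hA' u) _; apply: ler_wpM2r; first exact: expR_ge0.
      by apply: ler_wpM2r; rewrite ?exprn_ge0 ?addr_ge0 // lerDr.
    apply: le_trans (hA m u mn) _; apply: ler_wpM2r; first exact: expR_ge0.
    by apply: ler_wpM2r; rewrite ?exprn_ge0 ?addr_ge0 // lerDl.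
  by move=> /(_ N (leqnn N)).
have [C1 C10 h1] := expR_poly N; have [C2 C20 h2] := gauss_poly (N.+1 + N).
exists (2 ^+ N * (4 ^+ N.+1 * (A * (C1 * C2)) * B)).
  by rewrite !mulr_ge0 ?exprn_ge0.
move=> xi z xi3; pose v := xi - 3; have v0 : 0 <= v by rewrite subr_ge0.
have E1 := expR_ge0 (- v / 2); have E2 := expR_ge0 (- v ^+ 2 / 2).
have [z2|z2] := ltP 2 z.
  move=> m mN; have o : open [set y : R | 2 < y] by exact: open_gt.
  rewrite (@derive1n_local R _ (prof xi) (fun=> 0) m o _ z z2).
    rewrite derive1n_cst; have -> : (if m is 0 then 0 else 0) = 0 :> R by case: (m).
    by rewrite normr0 mulr0 !mulr_ge0 ?exprn_ge0.
  by move=> y /= y2; rewrite /prof hstep0 ?mulr0 //; slra.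
rewrite -/v.
have -> : 2 ^+ N * (4 ^+ N.+1 * (A * (C1 * C2)) * B) * expR (- v / 2) * expR (- v ^+ 2 / 2) =
  2 ^+ N * (4 ^+ N.+1 * (A * (C1 * C2 * (expR (- v / 2) * expR (- v ^+ 2 / 2)))) * B) by ring.
apply: (sdec_mul (smooth_shift xi (@smooth_gauss R 0)) (smooth_shift 2 (@smooth_hstep R))) (hB z) => m mN.
rewrite derive1n_shift; last exact: smooth_gauss.
pose w := 3 - z; have w1 : 1 <= w by rewrite /w; slra.
have zw : 1 + `|z| <= 4 * (1 + w).
  have : `|z| <= w + 3 by rewrite ler_norml /w; apply/andP; split; slra.
  by move: w1; clear; lra.
have uE : z - xi = - (v + w) by rewrite /v /w; ring.
have := hA m (z - xi) mN; rewrite uE normrN sqrrN [`|v + w|]ger0_norm; last slra.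
move=> h3.
have h4 : (1 + (v + w)) ^+ N <= (1 + v) ^+ N * (1 + w) ^+ N.
  by rewrite -exprMn; apply: lerXn2r; rewrite ?nnegrE ?mulr_ge0; nra.
have h5 : expR (- (v + w) ^+ 2 / 2) <= expR (- v ^+ 2 / 2) * (expR (- v / 2) * expR (- v / 2)) * expR (- w ^+ 2 / 2).
  by rewrite -!expRD ler_expR; move: v0 w1; clear; nra.
apply: (@le_trans _ _ (4 ^+ N.+1 * (1 + w) ^+ N.+1 *
   (A * ((1 + v) ^+ N * (1 + w) ^+ N) * (expR (- v ^+ 2 / 2) * (expR (- v / 2) * expR (- v / 2)) * expR (- w ^+ 2 / 2))))).
  apply: ler_pM => //.
    by rewrite -exprMn; apply: lerXn2r; rewrite ?nnegrE //; have := normr_ge0 z; slra.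
  apply: le_trans h3 _; apply: ler_pM => //.
  - by rewrite mulr_ge0 // exprn_ge0 //; slra.
  - exact: ler_wpM2l.
have h6 := h1 v v0; have h7 := h2 w w1.
have -> : 4 ^+ N.+1 * (1 + w) ^+ N.+1 *
   (A * ((1 + v) ^+ N * (1 + w) ^+ N) * (expR (- v ^+ 2 / 2) * (expR (- v / 2) * expR (- v / 2)) * expR (- w ^+ 2 / 2))) =
   4 ^+ N.+1 * (A * ((((1 + v) ^+ N * expR (- v / 2)) * ((1 + w) ^+ (N.+1 + N) * expR (- w ^+ 2 / 2))) *
     (expR (- v / 2) * expR (- v ^+ 2 / 2)))).
  by rewrite exprD; ring.
apply: ler_wpM2l; first exact: exprn_ge0.
apply: ler_wpM2l => //; apply: ler_wpM2r; first by rewrite mulr_ge0.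
apply: ler_pM => //.
- by rewrite mulr_ge0 // exprn_ge0 //; slra.
- by rewrite mulr_ge0 ?expR_ge0 // exprn_ge0 //; slra.
rewrite mulNr expRN ler_pdivrMr ?expR_gt0 //.
Qed.

Lemma prof_cvg D c ep xi : cdist D -> null_at D c -> `|ep| = 1 ->
  D (zoom c s (dil 0 ep (prof xi))) @[s --> 0^'+] --> 0.
Proof.
move=> cD nD e1; have sp := @smooth_prof xi.
apply: (@decay_cvg0 R D c (dil 0 ep (prof xi)) (-1) cD nD (smooth_dil_at 0 ep sp)); first slra.
move=> N; have [M M0 hM] := prof_dec N xi; exists M => //.
by apply: (sdec_tdec M0) => z; exact: (sdec_dil e1 sp).
Qed.

(** For centres beyond some X the gain in [prof_far] beats all constants. For [xi] in [[0, X]] each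
    single profile tends to 0, and Lipschitz dependence on [xi] makes this uniform by compactness.
    The error has the shape of a Gaussian centred at 3, which a point mass at distance [3 tau]
    inside the gap can compensate. *)
Lemma corner_estimate D c ep : cdist D -> null_at D c -> `|ep| = 1 -> forall eta, 0 < eta ->
  exists2 d, 0 < d & forall tau xi, 0 < tau -> tau < d -> 0 <= xi ->
    `|D (zoom c tau (dil 0 ep (prof xi)))| <= eta * expR (- (xi - 3) ^+ 2 / 2).
Proof.
move=> cD nD e1 eta eta0; have [C [N [C0 hC]]] := sdec_bound cD nD.
have [A A0 hA] := prof_far N.
have [X X3 hX] : exists2 X, 3 <= X & C * A * expR (- (X - 3) / 2) <= eta.
  exists (3 + 2 * (C * A / eta)); first by rewrite lerDl mulr_ge0 // divr_ge0 ?mulr_ge0 // ltW.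
  rewrite (_ : - (3 + 2 * (C * A / eta) - 3) / 2 = - (C * A / eta)); last by field; rewrite gt_eqF.
  rewrite expRN ler_pdivrMr ?expR_gt0 //.
  have := @expR_ge1Dx R (C * A / eta) => h.
  apply: (@le_trans _ _ (eta * (C * A / eta))); first by rewrite mulrCA mulfV ?mulr1 // gt_eqF.
  by apply: ler_wpM2l; [exact: ltW|slra].
have X0 : 0 <= X by slra.
(* A lower bound of the Gaussian factor in the conclusion for all [xi] in [[0, X]]. *)
pose m0 := expR (- (X + 3) ^+ 2 / 2); have m00 : 0 < m0 by exact: expR_gt0.
have [Li Li0 hLi] := prof_lip N X0.
have em : 0 < eta * m0 / 2 by rewrite divr_gt0 // mulr_gt0.
have small : exists2 d, 0 < d & forall tau xi, 0 < tau -> tau < d -> 0 <= xi -> xi <= X ->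
    `|D (zoom c tau (dil 0 ep (prof xi)))| <= eta * m0.
  pose Gl (u v : R) := exists2 d, 0 < d & forall tau xi, 0 < tau -> tau < d -> u <= xi -> xi <= v ->
    `|D (zoom c tau (dil 0 ep (prof xi)))| <= eta * m0.
  apply: (@cousin R Gl 0 X); first slra.
    move=> u v u0 uv vX [d1 d10 hd1] [d2 d20 hd2]; exists (Num.min d1 d2); first by rewrite lt_min d10.
    move=> tau xi t0; rewrite lt_min => /andP[td1 td2] x1 x2.
    have [h|h] := leP xi (u + 2 / 3 * (v - u)); first exact: hd1.
    by apply: hd2 => //; slra.
  move=> xi0 /andP[x0 xX]; have CL : 0 < C * Li + 1 by rewrite ltr_wpDl // mulr_ge0.
  exists (eta * m0 / 2 / (C * Li + 1)); first exact: divr_gt0.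
  move=> u v u0 vX xu uv vx.
  have /right0P/(_ _ em)[d d0 hd] := prof_cvg xi0 cD nD e1.
  exists (Num.min d 1); first by rewrite lt_min d0 ltr01.
  move=> tau xi t0; rewrite lt_min => /andP[td t1] x1 x2.
  have s1 := @smooth_prof xi; have s2 := @smooth_prof xi0.
  have sz1 := smooth_zoom c tau (smooth_dil_at 0 ep s1).
  have sz2 := smooth_zoom c tau (smooth_dil_at 0 ep s2).
  have hb : `|D (zoom c tau (dil 0 ep (prof xi))) - D (zoom c tau (dil 0 ep (prof xi0)))| <= C * (Li * `|xi - xi0|).
    rewrite -(cdistB cD sz1 sz2).
    have -> : (fun y => zoom c tau (dil 0 ep (prof xi)) y - zoom c tau (dil 0 ep (prof xi0)) y) =
      zoom c tau (dil 0 ep (fun z => prof xi z - prof xi0 z)) by [].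
    have sB := smooth_sub s1 s2.
    apply: (hC tau _ _ t0 (ltW t1) (smooth_dil_at 0 ep sB)); first by rewrite mulr_ge0.
    move=> z; apply: (sdec_dil e1 sB); apply: hLi; last exact/andP.
    by apply/andP; split; slra.
  have := hd tau t0 td; rewrite subr0 => h0.
  have xx : `|xi - xi0| <= eta * m0 / 2 / (C * Li + 1).
    by rewrite ler_norml; apply/andP; split; slra.
  have h1 : C * (Li * `|xi - xi0|) <= eta * m0 / 2.
    rewrite mulrA; apply: (@le_trans _ _ ((C * Li + 1) * `|xi - xi0|)).
      by apply: ler_wpM2r; rewrite // lerDl.
    by move: xx; rewrite ler_pdivlMr // mulrC.
  set p := D _ in hb *; set q := D _ in hb h0.
  have -> : p = (p - q) + q by ring.
  apply: le_trans (ler_normD _ _) _; move: hb h0 h1; clear; lra.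
have [d d0 hd] := small; exists (Num.min d 1); first by rewrite lt_min d0 ltr01.
move=> tau xi t0; rewrite lt_min => /andP[td t1] x0.
have [xX|Xx] := leP xi X.
  apply: le_trans (hd tau xi t0 td x0 xX) _; apply: ler_wpM2l; first exact: ltW.
  rewrite ler_expR; suff : (xi - 3) ^+ 2 <= (X + 3) ^+ 2 by slra.
  rewrite -[leLHS]ger0_norm ?sqr_ge0 // normrX; apply: lerXn2r; rewrite ?nnegrE //; first slra.
  by rewrite ler_norml; apply/andP; split; slra.
have x3 : 3 <= xi by slra.
pose M := A * expR (- (xi - 3) / 2) * expR (- (xi - 3) ^+ 2 / 2).
have M0 : 0 <= M by rewrite !mulr_ge0 ?expR_ge0.
have sp := @smooth_prof xi.
have hM z : sdec N M (dil 0 ep (prof xi)) z by apply: (sdec_dil e1 sp); exact: hA.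
apply: le_trans (hC tau _ M t0 (ltW t1) (smooth_dil_at 0 ep sp) M0 hM) _.
rewrite /M !mulrA; apply: ler_wpM2r; first exact: expR_ge0.
apply: le_trans hX; apply: ler_wpM2l; first exact: mulr_ge0.
by rewrite ler_expR; slra.
Qed.

End CornerEstimate.

(** * Local positivity, and averages inside a gap of the bad set *)

Section PositivityCore.
Context {R : realType}.
Implicit Types (T D mu : (R -> R) -> R) (f h psi phi : R -> R) (x y z u b c d B C K L M e w s p q tau eta v : R) (m n N k j : nat).

Notation g := (@gauss R 0).

Lemma cdist_add D mu : cdist D -> cdist mu -> cdist (fun psi => D psi + mu psi).
Proof.
move=> [D1 [C1 [N1 [L1 [C10 L10 h1]]]]] [M1 [C2 [N2 [L2 [C20 L20 h2]]]]]; split.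
  by move=> c f h sf sh; rewrite D1 // M1 //; ring.
exists (C1 + C2), (maxn N1 N2), (Num.max L1 L2); split.
- exact: addr_ge0.
- by rewrite lt_max L10.
move=> f M sf hM; apply: le_trans (ler_normD _ _) _; rewrite mulrDl; apply: lerD.
  apply: (h1 f M sf) => y yL; apply: derivs_leW (hM y _); rewrite ?leq_maxl //.
  by rewrite le_max yL.
apply: (h2 f M sf) => y yL; apply: derivs_leW (hM y _); rewrite ?leq_maxr //.
by rewrite le_max yL orbT.
Qed.

Lemma cdist_eval c z : 0 <= c -> cdist (fun psi => c * psi z).
Proof.
move=> c0; split; first by move=> k f h _ _; ring.
exists c, 0%N, (`|z| + 1); split => //.
move=> f M sf hM; rewrite normrM ger0_norm //; apply: ler_wpM2l => //.
by apply: (hM z _ 0%N) => //; rewrite lerDl.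
Qed.

Definition positive_at T x : Prop := exists2 d, 0 < d & pos_on T (x - d) (x + d).

Lemma pos_on_sub T p q p' q' : p <= p' -> q' <= q -> pos_on T p q -> pos_on T p' q'.
Proof.
move=> pp qq h psi sp psi0 hz; apply: h => // y /orP[yp|yq]; apply: hz; apply/orP.
  by left; exact: le_trans pp.
by right; exact: le_trans yq.
Qed.

Lemma pos_on_gluing T p q : cdist T -> p < q -> (forall x, p <= x <= q -> positive_at T x) -> pos_on T p q.
Proof.
move=> cT pq hx psi sp psi0 hz.
pose Q f := (forall y, 0 <= f y) -> 0 <= T f.
apply: (@local_gluing R Q p q pq) psi sp hz psi0.
  move=> f F sf sF F01 Q1 Q2 f0; have s1F := smooth_sub (smooth_const 1) sF.
  have -> : f = fun y => f y * (1 - F y) + f y * F y by apply/funext => y; ring.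
  rewrite (cdistD cT (smooth_mul sf s1F) (smooth_mul sf sF)); apply: addr_ge0.
    by apply: Q1 => y; apply: mulr_ge0 => //; rewrite subr_ge0; have /andP[] := F01 y.
  by apply: Q2 => y; apply: mulr_ge0 => //; have /andP[] := F01 y.
move=> x px; have [d d0 hd] := hx x px; exists d => // psi sp hz psi0.
apply: hd => // y /orP[yd|yd]; apply: hz; rewrite ler_normr; apply/orP; [right|left]; slra.
Qed.

Lemma positive_at_open T x : positive_at T x -> exists2 d, 0 < d & forall y, `|y - x| < d -> positive_at T y.
Proof.
move=> [d d0 hd]; exists (d / 2); first by rewrite divr_gt0.
move=> y; rewrite ltr_norml => /andP[y1 y2]; exists (d / 2); first by rewrite divr_gt0.
by apply: pos_on_sub hd; slra.
Qed.

Section Core.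
Variables (D mu : (R -> R) -> R).
Hypotheses (cD : cdist D) (nD : forall x, null_at D x) (cmu : cdist mu)
  (mu_ge0 : forall psi, smooth psi -> (forall y, 0 <= psi y) -> 0 <= mu psi).

Let T psi := D psi + mu psi.
Let cT : cdist T := cdist_add cD cmu.

Lemma T_lower psi e : smooth psi -> (forall y, 0 <= psi y) -> `|D psi| <= e -> - e <= T psi.
Proof.
move=> sp p0; rewrite ler_norml => /andP[h _].
by apply: le_trans h _; rewrite /T lerDl; exact: mu_ge0.
Qed.

(** The test function is cut off near x: away from x positivity is known on both sides, and on the
    core D is small by nullness of its product with psi, while mu is nonnegative. *)
Lemma positive_not_isolated x d : 0 < d -> (forall y, y != x -> `|y - x| < d -> positive_at T y) ->
  positive_at T x.
Proof.
move=> d0 hy; exists (d / 2); first by rewrite divr_gt0.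
move=> psi sp psi0 hz; rewrite -[leLHS]oppr0 lerNl; apply/ler_addgt0Pr => e e0; rewrite add0r lerNl.
have [d' d'0 hd'] := null_at_mul cD (nD x) sp (@smooth_bump R) (fun y (y2 : 2 < `|y|) => @bump0 R y (ltW y2)) e0.
pose s := Num.min d' (d / 2) / 2.
have m0 : 0 < Num.min d' (d / 2) by rewrite lt_min d'0 divr_gt0.
have m1 : Num.min d' (d / 2) <= d' by rewrite ge_min lexx.
have m2 : Num.min d' (d / 2) <= d / 2 by rewrite ge_min lexx orbT.
have s0 : 0 < s by rewrite /s; slra.
have sd' : s < d' by rewrite /s; slra.
have sd : s < d / 2 by rewrite /s; slra.
pose kap := zoom x s (@bump R); have sk : smooth kap := smooth_zoom x s (@smooth_bump R).
have k01 y : 0 <= kap y <= 1 by exact: bump_itv.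
have k1 y : `|y - x| <= s -> kap y = 1.
  by move=> h; rewrite /kap /zoom bump1 // normrM normfV (gtr0_norm s0) ler_pdivrMr // mul1r.
(* Separates the pieces left and right of x; its transition lies where [1 - kap] vanishes, so
   neither piece touches x. *)
pose r := ramp (x - s / 2) (x + s / 2); have sr : smooth r := @smooth_ramp R _ _.
have ss : x - s / 2 < x + s / 2 by slra.
have r01 y : 0 <= r y <= 1 by exact: ramp_itv.
have s1k := smooth_sub (smooth_const 1) sk; have s1r := smooth_sub (smooth_const 1) sr.
have sA := smooth_mul (smooth_mul sp s1k) sr; have sB := smooth_mul (smooth_mul sp s1k) s1r.
have sC := smooth_mul sp sk.
have eT : T psi = T (fun y => psi y * (1 - kap y) * r y) + T (fun y => psi y * (1 - kap y) * (1 - r y)) +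
    T (fun y => psi y * kap y).
  rewrite -(cdistD cT sA sB) -(cdistD cT (smooth_add sA sB) sC); congr T; apply/funext => y; ring.
have k2 y : 0 <= psi y * (1 - kap y).
  by rewrite mulr_ge0 // subr_ge0; have /andP[] := k01 y.
have tA : 0 <= T (fun y => psi y * (1 - kap y) * r y).
  have pA : pos_on T (x + s) (x + d / 2).
    apply: pos_on_gluing => //; first slra.
    move=> y /andP[y1 y2]; apply: hy; first by rewrite gt_eqF //; slra.
    by rewrite ger0_norm; slra.
  apply: pA sA _ _ => y; first by apply: mulr_ge0 => //; have /andP[] := r01 y.
  move=> /orP[ys|yd]; last by rewrite hz ?mul0r // yd orbT.
  have [yr|yr] := leP y (x - s / 2); first by rewrite /r ramp0 ?mulr0.
  by rewrite k1 ?subrr ?mulr0 ?mul0r // ler_norml; apply/andP; split; slra.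
have tB : 0 <= T (fun y => psi y * (1 - kap y) * (1 - r y)).
  have pB : pos_on T (x - d / 2) (x - s).
    apply: pos_on_gluing => //; first slra.
    move=> y /andP[y1 y2]; apply: hy; first by rewrite lt_eqF //; slra.
    by rewrite ler0_norm; slra.
  apply: pB sB _ _ => y; first by apply: mulr_ge0 => //; rewrite subr_ge0; have /andP[] := r01 y.
  move=> /orP[yd|ys]; first by rewrite hz ?mul0r // yd.
  have [yr|yr] := leP (x + s / 2) y; first by rewrite /r ramp1 ?subrr ?mulr0.
  by rewrite k1 ?subrr ?mulr0 ?mul0r // ler_norml; apply/andP; split; slra.
have tC : - e <= T (fun y => psi y * kap y).
  apply: T_lower sC _ (hd' s s0 sd') => y; rewrite mulr_ge0 //; by have /andP[] := k01 y.
by rewrite eT; slra.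
Qed.

(** The kernel is split into its parts left of [c + 2 tau] and right of [d - 2 tau] and a middle
    part living strictly inside the gap. The middle part is nonnegative under T, and the other two
    fall under [corner_estimate]. *)
Lemma initial_estimate c d : c < d ->
  (forall p q, c < p -> p < q -> q < d -> pos_on T p q) -> forall eta, 0 < eta ->
  exists2 t0, 0 < t0 & forall tau x, 0 < tau -> tau < t0 -> c <= x -> x <= d ->
    - (eta * g ((x - c) / tau - 3) + eta * g ((d - x) / tau - 3)) <= T (zoom x tau g).
Proof.
move=> cd hcd eta eta0.
have n1 : `|1 : R| = 1 by rewrite normr1.
have n2 : `|-1 : R| = 1 by rewrite normrN normr1.
have [d1 d10 h1] := corner_estimate cD (nD c) n1 eta0.
have [d2 d20 h2] := corner_estimate cD (nD d) n2 eta0.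
(* The last bound keeps the transition zones of the two cutoffs apart. *)
exists (Num.min (Num.min d1 d2) ((d - c) / 8)).
  by rewrite !lt_min d10 d20 divr_gt0 // subr_gt0.
move=> tau x t0; rewrite !lt_min => /andP[/andP[td1 td2] tcd] cx xd.
have tn : tau != 0 by rewrite gt_eqF.
pose A1 := zoom c tau (dil 0 1 (prof ((x - c) / tau))).
pose A2 := zoom d tau (dil 0 (-1) (prof ((d - x) / tau))).
pose hc y := hstep ((y - c) / tau - 2) : R; pose hd y := hstep ((d - y) / tau - 2) : R.
have eA1 y : A1 y = zoom x tau g y * hc y.
  rewrite /A1 /zoom /dil /prof /hc; congr (g _ * hstep _); field => //.
have gE z : g (- z) = g z by rewrite /gauss !expr0 sqrrN.
have eA2 y : A2 y = zoom x tau g y * hd y.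
  rewrite /A2 /zoom /dil /prof /hd -gE; congr (g _ * hstep _); field => //.
have sG : smooth (zoom x tau g) := smooth_zoom x tau (@smooth_gauss R 0).
have sA1 : smooth A1 := smooth_zoom c tau (smooth_dil_at 0 1 (@smooth_prof R _)).
have sA2 : smooth A2 := smooth_zoom d tau (smooth_dil_at 0 (-1) (@smooth_prof R _)).
pose A3 y := zoom x tau g y - A1 y - A2 y.
have sA3 : smooth A3 := smooth_sub (smooth_sub sG sA1) sA2.
have eG : T (zoom x tau g) = T A1 + T A2 + T A3.
  rewrite -(cdistD cT sA1 sA2) -(cdistD cT (smooth_add sA1 sA2) sA3).
  by congr T; apply/funext => y; rewrite /A3; ring.
have g0 z : 0 <= g z by rewrite /gauss expr0 mul1r expR_ge0.
have h01 z : 0 <= @hstep R z <= 1 by exact: step_itv.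
have x1 : 0 <= (x - c) / tau by rewrite divr_ge0 ?subr_ge0 // ltW.
have x2 : 0 <= (d - x) / tau by rewrite divr_ge0 ?subr_ge0 // ltW.
have gX z : g z = expR (- z ^+ 2 / 2) by rewrite /gauss expr0 mul1r.
have t1 : - (eta * g ((x - c) / tau - 3)) <= T A1.
  apply: T_lower sA1 _ _ => [y|]; last by rewrite gX; exact: h1.
  by rewrite eA1 mulr_ge0 ?g0 //; have /andP[] := h01 ((y - c) / tau - 2).
have t2 : - (eta * g ((d - x) / tau - 3)) <= T A2.
  apply: T_lower sA2 _ _ => [y|]; last by rewrite gX; exact: h2.
  by rewrite eA2 mulr_ge0 ?g0 //; have /andP[] := h01 ((d - y) / tau - 2).
have c8 : 8 * tau < d - c by move: tcd; rewrite ltr_pdivlMr // mulrC.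
have eA3 y : A3 y = zoom x tau g y * (1 - hc y - hd y) by rewrite /A3 eA1 eA2; ring.
have hd0 y : y <= c + 2 * tau -> hd y = 0.
  by move=> yc; rewrite /hd hstep0 // subr_ge0 ler_pdivlMr //; slra.
have hc0 y : c + 2 * tau <= y -> hc y = 0.
  by move=> yc; rewrite /hc hstep0 // subr_ge0 ler_pdivlMr //; slra.
have t3 : 0 <= T A3.
  apply: (hcd (c + tau) (d - tau) _ _ _ A3 sA3); [by rewrite ltrDl|by slra|by rewrite ltrBlDr ltrDl|move=> y|move=> y].
    rewrite eA3 mulr_ge0 ?g0 //; have [yc|yc] := leP y (c + 2 * tau).
      by rewrite hd0 // subr0 subr_ge0; have /andP[] := h01 ((y - c) / tau - 2).
    by rewrite hc0 ?subr0 ?subr_ge0; [have /andP[] := h01 ((d - y) / tau - 2)|exact: ltW].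
  move=> /orP[yc|yd]; rewrite eA3.
    by rewrite hd0 ?subr0 /hc ?hstep1 ?subrr ?mulr0 //; [rewrite lerBlDr ler_pdivrMr //; slra|slra].
  by rewrite hc0 ?subr0 /hd ?hstep1 ?subrr ?mulr0 //; [rewrite lerBlDr ler_pdivrMr //; slra|slra].
by rewrite eG; move: t1 t2 t3; clear; lra.
Qed.

End Core.

End PositivityCore.

(** * Absence of bad points *)

Section PositivityTheorem.
Context {R : realType}.
Implicit Types (f h psi phi : R -> R) (x y z u b c d B C K L M e w s p q tau eta v : R) (m n N k j : nat).

Notation g := (@gauss R 0).

Lemma gauss0_ge0 z : 0 <= g z. Proof. by rewrite /gauss expr0 mul1r expR_ge0. Qed.

Lemma gauss0_le1 z : g z <= 1.
Proof. by rewrite /gauss expr0 mul1r -[leRHS]expR0 ler_expR; have := sqr_ge0 z; slra. Qed.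

Variables (D mu : (R -> R) -> R).
Hypotheses (cD : cdist D) (nD : forall x, null_at D x) (cmu : cdist mu)
  (mu_ge0 : forall psi, smooth psi -> (forall y, 0 <= psi y) -> 0 <= mu psi).

Let T psi := D psi + mu psi.
Let cT : cdist T := cdist_add cD cmu.

(* Adding point masses at c + 3 tau and d - 3 tau makes the initial values at time tau nonnegative,
   so that the maximum principle applies; the masses are then sent to 0. *)
Lemma gap_positive c d s0 : c < d -> 0 < s0 ->
  (forall s, 0 < s -> s < s0 -> 0 <= T (zoom c s g)) ->
  (forall s, 0 < s -> s < s0 -> 0 <= T (zoom d s g)) ->
  (forall p q, c < p -> p < q -> q < d -> pos_on T p q) ->
  forall x s, c < x -> x < d -> 0 < s -> s < s0 -> 0 <= T (zoom x s g).
Proof.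
move=> cd s00 hc hd hcd x s cx xd s1 ss0.
rewrite -[leLHS]oppr0 lerNl; apply/ler_addgt0Pr => e e0; rewrite add0r lerNl.
(* Since [g <= 1], the two auxiliary masses add at most [2 * eta = e] to the final value. *)
pose eta := e / 2; have eta0 : 0 < eta by rewrite divr_gt0.
have [t0 t00 ht] := initial_estimate cD nD cmu mu_ge0 cd hcd eta0.
pose tau := Num.min (t0 / 2) s.
have tau0 : 0 < tau by rewrite lt_min divr_gt0.
have taut : tau < t0 by apply: (@le_lt_trans _ _ (t0 / 2)); [rewrite ge_min lexx|slra].
have taus : tau <= s by rewrite ge_min lexx orbT.
pose T' psi := T psi + (eta * psi (c + 3 * tau) + eta * psi (d - 3 * tau)).
have cT' : cdist T'.
  by apply: (cdist_add cT (cdist_add _ _)); apply: cdist_eval; exact: ltW.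
have aux y r : 0 <= T (dil y r g) -> 0 <= T' (dil y r g).
  by move=> h; apply: (addr_ge0 h); apply: addr_ge0; apply: (mulr_ge0 (ltW eta0)); exact: gauss0_ge0.
have zd y r : T (dil y r g) = T (zoom y r^-1 g) by rewrite zoom_dil invrK.
have si0 : 0 < s^-1 by rewrite invr_gt0.
have sti : s^-1 <= tau^-1 by rewrite lef_pV2.
have rs r : s^-1 <= r -> 0 < r^-1 /\ r^-1 < s0.
  move=> h; have r0 : 0 < r by exact: lt_le_trans h.
  split; first by rewrite invr_gt0.
  by apply: le_lt_trans ss0; rewrite -[leRHS]invrK lef_pV2 ?posrE.
have := @maximum_principle R T' c d s^-1 tau^-1 cT' cd si0 sti _ _ _ x s^-1 (ltW cx) (ltW xd) (lexx _) sti.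
rewrite /T' zd invrK => main.
have : 0 <= T (zoom x s g) + (eta * dil x s^-1 g (c + 3 * tau) + eta * dil x s^-1 g (d - 3 * tau)).
- apply: main.
  + by move=> r r1 r2; apply: aux; rewrite zd; have [? ?] := rs r r1; exact: hc.
  + by move=> r r1 r2; apply: aux; rewrite zd; have [? ?] := rs r r1; exact: hd.
  move=> y cy yd; have := ht tau y tau0 taut cy yd; rewrite zd invrK /dil.
  have e1 : tau^-1 * (c + 3 * tau - y) = - ((y - c) / tau - 3) by field; rewrite gt_eqF.
  have e2 : tau^-1 * (d - 3 * tau - y) = (d - y) / tau - 3 by field; rewrite gt_eqF.
  have gE z : g (- z) = g z by rewrite /gauss !expr0 sqrrN.
  by rewrite e1 e2 gE -/(T (zoom y tau g)); set w := T _; slra.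
have h1 := gauss0_le1 (s^-1 * (c + 3 * tau - x)); have h2 := gauss0_le1 (s^-1 * (d - 3 * tau - x)).
have : eta * dil x s^-1 g (c + 3 * tau) <= eta * 1 by apply: ler_wpM2l => //; exact: ltW.
have : eta * dil x s^-1 g (d - 3 * tau) <= eta * 1 by apply: ler_wpM2l => //; exact: ltW.
by rewrite /eta; slra.
Qed.

Lemma gauss_continuous s x : 0 < s -> T (zoom x s g) < 0 -> exists2 d, 0 < d &
  forall y, `|y - x| < d -> T (zoom y s g) < 0.
Proof.
move=> s0 neg.
have dT := is_derive_center x s^-1 cT (@smooth_gauss R 0) (@bounded_derivs_gauss R 0).
have [d d0 hd] := is_derive_eps dT ltr01.
set l := - s^-1 * _ in hd.
have K0 : 0 < 1 + `|l| by rewrite ltr_pwDl.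
pose r := - T (zoom x s g) / (1 + `|l|); have r0 : 0 < r by rewrite divr_gt0 ?oppr_gt0.
exists (Num.min d r); first by rewrite lt_min d0.
move=> y; rewrite lt_min => /andP[yd yr]; have := hd (y - x) yd.
rewrite (_ : x + (y - x) = y); last by ring.
rewrite -!zoom_dil mul1r; set p := T _; set q := T _ => h.
have h1 : l * (y - x) <= `|l| * `|y - x| by rewrite -normrM; exact: ler_norm.
move: yr; rewrite /r -/q ltr_pdivlMr // => h2.
by move: h; rewrite ler_norml => /andP[_ h3]; move: h1 h2 h3; clear; lra.
Qed.

Definition bad x : Prop := ~ positive_at T x.

Lemma bad_not_isolated x d : bad x -> 0 < d -> exists2 y, y != x /\ `|y - x| < d & bad y.
Proof.
move=> bx d0; apply: contrapT => no; apply: bx.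
apply: (positive_not_isolated cD nD cmu mu_ge0 d0) => y yx yd.
by apply: contrapT => nb; apply: no; exists y.
Qed.

(* Baire category, by nested intervals avoiding the points of E one at a time. *)
Lemma bad_interval (E : set R) z : countable E -> bad z ->
  (forall x, ~ E x -> bad x -> exists2 d, 0 < d & forall t, 0 < t -> t < d -> 0 <= T (zoom x t g)) ->
  exists p q s0, [/\ 0 < s0, exists2 x, p < x < q & bad x &
    forall x s, p < x -> x < q -> bad x -> 0 < s -> s < s0 -> 0 <= T (zoom x s g)].
Proof.
move=> /countable_injP[f finj] bz hE; apply: contrapT => no.
have fE x y : E x -> E y -> f x = f y -> x = y by move=> Ex Ey; apply: finj; exact: mem_set.
have neg p q s0 : 0 < s0 -> (exists2 x, p < x < q & bad x) ->
    exists x s, [/\ p < x < q, bad x, 0 < s < s0 & T (zoom x s g) < 0].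
  move=> s00 hb; apply: contrapT => no'; apply: no; exists p, q, s0; split => // x s px xq bx s1 s2.
  rewrite leNgt; apply/negP => lt; apply: no'; exists x, s; split => //; exact/andP.
pose ok (w : R * R) := exists2 x, w.1 < x < w.2 & bad x.
(* One Baire step: a smaller interval, of length at most [2 / (n + 1)], that still meets the bad
   set, on which the averages at some scale below [1 / (n + 1)] are negative, and which avoids the
   n-th point of E. *)
have step (n : nat) (w : R * R) : exists w' : R * R, ok w -> [/\ ok w', w.1 <= w'.1, w'.1 < w'.2, w'.2 <= w.2 &
   (exists2 s, 0 < s < n.+1%:R^-1 & forall x, w'.1 <= x -> x <= w'.2 -> T (zoom x s g) < 0) /\
   (forall x, w'.1 <= x -> x <= w'.2 -> E x -> f x <> n) /\ w'.2 - w'.1 <= 2 * n.+1%:R^-1].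
  have [okw|nok] := pselect (ok w); last by exists w.
  have n0 : 0 < (n.+1%:R^-1 : R) by rewrite invr_gt0.
  have [x [s [/andP[px xq] bx sn negx]]] := neg w.1 w.2 _ n0 okw.
  have [s0 _] := andP sn; have [d d0 hd] := gauss_continuous s0 negx.
  have [x2 [b2 x2d px2 x2q] x2E] : exists2 x2, [/\ bad x2, `|x2 - x| < d, w.1 < x2 & x2 < w.2] & (E x2 -> f x2 <> n).
    (* If the point found is itself the n-th point of E, another bad point close to it takes its
       place, as bad points are not isolated. *)
    have [[Ex fx]|nE] := pselect (E x /\ f x = n); last first.
      exists x; first by split => //; rewrite subrr normr0.
      by move=> Ex fx; apply: nE.
    have m0 : 0 < Num.min d (Num.min (x - w.1) (w.2 - x)) by rewrite !lt_min d0 !subr_gt0 px.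
    have [y [yx]] := bad_not_isolated bx m0; rewrite !lt_min => /andP[yd /andP[y1 y2]] by'.
    exists y; first split => //.
    - by have := ler_norm (- (y - x)); rewrite normrN; slra.
    - by have := ler_norm (y - x); slra.
    by move=> Ey fy; move/eqP: yx; apply; apply: fE => //; rewrite fx.
  have [r r0 [r1 r2 [r3 r5] r4]] : exists2 r, 0 < r & [/\ w.1 <= x2 - r, x2 + r <= w.2,
      r < d - `|x2 - x| /\ r <= n.+1%:R^-1 & forall y, E y -> f y = n -> r < `|y - x2|].
    suff [r r0 [r1 r2 r3 r4]] : exists2 r, 0 < r & [/\ w.1 <= x2 - r, x2 + r <= w.2,
        r < d - `|x2 - x| & forall y, E y -> f y = n -> r < `|y - x2|].
      have m1 : Num.min r n.+1%:R^-1 <= r by rewrite ge_min lexx.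
      have m2 : Num.min r n.+1%:R^-1 <= n.+1%:R^-1 by rewrite ge_min lexx orbT.
      exists (Num.min r n.+1%:R^-1); first by rewrite lt_min r0.
      split; [by slra|by slra|by split => //; exact: le_lt_trans r3|].
      by move=> y Ey fy; apply: le_lt_trans m1 (r4 y Ey fy).
    have [[y [Ey fy]]|nE] := pselect (exists y, E y /\ f y = n); last first.
      pose r := Num.min (d - `|x2 - x|) (Num.min (x2 - w.1) (w.2 - x2)).
      have m0 : 0 < r by rewrite !lt_min !subr_gt0 x2d px2.
      have m1 : r <= d - `|x2 - x| by rewrite ge_min lexx.
      have m2 : r <= x2 - w.1 by rewrite /r minCA ge_min lexx.
      have m3 : r <= w.2 - x2 by rewrite /r minA ge_min lexx orbT.
      exists (r / 2); first by rewrite divr_gt0.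
      split; [by slra|by slra|by slra|]; move=> y Ey fy; exfalso; apply: nE; by exists y.
    have yx2 : y != x2 by apply/eqP => e; move: fy; rewrite e; apply: x2E; rewrite -e.
    pose r := Num.min `|y - x2| (Num.min (d - `|x2 - x|) (Num.min (x2 - w.1) (w.2 - x2))).
    have m0 : 0 < r by rewrite !lt_min normr_gt0 !subr_gt0 x2d px2 subr_eq0 yx2.
    have m1 : r <= d - `|x2 - x| by rewrite /r minCA ge_min lexx.
    have m2 : r <= x2 - w.1.
      by rewrite /r; do 2 (rewrite ge_min; apply/orP; right); rewrite ge_min lexx.
    have m3 : r <= w.2 - x2.
      by rewrite /r; do 3 (rewrite ge_min; apply/orP; right).
    have m4 : r <= `|y - x2| by rewrite /r ge_min lexx.
    exists (r / 2); first by rewrite divr_gt0.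
    split; [by slra|by slra|by slra|]; move=> y' Ey' fy'; rewrite (fE y' y) //; last by rewrite fy.
    slra.
  exists (x2 - r, x2 + r) => _; split => //=; try slra.
    by exists x2 => //=; apply/andP; split; slra.
  split.
    exists s => // y y1 y2; apply: hd; have -> : y - x = (y - x2) + (x2 - x) by ring.
    apply: le_lt_trans (ler_normD _ _) _.
    have : `|y - x2| <= r by rewrite ler_norml; apply/andP; split; slra.
    slra.
  split; last by move: r5; set v := n.+1%:R^-1 => ? /=; slra.
  move=> y y1 y2 Ey fy; have := r4 y Ey fy; rewrite ltNge => /negP; apply.
  by rewrite ler_norml; apply/andP; split; slra.
have /choice[nx hnx] : forall nw : nat * (R * R), exists w' : R * R, ok nw.2 -> [/\ ok w', nw.2.1 <= w'.1, w'.1 < w'.2, w'.2 <= nw.2.2 &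
   (exists2 s, 0 < s < nw.1.+1%:R^-1 & forall x, w'.1 <= x -> x <= w'.2 -> T (zoom x s g) < 0) /\
   (forall x, w'.1 <= x -> x <= w'.2 -> E x -> f x <> nw.1) /\ w'.2 - w'.1 <= 2 * nw.1.+1%:R^-1].
  by case=> n w; exact: step.
pose st : nat -> R * R := fix st n := if n is n'.+1 then nx (n', st n') else (z - 1, z + 1).
have okst n : ok (st n).
  elim: n => [|n IH]; first by exists z => //=; apply/andP; split; slra.
  by have [] := hnx (n, st n) IH.
have hst n := hnx (n, st n) (okst n).
have mle i j : (i <= j)%N -> (st i).1 <= (st j).1 /\ (st j).2 <= (st i).2.
  elim: j => [|j IH]; first by rewrite leqn0 => /eqP ->.
  rewrite leq_eqVlt => /orP[/eqP -> //|/IH[a1 a2]].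
  by have [_ b1 _ b2 _] := hst j; split; [exact: le_trans b1|exact: le_trans a2].
have lt12 n : (st n).1 < (st n).2 by have [x /andP[h1 h2] _] := okst n; exact: lt_trans h2.
have cross i j : (st i).1 <= (st j).2.
  have [a1 _] := mle i (maxn i j) (leq_maxl _ _).
  have [_ a2] := mle j (maxn i j) (leq_maxr _ _).
  exact: le_trans a1 (le_trans (ltW (lt12 (maxn i j))) a2).
pose S := range (fun n => (st n).1).
have hS : has_sup S.
  by split; [exists (st 0%N).1; exists 0%N|exists (st 0%N).2 => _ [n _ <-]; exact: cross].
have s1 n : (st n).1 <= sup S by apply: ub_le_sup; [case: hS|exists n].
have s2 n : sup S <= (st n).2 by apply: ge_sup; [case: hS|move=> _ [k _ <-]; exact: cross].
have nES : ~ E (sup S).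
  move=> ES; have [_ _ _ _ [_ [hf _]]] := hst (f (sup S)).
  by apply: (hf (sup S) (s1 (f (sup S)).+1) (s2 (f (sup S)).+1) ES).
have small d : 0 < d -> exists n, n.+1%:R^-1 < d.
  move=> d0; have di0 : 0 < d^-1 by rewrite invr_gt0.
  have := archi_boundP (ltW di0); set b := Num.bound _ => hb; exists b.
  rewrite invf_plt ?posrE ?ltr0n //; apply: lt_le_trans hb _.
  by rewrite ler_nat.
(* The nested intervals shrink to [sup S] and each contains a bad point, while the set of points
   that are not bad is open. *)
have bS : bad (sup S).
  move=> gS; have [d d0 hd] := positive_at_open gS.
  have [|n nd] := small (d / 2); first by rewrite divr_gt0.
  have [_ _ _ _ [_ [_ hw]]] := hst n.
  have [x /andP[x1 x2] bx] := okst n.+1.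
  have := s1 n.+1; have := s2 n.+1 => u1 u2; apply: bx; apply: hd.
  by move: hw x1 x2 u1 u2 nd; rewrite ltr_norml /=; set v := nx _; set w := n.+1%:R^-1; move=> *; apply/andP; split; slra.
have [d d0 hd] := hE _ nES bS.
have [n nd] := small d d0.
have [_ _ _ _ [[s /andP[s0 sn] hs] _]] := hst n.
have := hd s s0 (lt_trans sn nd).
by rewrite leNgt (hs (sup S) (s1 n.+1) (s2 n.+1)).
Qed.

(** The nearest bad point to the left; with [bad_closed_inf] it encloses a point that is not bad in
    a gap with bad endpoints. *)
Lemma bad_closed_sup x y : x < y -> bad x -> ~ bad y -> exists c, [/\ bad c, x <= c, c < y &
  forall z, c < z -> z <= y -> ~ bad z].
Proof.
move=> xy bx nby; pose S := [set z | bad z /\ x <= z <= y].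
have hS : has_sup S.
  by split; [exists x; split => //; rewrite lexx ltW|exists y => z [_ /andP[]]].
have xS : x <= sup S by apply: ub_le_sup; [case: hS|split => //; rewrite lexx ltW].
have Sy : sup S <= y by apply: ge_sup; [case: hS|move=> z [_ /andP[]]].
have bS : bad (sup S).
  move=> gS; have [d d0 hd] := positive_at_open gS.
  have [z [bz /andP[xz zy]] zS] := sup_adherent d0 hS.
  have zS' : z <= sup S by apply: ub_le_sup; [case: hS|split => //; rewrite xz].
  by apply: bz; apply: hd; rewrite ler0_norm ?subr_le0 //; slra.
exists (sup S); split => //.
  by rewrite lt_neqAle Sy andbT; apply/eqP => e; apply: nby; rewrite -e.
move=> z Sz zy bz; have := Sz; rewrite ltNge => /negP; apply.
by apply: ub_le_sup; [case: hS|split => //; rewrite zy andbT; slra].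
Qed.

Lemma bad_closed_inf x y : y < x -> bad x -> ~ bad y -> exists c, [/\ bad c, c <= x, y < c &
  forall z, y <= z -> z < c -> ~ bad z].
Proof.
move=> yx bx nby; pose S := [set z | bad z /\ y <= z <= x].
have hS : has_inf S.
  by split; [exists x; split => //; rewrite lexx ltW|exists y => z [_ /andP[]]].
have xS : inf S <= x by apply: ge_inf; [case: hS|split => //; rewrite lexx ltW].
have Sy : y <= inf S by apply: lb_le_inf; [case: hS|move=> z [_ /andP[]]].
have bS : bad (inf S).
  move=> gS; have [d d0 hd] := positive_at_open gS.
  have [z [bz /andP[yz zx]] zS] := inf_adherent d0 hS.
  have zS' : inf S <= z by apply: ge_inf; [case: hS|split => //; rewrite yz].
  by apply: bz; apply: hd; rewrite ger0_norm ?subr_ge0 //; slra.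
exists (inf S); split => //.
  by rewrite lt_neqAle Sy andbT; apply/eqP => e; apply: nby; rewrite e.
move=> z yz zS bz; have := zS; rewrite ltNge => /negP; apply.
by apply: ge_inf; [case: hS|split => //; rewrite yz /=; slra].
Qed.

Lemma no_bad_point (E : set R) z : countable E ->
  (forall x, ~ E x -> bad x -> exists2 d, 0 < d & forall t, 0 < t -> t < d -> 0 <= T (zoom x t g)) ->
  ~ bad z.
Proof.
move=> cE hE bz; have [p [q [s0 [s00 [x /andP[px xq] bx] hb]]]] := bad_interval cE bz hE.
have m0 : 0 < Num.min (x - p) (q - x) by rewrite lt_min !subr_gt0 px.
have [y [yx]] := bad_not_isolated bx m0; rewrite lt_min => /andP[y1 y2] by'.
have yp : p < y by have := ler_norm (- (y - x)); rewrite normrN; slra.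
have yq : y < q by have := ler_norm (y - x); slra.
(* The middle point must have room on both sides. Gaps inside []b1, b3[] then end at bad points of
   the chosen interval, where the averages are controlled at all scales below [s0]. *)
have [b1 [b2 [b3 [[B1 B2 B3] [b12 b23 pb1 b3q]]]]] :
    exists b1 b2 b3, [/\ bad b1, bad b2 & bad b3] /\ [/\ b1 < b2, b2 < b3, p < b1 & b3 < q].
  have pair u v : bad u -> bad v -> u < v -> p < u -> v < q ->
      exists b1 b2 b3, [/\ bad b1, bad b2 & bad b3] /\ [/\ b1 < b2, b2 < b3, p < b1 & b3 < q].
    move=> bu bv uv pu vq; have m1 : 0 < Num.min (u - p) (v - u) by rewrite lt_min !subr_gt0 pu.
    have [w [wu]] := bad_not_isolated bu m1; rewrite lt_min => /andP[w1 w2] bw.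
    have := ler_norm (- (w - u)); have := ler_norm (w - u); rewrite normrN => n1 n2.
    have [uw|wu'|e] := ltgtP u w; last by rewrite e eqxx in wu.
      by exists u, w, v; split; split => //; slra.
    by exists w, u, v; split; split => //; slra.
  have [xy|yx'|e] := ltgtP x y; last by rewrite e eqxx in yx.
    exact: (pair x y).
  exact: (pair y x).
have pos y' s : b1 < y' -> y' < b3 -> 0 < s -> s < s0 -> 0 <= T (zoom y' s g).
  move=> y'1 y'3 s1 s2; have [bad'|nb] := pselect (bad y').
    by apply: hb => //; slra.
  have [c [bc c1 c2 c3]] := bad_closed_sup y'1 B1 nb.
  have [d [bd d1 d2 d3]] := bad_closed_inf y'3 B3 nb.
  have cd : c < d by slra.
  apply: (gap_positive cd s00 _ _ _ c2 d2 s1 s2).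
  - by move=> s' ? ?; apply: hb => //; slra.
  - by move=> s' ? ?; apply: hb => //; slra.
  move=> p' q' cp pq qd; apply: pos_on_gluing => // v /andP[v1 v2].
  apply: contrapT => nv; have [vy|vy] := leP v y'; first by apply: (c3 v) => //; slra.
  by apply: (d3 v) => //; [exact: ltW|slra].
apply: B2; exists (Num.min (b2 - b1) (b3 - b2)); first by rewrite lt_min !subr_gt0 b12.
have pos' := @heat_positive R T b1 b3 s0 cT s00 pos.
apply: pos_on_sub pos'.
  by have : Num.min (b2 - b1) (b3 - b2) <= b2 - b1 by [rewrite ge_min lexx]; slra.
by have : Num.min (b2 - b1) (b3 - b2) <= b3 - b2 by [rewrite ge_min lexx orbT]; slra.
Qed.

Lemma positivity (E : set R) : countable E ->
  (forall x, ~ E x -> bad x -> exists2 d, 0 < d & forall t, 0 < t -> t < d -> 0 <= T (zoom x t g)) ->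
  forall psi, smooth psi -> (forall y, 0 <= psi y) -> 0 <= T psi.
Proof.
move=> cE hE psi sp psi0; have [L L0 hL] := cdist_far cT.
pose kap : R -> R := zoom 0 L (@bump R); have sk : smooth kap := smooth_zoom 0 L (@smooth_bump R).
have -> : T psi = T (fun y => psi y * kap y).
  apply/eqP; rewrite -subr_eq0 -(cdistB cT sp (smooth_mul sp sk)); apply/eqP.
  apply: hL; first exact: smooth_sub sp (smooth_mul sp sk).
  move=> y yL; rewrite /kap /zoom subr0 bump1 ?mulr1 ?subrr //.
  by rewrite normrM normfV (gtr0_norm L0) ler_pdivrMr // mul1r ltW.
have LL : - (2 * L) < 2 * L by slra.
apply: (pos_on_gluing cT LL _ (smooth_mul sp sk)) => [x _|y|y yL].
- by apply: contrapT; exact: no_bad_point cE hE.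
- by rewrite mulr_ge0 //; have /andP[] := bump_itv ((y - 0) / L).
rewrite /kap /zoom subr0 bump0 ?mulr0 // normrM normfV (gtr0_norm L0) ler_pdivlMr //.
by rewrite ler_normr; apply/orP; case/orP: yL => ?; [right|left]; slra.
Qed.

End PositivityTheorem.

(** * A small measure with infinite density on a null set *)

Section Penalty.
Context {R : realType}.
Implicit Types (f h psi phi : R -> R) (x y z u b c d B C K L M e w s t p q eps eta v : R) (m n N k j : nat).

Notation leb := (@lebesgue_measure R).
Notation seg p q := [set` `[p%R, q%R]%R].

Lemma open_cover_negligible (Z : set R) eps : leb.-negligible Z -> 0 < eps ->
  exists O : set R, [/\ open O, Z `<=` O & (leb O <= eps%:E)%E].
Proof.
move=> [A [mA A0 ZA]] e0.
have Afin : (leb A < +oo)%E by rewrite A0 ltry.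
have [U [oU AU hU]] := lebesgue_regularity_outer mA Afin e0.
exists U; split => //; first exact: subset_trans AU.
have mU : measurable (U : set (measurableTypeR R)) by exact: open_measurable.
rewrite -(setDUK AU); apply: le_trans (measureU2 leb mA (measurableD mU mA)) _.
by rewrite [X in (X + _)%E](_ : _ = 0%E) ?add0e; [exact: ltW|exact: A0].
Qed.

(** The measure is [eps] times Lebesgue measure plus the sum of its restrictions to open sets [V n]
    containing Z, of measure at most [eps / 2^(n + 1)]. A point of Z lies in every [V n], so on
    small intervals around it the density exceeds any given k. *)
Lemma penalty_measure (Z : set R) eps L : leb.-negligible Z -> 0 < eps -> 0 < L ->
  exists nu : {measure set (measurableTypeR R) -> \bar R}, [/\ (nu (seg (- L) L) <= (eps * (2 * L + 1))%:E)%E,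
    forall x t, 0 < t -> ((eps * (2 * t))%:E <= nu (seg (x - t) (x + t)))%E &
    forall x K, Z x -> exists2 d, 0 < d & forall t, 0 < t -> t < d ->
      ((K * (2 * t))%:E <= nu (seg (x - t) (x + t)))%E].
Proof.
move=> nZ e0 L0.
have itvE x t : 0 < t -> leb (seg (x - t) (x + t)) = (2 * t)%:E.
  move=> t0; rewrite lebesgue_measure_itv /= lte_fin ifT; last by slra.
  by rewrite -EFinB; congr EFin; ring.
have mitv x t : measurable ((seg (x - t) (x + t)) : set R) by [].
have en (n : nat) : 0 < eps / (2 ^ n.+1)%:R by rewrite divr_gt0 // ltr0n expn_gt0.
have /choice[V hV] : forall n, exists O : set R, [/\ open O, Z `<=` O & (leb O <= (eps / (2 ^ n.+1)%:R)%:E)%E].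
  by move=> n; exact: open_cover_negligible.
have mO n : measurable (V n) by apply: open_measurable; have [] := hV n.
pose m n : {measure set (measurableTypeR R) -> \bar R} := mrestr (leb : {measure set (measurableTypeR R) -> \bar R}) (mO n).
pose ms : {measure set (measurableTypeR R) -> \bar R} := mseries m 0.
pose nu : {measure set (measurableTypeR R) -> \bar R} := measure_add (mscale (NngNum (ltW e0)) leb) ms.
have nuE A : nu A = (eps%:E * leb A + ms A)%E by exact: measure_addE.
exists nu; split.
- rewrite nuE mulrDr mulr1 EFinD; apply: leeD.
    have -> : (seg (- L) L) = (seg (0 - L) (0 + L)) by rewrite sub0r add0r.
    by rewrite itvE.
  apply: (@le_trans _ _ (\sum_(0 <= i <oo) (0 + (eps / (2 ^ i.+1)%:R)%:E))%E).
    apply: lee_nneseries => // i _; rewrite add0e; have [_ _] := hV i.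
    apply: le_trans; apply: (le_measure leb); rewrite ?inE; [|exact: mO|exact: subIsetr].
    by apply: measurableI => //; exact: mO.
  apply: le_trans (epsilon_trick xpredT (fun=> lexx _) (ltW e0)) _.
  by rewrite eseries0 // add0e.
- move=> x t t0; rewrite nuE itvE // -EFinM leeDl //.
move=> x K Zx; have [k Kk] : exists k, K <= k%:R.
  by exists (Num.bound `|K|); apply: le_trans (ler_norm K) (ltW (archi_boundP (normr_ge0 K))).
have [d d0 hd] : exists2 d, 0 < d & forall y, `|y - x| < d -> forall i, (i < k)%N -> V i y.
  elim: k {Kk} => [|k [d d0 hd]]; first by exists 1.
  have [oO ZO _] := hV k.
  have /nbhs_ballP[d' /= d'0 hd'] := open_nbhs_nbhs (conj oO (ZO x Zx)).
  exists (Num.min d d'); first by rewrite lt_min d0.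
  move=> y; rewrite lt_min => /andP[y1 y2] i; rewrite ltnS leq_eqVlt => /orP[/eqP ->|]; last exact: hd.
  by apply: hd'; rewrite /ball /= distrC.
exists d => // t t0 td; rewrite nuE; apply: (@le_trans _ _ (ms (seg (x - t) (x + t)))); last first.
  by rewrite leeDr // mule_ge0 // lee_fin ltW.
apply: le_trans _ (@nneseries_lim_ge R _ xpredT 0 k _); last by move=> *; exact: measure_ge0.
rewrite /= (eq_big_nat _ _ (F2 := fun=> (2 * t)%:E)); last first.
  move=> i /andP[_ ik]; rewrite /m /= /mrestr setIidl ?itvE // => y /=; rewrite in_itv /= => /andP[y1 y2].
  by apply: (hd y _ i ik); rewrite ltr_norml; apply/andP; split; slra.
rewrite sumEFin lee_fin big_const_nat subn0 iter_addr_0 -[leRHS]mulr_natl.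
by apply: ler_wpM2r => //; slra.
Qed.

(* A measure of small mass that has infinite density at every point of the null set Z; it absorbs the
   failure of the lower bound on Z. *)
Lemma penalty (Z : set R) eps L : leb.-negligible Z -> 0 < eps -> 0 < L ->
  exists mu : (R -> R) -> R, [/\ cdist mu,
    forall psi, smooth psi -> (forall y, 0 <= psi y) -> 0 <= mu psi,
    forall psi M, smooth psi -> (forall y, `|y| <= L -> `|psi y| <= M) -> mu psi <= eps * (2 * L + 1) * M,
    forall psi x t c, smooth psi -> (forall y, 0 <= psi y) -> 0 < t -> - L <= x - t -> x + t <= L ->
      0 <= c -> (forall y, `|y - x| <= t -> c <= psi y) -> eps * (2 * t) * c <= mu psi &
    forall x K, - L < x -> x < L -> Z x -> exists2 d, 0 < d & forall t, 0 < t -> t < d ->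
      forall psi c, smooth psi -> (forall y, 0 <= psi y) ->
      0 <= c -> (forall y, `|y - x| <= t -> c <= psi y) -> K * (2 * t) * c <= mu psi].
Proof.
move=> nZ e0 L0; have [nu [nuL nu1 nu2]] := penalty_measure nZ e0 L0.
set A := (seg (- L) L) in nuL.
have mA : measurable (A : set (measurableTypeR R)) by exact: measurable_itv.
have nufin : (nu A < +oo)%E by apply: le_lt_trans nuL (ltry _).
have mpsi psi (S : set (measurableTypeR R)) : smooth psi -> measurable_fun S psi.
  by move=> sp; apply: measurable_funTS; apply: continuous_measurable_fun; exact: smooth_continuous sp.
have mE psi (S : set (measurableTypeR R)) : smooth psi -> measurable_fun S (fun y => (psi y)%:E).
  by move=> sp; apply/measurable_EFinP; exact: mpsi.
have mS x t : measurable (seg (x - t) (x + t) : set (measurableTypeR R)) by exact: measurable_itv.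
have int psi : smooth psi -> nu.-integrable A (EFin \o psi).
  move=> sp; apply: measurable_bounded_integrable => //; first exact: mpsi.
  have [B B0 hB] := smooth_bounded 0 L sp.
  exists B; split; [exact: num_real|move=> b Bb y /=]; rewrite /A /= in_itv /= => y12.
  by apply: le_trans (ltW Bb); apply: (hB y _ 0%N) => //; rewrite ler_norml.
have low psi x t c : smooth psi -> (forall y, 0 <= psi y) -> 0 < t -> - L <= x - t -> x + t <= L ->
    0 <= c -> (forall y, `|y - x| <= t -> c <= psi y) ->
    (c%:E * nu (seg (x - t) (x + t)) <= (\int[nu]_(y in A) psi y)%:E)%E.
  move=> sp p0 t0 x1 x2 c0 hc.
  rewrite fineK; last exact: integrable_fin_num (int _ sp).
  apply: (@le_trans _ _ (\int[nu]_(y in (seg (x - t) (x + t))) (psi y)%:E)%E); last first.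
    apply: (ge0_subset_integral nu (mS x t) mA (mE _ _ sp)); first by move=> y _; rewrite lee_fin.
    by move=> y /=; rewrite /A /= !in_itv /= => /andP[y1 y2]; apply/andP; split; slra.
  rewrite -(integral_cst nu (mS x t)); apply: (ge0_le_integral nu (mS x t)).
  - by move=> y _; rewrite lee_fin.
  - exact: measurable_cst.
  - exact: mE.
  move=> y /=; rewrite in_itv /= => /andP[y1 y2]; rewrite lee_fin; apply: hc.
  by rewrite ler_norml; apply/andP; split; slra.
have up psi M : smooth psi -> (forall y, `|y| <= L -> `|psi y| <= M) -> `|\int[nu]_(y in A) psi y| <= eps * (2 * L + 1) * M.
  move=> sp hM; have M0 : 0 <= M by apply: le_trans (hM 0 _) => //; rewrite normr0 ltW.
  apply: le_trans (le_normr_Rintegral mA (int _ sp)) _.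
  apply: (@le_trans _ _ (\int[nu]_(y in A) M)).
    apply: le_Rintegral => //.
    - by have := integrable_norm (int _ sp).
    - by have := int _ (smooth_const M).
    by move=> y /=; rewrite /A /= in_itv /= => y12; apply: hM; rewrite ler_norml.
  rewrite Rintegral_cst // mulrC; apply: ler_wpM2r => //.
  by rewrite -lee_fin fineK // ge0_fin_numE.
have C0 : 0 <= eps * (2 * L + 1) by apply: mulr_ge0; slra.
exists (fun psi => \int[nu]_(y in A) psi y); split.
- split.
    move=> c f h sf sh; rewrite RintegralD //; [|exact: int (smooth_scale c sf)|exact: int].
    by rewrite RintegralZl //; exact: int.
  exists (eps * (2 * L + 1)), 0%N, L; split => // f M sf hM.
  by apply: up => // y yL; exact: (hM y yL 0%N).
- by move=> psi sp p0; exact: Rintegral_ge0.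
- by move=> psi M sp hM; apply: le_trans (ler_norm _) _; apply: up.
- move=> psi x t c sp p0 t0 x1 x2 c0 hc; rewrite -lee_fin.
  apply: le_trans _ (low psi x t c sp p0 t0 x1 x2 c0 hc).
  by rewrite mulrC EFinM; apply: lee_wpmul2l => //; exact: nu1.
move=> x K x1 x2 Zx; have [d d0 hd] := nu2 x K Zx.
exists (Num.min d (Num.min (x + L) (L - x))); first by rewrite !lt_min d0 /= subr_gt0 x2 andbT; slra.
move=> t t0; rewrite !lt_min => /andP[td /andP[t1 t2]] psi c sp p0 c0 hc; rewrite -lee_fin.
have y1 : - L <= x - t by slra.
have y2 : x + t <= L by slra.
apply: le_trans _ (low psi x t c sp p0 t0 y1 y2 c0 hc).
by rewrite mulrC EFinM; apply: lee_wpmul2l => //; exact: hd.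
Qed.

End Penalty.

(** * Minor functionals lie below major ones *)

Section Comparison.
Context {R : realType}.
Implicit Types (P Q : (R -> R) -> R) (f : R -> \bar R) (psi phi : R -> R) (x y z u b c d B C K L M e w s t p q eps eta v r : R) (m n N k j : nat).

Notation g := (@gauss R 0).

(** The normalized heat kernel is an admissible profile for both clauses of a major or minor pair,
    which is what allows the bounds on averages to feed the heat equation. *)
Lemma gaussian_class1 : test_class1 (fun z : R => normal_peak 1 * g z).
Proof.
have sg := @smooth_gauss R 0.
have pk : 0 <= normal_peak (1 : R) by exact: normal_peak_ge0.
split; last first.
  move=> x; have dg := is_derive_gauss 0 x.
  have dk := isdZ (normal_peak 1) dg.
  have -> : derive1 (fun z : R => normal_peak 1 * g z) x = normal_peak 1 * (0%:R * gauss 0.-1 x + -1 * gauss 1 x).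
    by rewrite derive1E; exact: derive_val.
  rewrite mul0r add0r mulN1r mulrCA mulrN /gauss expr1 mulrA -expr2 mulrN oppr_le0.
  by apply: mulr_ge0 => //; apply: mulr_ge0; rewrite ?sqr_ge0 // expR_ge0.
split.
- exact: smooth_scale sg.
- by move=> x; apply: mulr_ge0 => //; exact: gauss0_ge0.
- rewrite (_ : (fun z : R => normal_peak 1 * g z) = normal_pdf 0 1).
    by rewrite /Rintegral integral_normal_pdf.
  apply/funext => z; rewrite -gauss_normal_pdf ?oner_neq0 // invr1 mul1r sub0r.
  by rewrite /gauss !expr0 sqrrN.
exists (-2); first by slra.
move=> m; have [C C0 hC] := @gauss_schwartz R m.+2 m.
exists (normal_peak 1 * C), 1 => x x1.
rewrite (derive1nZ m _ sg) normrM ger0_norm // -mulrA; apply: ler_wpM2l => //.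
have x0 : 0 < `|x| by exact: lt_trans x1.
have -> : `|x| `^ (-2 - m%:R) = (`|x| ^+ m.+2)^-1.
  rewrite -powR_mulrn ?ltW // -powRN; congr (_ `^ _); rewrite -addn2 natrD; ring.
rewrite ler_pdivlMr ?exprn_gt0 //; apply: le_trans (hC x); rewrite mulrC; apply: ler_wpM2r => //.
by apply: lerXn2r; rewrite ?nnegrE ?addr_ge0 // lerDr.
Qed.

(** [positivity] is applied to the difference plus a penalty whose contribution is proportional to
    [eps]; letting [eps] tend to 0 removes it. *)
Lemma majorant_ge P Q f a b : majorant P f a b -> majorant (opp_fun Q) (fun x => - f x)%E a b ->
  forall psi, smooth psi -> (forall y, 0 <= psi y) -> Q psi <= P psi.
Proof.
move=> [[cP sP nP _] [E1 [Z1 [cE1 nZ1 [f1 e1]]]]] [[cQ sQ nQ _] [E2 [Z2 [cE2 nZ2 [f2 e2]]]]] psi sp psi0.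
pose D h := P h + opp_fun Q h.
have cD : cdist D by exact: cdist_add.
have nD x : null_at D x.
  move=> h L sh hL e e0; have e20 : 0 < e / 2 by rewrite divr_gt0.
  have [d1 d10 h1] := nP x h L sh hL _ e20; have [d2 d20 h2] := nQ x h L sh hL _ e20.
  exists (Num.min d1 d2); first by rewrite lt_min d10.
  move=> s s0; rewrite lt_min => /andP[s1 s2]; apply: le_trans (ler_normD _ _) _.
  by have := h1 s s0 s1; have := h2 s s0 s2; slra.
have nZ : lebesgue_measure.-negligible (Z1 `|` Z2) by exact: negligibleU.
have cE : countable (E1 `|` E2) 
  by rewrite -bigcup2E; apply: bigcup_countable => // -[|[|i]] _ //=; exact: countable0.
pose phi := fun z : R => normal_peak 1 * g z.
have phi1 : test_class1 phi := gaussian_class1; have [phi0 _] := phi1.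
have pk : 0 < normal_peak (1 : R) by rewrite normal_peak_gt0 // oner_neq0.
have add r1 r2 x : (exists2 d, 0 < d & forall t, 0 < t -> t < d -> r1 <= t^-1 * P (zoom x t phi)) ->
    (exists2 d, 0 < d & forall t, 0 < t -> t < d -> r2 <= t^-1 * opp_fun Q (zoom x t phi)) ->
    exists2 d, 0 < d & forall t, 0 < t -> t < d -> r1 + r2 <= t^-1 * D (zoom x t phi).
  move=> [d1 d10 h1] [d2 d20 h2]; exists (Num.min d1 d2); first by rewrite lt_min d10.
  move=> t t0; rewrite lt_min => /andP[t1 t2]; rewrite /D mulrDr; apply: lerD; first exact: h1.
  exact: h2.
have low x : a <= x <= b -> ~ (E1 `|` E2) x ->
    exists r, exists2 d, 0 < d & forall t, 0 < t -> t < d -> r <= t^-1 * D (zoom x t phi).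
  move=> xab nE; have [r1 h1] := e1 x xab (fun h => nE (or_introl h)) _ phi1.
  have [r2 h2] := e2 x xab (fun h => nE (or_intror h)) _ phi1.
  by exists (r1 + r2); exact: add.
(* If [f x] is finite its value cancels. If it is infinite, one of the two functionals has averages
   above any prescribed bound, while those of the other are bounded below because x avoids the
   countable sets. *)
have ae x eta : 0 < eta -> a <= x <= b -> ~ (E1 `|` E2) x -> ~ (Z1 `|` Z2) x ->
    exists2 d, 0 < d & forall t, 0 < t -> t < d -> - eta <= t^-1 * D (zoom x t phi).
  move=> eta0 xab nE nz.
  have g1 := f1 x xab (fun h => nz (or_introl h)) _ phi0.
  have g2 := f2 x xab (fun h => nz (or_intror h)) _ phi0.
  have [r1 h1] := e1 x xab (fun h => nE (or_introl h)) _ phi1.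
  have [r2 h2] := e2 x xab (fun h => nE (or_intror h)) _ phi1.
  case fx : (f x) g1 g2 => [v||] g1 g2.
  - have -> : - eta = (v - eta / 2) + (- v - eta / 2) by field.
    by apply: add; [apply: g1|apply: g2]; rewrite ?lte_fin; slra.
  - have -> : - eta = (- eta - r2) + r2 by ring.
    by apply: add => //; apply: g1; rewrite ltry.
  - have -> : - eta = r1 + (- eta - r1) by ring.
    by apply: add => //; apply: g2; rewrite ltry.
pose L := `|a| + `|b| + 1; have L0 : 0 < L by rewrite ltr_wpDl // addr_ge0.
have aL : - L < a by have := ler_norm (- a); have := normr_ge0 b; rewrite normrN /L; slra.
have bL : b < L by have := ler_norm b; have := normr_ge0 a; rewrite /L; slra.
have [M M0 hM] := smooth_bounded 0 L sp.
(* The value of the profile at distance 1: the kernel at scale t is at least [c1] within distance t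
   of its centre, so the penalty of that interval bounds the average of mu from below. *)
pose c1 := normal_peak (1 : R) * expR (- 1 / 2); have c10 : 0 < c1 by rewrite mulr_gt0 // expR_gt0.
have phic x t y : 0 < t -> `|y - x| <= t -> c1 <= zoom x t phi y.
  move=> t0 yt; rewrite /zoom /phi /c1; apply: ler_wpM2l; first exact: ltW.
  rewrite /gauss expr0 mul1r ler_expR !mulNr lerN2 ler_pM2r ?invr_gt0 //.
  rewrite -real_normK ?num_real // expr_le1 // normrM normfV (gtr0_norm t0) ler_pdivrMr //.
  by rewrite mul1r.
have sphi x t : smooth (zoom x t phi) by apply: smooth_zoom; exact: smooth_class0.
have phige x t y : 0 <= zoom x t phi y by rewrite /zoom /phi; apply: mulr_ge0; [exact: ltW|exact: gauss0_ge0].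
have main eps : 0 < eps -> 0 <= D psi + eps * ((2 * L + 1) * M).
  move=> eps0; have [mu [cmu mu0 muM mu1 mu2]] := penalty nZ eps0 L0.
  have zE T x t : cdist T -> T (zoom x t phi) = normal_peak 1 * T (zoom x t g).
    by move=> cT; rewrite -(cdistZ _ cT (smooth_zoom x t (@smooth_gauss R 0))).
  have fin x t : 0 < t -> 0 <= t^-1 * D (zoom x t phi) + t^-1 * mu (zoom x t phi) ->
      0 <= D (zoom x t g) + mu (zoom x t g).
    by move=> t0; rewrite !zE // -mulrDr -mulrDr !pmulr_rge0 // invr_gt0.
  have : 0 <= D psi + mu psi.
    apply: (positivity cD nD cmu mu0 cE _ sp psi0) => x nE bx.
    have [xab|xab] := pselect (a <= x <= b); last first.
      (* Outside [a, b] both functionals vanish locally and only the nonnegative penalty is left. *)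
      exfalso; apply: bx.
      have [d d0 hd] : exists2 d, 0 < d & forall y, a - d < y -> y < b + d -> d <= `|y - x|.
        have [ax|xa] := ltP x a.
          by exists ((a - x) / 2); [rewrite divr_gt0 // subr_gt0|move=> y y1 _; rewrite ler_normr; apply/orP; left; slra].
        have bx' : b < x by rewrite ltNge; apply/negP => xb; apply: xab; rewrite xa.
        by exists ((x - b) / 2); [rewrite divr_gt0 // subr_gt0|move=> y _ y2; rewrite ler_normr; apply/orP; right; slra].
      exists d => // h sh h0 hz.
      have hab y : a - d < y -> y < b + d -> h y = 0.
        move=> y1 y2; apply: hz; have := hd y y1 y2; rewrite ler_normr => /orP[?|?].
          by apply/orP; right; slra.
        by apply/orP; left; slra.
      by rewrite /D (sP h d sh d0 hab) (sQ h d sh d0 hab) addr0 add0r; exact: mu0 sh h0.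
    have xL1 : - L < x by case/andP: xab => ? _; slra.
    have xL2 : x < L by case/andP: xab => ? ?; slra.
    have [Zx|nz] := pselect ((Z1 `|` Z2) x).
      have [r [d1 d10 h1]] := low x xab nE.
      (* This density makes the penalty contribute at least [- r] to the average, which offsets the
         lower bound r of D. *)
      have [d2 d20 h2] := mu2 x (- r / (2 * c1)) xL1 xL2 Zx.
      exists (Num.min d1 d2); first by rewrite lt_min d10.
      move=> t t0; rewrite lt_min => /andP[t1 t2]; apply: fin => //.
      have := h1 t t0 t1; have := h2 t t0 t2 _ _ (sphi x t) (phige x t) (ltW c10) (fun y => phic x t y t0).
      rewrite (_ : _ * (2 * t) * c1 = - r * t); last by field; rewrite gt_eqF.
      rewrite -ler_pdivlMr // [_ / t]mulrC; set p1 := t^-1 * _; set p2 := t^-1 * _; slra.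
    (* The Lebesgue part of the penalty contributes at least this much to every average, which pays
       for the loss allowed in [ae]. *)
    have eta0 : 0 < eps * 2 * c1 by rewrite !mulr_gt0.
    have [d1 d10 h1] := ae x _ eta0 xab nE nz.
    pose d2 := Num.min (x + L) (L - x); have d20 : 0 < d2 by rewrite lt_min subr_gt0 xL2 andbT; slra.
    exists (Num.min d1 d2); first by rewrite lt_min d10.
    move=> t t0; rewrite !lt_min => /and3P[t1 t2 t3]; apply: fin => //.
    have y1 : - L <= x - t by slra.
    have y2 : x + t <= L by slra.
    have := h1 t t0 t1; have := mu1 _ _ _ _ (sphi x t) (phige x t) t0 y1 y2 (ltW c10) (fun y => phic x t y t0).
    rewrite (_ : _ * (2 * t) * c1 = eps * 2 * c1 * t); last by ring.
    rewrite -ler_pdivlMr // [_ / t]mulrC; set p1 := t^-1 * _; set p2 := t^-1 * _; slra.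
  have := muM psi M sp (fun y yL => hM y yL 0%N (leqnn _)).
  by rewrite -mulrA; slra.
suff : 0 <= D psi by rewrite /D /opp_fun; slra.
rewrite -[leLHS]oppr0 lerNl; apply/ler_addgt0Pr => e e0; rewrite add0r.
have K0 : 0 < (2 * L + 1) * M + 1 by rewrite ltr_wpDl // mulr_ge0 //; slra.
have := main (e / ((2 * L + 1) * M + 1)); rewrite divr_gt0 // => /(_ isT) h.
have : e / ((2 * L + 1) * M + 1) * ((2 * L + 1) * M) <= e.
  by rewrite mulrAC ler_pdivrMr //; apply: ler_wpM2l; [exact: ltW|rewrite lerDl].
by slra.
Qed.

End Comparison.

(** * Integrability of the weighted function *)

Section WeightedIntegral.
Context {R : realType}.
Implicit Types (P Q : (R -> R) -> R) (f : R -> \bar R) (psi phi : R -> R) (a b x y z u c d e be w s t eps r : R) (j : nat).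

Lemma suppin_cutoff P a b psi : cdist P -> suppin P a b -> smooth psi ->
  P (fun y => cutoff a b y * psi y) = P psi.
Proof.
move=> cP sP sp; have sc := smooth_mul (@smooth_cutoff R a b) sp.
apply/eqP; rewrite eq_sym -subr_eq0 -(cdistB cP sp sc); apply/eqP; apply: (sP _ 1 (smooth_sub sp sc)) => //.
by move=> y y1 y2; rewrite cutoff1 // mul1r subrr.
Qed.

(* Positivity is tested on the difference of the constant bound of the weight and its truncations. *)
Lemma mulP_gap P N a b e be : 0 < be -> good P a b -> good N a b ->
  (forall psi, smooth psi -> (forall y, 0 <= psi y) -> 0 <= P psi + N psi) ->
  mulP P e be (fun=> 1) + mulP N e be (fun=> 1) <=
    (`|e| + 2 * (`|a| + `|b| + 1)) `^ be * (P (fun=> 1) + N (fun=> 1)).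
Proof.
move=> be0 [cP sP nP _] [cN sN nN _] PN0; set M := _ `^ be.
have s1 := @smooth_const R 1.
pose D psi := P psi + N psi; have cD : cdist D := cdist_add cP cN.
have hP := mulP_pv e cP nP be0 s1; have hN := mulP_pv e cN nN be0 s1.
apply/ler_addgt0Pr => eps eps0; have e20 : 0 < eps / 2 by rewrite divr_gt0.
have [j1 h1] := hP _ e20; have [j2 h2] := hN _ e20.
have := h1 _ (leq_maxl j1 j2); have := h2 _ (leq_maxr j1 j2).
set F := fun y => _ => F1 F2.
have sF : smooth F.
  have := @smooth_mul_theta R e (maxn j1 j2) _ (@smooth_pw_mul R e be _ s1); exact.
suff : D F <= M * D (fun=> 1).
  by move: F1 F2; rewrite /D !ler_norml => /andP[? ?] /andP[? ?]; slra.
have sc := @smooth_cutoff R a b.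
have red psi : smooth psi -> D psi = D (fun y => cutoff a b y * psi y).
  by move=> sp; rewrite /D !suppin_cutoff.
have sM : smooth (fun y => cutoff a b y * M) by exact: smooth_mul sc (smooth_const M).
rewrite -(cdistZ M cD s1) (red _ sF) (red _ (smooth_scale M s1)) -subr_ge0.
rewrite -(cdistB cD (smooth_mul sc (smooth_scale M s1)) (smooth_mul sc sF)).
apply: PN0; first exact: smooth_sub (smooth_mul sc (smooth_scale M s1)) (smooth_mul sc sF).
(* Where the cutoff does not vanish, [|y - e|] is at most the base of [M], and the truncation
   [theta] only lowers the weight. *)
move=> y; rewrite -mulrBr mulr1; have [yL|yL] := leP (2 * (`|a| + `|b| + 1)) `|y|.
  by rewrite cutoff0 ?mul0r.
apply: mulr_ge0; first by have /andP[] := bump_itv ((y - 0) / (`|a| + `|b| + 1)).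
rewrite subr_ge0 /F mulr1.
have /andP[t0 t1] : 0 <= theta e (maxn j1 j2) y <= 1.
  by have := bump_itv ((y - e) / (2^-1 ^+ maxn j1 j2)); rewrite /theta /zoom => /andP[? ?]; apply/andP; split; slra.
apply: (@le_trans _ _ (pw e be y)); first by rewrite -[leRHS]mulr1; apply: ler_wpM2l => //; exact: powR_ge0.
rewrite /pw /M; apply: ge0_ler_powR; rewrite ?nnegrE ?normr_ge0 //; first exact: ltW.
by have := ler_normB y e; slra.
Qed.

Lemma dist_integrable_mul a b f e be : 0 < be -> dist_integrable a b f ->
  dist_integrable a b (fun x => (`|x - e| `^ be)%:E * f x)%E.
Proof.
move=> be0 [[u0 [U0 major0]] [v0 [V0 minor0]] sup_inf].
set h := (fun x => (`|x - e| `^ be)%:E * f x)%E.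
(* Minor functionals enter through their opposites, so the weight is applied to [opp_fun Q] and the
   sign is restored afterwards. *)
pose wt Q := opp_fun (mulP (opp_fun Q) e be).
have wtM P : majorant P f a b -> majorant (mulP P e be) h a b by exact: majorant_mul.
have wtm Q : majorant (opp_fun Q) (fun x => - f x)%E a b -> majorant (opp_fun (wt Q)) (fun x => - h x)%E a b.
  move=> hQ; rewrite /wt opp_funK; apply: majorant_eq (majorant_mul e be0 hQ) => x _.
  by rewrite /h muleN.
have [P0 hP0] : exists P, majorant P f a b.
  have [_ hU _ _ _] := major0; have [ga hga] := hU b.
  have /major_valuesE[P [hP _]] : major_values a b f ga by exists u0, U0.
  by exists P.
have [Q0 hQ0] : exists Q, majorant (opp_fun Q) (fun x => - f x)%E a b.
  have [_ hV _ _ _] := minor0; have [ga hga] := hV b.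
  have /minor_valuesE[Q [hQ _]] : minor_values a b f ga by exists v0, V0.
  by exists Q.
have ord P Q k : majorant P k a b -> majorant (opp_fun Q) (fun x => - k x)%E a b -> Q (fun=> 1) <= P (fun=> 1).
  by move=> hP hQ; apply: (majorant_ge hP hQ (smooth_const 1)).
have majv P k : majorant P k a b -> major_values a b k (P (fun=> 1)).
  by move=> hP; apply/major_valuesE; exists P.
have minv Q k : majorant (opp_fun Q) (fun x => - k x)%E a b -> minor_values a b k (Q (fun=> 1)).
  by move=> hQ; apply/minor_valuesE; exists Q.
split.
- by have [u [U [hU _]]] := majv _ _ (wtM _ hP0); exists u, U.
- by have [v [V [hV _]]] := minv _ _ (wtm _ hQ0); exists v, V.
apply/eqP; rewrite eq_le; apply/andP; split.
  apply: ge_ereal_sup => _ [r /minor_valuesE[Q [hQ ->]] <-].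
  apply: le_ereal_inf_tmp => _ [r' /major_valuesE[P [hP ->]] <-].
  by rewrite lee_fin; exact: ord hP hQ.
have fin : ereal_inf (EFin @` major_values a b f) \is a fin_num.
  rewrite fin_numElt; apply/andP; split.
    rewrite -sup_inf; apply: lt_le_trans (ltNyr (Q0 (fun=> 1))) _.
    by apply: ereal_sup_ubound; exists (Q0 (fun=> 1)) => //; exact: minv.
  apply: le_lt_trans _ (ltry (P0 (fun=> 1))).
  by apply: ereal_inf_lbound; exists (P0 (fun=> 1)) => //; exact: majv.
apply/lee_addgt0Pr => eps eps0.
set M := (`|e| + 2 * (`|a| + `|b| + 1)) `^ be.
have M0 : 0 <= M by exact: powR_ge0.
(* The major and the minor functional each miss the integral by less than d, and the weight
   multiplies the total by at most M; [M + 1] keeps the denominator positive. *)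
pose d := eps / (2 * (M + 1)); have d0 : 0 < d by rewrite divr_gt0 // mulr_gt0 // ltr_wpDl.
have [_ [r /major_valuesE[P [hP ->]] <-]] := lb_ereal_inf_adherent d0 fin.
have fin' : ereal_sup (EFin @` minor_values a b f) \is a fin_num by rewrite sup_inf.
have [_ [r' /minor_valuesE[Q [hQ ->]] <-]] := ub_ereal_sup_adherent d0 fin'.
rewrite sup_inf -(fineK fin) -EFinB -EFinD !lte_fin => lo hi.
have gap : P (fun=> 1) - Q (fun=> 1) <= 2 * d by move: lo hi; set v := fine _ => *; slra.
have hPQ := majorant_ge hP hQ.
have : mulP P e be (fun=> 1) + mulP (opp_fun Q) e be (fun=> 1) <= M * (P (fun=> 1) - Q (fun=> 1)).
  by apply: (mulP_gap e be0 hP.1 hQ.1) => psi sp p0; rewrite /opp_fun subr_ge0; exact: hPQ.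
have : M * (P (fun=> 1) - Q (fun=> 1)) <= eps.
  apply: le_trans (ler_wpM2l M0 gap) _.
  have -> : eps = (M + 1) * (2 * d) by rewrite /d; field; rewrite gt_eqF // ltr_wpDl.
  by apply: ler_wpM2r; [apply: mulr_ge0; [|exact: ltW]|rewrite lerDl].
move=> g1 g2; apply: (@le_trans _ _ (mulP P e be (fun=> 1))%:E).
  by apply: ereal_inf_lbound; exists (mulP P e be (fun=> 1)) => //; exact/majv/wtM.
apply: (@le_trans _ _ (wt Q (fun=> 1) + eps)%:E); first by rewrite lee_fin /wt /opp_fun -/(opp_fun Q); slra.
rewrite EFinD; apply: leeD2r; apply: ereal_sup_ubound; exists (wt Q (fun=> 1)) => //.
exact/minv/wtm.
Qed.

Lemma dist_integrable_eq a b f k : (forall x, a <= x <= b -> f x = k x) ->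
  dist_integrable a b f -> dist_integrable a b k.
Proof.
move=> fk.
have M v V : major_pair a b f v V <-> major_pair a b k v V.
  split => -[? ? ? ? [E [Z [cE nZ hZ hE]]]]; split => //; exists E, Z; split => // x xab; [rewrite -fk|rewrite fk] => //; exact: hZ.
have m v V : minor_pair a b f v V <-> minor_pair a b k v V.
  split => -[? ? ? ? [E [Z [cE nZ hZ hE]]]]; split => //; exists E, Z; split => // x xab; [rewrite -fk|rewrite fk] => //; exact: hZ.
move=> [[u [U h1]] [v [V h2]] e]; split.
- by exists u, U; exact/M.
- by exists v, V; exact/m.
have -> : minor_values a b k = minor_values a b f.
  by apply/seteqP; split => r [v' [V' [h3 h4]]]; exists v', V'; (split; [exact/m|exact: h4]).
have -> // : major_values a b k = major_values a b f.
by apply/seteqP; split => r [v' [V' [h3 h4]]]; exists v', V'; (split; [exact/M|exact: h4]).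
Qed.

End WeightedIntegral.

Theorem proposition8p4 (R : realType) (a b : R) (hab : a < b)
    (f : R -> \bar R) (hf : dist_integrable a b f)
    (beta : R) (hbeta : 0 < beta) :
  dist_integrable a b (fun x : R => (((b - x) `^ beta)%:E * f x)%E) /\
  dist_integrable a b (fun x : R => (((x - a) `^ beta)%:E * f x)%E).
Proof.
split.
  apply: dist_integrable_eq (dist_integrable_mul b hbeta hf) => x /andP[_ xb].
  by rewrite distrC ger0_norm // subr_ge0.
apply: dist_integrable_eq (dist_integrable_mul a hbeta hf) => x /andP[ax _].
by rewrite ger0_norm // subr_ge0.
Qed.
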